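(* Let $X=\{x_n:n\in\mathbb Z\}$ with $(x_n)_{n\in\mathbb Z}$ a strictly increasing real sequence such that $d:=\inf_{n\in\mathbb Z}(x_{n+1}-x_n)>0$, and let $\Gamma_0,\Gamma_1,A_0,\gamma,M$ be as in the context. Let $B$ be a closed operator in $\ell^2(\mathbb Z)$. Then the operator $$A_{[B]}f=-f''\ \text{ on }\mathbb R\setminus X,\qquad\operatorname{dom}A_{[B]}=\bigl\{f\in H^2(\mathbb R\setminus X)\cap H^1(\mathbb R):\Gamma_0f=B\Gamma_1f\bigr\},$$ in $L^2(\mathbb R)$ is closed, the resolvent formula $$(A_{[B]}-\lambda)^{-1}=(A_0-\lambda)^{-1}+\gamma(\lambda)\bigl(I-BM(\lambda)\bigr)^{-1}B\gamma(\overline\lambda)^*$$ holds for all $\lambda\in\rho(A_{[B]})\cap\rho(A_0)$, and the following assertions are true. (i) If $B$ is self-adjoint, then $A_{[B]}$ is self-adjoint. If $B$ is maximal dissipative (maximal accumulative, respectively), then $A_{[B]}$ is maximal accumulative (maximal dissipative, respectively). (ii) $A_{[B^*]}=A_{[B]}^*$. Assume, additionally, that $B$ is bounded and everywhere defined on $\ell^2(\mathbb Z)$ and let $b\in\mathbb R$ be such that $\operatorname{Re}(B\zeta,\zeta)\le b\|\zeta\|^2$ for all $\zeta\in\ell^2(\mathbb Z)$. Then the operator $A_{[B]}$ is m-sectorial; in particular the inclusion $\sigma(A_{[B]})\subset\overline{W(A_{[B]})}$ holds, and for any $\mu<0$ and $C:=\frac12\coth\bigl(\frac d2\sqrt{-\mu}\bigr)$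 the following assertions are true. (a) If $b>0$, then for every $\xi<\mu-(Cb)^2$, $$W(A_{[B]})\subset\bigl\{z\in\mathbb C:\operatorname{Re}z\ge\mu-(Cb)^2,\ |\operatorname{Im}z|\le K_\xi(\operatorname{Re}z-\xi)^{1/2}\bigr\},\qquad K_\xi=\frac{2C\|\operatorname{Im}B\|}{1-\frac{Cb}{(\mu-\xi)^{1/2}}}.$$ (b) If $b\le0$, then $$W(A_{[B]})\subset\Bigl\{z\in\mathbb C:\operatorname{Re}z\ge0,\ |\operatorname{Im}z|\le\frac{2C\|\operatorname{Im}B\|(\operatorname{Re}z-\mu)}{(\operatorname{Re}z-\mu)^{1/2}-Cb}\Bigr\}.$$ (c) For any $w_0<0$ and each $\nu\in(0,\pi)$, $$\sigma(A_{[B]})\cap\mathbb U_{w_0,\nu}\subset\bigl\{z\in\mathbb U_{w_0,\nu}:\operatorname{dist}(z,[0,\infty))\le\tfrac14\coth^2(J_0)\|B\|^2\bigr\},$$ where $J_0=\frac d2\sqrt{|w_0|\sin\nu}\,\sin\bigl(\frac\nu2\bigr)$.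
   Context: $I_n=(x_n,x_{n+1})$, $f_n=f|_{I_n}$; $H^2(\mathbb R\setminus X)=\{f\in L^2(\mathbb R):f_n\in H^2(I_n)\ \forall n\in\mathbb Z,\ \sum_n\|f_n\|^2_{H^2(I_n)}<\infty\}$. For $f\in H^2(\mathbb R\setminus X)\cap H^1(\mathbb R)$: $\Gamma_0f=(f_n'(x_n)-f_{n-1}'(x_n))_{n\in\mathbb Z}$ and $\Gamma_1f=(-f(x_n))_{n\in\mathbb Z}$, both in $\ell^2(\mathbb Z)$. $A_0f=-f''$, $\operatorname{dom}A_0=H^2(\mathbb R)$, so $\rho(A_0)=\mathbb C\setminus[0,\infty)$. For $\lambda\in\mathbb C\setminus[0,\infty)$ and $\xi=(\xi_n)\in\ell^2(\mathbb Z)$, $$(\gamma(\lambda)\xi)(x)=\frac{-i}{2\sqrt\lambda}\sum_{n\in\mathbb Z}e^{i\sqrt\lambda|x_n-x|}\xi_n,\qquad M(\lambda)\xi=\Bigl(\frac{i}{2\sqrt\lambda}\sum_{n\in\mathbb Z}e^{i\sqrt\lambda|x_n-x_m|}\xi_n\Bigr)_{m\in\mathbb Z},$$ with $\operatorname{Im}\sqrt\lambda>0$; these define bounded operators $\ell^2(\mathbb Z)\to L^2(\mathbb R)$ and in $\ell^2(\mathbb Z)$, respectively. The condition $\Gamma_0f=B\Gamma_1f$ includes $\Gamma_1f\in\operatorname{dom}B$. If $B$ is not densely defined, $B^*$ is understood as a linear relation (closed subspace of $\ell^2(\mathbb Z)\times\ell^2(\mathbb Z)$), and the boundary condition for $A_{[B^*]}$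 as $(\Gamma_1f,\Gamma_0f)\in B^*$. $W(A)=\{(Af,f):f\in\operatorname{dom}A,\|f\|=1\}$. $A$ is m-sectorial if $W(A)$ is contained in a sector $\{z:\operatorname{Re}z\ge\eta,|\operatorname{Im}z|\le\kappa(\operatorname{Re}z-\eta)\}$, $\eta\in\mathbb R,\kappa>0$, whose complement meets $\rho(A)$. $A$ is maximal dissipative (maximal accumulative) if $W(A)\subset\overline{\mathbb C^+}$ and $\rho(A)\cap\mathbb C^-\ne\emptyset$ ($W(A)\subset\overline{\mathbb C^-}$ and $\rho(A)\cap\mathbb C^+\ne\emptyset$), where $\mathbb C^\pm=\{\lambda:\pm\operatorname{Im}\lambda>0\}$. $\operatorname{Im}B=\frac1{2i}(B-B^* )$. $\mathbb U_{w_0,\nu}=\{z\ne w_0:\arg(z-w_0)\in[\nu,2\pi-\nu]\}\cup\{w_0\}$ with $\arg\in[0,2\pi)$.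
   Formalization: If dom B is not all of ℓ²(ℤ), the displayed resolvent formula fails, its right side not being defined on all of L²(ℝ); it is proved on the domain of Bγ(λ̄)^*, on all of L²(ℝ) if dom B=ℓ²(ℤ), and for every closed B with (B^{-1}−M(λ))^{-1} in place of (I−BM(λ))^{-1}B. *)

(* Defs.v *)
From HB Require Import structures.
From mathcomp Require Import all_boot all_order all_algebra generic_quotient.
From mathcomp Require Import ring_quotient.
From mathcomp Require Import all_classical all_reals all_analysis.
From mathcomp Require Import measurable_realfun complex.
From mathcomp Require Import ring lra.

Set Implicit Arguments.
Unset Strict Implicit.
Unset Printing Implicit Defensive.

Import Order.TTheory GRing.Theory Num.Theory.
Import numFieldNormedType.Exports.
Local Open Scope ring_scope.
Local Open Scope classical_set_scope.
Local Open Scope complex_scope.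
Local Open Scope quotient_scope.

Local Notation Re := complex.Re.
Local Notation Im := complex.Im.

Section complex_numbers.
Context {R : realType}.
Implicit Types (z w : R[i]) (x : R).

Definition sqn z : R := Re z ^+ 2 + Im z ^+ 2.

Definition cabs z : R := Num.sqrt (sqn z).

Definition cexp z : R[i] :=
  (expR (Re z) * cos (Im z)) +i* (expR (Re z) * sin (Im z)).

Definition is_arg z (theta : R) : Prop :=
  0 <= theta < 2 * pi /\ z = (cabs z)%:C * cexp (theta *i).

Definition coth x : R := (expR x + expR (- x)) / (expR x - expR (- x)).

Definition upper_half : set R[i] := [set z | 0 < Im z].
Definition lower_half : set R[i] := [set z | Im z < 0].
Definition closed_upper_half : set R[i] := [set z | 0 <= Im z].
Definition closed_lower_half : set R[i] := [set z | Im z <= 0].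

Definition dist_to (z : R[i]) (A : set R[i]) : R :=
  inf [set cabs (z - w) | w in A].

Definition nonneg_axis : set R[i] := [set z | Im z = 0 /\ 0 <= Re z].

Definition cone_region (w0 nu : R) : set R[i] :=
  [set z | z = w0%:C \/
    (z <> w0%:C /\
     exists theta, is_arg (z - w0%:C) theta /\ nu <= theta <= 2 * pi - nu)].

Lemma ReD z w : Re (z + w) = Re z + Re w. Proof. by case: z w => ? ? []. Qed.
Lemma ImD z w : Im (z + w) = Im z + Im w. Proof. by case: z w => ? ? []. Qed.
Lemma ReM z w : Re (z * w) = Re z * Re w - Im z * Im w.
Proof. by case: z w => ? ? []. Qed.
Lemma ImM z w : Im (z * w) = Re z * Im w + Im z * Re w.
Proof. by case: z w => ? ? []. Qed.
Lemma ReC z : Re z^* = Re z. Proof. by case: z. Qed.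
Lemma ImC z : Im z^* = - Im z. Proof. by case: z. Qed.

Lemma sqn_ge0 z : 0 <= sqn z. Proof. by rewrite addr_ge0// sqr_ge0. Qed.

Lemma sqn0 : sqn 0 = 0. Proof. by rewrite /sqn/= expr0n/= addr0. Qed.

Lemma sqnM z w : sqn (z * w) = sqn z * sqn w.
Proof. by rewrite /sqn ReM ImM; ring. Qed.

Lemma sqnD_le z w : sqn (z + w) <= 2 * sqn z + 2 * sqn w.
Proof.
rewrite /sqn ReD ImD.
have := sqr_ge0 (Re z - Re w); have := sqr_ge0 (Im z - Im w); nra.
Qed.

Lemma mul_conj_bound z w :
  `|Re (z * w^*)| <= sqn z + sqn w /\ `|Im (z * w^*)| <= sqn z + sqn w.
Proof.
rewrite ReM ImM ReC ImC /sqn !ler_norml.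
move: (Re z) (Im z) (Re w) (Im w) => a b c e.
have := sqr_ge0 (a - c); have := sqr_ge0 (a + c).
have := sqr_ge0 (b - e); have := sqr_ge0 (b + e).
have := sqr_ge0 (a - e); have := sqr_ge0 (a + e).
have := sqr_ge0 (b - c); have := sqr_ge0 (b + c).
by move=> *; split; apply/andP; split; nra.
Qed.

Lemma mul_conj_self z : z * z^* = (sqn z)%:C.
Proof.
by apply/eqP; rewrite eq_complex ReM ImM ReC ImC /sqn/=; apply/andP; split;
  apply/eqP; ring.
Qed.

Lemma conj_mul_conj z w : (z * w^*)^* = w * z^*.
Proof.
by apply/eqP; rewrite eq_complex !(ReC, ImC, ReM, ImM); apply/andP; split;
  apply/eqP; ring.
Qed.

Lemma sqn_eq0 z : sqn z = 0 -> z = 0.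
Proof.
move=> /eqP; rewrite paddr_eq0 ?sqr_ge0// !sqrf_eq0 => /andP[/eqP h1 /eqP h2].
by apply/eqP; rewrite eq_complex h1 h2 eqxx.
Qed.

Lemma Im_sqrtC_gt0 z : ~ nonneg_axis z -> 0 < Im (sqrtC z).
Proof.
move=> zN; have := sqrtCK z; have : 0 <= 'Im (sqrtC z) by rewrite Im_rootC_ge0.
move: (sqrtC z) => s.
have -> : 'Im s = (Im s)%:C.
  by apply/eqP; rewrite -complexIm.
rewrite ler0c le_eqVlt => /orP[/eqP s0 sz|//].
exfalso; apply: zN; rewrite /nonneg_axis/= -sz expr2 ImM ReM -s0.
by split; [ring | rewrite mulr0 subr0 -expr2 sqr_ge0].
Qed.

End complex_numbers.

(* Sums over the integers are limits of the partial sums over [-N, N - 1].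
   Every sum taken below converges absolutely, so the order of summation is
   immaterial. *)
Section integer_sums.
Context {R : realType}.
Implicit Types (a b : int -> R) (f g : int -> R[i]).

Definition zseries a : R^nat := series (fun k => a (Posz k) + a (Negz k)).

Definition zsummable a : Prop := cvgn (zseries a).

Definition zsum a : R := limn (zseries a).

Definition csummable f : Prop :=
  zsummable (fun n => Re (f n)) /\ zsummable (fun n => Im (f n)).

Definition csum f : R[i] :=
  zsum (fun n => Re (f n)) +i* zsum (fun n => Im (f n)).

Lemma zseries_lin r s a b :
  zseries (fun n => r * a n + s * b n) =
  (fun N => r * zseries a N + s * zseries b N).
Proof.
apply/funext => N; rewrite /zseries /series/= !big_distrr/= -big_split/=.
by apply: eq_bigr => k _; ring.
Qed.

Lemma zsum_lin r s a b : zsummable a -> zsummable b ->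
  zsummable (fun n => r * a n + s * b n) /\
  zsum (fun n => r * a n + s * b n) = r * zsum a + s * zsum b.
Proof.
move=> ca cb; rewrite /zsummable /zsum zseries_lin.
have h : (fun N => r * zseries a N + s * zseries b N) @ \oo -->
    r * limn (zseries a) + s * limn (zseries b).
  by apply: cvgD; apply: cvgMr.
by split; [apply/cvg_ex; eexists; exact: h | apply: cvg_lim].
Qed.

Lemma zsummable_le a b : (forall n, `|a n| <= b n) ->
  zsummable b -> zsummable a.
Proof.
move=> ab cb; apply: normed_cvg.
apply: (@series_le_cvg _ _ (fun k => b (Posz k) + b (Negz k))) => // k /=.
- exact: normr_ge0.
- by rewrite addr_ge0// (le_trans _ (ab _)).
- by rewrite (le_trans (ler_normD _ _))// lerD.
Qed.

Lemma csum_lin (c : R[i]) f g : csummable f -> csummable g ->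
  csum (fun n => c * f n + g n) = c * csum f + csum g.
Proof.
move=> [f1 f2] [g1 g2].
have [h1 e1] := zsum_lin (Re c) (- Im c) f1 f2.
have [_ e1'] := zsum_lin 1 1 h1 g1.
have [h2 e2] := zsum_lin (Re c) (Im c) f2 f1.
have [_ e2'] := zsum_lin 1 1 h2 g2.
apply/eqP; rewrite eq_complex ReD ImD ReM ImM /csum/=; apply/andP; split.
- rewrite (_ : (fun n => _) = (fun n => 1 * (Re c * Re (f n) +
    - Im c * Im (f n)) + 1 * Re (g n))); last first.
    by apply/funext => n; rewrite ReD ReM; ring.
  by rewrite e1' e1; apply/eqP; ring.
- rewrite (_ : (fun n => _) = (fun n => 1 * (Re c * Im (f n) +
    Im c * Re (f n)) + 1 * Im (g n))); last first.
    by apply/funext => n; rewrite ImD ImM; ring.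
  by rewrite e2' e2; apply/eqP; ring.
Qed.

Lemma zsum_eq0 a : (forall n, 0 <= a n) -> zsummable a -> zsum a = 0 ->
  forall n, a n = 0.
Proof.
move=> a0 ca sa n.
have nd : {homo zseries a : m n / (m <= n)%N >-> m <= n}.
  by apply: nondecreasing_series => k _; rewrite addr_ge0.
have key k : a (Posz k) + a (Negz k) = 0.
  have := nondecreasing_cvgn_le nd ca k.+1.
  rewrite -/(zsum a) sa /zseries seriesEnat/= big_nat_recr//= => h.
  apply/eqP; rewrite eq_le addr_ge0// andbT (le_trans _ h)// lerDr.
  by apply: sumr_ge0 => i _; rewrite addr_ge0.
case: n => k; have := key k; have := a0 (Posz k); have := a0 (Negz k); lra.
Qed.

End integer_sums.

HB.mixin Record Lmodule_isPreHilbert (R : realType) (H : Type)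
    of GRing.Lmodule R[i] H := {
  inner : H -> H -> R[i];
  inner_linearl : forall (a : R[i]) (u v w : H),
    inner (a *: u + v) w = a * inner u w + inner v w;
  inner_conj : forall u v : H, inner v u = (inner u v)^*;
  inner_ge0 : forall u : H, 0 <= inner u u;
  inner_eq0 : forall u : H, inner u u = 0 -> u = 0
}.

#[short(type="preHilbertType")]
HB.structure Definition PreHilbert (R : realType) :=
  {H of Lmodule_isPreHilbert R H & GRing.Lmodule R[i] H}.

Notation "'[ u , v ]" := (inner u v) : ring_scope.

Section l2.
Variable R : realType.

Definition l2_pred : {pred int -> R[i]} :=
  mem [set xi : int -> R[i] | zsummable (fun n => sqn (xi n))].

Lemma l2_submod_closed : submod_closed l2_pred.
Proof.
split.
  rewrite inE/=; apply: (@zsummable_le _ _ (fun=> 0)) => [n|].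
    by rewrite sqn0 normr0.
  rewrite /zsummable /zseries addr0.
  rewrite (_ : series _ = cst 0); first exact: is_cvg_cst.
  by apply/funext => N; rewrite /series/= big1.
move=> c f g; rewrite !inE/= => cf cg.
apply: (@zsummable_le _ _ (fun n => (2 * sqn c) * sqn (f n) + 2 * sqn (g n))).
  move=> n; rewrite ger0_norm ?sqn_ge0// (le_trans (sqnD_le _ _))//.
  by rewrite -mulrA -sqnM.
by have [] := zsum_lin (2 * sqn c) 2 cf cg.
Qed.

HB.instance Definition _ := GRing.isSubmodClosed.Build _ _ l2_pred
  l2_submod_closed.

Definition l2 : Type := {xi : int -> R[i] | xi \in l2_pred}.

HB.instance Definition _ := [isSub of l2 for @sval _ _].
HB.instance Definition _ := [Choice of l2 by <:].
HB.instance Definition _ := [SubChoice_isSubLmodule of l2 by <:].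

Definition l2_fun (xi : l2) : int -> R[i] := \val xi.
Coercion l2_fun : l2 >-> Funclass.

Lemma l2P (xi : l2) : zsummable (fun n => sqn (xi n)).
Proof. by have := valP xi; rewrite inE. Qed.
Arguments l2P : clear implicits.

Definition l2_inner (xi eta : l2) : R[i] :=
  csum (fun n => xi n * (eta n)^*).

Lemma l2_csummable (xi eta : l2) : csummable (fun n => xi n * (eta n)^*).
Proof.
have [s _] := zsum_lin 1 1 (l2P xi) (l2P eta).
by split; apply: zsummable_le s => n; rewrite !mul1r;
  have [] := mul_conj_bound (xi n) (eta n).
Qed.

Lemma l2_inner_self (xi : l2) :
  l2_inner xi xi = (zsum (fun n => sqn (xi n)))%:C.
Proof.
rewrite /l2_inner /csum; congr (_ +i* _).
  by congr zsum; apply/funext => n; rewrite mul_conj_self.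
rewrite (_ : (fun n => _) = fun n => 0 * sqn (xi n) + 0 * sqn (xi n)).
  by have [_ ->] := zsum_lin 0 0 (l2P xi) (l2P xi); rewrite !mul0r addr0.
by apply/funext => n; rewrite mul_conj_self !mul0r addr0.
Qed.

Let l2_linearl (a : R[i]) (u v w : l2) :
  l2_inner (a *: u + v) w = a * l2_inner u w + l2_inner v w.
Proof.
rewrite -csum_lin; [|exact: l2_csummable|exact: l2_csummable].
by congr csum; apply/funext => n; rewrite mulrA -mulrDl.
Qed.

Let l2_conj (u v : l2) : l2_inner v u = (l2_inner u v)^*.
Proof.
have [_ c2] := l2_csummable u v.
apply/eqP; rewrite eq_complex ReC ImC; apply/andP; split; apply/eqP => /=.
  by congr zsum; apply/funext => n; rewrite -[in RHS]conj_mul_conj ReC.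
rewrite (_ : - _ = -1 * zsum (fun n => Im (u n * (v n)^*)) +
  0 * zsum (fun n => Im (u n * (v n)^*))); last by ring.
have [_ <-] := zsum_lin (-1) 0 c2 c2; congr zsum; apply/funext => n.
by rewrite -conj_mul_conj ImC; ring.
Qed.

Let zsum_sqn_ge0 (u : l2) : 0 <= zsum (fun n => sqn (u n)).
Proof.
apply: limr_ge; first exact: l2P.
by near=> N; apply: sumr_ge0 => k _; rewrite addr_ge0 ?sqn_ge0.
Unshelve. all: by end_near. Qed.

Let l2_ge0 (u : l2) : 0 <= l2_inner u u.
Proof. by rewrite l2_inner_self ler0c. Qed.

Let l2_eq0 (u : l2) : l2_inner u u = 0 -> u = 0.
Proof.
rewrite l2_inner_self => -[] h; apply/val_inj/funext => n.
apply: sqn_eq0; apply: (zsum_eq0 _ (l2P u) h) => m; exact: sqn_ge0.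
Qed.

HB.instance Definition _ := Lmodule_isPreHilbert.Build R l2
  l2_linearl l2_conj l2_ge0 l2_eq0.

End l2.

Section L2.
Context {d : measure_display} {T : measurableType d} {R : realType}.
Variable mu : {measure set T -> \bar R}.
Implicit Types (D : set T) (f g : T -> R[i]).

Definition cmeasurable D f : Prop :=
  measurable_fun D (fun x => Re (f x)) /\ measurable_fun D (fun x => Im (f x)).

Definition L2on D f : Prop :=
  cmeasurable D f /\ (\int[mu]_(x in D) (sqn (f x))%:E < +oo)%E.

Definition cint D f : R[i] :=
  (\int[mu]_(x in D) Re (f x)) +i* (\int[mu]_(x in D) Im (f x)).

Definition cintegrable D f : Prop :=
  mu.-integrable D (fun x => (Re (f x))%:E) /\
  mu.-integrable D (fun x => (Im (f x))%:E).

Lemma cmeasurable_lin (c : R[i]) f g :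
  cmeasurable setT f -> cmeasurable setT g ->
  cmeasurable setT (fun x => c * f x + g x).
Proof.
move=> [f1 f2] [g1 g2]; split.
- rewrite (_ : (fun x => _) = fun x => (Re c * Re (f x) - Im c * Im (f x))
    + Re (g x)); last by apply/funext => x; rewrite ReD ReM.
  apply: measurable_funD => //; apply: measurable_funB => //;
  by apply: measurable_funM => //.
- rewrite (_ : (fun x => _) = fun x => (Re c * Im (f x) + Im c * Re (f x))
    + Im (g x)); last by apply/funext => x; rewrite ImD ImM.
  apply: measurable_funD => //; apply: measurable_funD => //;
  by apply: measurable_funM => //.
Qed.

Lemma measurable_sqn f : cmeasurable setT f ->
  measurable_fun setT (fun x => sqn (f x)).
Proof.
by move=> [f1 f2]; apply: measurable_funD; apply: measurable_funX.
Qed.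

Lemma sqn_integrable f : L2on setT f ->
  mu.-integrable setT (fun x => (sqn (f x))%:E).
Proof.
move=> [mf foo]; apply/integrableP; split.
  by apply/measurable_EFinP; exact: measurable_sqn.
under eq_integral => x _ do rewrite gee0_abs ?lee_fin ?sqn_ge0//.
exact: foo.
Qed.

Lemma L2on_lin (c : R[i]) f g : L2on setT f -> L2on setT g ->
  L2on setT (fun x => c * f x + g x).
Proof.
move=> Lf Lg; have [mf _] := Lf; have [mg _] := Lg.
have mfg := cmeasurable_lin c mf mg.
split => //.
have If := sqn_integrable Lf; have Ig := sqn_integrable Lg.
have I : mu.-integrable setT
    (fun x => ((2 * sqn c) * sqn (f x) + 2 * sqn (g x))%:E).
  under eq_fun => x do rewrite EFinD !(EFinM, EFinD).
  by apply: integrableD => //; apply: integrableZl.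
have /integrableP[_] := I; apply: le_lt_trans.
apply: ge0_le_integral => //.
- by move=> x _; rewrite lee_fin sqn_ge0.
- by apply/measurable_EFinP; exact: measurable_sqn.
- by apply: measurableT_comp => //; exact: measurable_int I.
- move=> x _; rewrite abse_EFin lee_fin (le_trans _ (ler_norm _))//.
  by rewrite (le_trans (sqnD_le _ _))// sqnM mulrA.
Qed.

Definition L2_pred : {pred T -> R[i]} :=
  mem [set f : T -> R[i] | L2on setT f].

Lemma L2_submod_closed : submod_closed L2_pred.
Proof.
split.
  rewrite inE/=; split; first by split; exact: measurable_cst.
  by under eq_integral => x _ do rewrite sqn0; rewrite integral0.
by move=> c f g; rewrite !inE/=; exact: L2on_lin.
Qed.

HB.instance Definition _ := GRing.isSubmodClosed.Build _ _ L2_pred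
  L2_submod_closed.

Definition L2fun : Type := {f : T -> R[i] | f \in L2_pred}.

HB.instance Definition _ := [isSub of L2fun for @sval _ _].
HB.instance Definition _ := [Choice of L2fun by <:].
HB.instance Definition _ := [SubChoice_isSubLmodule of L2fun by <:].

Definition L2fun_fun (f : L2fun) : T -> R[i] := \val f.
Local Coercion L2fun_fun : L2fun >-> Funclass.

Lemma L2funP (f : L2fun) : L2on setT f.
Proof. by have := valP f; rewrite inE. Qed.

Lemma L2fun_linE c (f g : L2fun) x :
  L2fun_fun (c *: f + g) x = c * L2fun_fun f x + L2fun_fun g x.
Proof. by []. Qed.

Lemma L2fun_subE (f g : L2fun) x :
  L2fun_fun (f - g) x = L2fun_fun f x - L2fun_fun g x.
Proof. by []. Qed.

Lemma L2fun_scaleE c (f : L2fun) x :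
  L2fun_fun (c *: f) x = c * L2fun_fun f x.
Proof. by []. Qed.

Definition null_fun : {pred L2fun} :=
  mem [set f : L2fun | {ae mu, forall x, f x = 0}].

Lemma null_submod_closed : submod_closed null_fun.
Proof.
split.
  by rewrite inE/=; apply/aeW.
move=> c f g; rewrite !inE/= => f0 g0.
move: f0 g0; apply: filterS2 => x fx gx; by rewrite L2fun_linE fx gx mulr0 addr0.
Qed.

HB.instance Definition _ := GRing.isSubmodClosed.Build _ _ null_fun
  null_submod_closed.

Definition L2 : Type := Quotient.quot null_fun.

HB.instance Definition _ := GRing.Zmodule.on L2.
HB.instance Definition _ := EqQuotient.on L2.

Definition L2_fun (u : L2) : T -> R[i] := L2fun_fun (repr u).
Coercion L2_fun : L2 >-> Funclass.

Lemma L2P (u : L2) : L2on setT u. Proof. exact: L2funP. Qed.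

Lemma L2_eqP (f g : L2fun) :
  {ae mu, forall x, f x = g x} <-> \pi_L2 f = \pi_L2 g.
Proof.
have -> : (\pi_L2 f = \pi_L2 g) <-> (f - g \in null_fun).
  by rewrite Quotient.idealrBE; split => /eqP.
rewrite inE/=; split; apply: filterS => x.
  by rewrite L2fun_subE => ->; rewrite subrr.
by rewrite L2fun_subE => /subr0_eq.
Qed.

Lemma L2_reprE (f : L2fun) : {ae mu, forall x, (\pi_L2 f : L2) x = f x}.
Proof. by apply/L2_eqP; rewrite reprK. Qed.

Lemma L2_ae_inj (u v : L2) : {ae mu, forall x, u x = v x} -> u = v.
Proof. by move=> /L2_eqP; rewrite !reprK. Qed.

Definition L2_scale (c : R[i]) (u : L2) : L2 := \pi_L2 (c *: repr u).

Lemma L2_pi_scale c (f : L2fun) :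
  L2_scale c (\pi_L2 f) = \pi_L2 (c *: f).
Proof.
apply/L2_eqP; have := L2_reprE f; apply: filterS => x fx.
by rewrite !L2fun_scaleE -/(L2_fun _ _) fx.
Qed.

Let L2_scaleA a b (u : L2) : L2_scale a (L2_scale b u) = L2_scale (a * b) u.
Proof. by rewrite {2}/L2_scale L2_pi_scale scalerA. Qed.

Let L2_scale1 : left_id 1 L2_scale.
Proof. by move=> u; rewrite /L2_scale scale1r reprK. Qed.

Let L2_scaleDr : right_distributive L2_scale +%R.
Proof.
move=> c u v; rewrite -[u]reprK -[v]reprK -[X in L2_scale c X]raddfD.
by rewrite !L2_pi_scale scalerDr raddfD.
Qed.

Let L2_scaleDl u : {morph L2_scale^~ u : a b / a + b}.
Proof. by move=> a b; rewrite /L2_scale scalerDl raddfD. Qed.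

HB.instance Definition _ := GRing.Zmodule_isLmodule.Build R[i] L2
  L2_scaleA L2_scale1 L2_scaleDr L2_scaleDl.

Lemma L2_linE (c : R[i]) (u v : L2) :
  {ae mu, forall x, L2_fun (c *: u + v) x = c * u x + v x}.
Proof.
have -> : c *: u + v = \pi_L2 (c *: repr u + repr v).
  by rewrite raddfD /= -[v in LHS]reprK.
exact: L2_reprE.
Qed.

Definition L2_inner (u v : L2) : R[i] := cint setT (fun x => u x * (v x)^*).

Lemma cint_lin (c : R[i]) f g : cintegrable setT f -> cintegrable setT g ->
  cint setT (fun x => c * f x + g x) = c * cint setT f + cint setT g.
Proof.
move=> [f1 f2] [g1 g2].
have lin2 (r s : R) (a b : T -> R) :
    mu.-integrable setT (EFin \o a) -> mu.-integrable setT (EFin \o b) ->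
    mu.-integrable setT (EFin \o (fun x => r * a x + s * b x)) /\
    \int[mu]_x (r * a x + s * b x) = r * \int[mu]_x a x + s * \int[mu]_x b x.
  move=> Ia Ib.
  have Ira : mu.-integrable setT (EFin \o (fun x => r * a x)).
    exact: (integrableZl measurableT r Ia).
  have Isb : mu.-integrable setT (EFin \o (fun x => s * b x)).
    exact: (integrableZl measurableT s Ib).
  split.
    exact: (integrableD measurableT Ira Isb).
  by rewrite RintegralD// !RintegralZl.
have [h1 e1] := lin2 (Re c) (- Im c) _ _ f1 f2.
have [_ e1'] := lin2 1 1 _ _ h1 g1.
have [h2 e2] := lin2 (Re c) (Im c) _ _ f2 f1.
have [_ e2'] := lin2 1 1 _ _ h2 g2.
apply/eqP; rewrite eq_complex ReD ImD ReM ImM /cint/=; apply/andP; split.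
- rewrite (_ : (fun x => _) = (fun x => 1 * (Re c * Re (f x) +
    - Im c * Im (f x)) + 1 * Re (g x))); last first.
    by apply/funext => x; rewrite ReD ReM; ring.
  by rewrite e1' e1; apply/eqP; ring.
- rewrite (_ : (fun x => _) = (fun x => 1 * (Re c * Im (f x) +
    Im c * Re (f x)) + 1 * Im (g x))); last first.
    by apply/funext => x; rewrite ImD ImM; ring.
  by rewrite e2' e2; apply/eqP; ring.
Qed.

Lemma cmeasurable_mul_conj f g : cmeasurable setT f -> cmeasurable setT g ->
  cmeasurable setT (fun x => f x * (g x)^*).
Proof.
move=> [f1 f2] [g1 g2]; split.
- rewrite (_ : (fun x => _) = fun x => Re (f x) * Re (g x) +
    Im (f x) * Im (g x)); last first.
    by apply/funext => x; rewrite ReM ReC ImC; ring.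
  by apply: measurable_funD; apply: measurable_funM.
- rewrite (_ : (fun x => _) = fun x => Im (f x) * Re (g x) -
    Re (f x) * Im (g x)); last first.
    by apply/funext => x; rewrite ImM ReC ImC; ring.
  by apply: measurable_funB; apply: measurable_funM.
Qed.

Lemma L2on_mul_conj f g : L2on setT f -> L2on setT g ->
  cintegrable setT (fun x => f x * (g x)^*).
Proof.
move=> Lf Lg; have [m1 m2] := cmeasurable_mul_conj (proj1 Lf) (proj1 Lg).
have I : mu.-integrable setT (fun x => (sqn (f x) + sqn (g x))%:E).
  exact: (integrableD measurableT (sqn_integrable Lf) (sqn_integrable Lg)).
by split; apply: (le_integrable _ _ _ I) => //;
  first [exact/measurable_EFinP
  | move=> x _; rewrite !abse_EFin lee_fin (le_trans _ (ler_norm _))//;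
    have [] := mul_conj_bound (f x) (g x)].
Qed.

Lemma eq_cint f g : cmeasurable setT f -> cmeasurable setT g ->
  {ae mu, forall x, f x = g x} -> cint setT f = cint setT g.
Proof.
move=> [f1 f2] [g1 g2] fg; rewrite /cint; congr (_ +i* _); congr fine;
  apply: ae_eq_integral => //; try exact/measurable_EFinP;
  by apply: filterS fg => x fgx _; rewrite fgx.
Qed.

Let L2_linearl (a : R[i]) (u v w : L2) :
  L2_inner (a *: u + v) w = a * L2_inner u w + L2_inner v w.
Proof.
have Pm (p q : L2) := L2on_mul_conj (L2P p) (L2P q).
rewrite -cint_lin//; apply: eq_cint.
- by apply: cmeasurable_mul_conj; apply: (proj1 (L2P _)).
- apply: cmeasurable_lin; apply: cmeasurable_mul_conj;
  by apply: (proj1 (L2P _)).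
- have := L2_linE a u v; apply: filterS => x ->.
  by rewrite mulrDl mulrA.
Qed.

Let L2_conj (u v : L2) : L2_inner v u = (L2_inner u v)^*.
Proof.
have [_ I2] := L2on_mul_conj (L2P u) (L2P v).
apply/eqP; rewrite eq_complex ReC ImC; apply/andP; split; apply/eqP => /=.
  by congr fine; apply: eq_integral => x _; rewrite -[in RHS]conj_mul_conj ReC.
rewrite -[RHS]mulN1r -RintegralZl//; apply: eq_Rintegral => x _.
by rewrite -conj_mul_conj ImC; ring.
Qed.

Lemma L2_inner_self (u : L2) :
  L2_inner u u = (\int[mu]_x sqn (u x))%:C.
Proof.
rewrite /L2_inner /cint; congr (_ +i* _).
  by apply: eq_Rintegral => x _; rewrite mul_conj_self.
rewrite (_ : (fun x => _) = cst 0); first by rewrite /Rintegral integral0.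
by apply/funext => x; rewrite mul_conj_self.
Qed.

Let L2_ge0 (u : L2) : 0 <= L2_inner u u.
Proof.
rewrite L2_inner_self ler0c; apply: fine_ge0; apply: integral_ge0 => x _.
by rewrite lee_fin sqn_ge0.
Qed.

Let L2_eq0 (u : L2) : L2_inner u u = 0 -> u = 0.
Proof.
rewrite L2_inner_self => -[] h.
have Iu := sqn_integrable (L2P u).
have e0 : (\int[mu]_x (sqn (u x))%:E = 0)%E.
  have := integrable_fin_num measurableT Iu.
  by move=> /fineK; rewrite -/(Rintegral _ _ _) h => <-.
have /ae_eq_integral_abs : measurable_fun setT (fun x => (sqn (u x))%:E).
  exact: measurable_int Iu.
move=> /(_ mu measurableT)/iffLR.
under eq_integral => x _ do rewrite gee0_abs ?lee_fin ?sqn_ge0//.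
move=> /(_ e0) u0; apply: L2_ae_inj.
have -> : (0 : L2) = \pi_L2 0 by rewrite raddf0.
have := L2_reprE 0; apply: filterS2 u0 => x /(_ I)[] ux.
by rewrite -/(L2_fun _ _) => ->; rewrite (sqn_eq0 ux).
Qed.

HB.instance Definition _ := Lmodule_isPreHilbert.Build R L2
  L2_linearl L2_conj L2_ge0 L2_eq0.

End L2.
Arguments L2 {d T R} mu.

Section linear_relations.
Context {R : realType}.
Implicit Types (H K L : preHilbertType R) (c l z : R[i]).

Definition hnorm {H} (u : H) : R := Num.sqrt (Re '[u, u]).

Definition hcvg {H} (u_ : nat -> H) (u : H) : Prop :=
  (fun n => hnorm (u_ n - u)) @ \oo --> 0.

(* Operators from H to K are identified with their graphs. *)
Definition rel_dom {H K} (A : set (H * K)) : set H :=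
  [set u | exists v, A (u, v)].

Definition single_valued {H K} (A : set (H * K)) : Prop :=
  forall u v w, A (u, v) -> A (u, w) -> v = w.

Definition linear_rel {H K} (A : set (H * K)) : Prop :=
  A (0, 0) /\
  forall c p q, A p -> A q -> A (c *: p.1 + q.1, c *: p.2 + q.2).

Definition closed_rel {H K} (A : set (H * K)) : Prop :=
  forall (u_ : nat -> H) (v_ : nat -> K) u v,
    (forall n, A (u_ n, v_ n)) -> hcvg u_ u -> hcvg v_ v -> A (u, v).

Definition closed_operator {H K} (A : set (H * K)) : Prop :=
  [/\ linear_rel A, single_valued A & closed_rel A].

Definition everywhere_defined {H K} (A : set (H * K)) : Prop :=
  rel_dom A = setT.

Definition bounded_rel {H K} (A : set (H * K)) : Prop :=
  exists k : R, forall u v, A (u, v) -> hnorm v <= k * hnorm u.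

Definition rel_norm {H K} (A : set (H * K)) : R :=
  sup [set r | exists u v, [/\ A (u, v), hnorm u <= 1 & r = hnorm v]].

Definition rel_id {H} : set (H * H) := [set p | p.1 = p.2].

Definition rel_inv {H K} (A : set (H * K)) : set (K * H) :=
  [set p | A (p.2, p.1)].

Definition rel_comp {H K L} (A : set (K * L)) (B : set (H * K)) : set (H * L) :=
  [set p | exists v, B (p.1, v) /\ A (v, p.2)].

Definition rel_add {H K} (A B : set (H * K)) : set (H * K) :=
  [set p | exists v w, [/\ A (p.1, v), B (p.1, w) & p.2 = v + w]].

Definition rel_scale {H K} c (A : set (H * K)) : set (H * K) :=
  [set p | exists v, A (p.1, v) /\ p.2 = c *: v].

Definition rel_sub {H K} (A B : set (H * K)) : set (H * K) :=
  rel_add A (rel_scale (-1) B).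

(* If B is unbounded, the operator (I - B M)^-1 B gamma^* is not everywhere
   defined, and it is compared with a restriction of a resolvent. *)
Definition rel_restrict {H K} (A : set (H * K)) (D : set H) : set (H * K) :=
  [set p | A p /\ D p.1].

Definition rel_adj {H K} (A : set (H * K)) : set (K * H) :=
  [set p | forall u v, A (u, v) -> '[v, p.1] = '[u, p.2]].

Definition rel_Im {H} (A : set (H * H)) : set (H * H) :=
  rel_scale ((2 * 'i%C)^-1) (rel_sub A (rel_adj A)).

Definition self_adjoint {H} (A : set (H * H)) : Prop := rel_adj A = A.

Definition resolvent {H} (A : set (H * H)) l : set (H * H) :=
  rel_inv (rel_sub A (rel_scale l rel_id)).

Definition resolvent_set {H} (A : set (H * H)) : set R[i] :=
  [set l | [/\ single_valued (resolvent A l),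
               everywhere_defined (resolvent A l) &
               bounded_rel (resolvent A l)]].

Definition spectrum {H} (A : set (H * H)) : set R[i] := ~` resolvent_set A.

Definition num_range {H} (A : set (H * H)) : set R[i] :=
  [set z | exists u v, [/\ A (u, v), hnorm u = 1 & z = '[v, u]]].

Definition maximal_dissipative {H} (A : set (H * H)) : Prop :=
  num_range A `<=` closed_upper_half /\
  resolvent_set A `&` lower_half !=set0.

Definition maximal_accumulative {H} (A : set (H * H)) : Prop :=
  num_range A `<=` closed_lower_half /\
  resolvent_set A `&` upper_half !=set0.

Definition sector (eta kappa : R) : set R[i] :=
  [set z | eta <= Re z /\ `|Im z| <= kappa * (Re z - eta)].

Definition m_sectorial {H} (A : set (H * H)) : Prop :=
  exists eta kappa : R, [/\ 0 < kappa, num_range A `<=` sector eta kappa &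
    resolvent_set A `&` ~` sector eta kappa !=set0].

End linear_relations.

Notation L2R R := (L2 (@lebesgue_measure R)).

Section sobolev.
Context {R : realType}.
Notation leb := (@lebesgue_measure R).
Implicit Types (D I : set R) (f g h : R -> R[i]) (x : int -> R).

(* Sobolev spaces on open intervals are defined by weak derivatives, tested
   against C^1 functions with compact support in I. *)
Definition test_fun I (phi : R -> R) : Prop :=
  [/\ forall t, derivable phi t 1, continuous (derive1 phi) &
      exists K, [/\ compact K, K `<=` I & forall t, ~ K t -> phi t = 0]].

Definition weak_deriv I f g : Prop :=
  forall phi, test_fun I phi ->
    cint leb I (fun t : R => f t * (derive1 phi t)%:C) =
    - cint leb I (fun t : R => g t * (phi t)%:C).

(* f belongs to H^1(I), respectively H^2(I), for an open interval I, with the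
   indicated weak derivatives. *)
Definition is_H1 I f f1 : Prop :=
  [/\ L2on leb I f, L2on leb I f1 & weak_deriv I f f1].

Definition is_H2 I f f1 f2 : Prop := is_H1 I f f1 /\ is_H1 I f1 f2.

Definition H2_sqnorm I f f1 f2 : R :=
  \int[leb]_(t in I) (sqn (f t) + sqn (f1 t) + sqn (f2 t)).

Definition gap x (n : int) : set R := `]x n, x (n + 1)[.

Definition is_H2_off x f f1 f2 : Prop :=
  (forall n, is_H2 (gap x n) f f1 f2) /\
  zsummable (fun n => H2_sqnorm (gap x n) f f1 f2).

(* v is the value at a of the continuous representative of the restriction of
   f to I, extended by continuity if a is an endpoint of I. *)
Definition trace I f (a : R) (v : R[i]) : Prop :=
  exists F : R -> R[i], {ae leb, forall t, I t -> F t = f t} /\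
    (F t : R[i]^o) @[t --> within I (nbhs a)] --> (v : R[i]^o).

Definition Gamma0 x f1 (xi : l2 R) : Prop :=
  forall n, exists p q, [/\ trace (gap x n) f1 (x n) p,
    trace (gap x (n - 1)) f1 (x n) q & xi n = p - q].

Definition Gamma1 x f (xi : l2 R) : Prop :=
  forall n, trace setT f (x n) (- xi n).

(* The boundary condition reads (Gamma1 f, Gamma0 f) \in B, so that B may be
   an arbitrary linear relation. *)
Definition A_brack x (B : set (l2 R * l2 R)) : set (L2R R * L2R R) :=
  [set p : L2R R * L2R R | exists f1 f2 g, [/\ is_H2_off x p.1 f1 f2, is_H1 setT p.1 g,
    (exists xi eta, [/\ Gamma1 x p.1 xi, Gamma0 x f1 eta & B (xi, eta)]) &
    {ae leb, forall t : R, p.2 t = - f2 t}]].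

Definition A_free : set (L2R R * L2R R) :=
  [set p : L2R R * L2R R | exists f1 f2, is_H2 setT p.1 f1 f2 /\
    {ae leb, forall t : R, p.2 t = - f2 t}].

(* On the complement of [0, +oo[ the square root sqrtC has positive imaginary
   part, see Im_sqrtC_gt0. *)
Definition gamma_field x (l : R[i]) : set (l2 R * L2R R) :=
  [set p : l2 R * L2R R | {ae leb, forall t : R, p.2 t = - 'i%C / (2 * sqrtC l) *
    csum (fun n => cexp ('i%C * sqrtC l * `|x n - t|%:C) * p.1 n)}].

Definition weyl_fun x (l : R[i]) : set (l2 R * l2 R) :=
  [set p : l2 R * l2 R | forall m, p.2 m = 'i%C / (2 * sqrtC l) *
    csum (fun n => cexp ('i%C * sqrtC l * `|x n - x m|%:C) * p.1 n)].

End sobolev.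

(* Main.v *)
(** A_[B] is the restriction, by the boundary condition (Gamma1 f, Gamma0 f) in B,
    of the maximal operator [T f = - f''] on H^2(R \ X) /\ H^1(R). Integrating by
    parts on each gap and telescoping over the nodes gives
      (T f, g) = (f', g') - (Gamma0 f, Gamma1 g),
    hence Green's identity. A solution of [T f = s^2 f + h] with prescribed jumps
    is, on each gap, a particular solution plus a right- and a left-going
    exponential; continuity at the nodes turns into two first-order recurrences
    whose coefficients are at most exp (- d Im s) < 1 in modulus, so they are
    uniquely solvable in l^2, and telescoping identifies the solution with the
    kernel series defining gamma and M. The same contraction gives
    |M(s^2)| <= coth (d Im s / 2) / (2 |s|).

    Closedness, the adjoint, the dissipative case and Krein's formula then follow
    for any boundary triple whose Weyl function has an imaginary part bounded
    from below at one point. For the bounds on the numerical range, the bound on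
    M at negative points gives [|Gamma1 f|^2 <= 2 C (|f'|^2 - mu)^(1/2)] when
    [|f| = 1], while
      (A_[B] f, f) = |f'|^2 - (B Gamma1 f, Gamma1 f).
    The spectrum lies in the closure of the numerical range because the numerical
    range of the adjoint is approximated by conjugates of that of A_[B], and part
    (c) holds because [|B| |M(l)| < 1] puts [l] in the resolvent set. *)

Require Import Defs.
From mathcomp Require Import all_boot all_order all_algebra.
From mathcomp Require Import all_classical all_reals all_analysis.
From mathcomp Require Import measurable_realfun complex.
From mathcomp Require Import ring lra zify.

Set Implicit Arguments.
Unset Strict Implicit.

Import Order.TTheory GRing.Theory Num.Theory.
Import numFieldNormedType.Exports.
Local Open Scope ring_scope.
Local Open Scope classical_set_scope.
Local Open Scope complex_scope.

Local Notation Re := complex.Re.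
Local Notation Im := complex.Im.
Local Notation ReD := Defs.ReD.
Local Notation ImD := Defs.ImD.
Local Notation ReM := Defs.ReM.
Local Notation ImM := Defs.ImM.

(** * Hilbert spaces *)

Section complex_modulus.
Context {R : realType}.
Implicit Types (z w : R[i]) (r : R).

(** [B] may be unbounded and not densely defined, so operators are handled as graphs and the adjoint
    formula cannot rest on density arguments. It rests on the surjectivity of (Gamma0, Gamma1),
    which, like the continuity of both traces in the graph norm, follows from a single estimate at
    one point l0: Im M(l0) >= c0 > 0, that is, gamma(l0) is bounded below. The point is l0 = s^2
    with s = (9/d)(1 + i): the waves decay so much between nodes that M(l0) is a small perturbation
    of its diagonal i/(2s).

    A distance delta from z to the numerical range bounds A_[B] - z below, but surjectivity needs
    the same bound for the adjoint, whose domain is a different one. Adding gamma(iy) zeta to an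
    element of the adjoint domain changes the boundary condition from that of the adjoint of B to
    that of B at arbitrarily small cost, which transfers the bound.

    Krein's formula is stated for l in the resolvent set of A_0, so every point of [0, oo) must be
    shown to lie in the spectrum of A_0. This is done without Fourier transform: the norm of
    gamma(l) on a unit vector is explicit and blows up at the half-line. *)

Lemma complex_ext z w : Re z = Re w -> Im z = Im w -> z = w.
Proof. by move=> h1 h2; apply/eqP; rewrite eq_complex h1 h2 !eqxx. Qed.

Lemma ReN z : Re (- z) = - Re z. Proof. by case: z. Qed.
Lemma ImN z : Im (- z) = - Im z. Proof. by case: z. Qed.
Lemma ReB z w : Re (z - w) = Re z - Re w. Proof. by rewrite ReD ReN. Qed.
Lemma ImB z w : Im (z - w) = Im z - Im w. Proof. by rewrite ImD ImN. Qed.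
Definition ReImE := (@ReD R, @ImD R, @ReM R, @ImM R, @ReC R, @ImC R, ReN, ImN).

Lemma cabs_ge0 z : 0 <= cabs z. Proof. exact: sqrtr_ge0. Qed.
Lemma cabs_sqr z : cabs z ^+ 2 = sqn z. Proof. by rewrite sqr_sqrtr// sqn_ge0. Qed.
Lemma cabsM z w : cabs (z * w) = cabs z * cabs w.
Proof. by rewrite /cabs sqnM sqrtrM// sqn_ge0. Qed.
Lemma cabs0 : cabs (0 : R[i]) = 0. Proof. by rewrite /cabs sqn0 sqrtr0. Qed.
Lemma cabs_eq0 z : cabs z = 0 -> z = 0.
Proof. by move=> h; apply: sqn_eq0; rewrite -cabs_sqr h expr0n. Qed.
Lemma cabs_gt0 z : z != 0 -> 0 < cabs z.
Proof.
move=> z0; rewrite lt_neqAle cabs_ge0 andbT eq_sym.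
by apply: contra z0 => /eqP/cabs_eq0 ->.
Qed.
Lemma cabsC z : cabs z^* = cabs z.
Proof. by rewrite /cabs /sqn ReC ImC sqrrN. Qed.
Lemma cabsN z : cabs (- z) = cabs z.
Proof. by rewrite /cabs /sqn ReN ImN !sqrrN. Qed.
Lemma cabsr r : cabs (r%:C) = `|r|.
Proof. by rewrite /cabs /sqn/= expr0n/= addr0 sqrtr_sqr. Qed.
Lemma Re_le_cabs z : `|Re z| <= cabs z.
Proof. by rewrite -sqrtr_sqr ler_sqrt ?sqn_ge0// lerDl sqr_ge0. Qed.
Lemma Im_le_cabs z : `|Im z| <= cabs z.
Proof. by rewrite -sqrtr_sqr ler_sqrt ?sqn_ge0// lerDr sqr_ge0. Qed.

(** Take for [theta] the phase conj z / |z|; [0 <= k] covers [z = 0]. Bounds on real parts that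
    survive rotation become bounds on moduli, which serves both the triangle inequality and
    Cauchy-Schwarz. *)
Lemma cabs_sup z (k : R) :
  (forall theta : R[i], cabs theta = 1 -> Re (theta * z) <= k) -> 0 <= k -> cabs z <= k.
Proof.
move=> h k0; have [->|z0] := eqVneq z 0; first by rewrite cabs0.
have c0 := cabs_gt0 z0.
have := h (z^* * ((cabs z)^-1)%:C).
rewrite cabsM cabsC cabsr ger0_norm ?invr_ge0 ?cabs_ge0// divff ?gt_eqF// => /(_ erefl).
rewrite mulrAC [z^* * z]mulrC mul_conj_self ReM/= mulr0 subr0 -cabs_sqr expr2 mulfK ?gt_eqF//.
Qed.

Lemma cabsD z w : cabs (z + w) <= cabs z + cabs w.
Proof.
apply: cabs_sup; last by rewrite addr_ge0 ?cabs_ge0.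
move=> t t1; rewrite mulrDr ReD lerD// (le_trans (ler_norm _))//
  (le_trans (Re_le_cabs _))// cabsM t1 mul1r//.
Qed.

End complex_modulus.

Section pre_hilbert.
Context {R : realType} {H : preHilbertType R}.
Implicit Types (u v w : H) (a : R[i]).

Lemma innerDl u v w : '[u + v, w] = '[u, w] + '[v, w].
Proof. by rewrite -[u]scale1r inner_linearl mul1r scale1r. Qed.
Lemma inner0l u : '[0, u] = 0 :> R[i].
Proof. by apply: (addrI '[(0 : H), u]); rewrite -innerDl !addr0. Qed.
Lemma innerZl a u v : '[a *: u, v] = a * '[u, v].
Proof. by rewrite -[a *: u]addr0 inner_linearl inner0l addr0. Qed.
Lemma innerNl u v : '[- u, v] = - '[u, v].
Proof. by rewrite -scaleN1r innerZl mulN1r. Qed.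
Lemma innerBl u v w : '[u - v, w] = '[u, w] - '[v, w].
Proof. by rewrite innerDl innerNl. Qed.
Lemma innerDr u v w : '[w, u + v] = '[w, u] + '[w, v].
Proof. by rewrite inner_conj innerDl rmorphD/= -!inner_conj. Qed.
Lemma inner0r u : '[u, 0] = 0 :> R[i].
Proof. by rewrite inner_conj inner0l rmorph0. Qed.
Lemma innerZr a u v : '[u, a *: v] = a^* * '[u, v].
Proof. by rewrite inner_conj innerZl rmorphM/= -inner_conj. Qed.
Lemma innerNr u v : '[u, - v] = - '[u, v].
Proof. by rewrite inner_conj innerNl rmorphN/= -inner_conj. Qed.
Lemma innerBr u v w : '[w, u - v] = '[w, u] - '[w, v].
Proof. by rewrite innerDr innerNr. Qed.
Definition innerE := (innerDl, innerDr, innerNl, innerNr, innerZl, innerZr).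

Lemma Re_inner_conj u v : Re '[v, u] = Re '[u, v].
Proof. by rewrite inner_conj ReC. Qed.
Lemma Im_inner_conj u v : Im '[v, u] = - Im '[u, v].
Proof. by rewrite inner_conj ImC. Qed.

Lemma Im_inner_self u : Im '[u, u] = 0.
Proof. by have := Im_inner_conj u u; lra. Qed.
Lemma Re_inner_self_ge0 u : 0 <= Re '[u, u].
Proof. by have := inner_ge0 u; rewrite lecE/= => /andP[]. Qed.

Lemma hnorm_ge0 u : 0 <= hnorm u. Proof. exact: sqrtr_ge0. Qed.
Lemma hnorm_sqr u : hnorm u ^+ 2 = Re '[u, u].
Proof. by rewrite sqr_sqrtr// Re_inner_self_ge0. Qed.
Lemma inner_selfE u : '[u, u] = (hnorm u ^+ 2)%:C.
Proof. by apply: complex_ext; rewrite ?Im_inner_self ?hnorm_sqr. Qed.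
Lemma hnorm0 : hnorm (0 : H) = 0.
Proof. by rewrite /hnorm inner0l sqrtr0. Qed.
Lemma hnorm_eq0 u : hnorm u = 0 -> u = 0.
Proof. by move=> h; apply: inner_eq0; rewrite inner_selfE h expr0n. Qed.
Lemma hnormZ a u : hnorm (a *: u) = cabs a * hnorm u.
Proof.
rewrite /hnorm innerZl innerZr mulrA mul_conj_self ReM/= mul0r subr0.
by rewrite sqrtrM// sqn_ge0.
Qed.
Lemma hnormN u : hnorm (- u) = hnorm u.
Proof. by rewrite /hnorm innerNl innerNr opprK. Qed.
Lemma hnormBC u v : hnorm (u - v) = hnorm (v - u).
Proof. by rewrite -hnormN opprB. Qed.

Lemma hnormD_sqr u v :
  hnorm (u + v) ^+ 2 = hnorm u ^+ 2 + 2 * Re '[u, v] + hnorm v ^+ 2.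
Proof. by rewrite !hnorm_sqr !innerE !ReD (Re_inner_conj u v); ring. Qed.

Lemma Re_inner_le u v : Re '[u, v] <= hnorm u * hnorm v.
Proof.
have [->|v0] := eqVneq v 0; first by rewrite inner0r hnorm0 mulr0.
have nv : 0 < hnorm v.
  rewrite lt_neqAle hnorm_ge0 andbT eq_sym.
  by apply: contra v0 => /eqP/hnorm_eq0 ->.
(* This [t] gives [u] and [t v] the same norm, so expanding |u - t v|^2 >= 0 leaves t Re(u, v) <=
   |u|^2. *)
pose t : R := hnorm u / hnorm v.
have := sqr_ge0 (hnorm (u + (- t)%:C *: v)).
rewrite hnormD_sqr hnormZ innerZr ReM ReC ImC cabsr normrN exprMn real_normK ?num_real//.
rewrite /= oppr0 mul0r subr0 /t.
rewrite -exprMn divfK ?gt_eqF// => h.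
have {h} : hnorm u / hnorm v * Re '[u, v] <= hnorm u ^+ 2 by lra.
have [->|u0] := eqVneq u 0; first by rewrite inner0l hnorm0 !mul0r.
have nu : 0 < hnorm u.
  rewrite lt_neqAle hnorm_ge0 andbT eq_sym.
  by apply: contra u0 => /eqP/hnorm_eq0 ->.
rewrite mulrAC ler_pdivrMr// expr2 -!mulrA ler_pM2l//.
Qed.

Lemma cabs_inner_le u v : cabs '[u, v] <= hnorm u * hnorm v.
Proof.
apply: cabs_sup; last by rewrite mulr_ge0 ?hnorm_ge0.
by move=> t t1; rewrite -innerZl (le_trans (Re_inner_le _ _))// hnormZ t1 mul1r.
Qed.
Lemma Re_inner_norm_le u v : `|Re '[u, v]| <= hnorm u * hnorm v.
Proof. exact: le_trans (Re_le_cabs _) (cabs_inner_le _ _). Qed.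
Lemma Im_inner_norm_le u v : `|Im '[u, v]| <= hnorm u * hnorm v.
Proof. exact: le_trans (Im_le_cabs _) (cabs_inner_le _ _). Qed.

Lemma ler_hnormD u v : hnorm (u + v) <= hnorm u + hnorm v.
Proof.
rewrite -(ler_pXn2r (n := 2))// ?nnegrE ?addr_ge0 ?hnorm_ge0//.
by rewrite hnormD_sqr sqrrD -mulr_natl; have := Re_inner_le u v; lra.
Qed.
Lemma ler_hnormB u v : hnorm (u - v) <= hnorm u + hnorm v.
Proof. by rewrite (le_trans (ler_hnormD _ _))// hnormN. Qed.
Lemma ler_hnorm_dist u v w : hnorm (u - w) <= hnorm (u - v) + hnorm (v - w).
Proof. by rewrite -[u in X in X <= _](subrK v) -addrA ler_hnormD. Qed.
Lemma lerB_hnorm u v : hnorm u - hnorm v <= hnorm (u - v).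
Proof. by rewrite lerBlDr -{1}[u](subrK v) ler_hnormD. Qed.

Lemma hcvgP (u_ : nat -> H) u : hcvg u_ u <->
  forall e : R, 0 < e -> exists N, forall n, (N <= n)%N -> hnorm (u_ n - u) < e.
Proof.
split => [/cvgrPdist_lt h e e0|h].
  have [N _ hN] := h e e0; exists N => n Nn.
  by have := hN n Nn; rewrite /= sub0r normrN ger0_norm ?hnorm_ge0.
apply/cvgrPdist_lt => e e0; have [N hN] := h e e0; exists N => // n Nn.
by rewrite /= sub0r normrN ger0_norm ?hnorm_ge0//; apply: hN.
Qed.

Lemma hcvg_unique (u_ : nat -> H) u v : hcvg u_ u -> hcvg u_ v -> u = v.
Proof.
move=> /hcvgP hu /hcvgP hv; apply/eqP; rewrite -subr_eq0; apply/eqP/hnorm_eq0.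
apply/eqP; rewrite eq_le hnorm_ge0 andbT; apply/ler_addgt0Pr => e e0.
have e2 : 0 < e / 2 by lra.
have [N1 h1] := hu _ e2; have [N2 h2] := hv _ e2.
have := h1 (maxn N1 N2) (leq_maxl _ _); have := h2 (maxn N1 N2) (leq_maxr _ _).
have := ler_hnorm_dist u (u_ (maxn N1 N2)) v.
rewrite (hnormBC u (u_ _)); lra.
Qed.

Definition hcauchy (u_ : nat -> H) := forall e : R, 0 < e ->
  exists N, forall m n, (N <= m)%N -> (N <= n)%N -> hnorm (u_ m - u_ n) < e.

Lemma hcvg_cauchy (u_ : nat -> H) u : hcvg u_ u -> hcauchy u_.
Proof.
move=> /hcvgP hu e e0; have e2 : 0 < e / 2 by lra.
have [N hN] := hu _ e2; exists N => m n /hN hm /hN hn.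
have := ler_hnorm_dist (u_ m) u (u_ n); rewrite (hnormBC u); lra.
Qed.

End pre_hilbert.

Definition hcomplete {R : realType} (H : preHilbertType R) :=
  forall u_ : nat -> H, hcauchy u_ -> exists u, hcvg u_ u.

Section hilbert.
Context {R : realType} {H : preHilbertType R} (Hc : hcomplete H).

Lemma contraction_fixpoint (F : H -> H) (q : R) : 0 <= q < 1 ->
  (forall u v, hnorm (F u - F v) <= q * hnorm (u - v)) -> exists u, F u = u.
Proof.
move=> /andP[q0 q1] hF.
pose u_ n := iter n F 0; pose r := hnorm (u_ 1%N - u_ 0%N).
have q1' : 0 < 1 - q by lra.
have r0 : 0 <= r by exact: hnorm_ge0.
have stepn n : hnorm (u_ n.+1 - u_ n) <= q ^+ n * r.
  elim: n => [|n ih]; first by rewrite expr0 mul1r.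
  by rewrite (le_trans (hF _ _))// exprS -mulrA ler_wpM2l.
have tail n k : hnorm (u_ (n + k)%N - u_ n) <= q ^+ n * r / (1 - q).
  elim: k n => [n|k ih n].
    by rewrite addn0 subrr hnorm0 divr_ge0 ?mulr_ge0 ?exprn_ge0// ltW.
  rewrite (le_trans (ler_hnorm_dist _ (u_ n.+1) _))//.
  have := ih n.+1; rewrite addSnnS => h.
  rewrite (le_trans (lerD h (stepn n)))// exprS.
  rewrite [leRHS](_ : _ = q * q ^+ n * r / (1 - q) + q ^+ n * r)//.
  by field; rewrite gt_eqF.
have cF : hcauchy u_.
  move=> e e0.
  have : (fun n => q ^+ n * (r / (1 - q))) @ \oo --> 0.
    rewrite -[X in _ --> X](mul0r (r / (1 - q))); apply: cvgMl.
    by apply: cvg_expr; rewrite ger0_norm.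
  move=> /cvgrPdist_lt/(_ (e / 2)); have e2 : 0 < e / 2 by lra.
  move=> /(_ e2)[N _ hN]; exists N => m n Nm Nn.
  have key k : (N <= k)%N -> hnorm (u_ k - u_ N) < e / 2.
    move=> Nk; have := tail N (k - N)%N; rewrite subnKC// => h.
    rewrite (le_lt_trans h)//; have := hN N (leqnn _).
    rewrite /= sub0r normrN -mulrA ger0_norm//.
    by rewrite mulr_ge0 ?exprn_ge0// divr_ge0// ltW.
  have := key _ Nm; have := key _ Nn; have := ler_hnorm_dist (u_ m) (u_ N) (u_ n).
  by rewrite (hnormBC (u_ N)); lra.
have [u /hcvgP hu] := Hc cF; exists u.
apply: (@hcvg_unique _ _ (fun n => u_ n.+1)); apply/hcvgP => e e0;
  have [N hN] := hu e e0; exists N => n Nn; last exact: hN (leqW Nn).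
rewrite (le_lt_trans (hF _ _))// (le_lt_trans _ (hN n Nn))//.
by rewrite ler_piMl ?hnorm_ge0// ltW.
Qed.

End hilbert.

(** * Surjectivity by perturbation and by the method of continuity *)

Section continuity_method.
Context {R : realType} {H K : preHilbertType R} (Kc : hcomplete K).

Definition hlinear (P : H -> K) := forall c u v, P (c *: u + v) = c *: P u + P v.

Lemma hlinearB P : hlinear P -> forall u v, P (u - v) = P u - P v.
Proof. by move=> h u v; rewrite addrC -scaleN1r h scaleN1r addrC. Qed.
Lemma hlinearZ P : hlinear P -> forall c u, P (c *: u) = c *: P u.
Proof.
move=> h c u; have h0 : P 0 = 0 by rewrite -(subrr (0 : H)) (hlinearB h) subrr.
by rewrite -[c *: u]addr0 h h0 addr0.
Qed.

(** The data [w] is a fixed point of [w -> v - P (S w)], where [S] is any choice of preimages under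
    [T]. Nothing says that [S] is linear, but [T] is, so the lower bound applies to differences of
    preimages and makes the map a contraction of ratio [p / c]. *)
Lemma perturb_surjective (T : set (H * K)) (P : H -> K) (c p : R) :
  linear_rel T -> (forall v, exists u, T (u, v)) ->
  (forall u v, T (u, v) -> c * hnorm u <= hnorm v) ->
  hlinear P -> (forall u, hnorm (P u) <= p * hnorm u) -> 0 <= p < c ->
  forall v, exists u w, T (u, w) /\ v = w + P u.
Proof.
move=> [_ Tl] Ts Tb Pl Pb /andP[p0 pc] v.
have c0 : 0 < c by lra.
have [S hS] := choice Ts.
pose F w := v - P (S w).
have TSB w w' : T (S w - S w', w - w').
  have := Tl (-1) _ _ (hS w') (hS w).
  by rewrite /= !scaleN1r ![- _ + _]addrC.
have hF w w' : hnorm (F w - F w') <= p / c * hnorm (w - w').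
  have -> : F w - F w' = P (S w' - S w).
    by rewrite (hlinearB Pl) /F opprB addrC addrA subrK.
  rewrite (le_trans (Pb _))// -mulrA ler_wpM2l// ler_pdivlMl//.
  by rewrite hnormBC; exact: (Tb _ _ (TSB w w')).
have [|w Fw] := contraction_fixpoint Kc (q := p / c) _ hF.
  by rewrite divr_ge0 ?(ltW c0)// ltr_pdivrMr// mul1r.
by exists (S w), w; split; [exact: hS|rewrite -{1}Fw /F subrK].
Qed.

(** The lower bound is uniform along the segment from [T] to [T + P], so the segment is crossed in
    [n > p / c] equal steps, each a perturbation of norm less than [c]. *)
Lemma continuity_method (T : set (H * K)) (P : H -> K) (c p : R) :
  linear_rel T -> (forall v, exists u, T (u, v)) ->
  hlinear P -> (forall u, hnorm (P u) <= p * hnorm u) -> 0 < c ->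
  (forall theta : R, 0 <= theta <= 1 -> forall u v, T (u, v) ->
     c * hnorm u <= hnorm (v + theta%:C *: P u)) ->
  forall v, exists u w, T (u, w) /\ v = w + P u.
Proof.
move=> Tl Ts Pl Pb c0 Tb.
wlog p0 : p Pb / 0 <= p.
  move=> /(_ `|p|); apply => //= u; rewrite (le_trans (Pb u))//.
  by rewrite ler_wpM2r ?hnorm_ge0// ler_norm.
pose n := (Num.truncn (p / c)).+1.
have n0 : (0 : R) < n%:R by rewrite ltr0n.
have pn : p / n%:R < c.
  by rewrite ltr_pdivrMr// mulrC -ltr_pdivrMr//; exact: truncnS_gt.
pose Tj j : set (H * K) := [set q | exists w, T (q.1, w) /\
   q.2 = w + (j%:R / n%:R)%:C *: P q.1].
have Tjl j : linear_rel (Tj j).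
  have [T0 Tl'] := Tl; split.
    exists 0; split => //=; rewrite -(subrr (0 : H)) (hlinearB Pl) subrr scaler0 addr0//.
  move=> a q r [w [h1 e1]] [w' [h2 e2]]; exists (a *: w + w'); split.
    exact: Tl' h1 h2.
  by rewrite /= e1 e2 Pl !scalerDr !scalerA [_%:C * a]mulrC addrACA.
suff step j : (j <= n)%N -> forall v, exists u, Tj j (u, v).
  move=> v; have [u [w [h e]]] := step n (leqnn _) v.
  by exists u, w; split => //; move: e => /= ->; rewrite divff ?gt_eqF// scale1r.
elim: j => [_ v|j ih jn v].
  have [u h] := Ts v; exists u, v; split => //=.
  by rewrite mul0r scale0r addr0.
have Pl' : hlinear (fun u => (n%:R^-1)%:C *: P u).
  by move=> a u u'; rewrite Pl scalerDr !scalerA mulrC.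
have [| | |u [w [[w' [h1 /= h2]] h3]]] :=
    @perturb_surjective (Tj j) _ c (p / n%:R) (Tjl j) (ih (ltnW jn)) _ Pl' _ _ v.
- move=> u w [w' [h1 /= ->]]; apply: Tb => //.
  by rewrite divr_ge0//= ler_pdivrMr// mul1r ler_nat ltnW.
- move=> u; rewrite hnormZ cabsr ger0_norm ?invr_ge0//.
  by rewrite mulrC mulrAC ler_wpM2r ?invr_ge0.
- by rewrite pn andbT divr_ge0// ltW.
exists u, w'; split => //=; rewrite h3 h2 -addrA -scalerDl; congr (_ + _ *: _).
by rewrite -rmorphD/= -natr1 mulrDl mul1r.
Qed.

End continuity_method.

Section coercive.
Context {R : realType} {H : preHilbertType R} (Hc : hcomplete H).

(** Lax-Milgram by continuity from [c I] to [P]: every [c I + theta (P - c I)] has coercivity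
    constant [c], hence is bounded below by [c]. *)
Lemma coercive_surjective (P : H -> H) (c p : R) : hlinear P ->
  (forall u, hnorm (P u) <= p * hnorm u) -> 0 < c ->
  (forall u, c * hnorm u ^+ 2 <= Re '[P u, u]) ->
  forall v, exists u, P u = v.
Proof.
move=> Pl Pb c0 Pc v.
pose Q u := P u - c%:C *: u.
have Ql : hlinear Q.
  by move=> a u w; rewrite /Q Pl scalerBr scalerDr !scalerA [a * _]mulrC opprD addrACA.
have [| | | |u [w [h ->]]] :=
    @continuity_method _ H H Hc [set q | q.2 = c%:C *: q.1] Q c (p + c) _ _ Ql _ c0 _ v.
- split => [|a q r]/=; first by rewrite scaler0.
  by move=> -> ->; rewrite scalerDr !scalerA mulrC.
- move=> w; exists ((c^-1)%:C *: w) => /=; rewrite scalerA.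
  by rewrite -rmorphM/= divff ?gt_eqF// scale1r.
- move=> u; rewrite /Q (le_trans (ler_hnormB _ _))// mulrDl hnormZ cabsr gtr0_norm//.
  by rewrite lerD2r.
- move=> t /andP[t0 t1] u w /= ->.
  have [->|u0] := eqVneq u 0; first by rewrite hnorm0 mulr0 hnorm_ge0.
  have nu : 0 < hnorm u.
    rewrite lt_neqAle hnorm_ge0 andbT eq_sym.
    by apply: contra u0 => /eqP/hnorm_eq0 ->.
  rewrite -(ler_pM2r nu) (le_trans _ (Re_inner_le _ _))// /Q.
  rewrite !innerE inner_selfE !ReImE/= !mul0r !subr0 mulrBr.
  have := Pc u; nra.
by exists u; move: h => /= ->; rewrite /Q addrC subrK.
Qed.

(** [S T] is coercive, because (S T u, u) = |T u|^2 >= c^2 |u|^2; its surjectivity gives that of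
    [S]. *)
Lemma adjoint_pair_surjective (S T : H -> H) (c p : R) : hlinear S -> hlinear T ->
  (forall u v, '[S u, v] = '[u, T v]) ->
  (forall u, hnorm (S u) <= p * hnorm u) ->
  (forall u, hnorm (T u) <= p * hnorm u) -> 0 < c ->
  (forall u, c * hnorm u <= hnorm (T u)) ->
  forall v, exists u, S u = v.
Proof.
move=> Sl Tl ST Sb Tb c0 Tc v.
have [| | | |u <-] := @coercive_surjective (fun u => S (T u)) (c ^+ 2) (`|p| * `|p|) _ _ _ _ v.
- by move=> a u w; rewrite Tl Sl.
- move=> u; rewrite (le_trans (Sb _))// -mulrA.
  rewrite (le_trans (ler_wpM2r (hnorm_ge0 _) (ler_norm p)))// ler_wpM2l//.
  by rewrite (le_trans (Tb _))// ler_wpM2r ?hnorm_ge0// ler_norm.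
- by rewrite exprn_gt0.
- move=> u; rewrite ST inner_selfE/= -exprMn ler_pXn2r// nnegrE ?hnorm_ge0//.
  by rewrite mulr_ge0 ?hnorm_ge0// ltW.
by exists (T u).
Qed.

End coercive.

Section riesz.
Context {R : realType} {H : preHilbertType R} (Hc : hcomplete H).

Lemma hnorm_gt0 (u : H) : u != 0 -> 0 < hnorm u.
Proof.
move=> u0; rewrite lt_neqAle hnorm_ge0 andbT eq_sym.
by apply: contra u0 => /eqP/hnorm_eq0 ->.
Qed.

Lemma hnormB_sqr (u v : H) :
  hnorm (u - v) ^+ 2 = hnorm u ^+ 2 - 2 * Re '[u, v] + hnorm v ^+ 2.
Proof. by rewrite hnormD_sqr innerNr ReN hnormN; ring. Qed.

Lemma inner_ext (u v : H) : (forall w, '[w, u] = '[w, v]) -> u = v.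
Proof.
move=> h; apply/eqP; rewrite -subr_eq0; apply/eqP/inner_eq0.
by rewrite innerBr h subrr.
Qed.

(* The representing vector is the minimizer of ||u||^2 - 2 Re phi(u). *)
Lemma riesz_representation (phi : H -> R[i]) (p : R) :
  (forall c u v, phi (c *: u + v) = c * phi u + phi v) ->
  (forall u, cabs (phi u) <= p * hnorm u) ->
  exists w, forall u, phi u = '[u, w].
Proof.
move=> phil phib.
have phi0 : phi 0 = 0.
  have := phil 0 0 0; rewrite scale0r addr0 mul0r add0r => h.
  by have := phil (-1) 0 0; rewrite scaler0 addr0 mulN1r addNr.
have phiD u v : phi (u + v) = phi u + phi v.
  by rewrite -[u in LHS]scale1r phil mul1r.
have phiZ c u : phi (c *: u) = c * phi u.
  by rewrite -[c *: u]addr0 phil phi0 addr0.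
pose J u := hnorm u ^+ 2 - 2 * Re (phi u).
have JB u : - p ^+ 2 <= J u.
  have := le_trans (ler_norm _) (le_trans (Re_le_cabs (phi u)) (phib u)).
  by have := sqr_ge0 (hnorm u - p); rewrite /J; nra.
have hasinf : has_inf (range J).
  by split; [exists (J 0), 0|exists (- p ^+ 2) => _ [u _ <-]].
pose m := inf (range J).
have Jm u : m <= J u by apply: (ge_inf (proj2 hasinf)); exists u.
(* Parallelogram identity, together with [m <= J] at the midpoint of [u] and [v]. It makes every
   minimizing sequence Cauchy. *)
have mid u v : hnorm (u - v) ^+ 2 <= 2 * (J u - m) + 2 * (J v - m).
  have := Jm ((2^-1)%:C *: (u + v)).
  rewrite /J phiZ hnormZ cabsr phiD exprMn ger0_norm// hnormD_sqr hnormB_sqr.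
  by rewrite ReM/= ReD mul0r subr0; nra.
have /choice[u_ hu_] : forall n, exists u, J u < m + n.+1%:R^-1.
  move=> n.
  have [_ [u _ <-] h] : exists2 e, range J e & e < m + n.+1%:R^-1.
    by apply: inf_adherent => //; rewrite invr_gt0.
  by exists u.
have small (e : R) : 0 < e -> exists N, forall n, (N <= n)%N -> J (u_ n) - m < e.
  move=> e0; exists (Num.truncn e^-1) => n Nn.
  have : n.+1%:R^-1 < e.
    rewrite invf_plt ?posrE//; apply: lt_le_trans (truncnS_gt _) _.
    by rewrite ler_nat.
  by rewrite ltrBlDl => h; rewrite (lt_trans (hu_ n))// ltrD2l.
have cu : hcauchy u_.
  move=> e e0; have [|N hN] := small (e ^+ 2 / 4); first by rewrite divr_gt0// exprn_gt0.
  exists N => i j /hN hi /hN hj.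
  rewrite -(ltr_pXn2r (n := 2))// ?nnegrE ?hnorm_ge0 ?ltW//.
  by have := mid (u_ i) (u_ j); lra.
have [w hw] := Hc cu.
have Jw : J w = m.
  apply/eqP; rewrite eq_le Jm andbT; apply/ler_addgt0Pr => e e0.
  have /hcvgP hw' := hw.
  (* Radius within which replacing [w] by [u] changes the linear terms of [J] by at most [e / 2];
     the [1] in the denominator keeps it positive. *)
  pose r := Num.min 1 (e / 2 / (2 * hnorm w + 1 + 2 * `|p|)).
  have r0 : 0 < r.
    rewrite lt_min ltr01/= !divr_gt0//.
    by have := hnorm_ge0 w; have := normr_ge0 p; lra.
  have [N1 h1] := hw' r r0; have [|N2 h2] := small (e / 2); first by lra.
  have := h1 _ (leq_maxl N1 N2); have := h2 _ (leq_maxr N1 N2).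
  move: (u_ _) => u Ju uw.
  have e1 : J w = J u - (hnorm (u - w) ^+ 2 + 2 * Re '[u - w, w] - 2 * Re (phi (u - w))).
    have -> : J u = J ((u - w) + w) by rewrite subrK.
    by rewrite /J hnormD_sqr phiD ReD; ring.
  have := le_trans (ler_norm _) (le_trans (Re_le_cabs (phi (u - w))) (phib (u - w))).
  have := Re_inner_norm_le (u - w) w; rewrite ler_norml => /andP[h3 _] h4.
  have {h4} h4 : Re (phi (u - w)) <= `|p| * hnorm (u - w).
    by rewrite (le_trans h4)// ler_wpM2r ?hnorm_ge0// ler_norm.
  have := sqr_ge0 (hnorm (u - w)).
  have : hnorm (u - w) * (2 * hnorm w + 1 + 2 * `|p|) <= e / 2.
    rewrite -ler_pdivlMr; last by have := hnorm_ge0 w; have := normr_ge0 p; lra.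
    by rewrite (le_trans (ltW uw))// ge_min lexx orbT.
  have := hnorm_ge0 (u - w); nra.
have stat u : Re (phi u) = Re '[u, w].
  pose t := Re (phi u) - Re '[u, w].
  (* Variation of [J] at its minimizer [w] in the real direction [u]. Inserting r = t / |u|^2 forces
     [t = 0]. *)
  have ht (r : R) : 0 <= r ^+ 2 * hnorm u ^+ 2 - 2 * r * t.
    have := Jm (r%:C *: u + w); rewrite -Jw /J phil ReD hnormD_sqr hnormZ innerZl.
    by rewrite cabsr !ReM/= exprMn real_normK ?num_real// /t; lra.
  suff : t = 0 by rewrite /t; lra.
  have [u0|u0] := eqVneq u 0.
    by rewrite /t u0 phi0 inner0l subrr.
  have nu := hnorm_gt0 u0.
  have N0 : 0 < hnorm u ^+ 2 by rewrite exprn_gt0.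
  have e : t / hnorm u ^+ 2 * hnorm u ^+ 2 = t by rewrite divfK ?gt_eqF.
  have := ht (t / hnorm u ^+ 2); move: (t / _) e => r e h.
  have : r ^+ 2 * hnorm u ^+ 2 <= 0 by move: h; rewrite -e; lra.
  rewrite pmulr_lle0// => r2; rewrite -e (_ : r = 0) ?mul0r//.
  by apply/eqP; rewrite -sqrf_eq0 eq_le r2 sqr_ge0.
exists w => u. apply: complex_ext; first exact: stat.
(* Multiplying [u] by -i converts the identity of real parts into the one of imaginary parts. *)
have := stat ((- 'i)%C *: u); rewrite phiZ innerZl !ReM/=; lra.
Qed.

Lemma bounded_adjoint (K : preHilbertType R) (P : H -> K) (p : R) : hlinear P ->
  (forall u, hnorm (P u) <= p * hnorm u) ->
  exists Q : K -> H, [/\ hlinear Q, forall u v, '[P u, v] = '[u, Q v] &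
    forall v, hnorm (Q v) <= `|p| * hnorm v].
Proof.
move=> Pl Pb.
have Pb' u : hnorm (P u) <= `|p| * hnorm u.
  by rewrite (le_trans (Pb _))// ler_wpM2r ?hnorm_ge0// ler_norm.
have /choice[Q hQ] : forall v, exists w, forall u, '[P u, v] = '[u, w].
  move=> v.
  apply: (@riesz_representation (fun u => '[P u, v]) (`|p| * hnorm v)).
    by move=> c u w; rewrite Pl innerDl innerZl.
  move=> u; rewrite (le_trans (cabs_inner_le _ _))//.
  by rewrite mulrAC ler_wpM2r ?hnorm_ge0.
exists Q; split=> [c u v|u v|v].
- apply: inner_ext => w; rewrite -hQ !innerDr !innerZr -!hQ//.
- exact: hQ.
have [q0|q0] := eqVneq (Q v) 0; first by rewrite q0 hnorm0 mulr_ge0 ?hnorm_ge0.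
rewrite -(ler_pM2l (hnorm_gt0 q0)) -expr2 hnorm_sqr -hQ.
rewrite (le_trans (Re_inner_le _ _))// mulrA [hnorm (Q v) * _]mulrC.
by rewrite ler_wpM2r ?hnorm_ge0.
Qed.

End riesz.

Section bounded_relations.
Context {R : realType} {H : preHilbertType R}.

Lemma bounded_rel_fun (K : preHilbertType R) (B : set (H * K)) :
  linear_rel B -> single_valued B -> everywhere_defined B -> bounded_rel B ->
  exists P : H -> K, [/\ hlinear P, forall u v, B (u, v) <-> v = P u,
    0 <= rel_norm B & forall u, hnorm (P u) <= rel_norm B * hnorm u].
Proof.
move=> [B0 Bl] Bs Bd [k Bk].
have /choice[P hP] : forall u, exists v, B (u, v).
  by move=> u; have : rel_dom B u by rewrite Bd.
have BP u v : B (u, v) <-> v = P u.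
  by split=> [h|->//]; exact: Bs h (hP u).
have Pl : hlinear P by move=> c u v; apply/esym/BP; exact: Bl _ _ _ (hP u) (hP v).
have ub : has_ubound [set r | exists u v, [/\ B (u, v), hnorm u <= 1 & r = hnorm v]].
  exists `|k| => _ [u [v [h u1 ->]]]; rewrite (le_trans (Bk _ _ h))//.
  rewrite (le_trans (ler_wpM2r (hnorm_ge0 _) (ler_norm k)))//.
  by rewrite ler_piMr.
have bd u : hnorm u <= 1 -> hnorm (P u) <= rel_norm B.
  by move=> u1; apply: ub_le_sup => //; exists u, (P u).
exists P; split=> //; first by rewrite (le_trans (hnorm_ge0 (P 0)))// bd// hnorm0.
move=> u; have [->|u0] := eqVneq u 0.
  have -> : P 0 = 0 by apply/esym/BP.
  by rewrite !hnorm0 mulr0.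
have nu := hnorm_gt0 u0.
have := bd ((hnorm u)^-1%:C *: u).
rewrite (hlinearZ Pl) !hnormZ cabsr ger0_norm ?invr_ge0 ?hnorm_ge0//.
by rewrite mulVf ?gt_eqF// => /(_ (lexx _)); rewrite mulrC ler_pdivrMr.
Qed.

Lemma resolventE (A : set (H * H)) l h f : resolvent A l (h, f) <-> A (f, h + l *: f).
Proof.
split=> [[v [_ /= [h1 [_ [[v2 /= [e ->]] ->]] ->]]]|h1].
  by have <- : f = v2 := e; rewrite scaleN1r subrK.
exists (h + l *: f), (- (l *: f)); split => //=; last by rewrite addrK.
by exists (l *: f); split; [exists f|rewrite scaleN1r].
Qed.

Lemma rel_subE (K : preHilbertType R) (A B : set (H * K)) u w :
  rel_sub A B (u, w) <-> exists v v', [/\ A (u, v), B (u, v') & w = v - v'].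
Proof.
split=> [[v [v1 [h1 [v' [h2 e]] e']]]|[v [v' [h1 h2 ->]]]].
  exists v, v'; split => //; have -> : w = v + v1 := e'.
  by have -> : v1 = -1 *: v' := e; rewrite scaleN1r.
by exists v, (- v'); split => //=; exists v'; rewrite scaleN1r.
Qed.

Lemma resolvent_setP (A : set (H * H)) l (C : R) : linear_rel A ->
  (forall h, exists f, A (f, h + l *: f)) ->
  (forall h f, A (f, h + l *: f) -> hnorm f <= C * hnorm h) -> resolvent_set A l.
Proof.
move=> [_ Al] As Ab; split.
- move=> h f f' /resolventE h1 /resolventE h2; apply/eqP; rewrite -subr_eq0.
  have := Al (-1) _ _ h2 h1; rewrite /= !scaleN1r ![- _ + _]addrC => h3.
  apply/eqP/hnorm_eq0/eqP; rewrite eq_le hnorm_ge0 andbT.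
  rewrite (le_trans (Ab 0 _ _)) ?hnorm0 ?mulr0//.
  by rewrite add0r scalerBr; move: h3; rewrite opprD addrACA subrr add0r.
- by apply/seteqP; split => // h _; have [f hf] := As h; exists f; apply/resolventE.
- by exists C => h f /resolventE; exact: Ab.
Qed.

End bounded_relations.

Section convergence_bounds.
Context {R : realType} {H1 H2 H3 : preHilbertType R}.

Lemma hcauchy_le (a : nat -> H1) (b : nat -> H2) (c : nat -> H3) (C : R) :
  hcauchy a -> hcauchy b ->
  (forall m n, hnorm (c m - c n) <= C * (hnorm (a m - a n) + hnorm (b m - b n))) ->
  hcauchy c.
Proof.
move=> ca cb h e e0.
have e1 : 0 < e / (2 * (`|C| + 1)) by rewrite divr_gt0// mulr_gt0// ltr_wpDl.
have [N1 h1] := ca _ e1; have [N2 h2] := cb _ e1.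
exists (maxn N1 N2) => m n; rewrite !geq_max => /andP[m1 m2] /andP[n1 n2].
have ab : hnorm (a m - a n) + hnorm (b m - b n) < e / (`|C| + 1).
  rewrite (lt_le_trans (ltrD (h1 _ _ m1 n1) (h2 _ _ m2 n2)))//.
  by rewrite invfM; lra.
rewrite (le_lt_trans (h m n))//.
rewrite (le_lt_trans (y := (`|C| + 1) * (hnorm (a m - a n) + hnorm (b m - b n))))//.
  rewrite ler_wpM2r ?addr_ge0 ?hnorm_ge0//.
  by rewrite (le_trans (ler_norm C))// lerDl.
by rewrite mulrC -ltr_pdivlMr// ltr_wpDl.
Qed.

Lemma hcvg_le (a_ : nat -> H1) (b_ : nat -> H2) (c_ : nat -> H3) a b c (C : R) :
  hcvg a_ a -> hcvg b_ b ->
  (forall n, hnorm (c_ n - c) <= C * (hnorm (a_ n - a) + hnorm (b_ n - b))) ->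
  hcvg c_ c.
Proof.
move=> /hcvgP ca /hcvgP cb h; apply/hcvgP => e e0.
have e1 : 0 < e / (2 * (`|C| + 1)) by rewrite divr_gt0// mulr_gt0// ltr_wpDl.
have [N1 h1] := ca _ e1; have [N2 h2] := cb _ e1.
exists (maxn N1 N2) => n; rewrite !geq_max => /andP[n1 n2].
have ab : hnorm (a_ n - a) + hnorm (b_ n - b) < e / (`|C| + 1).
  rewrite (lt_le_trans (ltrD (h1 _ n1) (h2 _ n2)))//.
  by rewrite invfM; lra.
rewrite (le_lt_trans (h n))//.
rewrite (le_lt_trans (y := (`|C| + 1) * (hnorm (a_ n - a) + hnorm (b_ n - b))))//.
  rewrite ler_wpM2r ?addr_ge0 ?hnorm_ge0//.
  by rewrite (le_trans (ler_norm C))// lerDl.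
by rewrite mulrC -ltr_pdivlMr// ltr_wpDl.
Qed.

End convergence_bounds.

(** * Abstract boundary triples *)

Lemma nonreal_axis {R : realType} (l : R[i]) : Im l != 0 -> ~ nonneg_axis l.
Proof. by move=> /eqP h []. Qed.

Lemma nonneg_axis_conj {R : realType} (l : R[i]) : ~ nonneg_axis l -> ~ nonneg_axis l^*.
Proof. by move=> h [h1 h2]; apply: h; split; move: h1 h2; rewrite ImC ReC; lra. Qed.

(* An abstract boundary triple: [D f k z e] reads [k = T f], [z = Gamma1 f] and
   [e = Gamma0 f] for the maximal operator [T]. *)
Record boundary_system {R : realType} (H K : preHilbertType R)
    (D : H -> H -> K -> K -> Prop) : Prop := {
  bs_lin : forall c f k z e f' k' z' e', D f k z e -> D f' k' z' e' ->
    D (c *: f + f') (c *: k + k') (c *: z + z') (c *: e + e');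
  bs_green : forall f k z e f' k' z' e', D f k z e -> D f' k' z' e' ->
    '[k, f'] + '[e, z'] = '[f, k'] + '[z, e'];
  bs_pos : forall f k z e, D f k z e -> 0 <= Re ('[k, f] + '[e, z]);
  bs_ker : forall k z e, D 0 k z e -> [/\ k = 0, z = 0 & e = 0];
  bs_solve : forall l, ~ nonneg_axis l -> forall h xi,
    exists f z, D f (h + l *: f) z xi }.

Section boundary_system_theory.
Context {R : realType} {H K : preHilbertType R} {D : H -> H -> K -> K -> Prop}
  (BS : boundary_system D).

Definition brack (B : set (K * K)) : set (H * H) :=
  [set p | exists z e, D p.1 p.2 z e /\ B (z, e)].

Definition gamma_rel (l : R[i]) : set (K * H) :=
  [set p | exists z, D p.2 (l *: p.2) z p.1].

Definition weyl_rel (l : R[i]) : set (K * K) :=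
  [set p | exists u, D u (l *: u) p.2 p.1].

Lemma bs_sub f k z e f' k' z' e' : D f k z e -> D f' k' z' e' ->
  D (f - f') (k - k') (z - z') (e - e').
Proof.
move=> h h'; have := bs_lin BS (-1) h' h.
by rewrite !scaleN1r ![- _ + _]addrC.
Qed.

Lemma bs_zero : D 0 0 0 0.
Proof.
have [|f [z h]] := bs_solve BS (l := -1) _ 0 0; last first.
  by have := bs_sub h h; rewrite !subrr.
by move=> [_]; rewrite /= lerNr oppr0 ler10.
Qed.

Lemma bs_scale c f k z e : D f k z e -> D (c *: f) (c *: k) (c *: z) (c *: e).
Proof. by move=> h; have := bs_lin BS c h bs_zero; rewrite !addr0. Qed.

Lemma bs_add f k z e f' k' z' e' : D f k z e -> D f' k' z' e' ->
  D (f + f') (k + k') (z + z') (e + e').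
Proof. by move=> h h'; have := bs_lin BS 1 h h'; rewrite !scale1r. Qed.

Lemma green_im f k z e : D f k z e -> Im ('[k, f] + '[e, z]) = 0.
Proof.
move=> h; have /(congr1 (@complex.Im R)) := bs_green BS h h.
by rewrite !ImD (Im_inner_conj f k) (Im_inner_conj z e); lra.
Qed.

(** If Gamma0 f = 0, the form value of [f] is l |f|^2. It is real by Green's identity and
    nonnegative by [bs_pos], so [l] lies on the half-line unless [f = 0]. *)
Lemma bs_inj l f z : ~ nonneg_axis l -> D f (l *: f) z 0 -> f = 0 /\ z = 0.
Proof.
move=> nl h; have [f0|f0] := eqVneq f 0.
  by move: h; rewrite f0 scaler0 => /(bs_ker BS)[].
exfalso; apply: nl; have nf := hnorm_gt0 f0.
have := bs_pos BS h; have := green_im h.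
rewrite inner0l addr0 innerZl inner_selfE ReM ImM/= !mulr0 subr0 add0r => /eqP.
rewrite mulf_eq0 expf_eq0/= [hnorm f == 0]gt_eqF// orbF => /eqP i0.
by rewrite pmulr_lge0 ?exprn_gt0.
Qed.

Lemma solve_uniq l h f z f' z' xi : ~ nonneg_axis l -> D f (h + l *: f) z xi ->
  D f' (h + l *: f') z' xi -> f = f' /\ z = z'.
Proof.
move=> nl h1 h2; have := bs_sub h1 h2.
rewrite opprD addrACA subrr add0r subrr -scalerBr => /(bs_inj nl)[/eqP + /eqP].
by rewrite !subr_eq0 => /eqP -> /eqP ->.
Qed.

Lemma gamma_uniq l f z f' z' xi : ~ nonneg_axis l -> D f (l *: f) z xi ->
  D f' (l *: f') z' xi -> f = f' /\ z = z'.
Proof.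
by move=> nl; rewrite -[l *: f]add0r -[l *: f']add0r; exact: solve_uniq.
Qed.

Lemma gamma_solve l xi : ~ nonneg_axis l -> exists f z, D f (l *: f) z xi.
Proof.
move=> nl; have [f [z h]] := bs_solve BS nl 0 xi.
by exists f, z; rewrite add0r in h.
Qed.

(** The von Neumann type splitting of the maximal domain into the domain of A_0 and the kernel of T
    - l: [g] is the A_0-resolvent applied to [k - l f], and [u] carries the whole of Gamma0 f. *)
Lemma decomposition l f k z e : ~ nonneg_axis l -> D f k z e ->
  exists g zg u zu, [/\ D g (k - l *: f + l *: g) zg 0, D u (l *: u) zu e,
    f = g + u & z = zg + zu].
Proof.
move=> nl h; have [g [zg h1]] := bs_solve BS nl (k - l *: f) 0.
have [u [zu h2]] := gamma_solve e nl.
exists g, zg, u, zu; split => //.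
all: have := bs_sub (bs_sub h h1) h2; rewrite subr0 subrr.
all: rewrite (_ : k - _ - _ = l *: (f - g - u)); last by
  rewrite !scalerBr opprD opprB addrA [k + _]addrC subrK.
all: move=> /(bs_inj nl)[/eqP + /eqP]; rewrite -!addrA -!opprD !subr_eq0.
by move=> /eqP.
by move=> _ /eqP.
Qed.

(** Green's identity for [u] and [g]; it identifies the adjoint of gamma(conj l) with Gamma1 (A_0 -
    l)^-1. *)
Lemma gamma_adj l g h zg u zu xi : D g (h + l *: g) zg 0 -> D u (l^* *: u) zu xi ->
  '[u, h] = '[xi, zg].
Proof.
move=> h1 h2; have := bs_green BS h2 h1.
rewrite innerDr innerZl innerZr inner0r addr0 => /(canRL (addKr _)) ->.
by rewrite addrC addrK.
Qed.

(** Im M(l) = (Im l) gamma(l)^* gamma(l), read off from the reality of the form. It turns bounds on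
    M into bounds on gamma and conversely. *)
Lemma gamma_im l u z xi : D u (l *: u) z xi -> Im l * hnorm u ^+ 2 = Im '[z, xi].
Proof.
move=> h; have := green_im h.
rewrite innerZl inner_selfE ImD ImM/= mulr0 add0r (Im_inner_conj z xi); lra.
Qed.

(** M(conj l) is the adjoint of M(l): in Green's identity the two terms without boundary data
    cancel. *)
Lemma weyl_conj l u z xi u' z' xi' : D u (l *: u) z xi -> D u' (l^* *: u') z' xi' ->
  '[xi, z'] = '[z, xi'].
Proof.
move=> h h'; have := bs_green BS h h'.
by rewrite innerZl innerZr conjCK => /addrI.
Qed.

(** A_0 is symmetric and nonnegative, so off the real axis the bound is 1 / |Im l|, and on the
    negative axis it is 1 / (- Re l). *)
Lemma resolvent0_bound l : ~ nonneg_axis l -> exists2 C : R, 0 <= C &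
  forall g h z, D g (h + l *: g) z 0 -> hnorm g <= C * hnorm h.
Proof.
move=> nl.
have key g h z (t : R) : D g (h + l *: g) z 0 -> 0 < t ->
    t * hnorm g ^+ 2 <= hnorm h * hnorm g -> hnorm g <= t^-1 * hnorm h.
  move=> _ t0; have [->|g0] := eqVneq g 0.
    by rewrite hnorm0 mulr_ge0 ?hnorm_ge0// invr_ge0 ltW.
  rewrite expr2 mulrA ler_pM2r ?hnorm_gt0// mulrC => ?.
  by rewrite mulrC ler_pdivlMr.
have [l0|l0] := eqVneq (Im l) 0; last first.
  exists `|Im l|^-1; first by rewrite invr_ge0.
  move=> g h z D1; apply: (key _ _ _ _ D1); first by rewrite normr_gt0.
  have := green_im D1; rewrite inner0l addr0 innerDl innerZl inner_selfE ImD ImM/=.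
  rewrite mulr0 add0r => e.
  rewrite -[_ ^+ 2]ger0_norm ?sqr_ge0// -normrM (_ : Im l * _ = - Im '[h, g]); last lra.
  by rewrite normrN Im_inner_norm_le.
have rl : 0 < - Re l.
  by rewrite oppr_gt0 ltNge; apply/negP => ?; exact: nl.
exists (- Re l)^-1; first by rewrite invr_ge0 ltW.
move=> g h z D1; apply: (key _ _ _ _ D1) => //.
have := bs_pos BS D1; rewrite inner0l addr0 innerDl innerZl inner_selfE ReD ReM/=.
by rewrite mulr0 subr0; have := Re_inner_le h g; lra.
Qed.

(** * Bounds propagated from the single point [l0] *)

Section weyl_bounds.
Context {l0 : R[i]} {m0 c0 : R} (l0_gt0 : 0 < Im l0) (c0_gt0 : 0 < c0)
  (weyl_le : forall u z xi, D u (l0 *: u) z xi -> hnorm z <= m0 * hnorm xi)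
  (weyl_im : forall u z xi, D u (l0 *: u) z xi -> c0 * hnorm xi ^+ 2 <= Im '[z, xi]).

Let nl0 : ~ nonneg_axis l0. Proof. by apply: nonreal_axis; rewrite gt_eqF. Qed.

(** Since gamma(l) = gamma(l0) + (l - l0)(A_0 - l)^-1 gamma(l0), bounds at [l0] and for the
    resolvent of A_0 reach every [l]. The trace Gamma1 on the domain of A_0 is bounded by duality
    with gamma(conj l), and M(l) - M(l0) is that trace of the correction term. *)
Lemma solve_bound l : ~ nonneg_axis l -> exists C : R, [/\ 0 <= C,
  forall g h z, D g (h + l *: g) z 0 -> hnorm g <= C * hnorm h /\ hnorm z <= C * hnorm h &
  forall u z xi, D u (l *: u) z xi -> hnorm u <= C * hnorm xi /\ hnorm z <= C * hnorm xi].
Proof.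
have g0 : exists2 C : R, 0 <= C & forall u z xi, D u (l0 *: u) z xi ->
    hnorm u <= C * hnorm xi.
  exists (Num.sqrt (`|m0| / Im l0)); first exact: sqrtr_ge0.
  move=> u z xi h; have m0' : 0 <= `|m0| / Im l0 by rewrite divr_ge0// ltW.
  rewrite -(ler_pXn2r (n := 2))// ?nnegrE ?mulr_ge0 ?hnorm_ge0 ?sqrtr_ge0//.
  rewrite exprMn (sqr_sqrtr m0') mulrAC ler_pdivlMr// mulrC (gamma_im h).
  rewrite (le_trans (ler_norm _))// (le_trans (Im_inner_norm_le _ _))//.
  rewrite expr2 mulrA ler_wpM2r ?hnorm_ge0// (le_trans (weyl_le h))//.
  by rewrite ler_wpM2r ?hnorm_ge0// ler_norm.
have gm l' : ~ nonneg_axis l' -> exists2 C : R, 0 <= C & forall u z xi,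
    D u (l' *: u) z xi -> hnorm u <= C * hnorm xi.
  move=> nl; have [C C0 hC] := g0; have [C' C'0 hC'] := resolvent0_bound nl.
  exists (C + C' * (cabs (l' - l0) * C)).
    by rewrite addr_ge0// !mulr_ge0// cabs_ge0.
  move=> u z xi h; have [u0 [z0 h0]] := gamma_solve xi nl0.
  have := bs_sub h h0; rewrite subrr.
  rewrite (_ : l' *: u - _ = (l' - l0) *: u0 + l' *: (u - u0)); last first.
    by rewrite scalerBr scalerBl [RHS]addrC addrA subrK.
  move=> /hC'; rewrite hnormZ => h1.
  have := hC _ _ _ h0; have := lerB_hnorm u u0 => h2 h3.
  have h4 := ler_wpM2l (cabs_ge0 (l' - l0)) h3.
  have h5 := ler_wpM2l C'0 h4; lra.
move=> nl; have [C1 C10 h1] := resolvent0_bound nl; have [C2 C20 h2] := gm l nl.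
have [C3 C30 h3] := gm _ (nonneg_axis_conj nl).
(* Duality: pairing [z] with itself through gamma(conj l) gives |z|^2 = Re(u, h) with |u| <= C3
   |z|. *)
have h4 g h z : D g (h + l *: g) z 0 -> hnorm z <= C3 * hnorm h.
  move=> Dg; have [u [zu Du]] := gamma_solve z (nonneg_axis_conj nl).
  have [->|z0] := eqVneq z 0; first by rewrite hnorm0 mulr_ge0 ?hnorm_ge0.
  rewrite -(ler_pM2r (hnorm_gt0 z0)) -expr2 hnorm_sqr -(gamma_adj Dg Du).
  rewrite (le_trans (Re_inner_le _ _))// mulrAC ler_wpM2r ?hnorm_ge0//.
  exact: h3 Du.
have [C5 C50 h6] := g0.
have h7 u z xi : D u (l *: u) z xi ->
    hnorm z <= (`|m0| + C3 * (cabs (l - l0) * C5)) * hnorm xi.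
  move=> h; have [u0 [z0 Du0]] := gamma_solve xi nl0.
  have := bs_sub h Du0; rewrite subrr.
  rewrite (_ : l *: u - _ = (l - l0) *: u0 + l *: (u - u0)); last first.
    by rewrite scalerBr scalerBl [RHS]addrC addrA subrK.
  move=> /h4; rewrite hnormZ => h8.
  have h9 := le_trans (weyl_le Du0) (ler_wpM2r (hnorm_ge0 xi) (ler_norm m0)).
  have h10 := ler_wpM2l C30 (ler_wpM2l (cabs_ge0 (l - l0)) (h6 _ _ _ Du0)).
  have := lerB_hnorm z z0; lra.
have [C6 C60 {}h7] : exists2 C : R, 0 <= C & forall u z xi, D u (l *: u) z xi ->
    hnorm z <= C * hnorm xi.
  exists (`|m0| + C3 * (cabs (l - l0) * C5)) => //.
  by rewrite addr_ge0// !mulr_ge0 ?cabs_ge0.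
exists (C1 + C2 + C3 + C6); split; first by rewrite !addr_ge0.
  move=> g h z Dg; have := h1 _ _ _ Dg; have := h4 _ _ _ Dg; have := hnorm_ge0 h.
  by split; nra.
move=> u z xi Du; have := h2 _ _ _ Du; have := h7 _ _ _ Du; have := hnorm_ge0 xi.
by split; nra.
Qed.

Lemma gamma_lower u z xi : D u (l0 *: u) z xi ->
  c0 * hnorm xi ^+ 2 <= Im l0 * hnorm u ^+ 2.
Proof. by move=> h; rewrite (gamma_im h) (weyl_im h). Qed.

Lemma gamma_lower_conj u z xi : D u (l0^* *: u) z xi ->
  c0 * hnorm xi ^+ 2 <= Im l0 * hnorm u ^+ 2.
Proof.
move=> h; have [u0 [z0 h0]] := gamma_solve xi nl0.
have := gamma_im h; rewrite ImC mulNr => /(canRL (@opprK _)) ->.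
by rewrite -Im_inner_conj (weyl_conj h0 h) (weyl_im h0).
Qed.

Lemma gamma_lower_norm : exists2 C : R, 0 <= C & forall u z xi,
  D u (l0 *: u) z xi \/ D u (l0^* *: u) z xi -> hnorm xi <= C * hnorm u.
Proof.
exists (Num.sqrt (Im l0 / c0)); first exact: sqrtr_ge0.
have q0 : 0 <= Im l0 / c0 by rewrite divr_ge0 ?ltW.
move=> u z xi h; rewrite -(ler_pXn2r (n := 2))// ?nnegrE ?mulr_ge0 ?hnorm_ge0 ?sqrtr_ge0//.
rewrite exprMn (sqr_sqrtr q0) mulrAC ler_pdivlMr// mulrC.
by case: h; [exact: gamma_lower|exact: gamma_lower_conj].
Qed.

(** After splitting at [l0], [e] is controlled by the kernel part [u] because gamma(l0) is bounded
    below, and then both parts of [z] are controlled as well. Both traces are thus continuous in the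
    graph norm of the maximal operator. *)
Lemma boundary_bound : exists2 C : R, 0 <= C & forall f k z e, D f k z e ->
  hnorm z <= C * (hnorm f + hnorm k) /\ hnorm e <= C * (hnorm f + hnorm k).
Proof.
have [C [C0 hR hG]] := solve_bound nl0; have [C' C'0 hL] := gamma_lower_norm.
have [L L0 LE] : exists2 L : R, 0 <= L & L = cabs l0 + 1.
  by exists (cabs l0 + 1) => //; rewrite addr_ge0 ?cabs_ge0.
have [C1 C10 C1E] : exists2 C1 : R, 0 <= C1 & C1 = C' * (1 + C * L).
  by exists (C' * (1 + C * L)) => //; rewrite mulr_ge0// addr_ge0// mulr_ge0.
exists (C * L + C * C1 + C1); first by rewrite !addr_ge0// !mulr_ge0.
move=> f k z e /(decomposition nl0)[g [zg [u [zu [Dg Du fgu ->]]]]].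
have [g1 g2] := hR _ _ _ Dg; have [u1 u2] := hG _ _ _ Du.
have := hL u zu e (or_introl Du).
have hh : hnorm (k - l0 *: f) <= L * (hnorm f + hnorm k).
  rewrite (le_trans (ler_hnormB _ _))// hnormZ LE.
  have := mulr_ge0 (cabs_ge0 l0) (hnorm_ge0 k); have := hnorm_ge0 f; lra.
have uf : hnorm u <= hnorm f + hnorm g.
  by rewrite (_ : u = f - g) ?ler_hnormB// fgu addrC addKr.
set S := hnorm f + hnorm k in hh *.
have Sf : hnorm f <= S by rewrite lerDl hnorm_ge0.
have S0 : 0 <= S by rewrite addr_ge0 ?hnorm_ge0.
have hCh := ler_wpM2l C0 hh.
move=> eu; have e1 : hnorm e <= C1 * S.
  rewrite (le_trans eu)// C1E -mulrA ler_wpM2l// mulrDl mul1r (le_trans uf)// lerD//.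
  by rewrite (le_trans g1)// -mulrA.
have Ce := ler_wpM2l C0 e1.
have CLS : 0 <= C * L * S by rewrite !mulr_ge0.
have CCS : 0 <= C * C1 * S by rewrite !mulr_ge0.
have CS : 0 <= C1 * S by rewrite mulr_ge0.
split; last by lra.
by rewrite (le_trans (ler_hnormD _ _))//; lra.
Qed.

(** The traces converge by [boundary_bound]. To see that they belong to [f], the boundary problem is
    solved with the limit data, and [f_ n] is shown to converge to this solution too. *)
Lemma boundary_closed (Kc : hcomplete K) (f_ k_ : nat -> H) (z_ e_ : nat -> K) f k :
  (forall n, D (f_ n) (k_ n) (z_ n) (e_ n)) -> hcvg f_ f -> hcvg k_ k ->
  exists z e, [/\ hcvg z_ z, hcvg e_ e & D f k z e].
Proof.
move=> hD cf ck; have [C C0 hC] := boundary_bound.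
have [z hz] : exists z, hcvg z_ z.
  apply: Kc; apply: (hcauchy_le (C := C) (hcvg_cauchy cf) (hcvg_cauchy ck)).
  by move=> m n; have [] := hC _ _ _ _ (bs_sub (hD m) (hD n)).
have [e he] : exists e, hcvg e_ e.
  apply: Kc; apply: (hcauchy_le (C := C) (hcvg_cauchy cf) (hcvg_cauchy ck)).
  by move=> m n; have [] := hC _ _ _ _ (bs_sub (hD m) (hD n)).
exists z, e; split=> //.
have [f' [z' h']] := bs_solve BS nl0 (k - l0 *: f) e.
have [C' [C'0 hR hG]] := solve_bound nl0.
have ch : hcvg (fun n => k_ n - l0 *: f_ n) (k - l0 *: f).
  apply: (hcvg_le (C := cabs l0 + 1) cf ck) => n.
  rewrite (_ : _ - _ = (k_ n - k) - l0 *: (f_ n - f)); last first.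
    by rewrite scalerBr opprD addrACA -opprD.
  rewrite (le_trans (ler_hnormB _ _))// hnormZ.
  have := mulr_ge0 (cabs_ge0 l0) (hnorm_ge0 (k_ n - k)).
  have := hnorm_ge0 (f_ n - f); lra.
have key n : hnorm (f_ n - f') <= C' * (hnorm (k_ n - l0 *: f_ n - (k - l0 *: f)) +
    hnorm (e_ n - e)) /\
    hnorm (z_ n - z') <= C' * (hnorm (k_ n - l0 *: f_ n - (k - l0 *: f)) +
    hnorm (e_ n - e)).
  have [g [zg [u [zu [Dg Du -> ->]]]]] := decomposition nl0 (bs_sub (hD n) h').
  have [g1 g2] := hR _ _ _ Dg; have [u1 u2] := hG _ _ _ Du.
  have eh : k_ n - (k - l0 *: f + l0 *: f') - l0 *: (f_ n - f') =
      k_ n - l0 *: f_ n - (k - l0 *: f).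
    by rewrite scalerBr [- (l0 *: f_ n - _)]opprB opprD !addrA subrK addrAC.
  rewrite eh in g1 g2; rewrite mulrDr.
  by split; rewrite (le_trans (ler_hnormD _ _))// lerD.
have ff' : f = f'.
  by apply: (hcvg_unique cf); apply: (hcvg_le (C := C') ch he) => n; have [] := key n.
have zz' : z = z'.
  by apply: (hcvg_unique hz); apply: (hcvg_le (C := C') ch he) => n; have [] := key n.
by move: h'; rewrite -ff' -zz' subrK.
Qed.

End weyl_bounds.

Lemma brack_linear B : linear_rel B -> linear_rel (brack B).
Proof.
move=> [B0 Bl]; split; first by exists 0, 0; split => //; exact: bs_zero.
move=> c p q [z [e [h1 h2]]] [z' [e' [h1' h2']]].
exists (c *: z + z'), (c *: e + e'); split; first exact: (bs_lin BS).
exact: Bl h2 h2'.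
Qed.

Lemma brack_single_valued B : single_valued (brack B).
Proof.
move=> f k k' [z [e [h1 _]]] [z' [e' [h2 _]]].
have := bs_sub h1 h2; rewrite subrr => /(bs_ker BS)[/eqP]/=.
by rewrite subr_eq0 => /eqP.
Qed.

Section resolvent_formula.
Context (l : R[i]) (nl : ~ nonneg_axis l).

(** The adjoint relation has only one value at each [h] because gamma(conj l) is defined on all of
    [K]; that value is the trace found in [gamma_adj]. *)
Lemma gamma_adjE h w : rel_adj (gamma_rel l^*) (h, w) <-> exists f, D f (h + l *: f) w 0.
Proof.
split=> [hw|[f hf] xi u [z hu]]; last exact: gamma_adj hf hu.
have [f [z hf]] := bs_solve BS nl h 0; exists f.
suff -> : w = z by [].
apply: inner_ext => xi; have [u [zu hu]] := gamma_solve xi (nonneg_axis_conj nl).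
by rewrite -(gamma_adj hf hu) -(hw xi u)//; exists zu.
Qed.

Lemma weyl_relE xi z : weyl_rel l (xi, z) -> forall u z', D u (l *: u) z' xi -> z' = z.
Proof. by move=> [u h] u' z' h'; have [] := gamma_uniq nl h h'. Qed.

(** Writing f = g + u at [l], the boundary condition becomes: [e] is an image under [B] of zg + M e,
    where [zg] is the adjoint of gamma(conj l) applied to [h]. In terms of the inverse relation of
    [B] this is an identity of relations for every [B], without domain restrictions. *)
Lemma krein_formula (B : set (K * K)) (res0 : set (H * H)) :
  (forall h g, res0 (h, g) <-> exists z, D g (h + l *: g) z 0) ->
  resolvent (brack B) l = rel_add res0 (rel_comp (gamma_rel l)
    (rel_comp (rel_inv (rel_sub (rel_inv B) (weyl_rel l))) (rel_adj (gamma_rel l^*)))) :> set (H * H).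
Proof.
move=> hres0; apply/seteqP; split=> -[h f].
  move=> /resolventE[z [e [/= Df Bze]]].
  have [g [zg [u [zu [Dg Du fgu zgu]]]]] := decomposition nl Df.
  rewrite addrK in Dg.
  exists g, u; split => //=; first by apply/hres0; exists zg.
  exists e; split; last by exists zu.
  exists zg; split; first by apply/gamma_adjE; exists g.
  by apply/rel_subE; exists z, zu; split => //; [exists u|rewrite zgu addrK].
move=> [g [u [/hres0[zg Dg] [e [[w [/gamma_adjE[g' Dg'] sub]]]]]]].
have {sub} [z [zu [Bze Mzu wE]]] : exists z zu,
    [/\ rel_inv B (e, z), weyl_rel l (e, zu) & w = z - zu] by apply/rel_subE.
move=> [zu' Du] fE; apply/resolventE; rewrite /= in Dg Dg' Du fE.
have [_ zgw] := solve_uniq nl Dg Dg'.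
have zuE := weyl_relE Mzu Du.
exists z, e; split => //=; have := bs_add Dg Du; rewrite add0r zgw zuE wE subrK.
by rewrite -addrA -scalerDr fE.
Qed.

End resolvent_formula.

End boundary_system_theory.

(** * Closedness and the adjoint of the restricted operator *)

Section closed_and_adjoint.
Context {R : realType} {H K : preHilbertType R} {D : H -> H -> K -> K -> Prop}
  (BS : boundary_system D) (Kc : hcomplete K).
Context {l0 : R[i]} {m0 c0 : R} (l0_gt0 : 0 < Im l0) (c0_gt0 : 0 < c0)
  (weyl_le : forall u z xi, D u (l0 *: u) z xi -> hnorm z <= m0 * hnorm xi)
  (weyl_im : forall u z xi, D u (l0 *: u) z xi -> c0 * hnorm xi ^+ 2 <= Im '[z, xi]).

Notation brack := (@brack R H K D).

Let nl0 : ~ nonneg_axis l0. Proof. by apply: nonreal_axis; rewrite gt_eqF. Qed.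

Lemma brack_closed B : closed_rel B -> closed_rel (brack B).
Proof.
move=> Bc f_ k_ f k /choice[z_ /choice[e_ h]] cf ck.
have hD n : D (f_ n) (k_ n) (z_ n) (e_ n) by have [] := h n.
have [z [e [cz ce Dfk]]] :=
  boundary_closed BS l0_gt0 c0_gt0 weyl_le weyl_im Kc hD cf ck.
by exists z, e; split => //; apply: Bc cz ce => n; have [] := h n.
Qed.

(* gamma^* gamma is coercive, hence onto. *)
Lemma gamma_adj_gamma_surjective w : exists xi u zu g,
  D u (l0 *: u) zu xi /\ D g (u + l0^* *: g) w 0.
Proof.
have /choice[G hG] : forall xi, exists p : H * K, D p.1 (l0 *: p.1) p.2 xi.
  by move=> xi; have [u [z h]] := gamma_solve BS xi nl0; exists (u, z).
have nl0' := nonneg_axis_conj nl0.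
have /choice[S hS] : forall xi, exists p : H * K,
    D p.1 ((G xi).1 + l0^* *: p.1) p.2 0.
  by move=> xi; have [u [z h]] := bs_solve BS nl0' (G xi).1 0; exists (u, z).
have [C [C0 hR hC]] := solve_bound BS l0_gt0 weyl_le nl0.
have [C' [C'0 hR' hC']] := solve_bound BS l0_gt0 weyl_le nl0'.
have Gl c xi eta : (G (c *: xi + eta)).1 = c *: (G xi).1 + (G eta).1.
  apply: (proj1 (gamma_uniq BS nl0 (hG _) _)); last first.
    by have := bs_lin BS c (hG xi) (hG eta); rewrite scalerA mulrC -scalerA -scalerDr; exact.
have Sl : hlinear (fun xi => (S xi).2).
  move=> c xi eta; have := bs_lin BS c (hS xi) (hS eta).
  rewrite scalerDr addrACA scalerA [c * _]mulrC -scalerA -scalerDr -Gl scaler0 addr0 => h.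
  by have [] := solve_uniq BS nl0' (hS (c *: xi + eta)) h.
have [|||xi hxi] := @coercive_surjective _ _ Kc (fun xi => (S xi).2) (c0 / Im l0)
    (C' * C) Sl _ _ _ w.
- move=> xi; have [_ h] := hR' _ _ _ (hS xi); rewrite (le_trans h)// -mulrA ler_wpM2l//.
  by have [] := hC _ _ _ (hG xi).
- by rewrite divr_gt0.
- move=> xi; rewrite Re_inner_conj.
  have h : D (G xi).1 ((l0^*)^* *: (G xi).1) (G xi).2 xi by rewrite conjCK.
  rewrite -(gamma_adj BS (hS xi) h) -hnorm_sqr mulrAC ler_pdivrMr//.
  by rewrite [leRHS]mulrC; exact: (gamma_lower BS weyl_im (hG xi)).
exists xi, (G xi).1, (G xi).2, (S xi).1; split; first exact: hG.
by rewrite -hxi.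
Qed.

(** The value [e] is reached by gamma(l0) e. What is then missing in [z] is supplied by an element
    of the domain of A_0, which does not disturb [e]; such an element exists because the adjoint of
    gamma(l0) is onto. *)
Lemma boundary_surjective z e : exists f k, D f k z e.
Proof.
have [u [zu Du]] := gamma_solve BS e nl0.
have [xi [v [zv [g [_ Dg]]]]] := gamma_adj_gamma_surjective (z - zu).
exists (g + u), (v + l0^* *: g + l0 *: u).
by have := bs_add BS Dg Du; rewrite subrK add0r.
Qed.

(** One inclusion is Green's identity. For the other, an adjoint element [f] must first be shown to
    lie in the maximal domain, by building a solution [f0 + u] there and proving that the remainder
    [r] vanishes; surjectivity of the traces then identifies its boundary data. *)
Lemma brack_adj B : linear_rel B -> brack (rel_adj B) = rel_adj (brack B).
Proof.
move=> [B0 _]; apply/seteqP; split=> -[f k].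
  move=> [z [e [/= Df BB]]] g kg [z' [e' [/= Dg Bg]]] /=.
  have := bs_green BS Dg Df; rewrite -(BB z' e' Bg)/=.
  exact: addIr.
move=> hf; have nl0' := nonneg_axis_conj nl0.
(* [f0] removes the inhomogeneity, and [u] is the projection of [f - f0] onto the range of
   gamma(l0): both have the same image [w] under the adjoint of gamma(l0). Hence [g = g1 - g2] has
   zero boundary data and solves (T - conj l0) g = r. *)
have [f0 [z0 D0]] := bs_solve BS nl0 (k - l0 *: f) 0.
have [g1 [w D1]] := bs_solve BS nl0' (f - f0) 0.
have [xi [u [zu [g2 [Du D2]]]]] := gamma_adj_gamma_surjective w.
have := bs_sub BS D1 D2; rewrite !subrr opprD addrACA -scalerBr.
set g := g1 - g2; set r := f - f0 - u => Dg.
have r0 : r = 0.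
  apply: inner_eq0.
  (* Any [v] that satisfies Green's identity against [g] with eigenvalue [l0] is orthogonal to [r].
     This applies to [f - f0], since [g] with its zero data lies in the domain of the operator, and
     to [u]; so [r] is orthogonal to itself. *)
  have ort v : '[r + l0^* *: g, v] = '[g, l0 *: v] -> '[r, v] = 0.
    by rewrite innerDl innerZl innerZr => /(canRL (addrK _)); rewrite subrr.
  have e1 : '[r, f - f0] = 0.
    apply: ort; rewrite innerBr.
    have -> : '[r + l0^* *: g, f] = '[g, k] by apply: hf; exists 0, 0.
    have := bs_green BS Dg D0; rewrite inner0l addr0 inner0r addr0 => ->.
    by rewrite -innerBr; congr '[_, _]; rewrite scalerBr opprD opprB addrA subrKC.
  have e2 : '[r, u] = 0.
    apply: ort; have := bs_green BS Dg Du.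
    by rewrite inner0l inner0l !addr0.
  by rewrite {2}/r innerBr e1 e2 subrr.
have fE : f = f0 + u.
  by apply/eqP; rewrite -subr_eq0 opprD addrA; apply/eqP.
have Df : D f k (z0 + zu) xi.
  have := bs_add BS D0 Du; rewrite -fE add0r -addrA -scalerDr -fE subrK//.
exists (z0 + zu), xi; split => // z e Bze /=.
(* Every pair of [B] is the boundary data of some element, so testing the adjoint relation against
   these elements tests the pair [(z0 + zu, xi)] against all of [B]. *)
have [g' [k' Dg']] := boundary_surjective z e.
have := bs_green BS Dg' Df; rewrite (hf g' k'); last by exists z, e.
exact: addrI.
Qed.

End closed_and_adjoint.

(** * Krein's formula with the factor (I - B M)^-1 B *)

Section resolvent_formulas.
Context {R : realType} {H K : preHilbertType R} {D : H -> H -> K -> K -> Prop}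
  (BS : boundary_system D) (l : R[i]) (nl : ~ nonneg_axis l) (B : set (K * K))
  (Bl : linear_rel B).

Notation brack := (@brack R H K D).
Notation gamma_rel := (@gamma_rel R H K D).
Notation weyl_rel := (@weyl_rel R H K D).

Lemma rel_sub_id_compE (M : set (K * K)) xi w :
  rel_sub rel_id (rel_comp B M) (xi, w) <-> exists m, M (xi, m) /\ B (m, xi - w).
Proof.
split=> [/rel_subE[v [v' [/= e1 [m [/= h1 h2]] ->]]]|[m [h1 h2]]].
  by exists m; split => //; have <- : xi = v := e1; rewrite opprB addrC subrK.
apply/rel_subE; exists xi, (xi - w); split => //; first by exists m.
by rewrite opprB addrC subrK.
Qed.

(** A vector in the kernel of I - B M is sent by gamma(l) to an eigenvector of the restricted
    operator for [l], which single-valuedness of the resolvent excludes. *)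
Lemma krein_inverse_single_valued : single_valued (resolvent (brack B) l) ->
  single_valued (rel_inv (rel_sub rel_id (rel_comp B (weyl_rel l)))).
Proof.
move=> rs w xi xi' /rel_sub_id_compE[m [[u Du] Bm]] /rel_sub_id_compE[m' [[u' Du'] Bm']].
have Dd := bs_sub BS Du Du'; rewrite -scalerBr /= in Dd.
have Bd : B (m - m', xi - xi').
  have [_ /(_ (-1) _ _ Bm' Bm)] := Bl.
  by rewrite /= !scaleN1r ![- _ + _]addrC opprB addrA subrK.
have u0 : u - u' = 0.
  apply: (rs 0); apply/resolventE; rewrite add0r.
    by exists (m - m'), (xi - xi').
  by rewrite scaler0; exists 0, 0; split; [exact: bs_zero|case: Bl].
move: Dd; rewrite u0 scaler0 => /(bs_ker BS)[_ _ /eqP].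
by rewrite subr_eq0 => /eqP.
Qed.

(** Here e = B(zg + M e) is split as B zg + B M e. Linearity of [B] allows this only if [zg], the
    adjoint of gamma(conj l) applied to [h], is in the domain of [B]; hence the restriction on the
    left. *)
Lemma krein_formula_restrict (res0 : set (H * H)) :
  (forall h g, res0 (h, g) <-> exists z, D g (h + l *: g) z 0) ->
  rel_restrict (resolvent (brack B) l) (rel_dom (rel_comp B (rel_adj (gamma_rel l^*)))) =
  rel_add res0 (rel_comp (gamma_rel l)
    (rel_comp (rel_inv (rel_sub rel_id (rel_comp B (weyl_rel l))))
      (rel_comp B (rel_adj (gamma_rel l^*))))).
Proof.
move=> hres0; have [_ Bl'] := Bl; apply/seteqP; split=> -[h f].
  move=> [/resolventE[z [e [/= Df Bze]]] [b [w [/= /(gamma_adjE BS nl)[g Dg] Bwb]]]].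
  have [g' [zg [u [zu [Dg' Du fgu zgu]]]]] := decomposition BS nl Df.
  rewrite addrK in Dg'; have [_ zgw] := solve_uniq BS nl Dg' Dg.
  exists g', u; split => //=; first by apply/hres0; exists zg.
  exists e; split; last by exists zu.
  exists b; split; first by exists w; split => //; apply/(gamma_adjE BS nl); exists g.
  apply/rel_sub_id_compE; exists zu; split; first by exists u.
  have := Bl' (-1) _ _ Bwb Bze.
  by rewrite /= !scaleN1r ![- _ + _]addrC zgu zgw addrAC subrr add0r.
move=> [g [u [/hres0[zg Dg] [e [[b [[w [hw Bwb]] /rel_sub_id_compE[m [Mm Bm]]]] [zu' Du]]] fE]]].
have [g' Dg'] := iffLR (gamma_adjE BS nl _ _) hw.
rewrite /= in Dg Dg' Du fE hw Bwb Bm Mm.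
have [_ zgw] := solve_uniq BS nl Dg Dg'.
have zuE := weyl_relE BS nl Mm Du.
split; last by exists b, w.
apply/resolventE; exists (w + m), e; split => /=.
  by have := bs_add BS Dg Du; rewrite add0r zgw zuE -addrA -scalerDr fE.
have := Bl' 1 _ _ Bwb Bm; rewrite /= !scale1r.
by rewrite addrC [b + _]addrC subrK addrC.
Qed.

End resolvent_formulas.

Lemma hlinear0 {R : realType} {H K : preHilbertType R} (P : H -> K) :
  hlinear P -> P 0 = 0.
Proof. by move=> Pl; have := hlinearB Pl 0 0; rewrite !subrr. Qed.

(** * Scalar inequalities behind the enclosures of the numerical range *)

Section scalar_estimates.
Context {R : realType}.
Implicit Types (F N C b mu xi x v y : R).

(** [F] and [N] stand for |f'|^2 and |Gamma1 f|^2, [x] and [v] for the real and imaginary parts of a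
    point of the numerical range, [I] for |Im B|. With y = sqrt(F - mu), x - mu >= y^2 - 2 C b y,
    and completing the square gives the lower bound on [x]. *)
Lemma enclosure_pos F N C b mu xi x v I : 0 <= F -> mu < 0 -> 0 < C -> 0 < b -> 0 <= I ->
  N <= 2 * C * Num.sqrt (F - mu) -> F - b * N <= x -> `|v| <= I * N ->
  xi < mu - (C * b) ^+ 2 ->
  mu - (C * b) ^+ 2 <= x /\
  `|v| <= 2 * C * I / (1 - C * b / Num.sqrt (mu - xi)) * Num.sqrt (x - xi).
Proof.
move=> F0 mu0 C0 b0 I0; have Fmu : 0 <= F - mu by lra.
have := sqr_sqrtr Fmu; have := sqrtr_ge0 (F - mu); move: (Num.sqrt (F - mu)) => y y0 yE.
move=> Ny Fx vI xi0; have Cb0 : 0 < C * b by rewrite mulr_gt0.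
have bN : b * N <= 2 * (C * b) * y.
  by rewrite [leRHS](_ : _ = b * (2 * C * y)); [rewrite ler_pM2l|ring].
have x1 : mu - (C * b) ^+ 2 <= x by have := sqr_ge0 (y - C * b); nra.
split => //.
have wE : Num.sqrt (mu - xi) ^+ 2 = mu - xi.
  by rewrite sqr_sqrtr//; have := sqr_ge0 (C * b); lra.
have := sqrtr_ge0 (mu - xi); move: (Num.sqrt (mu - xi)) wE => w wE w0.
have Cbw : C * b < w.
  by rewrite -(ltr_pXn2r (n := 2))// ?nnegrE ?ltW//; lra.
have w1 : 0 < w by lra.
pose a := C * b / w; have aE : C * b = a * w by rewrite divfK ?gt_eqF.
have a0 : 0 <= a by rewrite divr_ge0// ltW.
have a1 : a < 1 by rewrite ltr_pdivrMr// mul1r.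
rewrite -/a (le_trans vI)//.
(* With w = sqrt(mu - xi) and C b = a w: y^2 - 2 a w y + w^2 equals (y (1 - a))^2 + (w - a y)^2 + 2
   a (1 - a) y^2. The factor 1 - a is the denominator of K_xi. *)
have y1 : y * (1 - a) <= Num.sqrt (x - xi).
  have h : (y * (1 - a)) ^+ 2 <= x - xi.
    rewrite (le_trans (y := y ^+ 2 - 2 * (a * w) * y + w ^+ 2))//; last by rewrite -aE; lra.
    have := sqr_ge0 (w - a * y).
    have : 0 <= a * (y ^+ 2 * (1 - a)).
      by rewrite mulr_ge0// mulr_ge0 ?sqr_ge0//; lra.
    nra.
  rewrite -[leLHS]ger0_norm; last by rewrite mulr_ge0//; lra.
  by rewrite -sqrtr_sqr ler_sqrt//; have := sqr_ge0 (y * (1 - a)); lra.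
rewrite (le_trans (ler_wpM2l I0 Ny))// [leRHS]mulrAC ler_pdivlMr; last by lra.
rewrite (_ : _ * (1 - a) = 2 * C * I * (y * (1 - a))); last by ring.
by rewrite ler_wpM2l// !mulr_ge0// ltW.
Qed.

(** For [b <= 0] the boundary term helps. With s = sqrt(x - mu) the claim reduces to N (s - C b) <=
    2 C s^2, in which [N] occurs on both sides of the available estimate y^2 <= s^2 + b N. *)
Lemma enclosure_neg F N C b mu x v I : 0 <= F -> mu < 0 -> 0 < C -> b <= 0 -> 0 <= I ->
  0 <= N -> N <= 2 * C * Num.sqrt (F - mu) -> F - b * N <= x -> `|v| <= I * N ->
  0 <= x /\ `|v| <= 2 * C * I * (x - mu) / (Num.sqrt (x - mu) - C * b).
Proof.
move=> F0 mu0 C0 b0 I0 N0; have Fmu : 0 <= F - mu by lra.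
have := sqr_sqrtr Fmu; have := sqrtr_ge0 (F - mu); move: (Num.sqrt (F - mu)) => y y0 yE.
move=> Ny Fx vI; have bN : 0 <= - (b * N) by rewrite -mulNr mulr_ge0// oppr_ge0.
have x0 : 0 <= x by lra.
split => //.
have r0 : 0 < x - mu by lra.
have sE := sqr_sqrtr (ltW r0).
have s0 : 0 < Num.sqrt (x - mu) by rewrite sqrtr_gt0.
move: (Num.sqrt (x - mu)) sE s0 => s sE s0.
have Cb : 0 <= - (C * b) by rewrite -mulrN mulr_ge0 ?oppr_ge0// ltW.
rewrite ler_pdivlMr; last by lra.
rewrite (le_trans (ler_wpM2r _ vI))//; first by lra.
rewrite (_ : 2 * C * I * _ = I * (2 * C * (x - mu))); last by ring.
rewrite -[leLHS]mulrA ler_wpM2l// -sE.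
have ys : y ^+ 2 - b * N <= s ^+ 2 by lra.
have ys' : y <= s by rewrite -(ler_pXn2r (n := 2))// ?nnegrE//; lra.
(* Proved by squaring: N^2 <= 4 C^2 (s^2 + b N), and 4 s^2 (s^2 + b N) differs from (2 s^2 + b N)^2
   by the square of b N. *)
have h1 : N * s <= C * (2 * s ^+ 2 - - (b * N)) .
  have C1 : 0 <= C * (s ^+ 2 - y ^+ 2 + b * N) by rewrite mulr_ge0//; lra.
  have h2 : N ^+ 2 <= 4 * C ^+ 2 * y ^+ 2.
    by rewrite (_ : _ * y ^+ 2 = (2 * C * y) ^+ 2); [rewrite ler_pXn2r ?nnegrE ?mulr_ge0// ltW|ring].
  have t0 : 0 <= 2 * s ^+ 2 - - (b * N).
    by have := sqr_ge0 y; have := sqr_ge0 s; lra.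
  rewrite -(ler_pXn2r (n := 2))// ?nnegrE ?mulr_ge0//; try lra.
  rewrite !exprMn.
  have h3 : N ^+ 2 * s ^+ 2 <= 4 * C ^+ 2 * (s ^+ 2 - - (b * N)) * s ^+ 2.
    rewrite ler_wpM2r ?sqr_ge0// (le_trans h2)// ler_wpM2l ?mulr_ge0 ?sqr_ge0//; lra.
  rewrite (le_trans h3)//.
  rewrite (_ : 4 * C ^+ 2 * _ * _ = C ^+ 2 * (4 * (s ^+ 2 - - (b * N)) * s ^+ 2)); last by ring.
  rewrite ler_wpM2l ?sqr_ge0//.
  by have := sqr_ge0 (b * N); nra.
nra.
Qed.

End scalar_estimates.

(** * Points of the resolvent set, and the trace inequality *)

Section boundary_spectrum.
Context {R : realType} {H K : preHilbertType R} {D : H -> H -> K -> K -> Prop}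
  (BS : boundary_system D) (Hc : hcomplete H) (Kc : hcomplete K).
Context {l0 : R[i]} {m0 c0 : R} (l0_gt0 : 0 < Im l0) (c0_gt0 : 0 < c0)
  (weyl_le : forall u z xi, D u (l0 *: u) z xi -> hnorm z <= m0 * hnorm xi)
  (weyl_im : forall u z xi, D u (l0 *: u) z xi -> c0 * hnorm xi ^+ 2 <= Im '[z, xi]).

Notation brack := (@brack R H K D).
Notation weyl_rel := (@weyl_rel R H K D).

Lemma brack_resolvent_set l B (c : R) : ~ nonneg_axis l -> linear_rel B -> 0 < c ->
  (forall w, exists xi z m, [/\ B (z, xi), weyl_rel l (xi, m) & w = z - m]) ->
  (forall xi z m, B (z, xi) -> weyl_rel l (xi, m) -> c * hnorm xi <= hnorm (z - m)) ->
  resolvent_set (brack B) l.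
Proof.
move=> nl Bl c_gt0 Bs Bb; have [C [C0 hR hG]] := solve_bound BS l0_gt0 weyl_le nl.
apply: (@resolvent_setP _ _ _ _ (C + C * (C / c))); first exact: brack_linear.
  move=> h; have [g [w Dg]] := bs_solve BS nl h 0.
  have [xi [z [m [Bz [u Du] wE]]]] := Bs w; rewrite /= in Du.
  exists (g + u), z, xi; split => //=.
  by have := bs_add BS Dg Du; rewrite add0r wE subrK -addrA -scalerDr.
move=> h f [z [e [/= /(decomposition BS nl)[g [zg [u [zu [Dg Du -> ->]]]]]]]].
rewrite addrK in Dg => Be.
have := Bb _ _ zu Be; rewrite addrK => /(_ (ex_intro _ u Du)) h1.
have [g1 g2] := hR _ _ _ Dg; have [u1 _] := hG _ _ _ Du.
have e1 : hnorm e <= C / c * hnorm h.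
  by rewrite mulrAC ler_pdivlMr// mulrC (le_trans h1).
rewrite (le_trans (ler_hnormD _ _))// mulrDl lerD// (le_trans u1)// -mulrA ler_wpM2l//.
Qed.

Lemma weyl_function l : ~ nonneg_axis l -> exists M : K -> K, hlinear M /\
  forall xi z, weyl_rel l (xi, z) <-> z = M xi.
Proof.
move=> nl.
have /choice[M hM] : forall xi, exists z, weyl_rel l (xi, z).
  by move=> xi; have [u [z h]] := gamma_solve BS xi nl; exists z, u.
have ME xi z : weyl_rel l (xi, z) <-> z = M xi.
  by split=> [[u Du]|->//]; exact: (weyl_relE BS nl (hM xi) Du).
exists M; split => // c u v; apply/esym/ME.
have [f Df] := hM u; have [g Dg] := hM v; exists (c *: f + g).
by have := bs_lin BS c Df Dg; rewrite scalerA mulrC -scalerA -scalerDr.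
Qed.

Section bounded_parameter.
Context {B : set (K * K)} {P : K -> K} {beta : R} (Pl : hlinear P)
  (BP : forall u v, B (u, v) <-> v = P u) (beta_ge0 : 0 <= beta)
  (Pb : forall u, hnorm (P u) <= beta * hnorm u).

Let Bl : linear_rel B.
Proof.
split; first by apply/BP; rewrite hlinear0.
by move=> c [u v] [u' v'] /BP -> /BP ->; apply/BP; rewrite Pl.
Qed.

Lemma id_sub_surjective (M : K -> K) (m : R) : hlinear M -> 0 <= m -> beta * m < 1 ->
  (forall u, hnorm (M u) <= m * hnorm u) ->
  (forall w, exists z, w = z - M (P z)) /\ (forall w, exists z, w = z - P (M z)).
Proof.
move=> Ml m_ge0 bm Mb.
have key (Q : K -> K) : hlinear Q -> (forall u, hnorm (Q u) <= beta * m * hnorm u) ->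
    forall w, exists z, w = z - Q z.
  move=> Ql Qb w.
  have [||||||u [v [e ->]]] :=
    @perturb_surjective _ K K Kc [set q | q.2 = q.1] (fun u => - Q u) 1 (beta * m) _ _ _ _ _ _ w.
  - by split => // c [u v] [u' v'] /= -> ->.
  - by move=> v; exists v.
  - by move=> u v /= ->; rewrite mul1r.
  - by move=> c u v; rewrite Ql opprD scalerN.
  - by move=> u; rewrite hnormN.
  - by rewrite bm mulr_ge0.
  by exists u; have -> : v = u := e.
split; apply: key.
- by move=> c u v; rewrite Pl Ml.
- by move=> u; rewrite (le_trans (Mb _))// [beta * m]mulrC -mulrA ler_wpM2l.
- by move=> c u v; rewrite Ml Pl.
- by move=> u; rewrite (le_trans (Pb _))// -mulrA ler_wpM2l.
Qed.

Lemma bounded_resolvent_set l (m : R) : ~ nonneg_axis l -> 0 <= m -> beta * m < 1 ->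
  (forall u z xi, D u (l *: u) z xi -> hnorm z <= m * hnorm xi) ->
  resolvent_set (brack B) l.
Proof.
move=> nl m_ge0 bm Mb; have [M [Ml ME]] := weyl_function nl.
have Mb' xi : hnorm (M xi) <= m * hnorm xi.
  by have [_ /(_ erefl)[u Du]] := ME xi (M xi); exact: Mb Du.
have [Ms _] := id_sub_surjective Ml m_ge0 bm Mb'.
have bm1 : 0 < 1 - beta * m by lra.
have b1 : 0 < beta + 1 by rewrite ltr_wpDl.
(* The constant comes from |xi| <= beta |z| and (1 - beta m) |z| <= |z - M P z|; [beta + 1] replaces
   [beta] to keep the denominator positive when [beta = 0]. *)
apply: (@brack_resolvent_set _ _ ((1 - beta * m) / (beta + 1))) => //.
- by rewrite divr_gt0.
- move=> w; have [z ->] := Ms w; exists (P z), z, (M (P z)); split => //; first exact/BP.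
  exact/ME.
move=> xi z m' /BP -> /ME ->.
have h1 : hnorm z * (1 - beta * m) <= hnorm (z - M (P z)).
  have := lerB_hnorm z (M (P z)); have := Mb' (P z); have := ler_wpM2l m_ge0 (Pb z); lra.
rewrite mulrAC ler_pdivrMr//.
rewrite (le_trans (ler_wpM2l (ltW bm1) (Pb z)))//.
have := ler_wpM2l beta_ge0 h1; have := hnorm_ge0 (z - M (P z)); lra.
Qed.

End bounded_parameter.

(** The sign [s] treats the dissipative and the accumulative case together. The point [l1] makes the
    inverse of [B] minus 1 / l1 onto, and the path from 1 / l1 to M(l) stays among operators whose
    imaginary part, times [s], is at least c2 > 0. The inverse of [B] has the opposite sign, so the
    lower bound holds along the whole path. *)
Lemma maximal_resolvent_set (s c : R) l l1 B : (s = 1 \/ s = -1) ->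
  ~ nonneg_axis l -> linear_rel B -> 0 < c ->
  (forall u z xi, D u (l *: u) z xi -> c * hnorm xi ^+ 2 <= s * Im '[z, xi]) ->
  (forall z xi, B (z, xi) -> 0 <= s * Im '[xi, z]) ->
  s * Im l1 < 0 -> resolvent_set B l1 -> resolvent_set (brack B) l.
Proof.
move=> s1 nl Bl c_gt0 Mim Bim l1_lt0 [_ l1s _].
have [M [Ml ME]] := weyl_function nl.
have [C [C0 _ hG]] := solve_bound BS l0_gt0 weyl_le nl.
have Mb xi : hnorm (M xi) <= C * hnorm xi.
  by have [_ /(_ erefl)[u Du]] := ME xi (M xi); have [] := hG _ _ _ Du.
have Mim' xi : c * hnorm xi ^+ 2 <= s * Im '[M xi, xi].
  by have [_ /(_ erefl)[u Du]] := ME xi (M xi); exact: Mim Du.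
have l1n : l1 != 0.
  by apply: contraTneq l1_lt0 => ->; rewrite mulr0 ltxx.
have sl1 : 0 < s * Im l1^-1.
  have -> : l1^-1 = l1^* * ((sqn l1)^-1)%:C.
    apply: (mulfI l1n); rewrite divff// mulrA mul_conj_self -rmorphM/= divff//.
    by apply: contra l1n => /eqP/sqn_eq0 ->.
  rewrite ImM ImC/= mulr0 add0r mulrA mulrN mulr_gt0 ?oppr_gt0//.
  rewrite invr_gt0 lt_neqAle sqn_ge0 andbT eq_sym.
  by apply: contra l1n => /eqP/sqn_eq0 ->.
pose c1 := Num.min c (s * Im l1^-1).
have [c2 c2_gt0 [c2c c2l]] : exists2 c2, 0 < c2 & c2 <= c /\ c2 <= s * Im l1^-1.
  by exists c1; rewrite /c1 ?lt_min ?c_gt0//; rewrite !ge_min !lexx orbT.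
have low (t : R) z xi : 0 <= t <= 1 -> B (z, xi) ->
    c2 * hnorm xi <= hnorm (z - l1^-1 *: xi + t%:C *: (l1^-1 *: xi - M xi)).
  move=> /andP[t0 t1] Bz; have [->|xi0] := eqVneq xi 0.
    by rewrite hnorm0 mulr0 hnorm_ge0.
  have := Bim _ _ Bz; rewrite (Im_inner_conj z xi) => Bz'.
  rewrite -(ler_pM2r (hnorm_gt0 xi0)).
  apply: le_trans (Im_inner_norm_le _ _); set X := '[_, _].
  have -> : Im X = Im '[z, xi] - (1 - t) * Im l1^-1 * hnorm xi ^+ 2 - t * Im '[M xi, xi].
    rewrite /X !innerE inner_selfE !ReImE/=; ring.
  have h1 : c2 * hnorm xi ^+ 2 <= s * Im '[M xi, xi].
    by rewrite (le_trans _ (Mim' xi))// ler_wpM2r ?sqr_ge0.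
  have h2 : c2 * hnorm xi ^+ 2 <= s * Im l1^-1 * hnorm xi ^+ 2.
    by rewrite ler_wpM2r ?sqr_ge0.
  rewrite -[leLHS]mulrA -expr2.
  have h3 : c2 * hnorm xi ^+ 2 <= (1 - t) * (s * Im l1^-1 * hnorm xi ^+ 2) + t * (s * Im '[M xi, xi]).
    by have := ler_wpM2l t0 h1; have := @ler_wpM2l _ (1 - t) _ _ _ h2; rewrite subr_ge0 t1 => /(_ isT); lra.
  rewrite ler_normr; case: s1 => sE; rewrite sE in h3 Bz'; apply/orP; [right|left]; lra.
pose T : set (K * K) := [set q | exists z, B (z, q.1) /\ q.2 = z - l1^-1 *: q.1].
pose Q xi := l1^-1 *: xi - M xi.
have Ql : hlinear Q.
  by move=> a u v; rewrite /Q Ml scalerDr scalerA [_ * a]mulrC -scalerA opprD addrACA -scalerBr.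
apply: (@brack_resolvent_set _ _ c2) => //.
- move=> w; have [||||xi [v [[z [Bz /= vE]] wE]]] :=
    @continuity_method _ _ _ Kc T Q c2 (cabs l1^-1 + C) _ _ Ql _ c2_gt0 _ w.
  + have [B0 Bl'] := Bl; split; first by exists 0; rewrite /= scaler0 subr0.
    move=> a [xi v] [xi' v'] [z [/= Bz ->]] [z' [/= Bz' ->]].
    exists (a *: z + z'); split; first exact: Bl' Bz Bz'.
    by rewrite /= !scalerDr scalerA [_ * a]mulrC -scalerA scalerN opprD addrACA.
  + move=> v; have : rel_dom (resolvent B l1) (- (l1 *: v)) by rewrite l1s.
    move=> [z /resolventE Bz]; exists (- (l1 *: v) + l1 *: z), z; split => //=.
    by rewrite scalerDr scalerN !scalerA mulVf// !scale1r opprD opprK addrCA subrr addr0.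
  + move=> u; rewrite /Q (le_trans (ler_hnormB _ _))// hnormZ mulrDl lerD2l.
    exact: Mb.
  + move=> t t01 u v [z [/= Bz ->]]; exact: low.
  exists xi, z, (M xi); split => //; first exact/ME.
  by rewrite wE vE /Q addrA subrK.
- move=> xi z m Bz /ME ->; have := low 1 z xi _ Bz; rewrite ler01 lexx => /(_ isT).
  by rewrite scale1r addrA subrK.
Qed.

(** Write a for the form plus kappa^2 times the inner product, and let u = gamma(- kappa^2) z.
    Green's identity gives a(f, u) = |z|^2, while a(u, u) <= m |z|^2 by the bound on M.
    Nonnegativity of a at f - u / m is then the claim. *)
Lemma trace_bound (kappa m : R) f k z e : 0 < kappa -> 0 < m ->
  (forall u z xi, D u ((- kappa ^+ 2)%:C *: u) z xi -> hnorm z <= m * hnorm xi) ->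
  D f k z e ->
  hnorm z ^+ 2 <= m * (Re ('[k, f] + '[e, z]) + kappa ^+ 2 * hnorm f ^+ 2).
Proof.
move=> k0 m_gt0 Mb Df.
have nl : ~ nonneg_axis (- kappa ^+ 2)%:C.
  by move=> [_] /=; rewrite oppr_ge0 leNgt exprn_gt0.
have [u [zu Du]] := gamma_solve BS z nl.
have := bs_pos BS (bs_sub BS Df (bs_scale BS (m^-1)%:C Du)).
have := sqr_ge0 (hnorm (f - (m^-1)%:C *: u)).
have := congr1 (@complex.Re R) (bs_green BS Du Df).
rewrite hnormD_sqr hnormN hnormZ innerNr innerZr !innerE !ReImE/= !inner_selfE/=.
rewrite cabsr exprMn real_normK ?num_real//.
rewrite (Im_inner_conj u f) (Re_inner_conj u f) (Re_inner_conj u k) (Re_inner_conj zu e).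
have := Re_inner_le z zu; have := ler_wpM2l (hnorm_ge0 z) (Mb _ _ _ Du).
have mi : 0 < m^-1 by rewrite invr_gt0.
rewrite mulrCA -expr2; move: (Re '[z, zu]) => q q1 q2 green sq pos.
have q3 : m^-1 * q <= hnorm z ^+ 2.
  by rewrite ler_pdivrMl//; lra.
have q4 := ler_wpM2l (ltW mi) q3.
rewrite -ler_pdivrMl//.
have := mulr_ge0 (sqr_ge0 kappa) sq.
nra.
Qed.

End boundary_spectrum.

Section closure_distance.
Context {R : realType}.

Lemma closure_dist (W : set R[i]) (z : R[i]) : ~ closure (W : set R[i]^o) z ->
  exists2 delta : R, 0 < delta & forall w, W w -> delta <= cabs (z - w).
Proof.
move=> zW; apply: contrapT => h; apply: zW => U /nbhs_ballP[e /= e0 eU].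
have [re ie] : 0 < Re e /\ Im e = 0.
  by move: e0; rewrite ltcE/= => /andP[/eqP -> ->].
have [w Ww zw] : exists2 w, W w & cabs (z - w) < Re e.
  apply: contrapT => h'; apply: h; exists (Re e) => // w Ww.
  by rewrite leNgt; apply/negP => ?; apply: h'; exists w.
exists w; split => //; apply: eU; rewrite -ball_normE /ball_/=.
rewrite ltcE/= ie eqxx/=.
by rewrite (le_lt_trans _ zw)// /cabs /sqn; case: (z - w).
Qed.

End closure_distance.

(** * The numerical range of [A_[B]] *)

Section numerical_range.
Context {R : realType} {H K : preHilbertType R} {D : H -> H -> K -> K -> Prop}
  (BS : boundary_system D) (Hc : hcomplete H) (Kc : hcomplete K).
Context {l0 : R[i]} {m0 c0 : R} (l0_gt0 : 0 < Im l0) (c0_gt0 : 0 < c0)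
  (weyl_le : forall u z xi, D u (l0 *: u) z xi -> hnorm z <= m0 * hnorm xi)
  (weyl_im : forall u z xi, D u (l0 *: u) z xi -> c0 * hnorm xi ^+ 2 <= Im '[z, xi]).
Context {B : set (K * K)} {P : K -> K} {beta b : R} (Pl : hlinear P)
  (BP : forall u v, B (u, v) <-> v = P u) (beta_ge0 : 0 <= beta)
  (Pb : forall u, hnorm (P u) <= beta * hnorm u)
  (Pre : forall u, Re '[P u, u] <= b * hnorm u ^+ 2).

Notation brack := (@brack R H K D).
Notation weyl_rel := (@weyl_rel R H K D).

Lemma num_range_brack w : num_range (brack B) w -> exists F N : R, exists f k z,
  [/\ D f k z (P z), hnorm f = 1, 0 <= F, N = hnorm z ^+ 2 &
   [/\ F = Re ('[k, f] + '[P z, z]), F - b * N <= Re w & Im w = - Im '[P z, z]]].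
Proof.
move=> [f [k [[z [e [/= Df /BP eE]]] f1 ->]]]; subst e.
exists (Re ('[k, f] + '[P z, z])), (hnorm z ^+ 2), f, k, z; split => //.
  exact: (bs_pos BS Df).
split => //; first by have := Pre z; rewrite ReD; lra.
by have := green_im BS Df; rewrite ImD; lra.
Qed.

(** [trace_bound] with kappa = sqrt(F - mu) and m = C / kappa; then F + kappa^2 <= 2 kappa^2 since
    [mu < 0]. The admissible range of [kappa] is respected because [F >= 0]. *)
Lemma trace_sqrt_bound mu C f k z e : mu < 0 -> 0 < C ->
  (forall kappa, Num.sqrt (- mu) <= kappa -> forall u z xi,
     D u ((- kappa ^+ 2)%:C *: u) z xi -> hnorm z <= C / kappa * hnorm xi) ->
  D f k z e -> hnorm f = 1 ->
  hnorm z ^+ 2 <= 2 * C * Num.sqrt (Re ('[k, f] + '[e, z]) - mu).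
Proof.
move=> mu0 C0 hC Df f1; have F0 := bs_pos BS Df; set F := Re _ in F0 *.
have Fmu : 0 < F - mu by lra.
have y0 : 0 < Num.sqrt (F - mu) by rewrite sqrtr_gt0.
have Cy : 0 < C / Num.sqrt (F - mu) by rewrite divr_gt0.
have := trace_bound BS y0 Cy (hC _ _) Df; rewrite -/F f1 expr1n mulr1.
move=> h; apply: le_trans (h _) _; first by rewrite ler_sqrt; lra.
rewrite sqr_sqrtr ?(ltW Fmu)// mulrAC ler_pdivrMr// -[leRHS]mulrA -expr2.
by rewrite sqr_sqrtr ?(ltW Fmu)// [2 * C]mulrC -mulrA ler_wpM2l ?ltW//; lra.
Qed.

Lemma m_sectorial_brack :
  (forall eps, 0 < eps -> exists2 kappa0, 0 < kappa0 & forall kappa : R, kappa0 <= kappa ->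
     forall u z xi, D u ((- kappa ^+ 2)%:C *: u) z xi -> hnorm z <= eps * hnorm xi) ->
  m_sectorial (brack B).
Proof.
(* With this [m], (|b| + beta) N is at most half of F + kappa^2, which bounds both the loss in the
   real part and the imaginary part. So the sector has vertex - kappa^2 and slope 1. *)
move=> small; pose m := (2 * (`|b| + beta + 1))^-1.
have t0 : 0 < `|b| + beta + 1 by rewrite ltr_wpDl// addr_ge0.
have m_gt0 : 0 < m by rewrite invr_gt0 mulr_gt0.
have mb : m * (`|b| + beta + 1) = 2^-1 by rewrite /m invfM -mulrA mulVf ?gt_eqF// mulr1.
clearbody m.
have [kappa k0 hk] := small _ m_gt0.
pose kp := Num.max kappa 1.
exists (- kappa ^+ 2), 1; split => //.
  move=> w /num_range_brack[F [N [f [k [z [Df f1 F0 NE [FE Fw Iw]]]]]]].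
  have := trace_bound BS k0 m_gt0 (hk _ (lexx _)) Df; rewrite -FE -NE f1 expr1n mulr1 => NF.
  have N0 : 0 <= N by rewrite NE sqr_ge0.
  have IN : `|Im w| <= beta * N.
    rewrite Iw normrN (le_trans (Im_inner_norm_le _ _))// NE expr2 mulrA.
    by rewrite ler_wpM2r ?hnorm_ge0.
  have bN : b * N <= `|b| * N by rewrite ler_wpM2r// ler_norm.
  have h1 : (`|b| + beta + 1) * N <= 2^-1 * (F + kappa ^+ 2).
    by rewrite -mb [m * _]mulrC -mulrA ler_wpM2l// ltW.
  have bN0 : 0 <= `|b| * N by rewrite mulr_ge0.
  have cN0 : 0 <= beta * N by rewrite mulr_ge0.
  have := sqr_ge0 kappa; split; rewrite /=; lra.
(* A real point to the left of the vertex, where the bound on M still holds. *)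
exists (- (kappa + 1) ^+ 2)%:C; split; last first.
  by move=> [/=]; rewrite lerN2 leNgt ltr_pXn2r// ?nnegrE; lra.
apply: (bounded_resolvent_set BS Kc l0_gt0 weyl_le Pl BP beta_ge0 Pb (m := m)) => //.
- by move=> [_] /=; rewrite oppr_ge0 leNgt exprn_gt0//; lra.
- exact: ltW.
- have : 0 <= m * `|b| by rewrite mulr_ge0// ltW.
  lra.
- by apply: hk; lra.
Qed.

Section spectral_inclusion.
Context (weyl_imag_small : forall eps, 0 < eps -> exists (y m : R),
  [/\ 1 <= y, 0 <= m <= eps & forall u z xi, D u ((y *i) *: u) z xi ->
    hnorm z <= m * hnorm xi]).
Context {Q : K -> K} (Ql : hlinear Q) (PQ : forall u v, '[P u, v] = '[u, Q v])
  (Qb : forall v, hnorm (Q v) <= beta * hnorm v).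

(* The numerical range of the adjoint is approximated by perturbing [f] by
   [gamma (i y) zeta] with [y] large, which is small in the form norm. *)
Lemma adjoint_form_approximation f k z (eps : R) : D f k z (Q z) -> 0 < eps ->
  exists g kg, [/\ brack B (g, kg), hnorm (g - f) <= eps &
    cabs ('[kg, g] - '[f, k]) <= eps].
Proof.
(* [eta] measures by how much the data of [f] violates the condition given by [B]; [T] below is a
   common majorant of all norms involved. *)
move=> Df eps0; have [eta etaE] : exists eta, eta = P z - Q z by eexists.
pose T := 1 + hnorm eta + hnorm z + hnorm k + beta.
have [T1 [Teta Tz Tk Tb]] : 1 <= T /\ [/\ hnorm eta <= T, hnorm z <= T, hnorm k <= T & beta <= T].
  rewrite /T; have := hnorm_ge0 eta; have := hnorm_ge0 z; have := hnorm_ge0 k.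
  by have := beta_ge0; move=> ? ? ? ?; split; [lra|split; lra].
clearbody T.
(* The error terms estimated at the end add up to at most 12 T^4 delta; the factor 32 leaves room
   for the smallness needed in the Neumann series. *)
have [delta [d0 d1 dT]] : exists delta : R, [/\ 0 < delta, delta <= 1 & 32 * T ^+ 4 * delta <= Num.min eps 1].
  exists (Num.min eps 1 / (32 * T ^+ 4)).
  have T4 : 0 < 32 * T ^+ 4 by rewrite mulr_gt0// exprn_gt0//; lra.
  split; first by rewrite divr_gt0// lt_min eps0 ltr01.
    rewrite ler_pdivrMr// mul1r ge_min; apply/orP; right.
    by have := exprn_ege1 4 T1; lra.
  by rewrite mulrC divfK// gt_eqF.
(* The bound m <= delta^2, with y |u|^2 = Im(M zeta, zeta) and y >= 1, makes |u| of order [delta]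
   and keeps y |u|^2 small although [y] is large. *)
have [y [m [y1 /andP[m_ge0 md] hm]]] := weyl_imag_small (exprn_gt0 2 d0).
have nl : ~ nonneg_axis (y *i) by apply: nonreal_axis; rewrite /= gt_eqF//; lra.
have [M [Ml ME]] := weyl_function BS nl.
have Mb xi : hnorm (M xi) <= m * hnorm xi.
  by have [_ /(_ erefl)[u Du]] := ME xi (M xi); exact: hm Du.
have Te : T ^+ 4 = T ^+ 2 * T ^+ 2 by rewrite -exprD.
have T2 : T <= T ^+ 2 by rewrite expr2 ler_peMr//; lra.
have T21 : 1 <= T ^+ 2 by lra.
have T24 : T ^+ 2 <= T ^+ 4 by rewrite Te ler_peMr//; lra.
have T34 : T ^+ 2 * T <= T ^+ 4 by rewrite Te ler_wpM2l//; lra.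
have Td : 32 * T ^+ 4 * delta <= 1.
  by rewrite (le_trans dT)// ge_min lexx orbT.
have dd : delta ^+ 2 <= delta by rewrite expr2 ler_piMr// ltW.
have md' : m <= delta := le_trans md dd.
have bm2 : beta * m <= 2^-1.
  have h1 : beta * m <= T * delta by rewrite ler_pM.
  have h2 : T * delta <= T ^+ 4 * delta by rewrite ler_wpM2r ?(ltW d0)//; lra.
  lra.
have [|_ Ms] := id_sub_surjective Kc Pl beta_ge0 Pb Ml m_ge0 _ Mb.
  by rewrite (le_lt_trans bm2)// invf_lt1// ltr1n.
(* [zeta - P M zeta = eta] says exactly that P (z + M zeta) = Q z + zeta, so that [f + u] satisfies
   the boundary condition of [B]. *)
have [zeta zE] := Ms eta.
have zb : hnorm zeta <= 2 * T.
  have h1 : hnorm (P (M zeta)) <= 2^-1 * hnorm zeta.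
    rewrite (le_trans (Pb _))// (le_trans (ler_wpM2l beta_ge0 (Mb _)))// mulrA.
    by rewrite ler_wpM2r ?hnorm_ge0.
  by have := lerB_hnorm zeta (P (M zeta)); rewrite -zE; lra.
have [u Du] : weyl_rel (y *i) (zeta, M zeta) by apply/ME.
rewrite /= in Du.
have Mzb : hnorm (M zeta) <= 2 * T * delta.
  by rewrite (le_trans (Mb _))// mulrC ler_pM ?hnorm_ge0.
have yu : y * hnorm u ^+ 2 <= 4 * T ^+ 2 * delta ^+ 2.
  have := gamma_im BS Du => /= ->.
  rewrite (le_trans (ler_norm _))// (le_trans (Im_inner_norm_le _ _))//.
  rewrite (le_trans (ler_wpM2r (hnorm_ge0 _) (Mb _)))//.
  rewrite (_ : 4 * _ * _ = delta ^+ 2 * (2 * T) * (2 * T)); last by ring.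
  by rewrite ler_pM ?mulr_ge0 ?hnorm_ge0// ler_pM ?hnorm_ge0.
have ub : hnorm u <= 2 * T * delta.
  rewrite -(ler_pXn2r (n := 2))// ?nnegrE ?hnorm_ge0//; last by rewrite !mulr_ge0 ?(ltW d0)//; lra.
  rewrite (_ : (2 * T * delta) ^+ 2 = 4 * T ^+ 2 * delta ^+ 2); last by ring.
  by rewrite (le_trans _ yu)// ler_peMl ?sqr_ge0.
have dTe : 32 * T ^+ 4 * delta <= eps by rewrite (le_trans dT)// ge_min lexx.
have Td4 : T * delta <= T ^+ 4 * delta by rewrite ler_wpM2r ?(ltW d0)//; lra.
exists (f + u), (k + (y *i) *: u); split.
- exists (z + M zeta), (Q z + zeta); split => /=; first exact: bs_add.
  apply/BP; have := Pl 1 z (M zeta); rewrite !scale1r => ->.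
  have := zE; rewrite etaE => /eqP; rewrite subr_eq => /eqP ->.
  by rewrite [RHS]addrAC subrK addrC.
- rewrite addrAC subrr add0r (le_trans ub)//.
  have : 0 <= T ^+ 4 * delta by rewrite mulr_ge0 ?(ltW d0)//; lra.
  lra.
(* Green's identity for (f, f) and (u, f) replaces all terms that are not visibly small; the
   right-hand side contains only products with [M zeta] or [u]. *)
have -> : '[k + (y *i) *: u, f + u] - '[f, k] =
    - '[P (M zeta), z] + ('[k, u] + '[u, k]) + '[M zeta, Q z] + (y *i) * '[u, u].
  have e1 := bs_green BS Df Df; have e2 := bs_green BS Du Df.
  have e3 : '[zeta, z] = '[P z, z] - '[Q z, z] + '[P (M zeta), z].
    by rewrite -innerBl -innerDl -etaE zE subrK.
  rewrite PQ in e3; rewrite !innerDl !innerDr innerZl in e2 *; rewrite innerZl.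
  have -> : '[f, k] = '[k, f] + '[Q z, z] - '[z, Q z] by rewrite e1 addrK.
  have -> : (y *i) * '[u, f] = '[u, k] + '[M zeta, Q z] - '[zeta, z].
    by rewrite -e2 addrK.
  rewrite e3; ring.
have b1 : cabs '[P (M zeta), z] <= 2 * T ^+ 3 * delta.
  rewrite (le_trans (cabs_inner_le _ _))//.
  rewrite (_ : 2 * _ * _ = T * (2 * T * delta) * T); last by ring.
  rewrite ler_pM ?hnorm_ge0// (le_trans (Pb _))// ler_pM ?hnorm_ge0//.
have b2 : cabs '[k, u] <= 2 * T ^+ 2 * delta.
  rewrite (le_trans (cabs_inner_le _ _))//.
  by rewrite (_ : 2 * _ * _ = T * (2 * T * delta)); [rewrite ler_pM ?hnorm_ge0|ring].
have b3 : cabs '[u, k] <= 2 * T ^+ 2 * delta by rewrite inner_conj cabsC.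
have b4 : cabs '[M zeta, Q z] <= 2 * T ^+ 3 * delta.
  rewrite (le_trans (cabs_inner_le _ _))//.
  rewrite (_ : 2 * _ * _ = (2 * T * delta) * (T * T)); last by ring.
  by rewrite ler_pM ?hnorm_ge0// (le_trans (Qb _))// ler_pM ?hnorm_ge0.
have b5 : cabs ((y *i) * '[u, u]) <= 4 * T ^+ 2 * delta.
  rewrite cabsM inner_selfE cabsr ger0_norm ?sqr_ge0//.
  have -> : cabs (y *i) = y by rewrite /cabs /sqn/= expr0n/= add0r sqrtr_sqr ger0_norm//; lra.
  by rewrite (le_trans yu)// ler_wpM2l// mulr_ge0// sqr_ge0.
rewrite (le_trans (cabsD _ _))// (le_trans (lerD (cabsD _ _) (lexx _)))//.
rewrite (le_trans (lerD (lerD (cabsD _ _) (lexx _)) (lexx _)))// cabsN.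
have b6 := cabsD '[k, u] '[u, k].
have T3 : T ^+ 3 * delta <= T ^+ 4 * delta.
  by rewrite ler_wpM2r ?(ltW d0)// ler_weXn2l.
have T2d : T ^+ 2 * delta <= T ^+ 4 * delta by rewrite ler_wpM2r// ltW.
have := hnorm_ge0 z; have := mulr_ge0 (ltW d0) (ltW d0); nra.
Qed.

End spectral_inclusion.

End numerical_range.

Lemma resolvent_function {R : realType} {H : preHilbertType R} (A : set (H * H)) l :
  linear_rel A -> resolvent_set A l -> exists (F : H -> H) (k : R), [/\ hlinear F,
    forall h, A (F h, h + l *: F h) & forall h, hnorm (F h) <= k * hnorm h].
Proof.
move=> [_ Al] [rs rd [k rk]].
have /choice[F hF] : forall h, exists f, resolvent A l (h, f).
  by move=> h; have : rel_dom (resolvent A l) h by rewrite rd.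
have AF h : A (F h, h + l *: F h) by apply/resolventE.
exists F, k; split => // [c u v|h]; last exact: rk.
apply: rs (hF _) _; apply/resolventE.
have := Al c _ _ (AF u) (AF v).
by rewrite /= !scalerDr scalerA mulrC -scalerA addrACA.
Qed.

(** * The spectrum lies in the closure of the numerical range *)

Section spectrum_closure.
Context {R : realType} {H K : preHilbertType R} {D : H -> H -> K -> K -> Prop}
  (BS : boundary_system D) (Hc : hcomplete H) (Kc : hcomplete K).
Context {l0 : R[i]} {m0 c0 : R} (l0_gt0 : 0 < Im l0) (c0_gt0 : 0 < c0)
  (weyl_le : forall u z xi, D u (l0 *: u) z xi -> hnorm z <= m0 * hnorm xi)
  (weyl_im : forall u z xi, D u (l0 *: u) z xi -> c0 * hnorm xi ^+ 2 <= Im '[z, xi]).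

Notation brack := (@brack R H K D).

(** Both A - z and its adjoint are bounded below by [delta], the former directly, the latter by
    approximating adjoint elements in form. Bounded operators are obtained by composing with
    resolvents at a negative point x0 known to be in both resolvent sets. *)
Lemma spectrum_brack B P (beta b : R) (Pl : hlinear P)
  (BP : forall u v : K, B (u, v) <-> v = P u) (beta_ge0 : 0 <= beta)
  (Pb : forall u, hnorm (P u) <= beta * hnorm u)
  (Pre : forall u, Re '[P u, u] <= b * hnorm u ^+ 2) :
  (forall eps, 0 < eps -> exists (y m : R),
    [/\ 1 <= y, 0 <= m <= eps & forall u z xi, D u ((y *i) *: u) z xi ->
    hnorm z <= m * hnorm xi]) ->
  (exists kappa m : R, [/\ 0 < kappa, 0 <= m, beta * m < 1 & forall u z xi,
     D u ((- kappa ^+ 2)%:C *: u) z xi -> hnorm z <= m * hnorm xi]) ->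
  spectrum (brack B) `<=` closure (num_range (brack B) : set R[i]^o).
Proof.
move=> imag [kappa [m [k0 m_ge0 bm hm]]] z zS; apply: contrapT => zW; apply: zS.
have [delta d0 hd] := closure_dist zW.
have Bl : linear_rel B.
  split; first by apply/BP; rewrite hlinear0.
  by move=> c [u v] [u' v'] /BP -> /BP ->; apply/BP; rewrite Pl.
have Al := brack_linear BS Bl.
have dnorm f k : brack B (f, k) -> delta * hnorm f ^+ 2 <= cabs ('[k, f] - z * '[f, f]).
  move=> Afk; have [->|f0] := eqVneq f 0.
    by rewrite hnorm0 expr0n/= mulr0 cabs_ge0.
  have nf := hnorm_gt0 f0.
  pose c := ((hnorm f)^-1)%:C : R[i].
  have : num_range (brack B) '[c *: k, c *: f].
    exists (c *: f), (c *: k); split => //.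
      have [_ /(_ c _ (0, 0) Afk)] := Al; rewrite /= !addr0; apply.
      by case: Al.
    by rewrite hnormZ cabsr ger0_norm ?invr_ge0 ?hnorm_ge0// mulVf// gt_eqF.
  move=> /hd; rewrite -cabsN opprB innerZl innerZr.
  have cc : Num.conj c = c by apply: complex_ext; rewrite ?ReC ?ImC//= oppr0.
  rewrite cc mulrA.
  have cf : c * c * '[f, f] = 1.
    by rewrite inner_selfE -!rmorphM/= -invfM -expr2 mulVf// expf_neq0// gt_eqF.
  rewrite (_ : c * c * '[k, f] - z = c * c * ('[k, f] - z * '[f, f])); last first.
    by rewrite mulrBr (mulrCA _ z) cf mulr1.
  rewrite !cabsM cabsr ger0_norm ?invr_ge0 ?hnorm_ge0//.
  rewrite -invfM -expr2 mulrC ler_pdivlMr// exprn_gt0//.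
have [Q [Ql PQ Qb']] := bounded_adjoint Kc Pl Pb.
have Qb v : hnorm (Q v) <= beta * hnorm v by rewrite -[beta]ger0_norm.
have BQ u v : rel_adj B (u, v) <-> v = Q u.
  split=> [h|->]; last by move=> a c /BP -> /=.
  by apply: inner_ext => a; rewrite -PQ; apply/esym/(h a (P a))/BP.
have dadj f k : rel_adj (brack B) (f, k) -> delta * hnorm f ^+ 2 <= cabs ('[f, k] - z * '[f, f]).
  rewrite -(brack_adj BS Kc l0_gt0 c0_gt0 weyl_le weyl_im Bl).
  move=> [y [e [/= Df /BQ eE]]]; subst e.
  (* Majorant of the total error: 1 for the form values, and [delta + |z|] for the change of the
     squared norms, which is at most eps (2 |f| + 1). *)
  pose T := 1 + (delta + cabs z) * (2 * hnorm f + 1).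
  have T1 : 0 < T by rewrite ltr_pwDl// mulr_ge0 ?addr_ge0 ?cabs_ge0 ?mulr_ge0 ?hnorm_ge0// ltW.
  apply/ler_addgt0Pr => e e0.
  have [eps [eps0 eps1 epsT]] : exists eps : R, [/\ 0 < eps, eps <= 1 & T * eps <= e].
    exists (Num.min 1 (e / T)); split.
    - by rewrite lt_min ltr01 divr_gt0.
    - by rewrite ge_min lexx.
    - by rewrite mulrC -ler_pdivlMr// ge_min lexx orbT.
  have [g [kg [Ag gf kf]]] := adjoint_form_approximation BS Kc Pl BP beta_ge0 Pb imag PQ Qb Df eps0.
  have h1 := dnorm _ _ Ag.
  have h2 : `|hnorm g ^+ 2 - hnorm f ^+ 2| <= eps * (2 * hnorm f + 1).
    have h3 := lerB_hnorm g f; have h4 := lerB_hnorm f g; rewrite hnormBC in h4.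
    have := hnorm_ge0 f; have := hnorm_ge0 g.
    rewrite subr_sqr normrM => g0 f0; rewrite ler_pM//.
      by rewrite ler_norml; apply/andP; split; lra.
    by rewrite ger0_norm ?addr_ge0//; lra.
  have h3 : cabs ('[kg, g] - z * '[g, g]) <= cabs ('[f, k] - z * '[f, f]) + eps +
      cabs z * `|hnorm g ^+ 2 - hnorm f ^+ 2|.
    rewrite (_ : '[kg, g] - _ = ('[f, k] - z * '[f, f]) + ('[kg, g] - '[f, k]) +
      (- z) * (hnorm g ^+ 2 - hnorm f ^+ 2)%:C); last first.
      by rewrite !inner_selfE rmorphB/=; ring.
    rewrite (le_trans (cabsD _ _))// cabsM cabsN cabsr lerD2r (le_trans (cabsD _ _))//.
    by rewrite lerD2l.
  have h4 : delta * hnorm f ^+ 2 <= delta * hnorm g ^+ 2 +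
      delta * `|hnorm g ^+ 2 - hnorm f ^+ 2|.
    rewrite -mulrDr ler_wpM2l ?(ltW d0)// -lerBlDl.
    by rewrite (le_trans (ler_norm _))// distrC.
  move: h2 h3 h4; move: `|_| => t h2 h3 h4.
  have h5 := ler_wpM2l (ltW d0) h2; have h6 := ler_wpM2l (cabs_ge0 z) h2.
  rewrite /T in epsT; lra.
have low (f g : H) (a : R) : a * hnorm f ^+ 2 <= cabs '[g, f] -> a * hnorm f <= hnorm g.
  have [->|f0] := eqVneq f 0; first by rewrite hnorm0 mulr0 hnorm_ge0.
  move=> h; rewrite -(ler_pM2r (hnorm_gt0 f0)) -mulrA -expr2.
  exact: le_trans h (cabs_inner_le _ _).
pose x0 : R[i] := (- kappa ^+ 2)%:C.
have nx0 : ~ nonneg_axis x0 by move=> [_] /=; rewrite oppr_ge0 leNgt exprn_gt0.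
have r0 : resolvent_set (brack B) x0.
  exact: (bounded_resolvent_set BS Kc l0_gt0 weyl_le Pl BP beta_ge0 Pb nx0 m_ge0 bm hm).
have r0' : resolvent_set (rel_adj (brack B)) x0.
  rewrite -(brack_adj BS Kc l0_gt0 c0_gt0 weyl_le weyl_im Bl).
  exact: (bounded_resolvent_set BS Kc l0_gt0 weyl_le Ql BQ beta_ge0 Qb nx0 m_ge0 bm hm).
have Al' : linear_rel (rel_adj (brack B)).
  rewrite -(brack_adj BS Kc l0_gt0 c0_gt0 weyl_le weyl_im Bl); apply: (brack_linear BS).
  split; first by apply/BQ; rewrite hlinear0.
  by move=> c [u v] [u' v'] /BQ -> /BQ ->; apply/BQ; rewrite Ql.
have [F [p1 [Fl AF Fb]]] := resolvent_function Al r0.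
have [G [p2 [Gl AG Gb]]] := resolvent_function Al' r0'.
have xC : Num.conj x0 = x0 by apply: complex_ext; rewrite ?ReC ?ImC//= oppr0.
have FG h v : '[F h, v] = '[h, G v].
  have := AG v _ _ (AF h); rewrite /= innerDl innerDr innerZl innerZr xC.
  by move=> /addIr.
(* [S] is (A - z)(A - x0)^-1 and [T] its adjoint. From |G v| <= |T v| / delta one gets |v| <= (1 +
   |x0 - z| / delta) |T v|, so [S] is onto, and hence so is A - z. *)
pose S h := h + (x0 - z) *: F h; pose T v := v + (x0 - z)^* *: G v.
have FS h : h + x0 *: F h - z *: F h = S h by rewrite /S scalerBl addrA.
have GT v : v + x0 *: G v - z^* *: G v = T v by rewrite /T rmorphB/= xC scalerBl addrA.
have linS (F' : H -> H) c : hlinear F' -> hlinear (fun h => h + c *: F' h).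
  by move=> h a u v; rewrite h !scalerDr !scalerA [c * a]mulrC addrACA.
pose q := 1 + cabs (x0 - z) * (`|p1| + `|p2|).
have bS (F' : H -> H) p c : cabs c = cabs (x0 - z) -> `|p| <= `|p1| + `|p2| ->
    (forall h, hnorm (F' h) <= p * hnorm h) -> forall h, hnorm (h + c *: F' h) <= q * hnorm h.
  move=> cE pp hp h; rewrite (le_trans (ler_hnormD _ _))// hnormZ mulrDl mul1r lerD2l cE.
  rewrite -mulrA ler_wpM2l ?cabs_ge0// (le_trans (hp h))// ler_wpM2r ?hnorm_ge0//.
  by rewrite (le_trans (ler_norm _)).
have Glow v : delta * hnorm (G v) <= hnorm (T v).
  apply: low; have := dadj _ _ (AG v).
  rewrite -GT; suff -> : '[v + x0 *: G v - z^* *: G v, G v] =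
    ('[G v, v + x0 *: G v] - z * '[G v, G v])^* by rewrite cabsC.
  by rewrite rmorphB rmorphM/= -!inner_conj innerBl innerZl.
have Tc0 : 0 < 1 + cabs (x0 - z) / delta by rewrite ltr_pwDl// divr_ge0 ?cabs_ge0// ltW.
have Ss := @adjoint_pair_surjective _ _ Hc S T (1 + cabs (x0 - z) / delta)^-1 q.
have {}Ss : forall v, exists u, S u = v.
  apply: Ss.
  - exact: linS.
  - exact: linS.
  - by move=> u v; rewrite /S /T innerDl innerDr innerZl innerZr conjCK FG.
  - by apply: (bS _ p1) => //; rewrite lerDl.
  - by apply: (bS _ p2); rewrite ?cabsC// lerDr.
  - by rewrite invr_gt0.
  move=> v; rewrite ler_pdivrMl// mulrDl mul1r.
  have vE : v = T v - (x0 - z)^* *: G v by rewrite addrK.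
  rewrite {1}vE (le_trans (ler_hnormB _ _))// lerD2l hnormZ cabsC.
  by rewrite -mulrA ler_wpM2l ?cabs_ge0// ler_pdivlMl.
apply: (@resolvent_setP _ _ _ _ delta^-1) => //.
  move=> h; have [w Sw] := Ss h; exists (F w).
  by rewrite -Sw -FS subrK.
move=> h f Af; rewrite ler_pdivlMl//; apply: low.
have := dnorm _ _ Af.
by rewrite innerDl innerZl addrK.
Qed.

End spectrum_closure.

(** If [l] were in the resolvent set of A_0, the resolvents at nearby l' would be uniformly bounded,
    and gamma(l') e = gamma(mu) e + (l' - mu)(A_0 - l')^-1 gamma(mu) e would stay bounded, against
    the assumed blow-up. *)
Lemma free_spectrum {R : realType} {H K : preHilbertType R} {D : H -> H -> K -> K -> Prop}
    (BS : boundary_system D) (A0 : set (H * H)) (e : K) (l : R[i]) :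
  (forall l', ~ nonneg_axis l' -> forall h, exists f z,
     D f (h + l' *: f) z 0 /\ A0 (f, h + l' *: f)) ->
  (forall T delta : R, 0 < delta -> exists l', [/\ ~ nonneg_axis l',
     cabs (l' - l) < delta & forall u z, D u (l' *: u) z e -> T <= hnorm u]) ->
  ~ resolvent_set A0 l.
Proof.
move=> A0s blow [_ _ [k hk]].
pose delta := (2 * (`|k| + 1))^-1.
have k1 : 0 < `|k| + 1 by rewrite ltr_wpDl.
have d0 : 0 < delta by rewrite invr_gt0 mulr_gt0.
have kd : `|k| * delta <= 2^-1.
  by rewrite /delta invfM mulrCA ger_pMr// ler_pdivrMr// mul1r lerDl.
have bd l' f h : cabs (l' - l) < delta -> A0 (f, h + l' *: f) ->
    hnorm f <= 2 * `|k| * hnorm h.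
  move=> ll' Af; have : resolvent A0 l (h + (l' - l) *: f, f).
    by apply/resolventE; rewrite scalerBl -addrA subrK.
  move=> /hk h1.
  have h2 : hnorm f <= `|k| * (hnorm h + delta * hnorm f).
    rewrite (le_trans h1)// (le_trans (ler_wpM2r (hnorm_ge0 _) (ler_norm k)))//.
    rewrite ler_wpM2l// (le_trans (ler_hnormD _ _))// lerD2l hnormZ.
    by rewrite ler_wpM2r ?hnorm_ge0// ltW.
  have := ler_wpM2r (hnorm_ge0 f) kd; lra.
have [mu [nmu mul _]] := blow 0 _ d0.
have [v [zv Dv]] := gamma_solve BS e nmu.
have [l' [nl' l'l h]] := blow (1 + (1 + 2 * `|k| * (2 * delta)) * hnorm v) _ d0.
have [u [zu Du]] := gamma_solve BS e nl'.
have Dd := bs_sub BS Du Dv; rewrite subrr in Dd.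
rewrite (_ : l' *: u - mu *: v = (l' - mu) *: v + l' *: (u - v)) in Dd; last first.
  by rewrite scalerBr scalerBl [RHS]addrC addrA subrK.
have [f [zf [Df Af]]] := A0s _ nl' ((l' - mu) *: v).
have [uvf _] := solve_uniq BS nl' Dd Df; rewrite -uvf in Af.
have := bd _ _ _ l'l Af; rewrite hnormZ.
have := h _ _ Du; have := lerB_hnorm u v.
have lm : cabs (l' - mu) <= 2 * delta.
  rewrite (_ : l' - mu = (l' - l) - (mu - l)); last by ring.
  by rewrite (le_trans (cabsD _ _))// cabsN; lra.
have := ler_wpM2r (hnorm_ge0 v) lm => h2.
have := @ler_wpM2l _ (2 * `|k|) _ _ _ h2; rewrite mulr_ge0// => /(_ isT).
lra.
Qed.

(** * Sequences, series and completeness *)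

Section scalar_functions.
Context {R : realType}.
Implicit Types (x y : R) (z : R[i]).

Lemma cothE x : 0 < x -> coth x = (1 + expR (- (2 * x))) / (1 - expR (- (2 * x))).
Proof.
move=> x0; have e0 := expR_gt0 x.
have e1 : expR (- (2 * x)) < 1 by rewrite expR_lt1; lra.
have -> : expR (- (2 * x)) = expR (- x) * expR (- x) by rewrite -expRD; congr expR; ring.
have ex : expR x * expR (- x) = 1 by rewrite -expRD subrr expR0.
have em : expR (- x) = (expR x)^-1 by rewrite expRN.
have lt1 : 1 < expR x by rewrite expR_gt1.
have d1 : expR x - (expR x)^-1 != 0.
  by rewrite gt_eqF// subr_gt0 (lt_trans _ lt1)// invf_lt1.
have d2 : 1 - (expR x)^-1 * (expR x)^-1 != 0.
  by rewrite gt_eqF// subr_gt0 -invfM invf_lt1 ?mulr_gt0// -[ltLHS]mulr1 ltr_pM.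
rewrite /coth em; apply/eqP; rewrite eqr_div//; apply/eqP.
field; rewrite gt_eqF//.
Qed.

Lemma coth_gt0 x : 0 < x -> 0 < coth x.
Proof.
move=> x0; rewrite cothE//; apply: divr_gt0.
  by rewrite addr_gt0// expR_gt0.
by rewrite subr_gt0 expR_lt1; lra.
Qed.

Lemma ler_coth x y : 0 < x -> x <= y -> coth y <= coth x.
Proof.
move=> x0 xy; have y0 : 0 < y by lra.
rewrite !cothE//.
have : expR (- (2 * y)) <= expR (- (2 * x)) by rewrite ler_expR; lra.
have : expR (- (2 * x)) < 1 by rewrite expR_lt1; lra.
move: (expR (- (2 * x))) (expR (- (2 * y))) => p q p1 qp.
rewrite ler_pdivrMr; last by lra.
by rewrite mulrAC ler_pdivlMr; lra.
Qed.

Lemma cexpD z w : cexp (z + w) = cexp z * cexp w.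
Proof.
apply: complex_ext; rewrite ?ReM ?ImM /cexp/= !ReD !ImD expRD ?cosD ?sinD; ring.
Qed.

Lemma cexp0 : cexp (0 : R[i]) = 1.
Proof. by apply: complex_ext; rewrite /cexp/= expR0 ?cos0 ?sin0 ?mulr1 ?mulr0. Qed.

Lemma cabs_cexp z : cabs (cexp z) = expR (Re z).
Proof.
rewrite /cabs /sqn/= !exprMn -mulrDr cos2Dsin2 mulr1 sqrtr_sqr.
by rewrite ger0_norm// expR_ge0.
Qed.

(** |w0| sin nu bounds from below the distance of the shifted cone from 0, and since [w0 < 0] shifts
    to the left, its points still have argument at distance at least [nu] from the positive axis.
    Everything is expressed by cosines, so arguments beyond [pi] need only a reflection. *)
Lemma cone_bounds (w0 nu : R) z : w0 < 0 -> 0 < nu < pi -> cone_region w0 nu z ->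
  `|w0| * sin nu <= cabs z /\ Re z <= cabs z * cos nu.
Proof.
move=> w00 /andP[nu0 nupi].
have s0 : 0 < sin nu by rewrite sin_gt0_pi// nu0.
have c2s2 := cos2Dsin2 nu.
have c1 : -1 <= cos nu <= 1 by rewrite cos_geN1 cos_le1.
have s1 := sin_le1 nu.
have {}s1 : sin nu <= 1 by [].
suff key (p q : R) : p <= Num.sqrt (p ^+ 2 + q ^+ 2) * cos nu ->
    z = (w0 + p) +i* q -> `|w0| * sin nu <= cabs z /\ Re z <= cabs z * cos nu.
  case=> [zE|[_ [t [[/andP[t0 t2] zE] /andP[nut tnu]]]]].
    by apply: (key 0 0); [rewrite expr0n/= addr0 sqrtr0 mul0r|rewrite zE addr0].
  apply: (key (Re (z - w0%:C)) (Im (z - w0%:C))).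
    rewrite -[Num.sqrt _]/(cabs (z - w0%:C)).
    have -> : Re (z - w0%:C) = cabs (z - w0%:C) * cos t.
      by rewrite {1}zE ReM /cexp/= expR0 mul1r mul0r subr0.
    rewrite ler_wpM2l ?cabs_ge0//.
    have [tpi|pit] := leP t pi.
      by rewrite leNgt ltr_cos ?in_itv/= -?leNgt//; apply/andP; split; lra.
    have -> : cos t = cos (2 * pi - t).
      by rewrite mulr_natl addrC cosD2pi cosN.
    by rewrite leNgt ltr_cos ?in_itv/= -?leNgt; [lra|apply/andP; split; lra|apply/andP; split; lra].
  by apply: complex_ext; rewrite ?ReB ?ImB/=; ring.
move=> hp zE; have w0E : `|w0| = - w0 by rewrite ltr0_norm.
have r0 := sqrtr_ge0 (p ^+ 2 + q ^+ 2).
have rE : Num.sqrt (p ^+ 2 + q ^+ 2) ^+ 2 = p ^+ 2 + q ^+ 2.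
  by rewrite sqr_sqrtr// addr_ge0 ?sqr_ge0.
have zr : cabs z ^+ 2 = (p + w0) ^+ 2 + q ^+ 2 by rewrite cabs_sqr /sqn zE/= addrC [w0 + p]addrC addrC.
have z0 := cabs_ge0 z.
move: (Num.sqrt _) r0 rE hp => r r0 rE hp; rewrite w0E.
split.
  rewrite -(ler_pXn2r (n := 2))// ?nnegrE ?mulr_ge0 ?(ltW s0)//; last by lra.
  rewrite zr exprMn.
  have -> : (p + w0) ^+ 2 + q ^+ 2 = r ^+ 2 + 2 * (p * w0) + w0 ^+ 2 by rewrite rE; ring.
  (* Multiplication by [w0 < 0] reverses the order; then |z|^2 >= (r + w0 cos nu)^2 + (w0 sin
     nu)^2. *)
  have h1 : r * cos nu * w0 <= p * w0 by rewrite ler_nM2r.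
  have := sqr_ge0 (r + cos nu * w0); nra.
have rz : `|r - cabs z| <= - w0.
  have h : (r - cabs z) * (r + cabs z) = - (w0 * (2 * p + w0)).
    by rewrite -subr_sqr zr rE; ring.
  have pr : `|p| <= r.
    by rewrite -(ler_pXn2r (n := 2))// ?nnegrE// rE real_normK ?num_real// lerDl sqr_ge0.
  have pr' : `|p + w0| <= cabs z.
    by rewrite -(ler_pXn2r (n := 2))// ?nnegrE// zr real_normK ?num_real// lerDl sqr_ge0.
  have [rz0|rz0] := eqVneq (r + cabs z) 0.
    have -> : r = 0 by lra.
    by have -> : cabs z = 0; [lra|rewrite subrr normr0; lra].
  have rz1 : 0 < r + cabs z by rewrite lt_neqAle eq_sym rz0 addr_ge0.
  have e : `|r - cabs z| * (r + cabs z) = - w0 * `|2 * p + w0|.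
    by rewrite -[X in _ * X = _](ger0_norm (ltW rz1)) -normrM h normrN normrM w0E.
  rewrite -(ler_pM2r rz1) e ler_pM2l ?oppr_gt0//.
  rewrite (_ : 2 * p + w0 = p + (p + w0)); last by ring.
  by rewrite (le_trans (ler_normD _ _))// lerD.
have -> : Re z = p + w0 by rewrite zE/= addrC.
move: rz; rewrite ler_norml => /andP[h1 h2].
move: c1 => /andP[c1 c1'].
have : (r - cabs z) * cos nu <= - w0.
  have [c0|c0] := leP 0 (cos nu).
    by rewrite (le_trans (ler_wpM2r c0 h2))// ler_piMr//; lra.
  have h3 : 0 <= - cos nu by lra.
  have h4 : cabs z - r <= - w0 by lra.
  have := ler_wpM2l h3 h4; have : 0 <= - w0 * (1 + cos nu) by rewrite mulr_ge0//; lra.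
  lra.
lra.
Qed.

End scalar_functions.

Section real_sequences.
Context {R : realType}.

Lemma real_cauchy_cvg (u : R^nat) : (forall e, 0 < e -> exists N, forall n, (N <= n)%N ->
  `|u N - u n| < e) -> cvgn u.
Proof.
move=> h; apply/cauchy_cvgP; apply: cauchy_exP => e e0.
by have [N hN] := h e e0; exists (u N); exists N => // n /= Nn; exact: hN.
Qed.

Lemma cvgn_eps (u : R^nat) l : u @ \oo --> l ->
  forall e, 0 < e -> exists N, forall n, (N <= n)%N -> `|l - u n| < e.
Proof. by move=> /cvgrPdist_lt h e /h[N _ hN]; exists N => n; exact: hN. Qed.

Lemma eps_cvgn (u : R^nat) l : (forall e, 0 < e -> exists N, forall n, (N <= n)%N ->
  `|l - u n| < e) -> u @ \oo --> l.
Proof. by move=> h; apply/cvgrPdist_lt => e /h[N hN]; exists N. Qed.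

Lemma cvgn_le_eventually (u : R^nat) l c N : u @ \oo --> l ->
  (forall n, (N <= n)%N -> u n <= c) -> l <= c.
Proof.
move=> ul uc; rewrite -(cvg_lim (@Rhausdorff R) ul).
by apply: limr_le; [apply/cvg_ex; exists l|exists N].
Qed.

End real_sequences.

Section integer_series.
Context {R : realType}.
Implicit Types (a b : int -> R).

Lemma zseriesS a N : zseries a N.+1 = zseries a N + (a (Posz N) + a (Negz N)).
Proof. by rewrite /zseries /series/= big_nat_recr. Qed.

Lemma zseries0 a : zseries a 0 = 0.
Proof. by rewrite /zseries /series/= big_geq. Qed.

Lemma ler_zseries a b N : (forall n, a n <= b n) -> zseries a N <= zseries b N.
Proof.
move=> ab; elim: N => [|N ih]; first by rewrite !zseries0.
by rewrite !zseriesS !lerD.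
Qed.

Lemma zseries_ge0 a N : (forall n, 0 <= a n) -> 0 <= zseries a N.
Proof.
move=> a0; elim: N => [|N ih]; first by rewrite zseries0.
by rewrite zseriesS !addr_ge0.
Qed.

Lemma zseries_homo a : (forall n, 0 <= a n) -> {homo zseries a : m n / (m <= n)%N >-> m <= n}.
Proof.
move=> a0; apply: nondecreasing_series => k _; rewrite addr_ge0//.
Qed.

Lemma zseries_le_zsum a N : (forall n, 0 <= a n) -> zsummable a -> zseries a N <= zsum a.
Proof. by move=> a0 ca; exact: nondecreasing_cvgn_le (zseries_homo a0) ca N. Qed.

Lemma zsummable_bound a C : (forall n, 0 <= a n) -> (forall N, zseries a N <= C) ->
  zsummable a.
Proof.
move=> a0 aC; apply: nondecreasing_is_cvgn; first exact: zseries_homo.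
by exists C => _ [N _ <-].
Qed.

Lemma zsum_le a C : zsummable a -> (forall N, zseries a N <= C) -> zsum a <= C.
Proof. by move=> ca aC; apply: limr_le => //; exact: nearW. Qed.

Lemma ler_zsum a b : (forall n, 0 <= a n) -> (forall n, a n <= b n) -> zsummable b ->
  zsummable a /\ zsum a <= zsum b.
Proof.
move=> a0 ab cb; have b0 n : 0 <= b n by apply: le_trans (ab n).
have h N : zseries a N <= zsum b.
  by rewrite (le_trans (ler_zseries N ab))// zseries_le_zsum.
have ca := zsummable_bound a0 h.
by split => //; exact: zsum_le.
Qed.

Lemma term_le_zsum a n : (forall n, 0 <= a n) -> zsummable a -> a n <= zsum a.
Proof.
move=> a0 ca; case: n => k; apply: le_trans (zseries_le_zsum k.+1 a0 ca);
  rewrite zseriesS; have := zseries_ge0 k a0; have := a0 (Posz k); have := a0 (Negz k); lra.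
Qed.

Lemma zsummable_cvg0 a : (forall n, 0 <= a n) -> zsummable a ->
  (fun k => a (Posz k)) @ \oo --> 0 /\ (fun k => a (Negz k)) @ \oo --> 0.
Proof.
move=> a0 /cvg_series_cvg_0 h.
by split; apply: (squeeze_cvgr (f := cst 0) _ _ h);
  [apply: nearW => k; rewrite /= a0 ?lerDl ?lerDr a0|exact: cvg_cst|
   apply: nearW => k; rewrite /= a0 ?lerDl ?lerDr a0|exact: cvg_cst].
Qed.

(** The partial sums run over [-N, N - 1], so the end indices are [N] and [- N]; the same window is
    used for the nodes. *)
Lemma zseries_telescope b N :
  zseries (fun n => b (n + 1) - b n) N = b (Posz N) - b (- Posz N).
Proof.
elim: N => [|N ih]; first by rewrite zseries0 oppr0 subrr.
rewrite zseriesS ih -[in RHS]addn1 PoszD !NegzE.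
have -> : - Posz N.+1 + 1 = - Posz N by rewrite -addn1 PoszD opprD addrNK.
by rewrite -addn1 PoszD; ring.
Qed.

Lemma zseriesD a b N : zseries (fun n => a n + b n) N = zseries a N + zseries b N.
Proof.
elim: N => [|N ih]; first by rewrite !zseries0 addr0.
by rewrite !zseriesS ih; ring.
Qed.

Lemma zseriesZ c a N : zseries (fun n => c * a n) N = c * zseries a N.
Proof.
elim: N => [|N ih]; first by rewrite !zseries0 mulr0.
by rewrite !zseriesS ih; ring.
Qed.

Lemma zseries_shift_pred a N :
  zseries (fun n => a (n - 1)) N = zseries a N - a (Posz N - 1) + a (Negz N).
Proof.
have := zseries_telescope (fun n => a (n - 1)) N.
rewrite (_ : (fun n => _ - _) = fun n => a n + -1 * a (n - 1)); last first.
  by apply/funext => n; rewrite addrK mulN1r.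
rewrite zseriesD zseriesZ NegzE -addn1 PoszD opprD; lra.
Qed.

Lemma zseries_shift_succ a N :
  zseries (fun n => a (n + 1)) N = zseries a N + a (Posz N) - a (- Posz N).
Proof.
have := zseries_telescope a N.
rewrite (_ : (fun n => _ - _) = fun n => a (n + 1) + -1 * a n); last first.
  by apply/funext => n; rewrite mulN1r.
rewrite zseriesD zseriesZ; lra.
Qed.

Lemma zsum_shift_pred a : (forall n, 0 <= a n) -> zsummable a ->
  zsummable (fun n => a (n - 1)) /\ zsum (fun n => a (n - 1)) <= zsum a.
Proof.
move=> a0 ca.
have h N : zseries (fun n => a (n - 1)) N <= zsum a.
  rewrite zseries_shift_pred (le_trans _ (zseries_le_zsum N.+1 a0 ca))// zseriesS.
  by have := a0 (Posz N - 1); have := a0 (Posz N); lra.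
have cs := zsummable_bound (fun n => a0 (n - 1)) h.
by split => //; exact: zsum_le.
Qed.

Lemma zsum_shift_succ a : (forall n, 0 <= a n) -> zsummable a ->
  zsummable (fun n => a (n + 1)) /\ zsum (fun n => a (n + 1)) <= zsum a.
Proof.
move=> a0 ca.
have h N : zseries (fun n => a (n + 1)) N <= zsum a.
  rewrite zseries_shift_succ (le_trans _ (zseries_le_zsum N.+1 a0 ca))// zseriesS.
  by have := a0 (- Posz N); have := a0 (Negz N); lra.
have cs := zsummable_bound (fun n => a0 (n + 1)) h.
by split => //; exact: zsum_le.
Qed.

Lemma zseries_cvg (a_ : nat -> int -> R) a N : (forall n, a_^~ n @ \oo --> a n) ->
  (fun j => zseries (a_ j) N) @ \oo --> zseries a N.
Proof.
move=> h; elim: N => [|N ih].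
  by under eq_fun do rewrite zseries0; rewrite zseries0; exact: cvg_cst.
under eq_fun do rewrite zseriesS; rewrite zseriesS.
by apply: cvgD => //; apply: cvgD.
Qed.

End integer_series.

Section l2_space.
Context {R : realType}.
Implicit Types (u v : l2 R).

Lemma l2_ext u v : (forall n, u n = v n) -> u = v.
Proof. by move=> h; apply/val_inj/funext. Qed.

Lemma l2_mk (f : int -> R[i]) : zsummable (fun n => sqn (f n)) ->
  exists u : l2 R, forall n, u n = f n.
Proof.
move=> h; have fP : f \in l2_pred (R := R) by rewrite inE.
by exists (exist _ f fP).
Qed.

Lemma l2D u v n : l2_fun (u + v) n = u n + v n. Proof. by []. Qed.
Lemma l2N u n : l2_fun (- u) n = - u n. Proof. by []. Qed.
Lemma l2Z c u n : l2_fun (c *: u) n = c * u n. Proof. by []. Qed.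
Lemma l20 n : l2_fun (0 : l2 R) n = 0. Proof. by []. Qed.

Lemma l2_hnorm_sqr u : hnorm u ^+ 2 = zsum (fun n => sqn (u n)).
Proof. by rewrite hnorm_sqr -[X in Re X]/(l2_inner u u) l2_inner_self. Qed.

Lemma l2_coord_le u n : cabs (u n) <= hnorm u.
Proof.
rewrite -(ler_pXn2r (n := 2))// ?nnegrE ?cabs_ge0 ?hnorm_ge0//.
rewrite cabs_sqr l2_hnorm_sqr.
apply: (term_le_zsum (a := fun n => sqn (u n))) => [m|]; [exact: sqn_ge0|exact: l2P].
Qed.

Lemma l2_hnorm_le u (C : R) : 0 <= C ->
  (forall N, zseries (fun n => sqn (u n)) N <= C ^+ 2) -> hnorm u <= C.
Proof.
move=> C0 h; rewrite -(ler_pXn2r (n := 2))// ?nnegrE ?hnorm_ge0//.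
by rewrite l2_hnorm_sqr; apply: zsum_le => //; exact: l2P.
Qed.

Lemma l2_partial_le u N : zseries (fun n => sqn (u n)) N <= hnorm u ^+ 2.
Proof.
by rewrite l2_hnorm_sqr; apply: zseries_le_zsum => [n|]; [exact: sqn_ge0|exact: l2P].
Qed.

Lemma sqn_cvg (f : nat -> R[i]) (z w : R[i]) : (fun j => Re (f j)) @ \oo --> Re z ->
  (fun j => Im (f j)) @ \oo --> Im z ->
  (fun j => sqn (w - f j)) @ \oo --> sqn (w - z).
Proof.
move=> h1 h2; rewrite /sqn; under eq_fun do rewrite ReB ImB.
rewrite ReB ImB; apply: cvgD.
  by rewrite expr2; apply: cvgM; apply: cvgB => //; exact: cvg_cst.
by rewrite expr2; apply: cvgM; apply: cvgB => //; exact: cvg_cst.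
Qed.

(** Coordinatewise limits; every bound is passed to the limit in a fixed finite partial sum before
    the number of terms grows. *)
Lemma l2_complete : hcomplete (l2 R).
Proof.
move=> u_ cu.
have coord (p : R[i] -> R) : (forall z w, p (z - w) = p z - p w) ->
    (forall z, `|p z| <= cabs z) -> forall n, cvgn (fun j => p (l2_fun (u_ j) n)).
  move=> pB pb n; apply: real_cauchy_cvg => e /cu[N hN]; exists N => j Nj.
  rewrite -pB (le_lt_trans (pb _))//.
  exact: le_lt_trans (l2_coord_le (u_ N - u_ j) n) (hN _ _ (leqnn _) Nj).
have cRe := coord _ ReB (@Re_le_cabs R); have cIm := coord _ ImB (@Im_le_cabs R).
pose L n : R[i] := limn (fun j => Re (l2_fun (u_ j) n)) +i* limn (fun j => Im (l2_fun (u_ j) n)).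
have Lc n w : (fun j => sqn (w - l2_fun (u_ j) n)) @ \oo --> sqn (w - L n).
  by apply: sqn_cvg; [exact: cRe|exact: cIm].
have sumc w K : (fun j => zseries (fun n => sqn (w n - l2_fun (u_ j) n)) K) @ \oo -->
    zseries (fun n => sqn (w n - L n)) K.
  exact: (@zseries_cvg _ (fun j n => sqn (w n - l2_fun (u_ j) n))).
have [u uE] : exists u : l2 R, forall n, u n = L n.
  apply: l2_mk; have [N hN] := cu 1 ltr01.
  apply: (@zsummable_bound _ _ ((hnorm (u_ N) + 1) ^+ 2)) => [n|K]; first exact: sqn_ge0.
  have := sumc (fun=> 0) K.
  rewrite (_ : (fun n => sqn (0 - L n)) = fun n => sqn (L n)); last first.
    by apply/funext => n; rewrite sub0r /sqn ReN ImN !sqrrN.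
  move=> /cvgn_le_eventually h; apply: (h _ N) => j Nj.
  rewrite (_ : (fun n => sqn (0 - _)) = fun n => sqn (l2_fun (u_ j) n)); last first.
    by apply/funext => n; rewrite sub0r /sqn ReN ImN !sqrrN.
  rewrite (le_trans (l2_partial_le _ _))//.
  rewrite ler_pXn2r ?nnegrE ?addr_ge0 ?hnorm_ge0//.
  have := lerB_hnorm (u_ j) (u_ N); have := hN _ _ Nj (leqnn N); lra.
exists u; apply/hcvgP => e e0; have e2 : 0 < e / 2 by lra.
have [N hN] := cu _ e2; exists N => m Nm.
apply: (@le_lt_trans _ _ (e / 2)); last by lra.
rewrite hnormBC; apply: l2_hnorm_le => [|K]; first exact: ltW.
have := sumc (l2_fun (u_ m)) K.
rewrite (_ : (fun n => sqn (_ - L n)) = fun n => sqn (l2_fun (u - u_ m) n)); last first.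
  by apply/funext => n; rewrite l2D l2N uE -opprB /sqn ReN ImN !sqrrN.
move=> /cvgn_le_eventually h; apply: (h _ N) => j Nj.
rewrite (le_trans (l2_partial_le (u_ m - u_ j) K))//.
by rewrite ler_pXn2r ?nnegrE ?hnorm_ge0 ?(ltW e2)// ltW// hN.
Qed.

Lemma sqn_le_cabs (z w : R[i]) (q : R) : 0 <= q -> cabs z <= q -> sqn (z * w) <= q ^+ 2 * sqn w.
Proof.
move=> q0 zq; rewrite sqnM ler_wpM2r ?sqn_ge0// -cabs_sqr.
by rewrite ler_pXn2r ?nnegrE ?cabs_ge0.
Qed.

Lemma weighted_shift_pred (w : int -> R[i]) (q : R) : 0 <= q -> (forall n, cabs (w n) <= q) ->
  exists Z : l2 R -> l2 R, [/\ hlinear Z, forall u n, Z u n = w n * u (n - 1) &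
    forall u, hnorm (Z u) <= q * hnorm u].
Proof.
move=> q0 wq.
have sum u : zsummable (fun n => sqn (w n * u (n - 1))) /\
    zsum (fun n => sqn (w n * u (n - 1))) <= q ^+ 2 * hnorm u ^+ 2.
  have [s1 s2] := zsum_shift_pred (a := fun n => sqn (u n)) (fun n => sqn_ge0 _) (@l2P R u).
  have [s3 s4] := zsum_lin (q ^+ 2) 0 s1 s1.
  have [||s5 s6] := ler_zsum (a := fun n => sqn (w n * u (n - 1))) _ _ s3.
  - by move=> n; exact: sqn_ge0.
  - by move=> n; rewrite mul0r addr0; exact: sqn_le_cabs.
  split => //; rewrite (le_trans s6)// s4 mul0r addr0 ler_wpM2l ?sqr_ge0//.
  by rewrite l2_hnorm_sqr.
have /choice[Z hZ] : forall u, exists v : l2 R, forall n, v n = w n * u (n - 1).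
  by move=> u; apply: l2_mk; have [] := sum u.
exists Z; split => // [c u v|u].
  by apply: l2_ext => n; rewrite l2D l2Z !hZ l2D l2Z mulrDr mulrCA.
rewrite -(ler_pXn2r (n := 2))// ?nnegrE ?mulr_ge0 ?hnorm_ge0//.
rewrite l2_hnorm_sqr exprMn; under eq_fun do rewrite hZ.
by have [] := sum u.
Qed.

Lemma weighted_shift_succ (w : int -> R[i]) (q : R) : 0 <= q -> (forall n, cabs (w n) <= q) ->
  exists Z : l2 R -> l2 R, [/\ hlinear Z, forall u n, Z u n = w n * u (n + 1) &
    forall u, hnorm (Z u) <= q * hnorm u].
Proof.
move=> q0 wq.
have sum u : zsummable (fun n => sqn (w n * u (n + 1))) /\
    zsum (fun n => sqn (w n * u (n + 1))) <= q ^+ 2 * hnorm u ^+ 2.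
  have [s1 s2] := zsum_shift_succ (a := fun n => sqn (u n)) (fun n => sqn_ge0 _) (@l2P R u).
  have [s3 s4] := zsum_lin (q ^+ 2) 0 s1 s1.
  have [||s5 s6] := ler_zsum (a := fun n => sqn (w n * u (n + 1))) _ _ s3.
  - by move=> n; exact: sqn_ge0.
  - by move=> n; rewrite mul0r addr0; exact: sqn_le_cabs.
  split => //; rewrite (le_trans s6)// s4 mul0r addr0 ler_wpM2l ?sqr_ge0//.
  by rewrite l2_hnorm_sqr.
have /choice[Z hZ] : forall u, exists v : l2 R, forall n, v n = w n * u (n + 1).
  by move=> u; apply: l2_mk; have [] := sum u.
exists Z; split => // [c u v|u].
  by apply: l2_ext => n; rewrite l2D l2Z !hZ l2D l2Z mulrDr mulrCA.
rewrite -(ler_pXn2r (n := 2))// ?nnegrE ?mulr_ge0 ?hnorm_ge0//.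
rewrite l2_hnorm_sqr exprMn; under eq_fun do rewrite hZ.
by have [] := sum u.
Qed.

Lemma neumann_solve (Z : l2 R -> l2 R) (q : R) : 0 <= q < 1 -> hlinear Z ->
  (forall u, hnorm (Z u) <= q * hnorm u) -> forall a, exists u, u = Z u + a.
Proof.
move=> q01 Zl Zb a.
have [u v|u hu] := contraction_fixpoint l2_complete (F := fun u => Z u + a) q01.
  by rewrite opprD addrACA subrr addr0 -(hlinearB Zl).
by exists u.
Qed.

End l2_space.

(** * Completeness of [L2] *)

Section L2_space.
Context {d : measure_display} {T : measurableType d} {R : realType}
  {mu : {measure set T -> \bar R}}.
Implicit Types (u v w : L2 mu) (f : T -> R[i]).

Lemma L2_mk f : L2on mu setT f -> exists u : L2 mu, {ae mu, forall x, u x = f x}.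
Proof.
move=> h; have fP : f \in L2_pred mu by rewrite inE.
by eexists; exact: (@L2_reprE _ _ _ mu (exist _ f fP)).
Qed.

Lemma L2_ext u v : {ae mu, forall x, u x = v x} -> u = v.
Proof. exact: L2_ae_inj. Qed.

Lemma L2BE u v : {ae mu, forall x, L2_fun (u - v) x = u x - v x}.
Proof.
have := L2_linE (-1) v u; rewrite scaleN1r addrC.
by apply: filterS => x ->; rewrite mulN1r addrC.
Qed.

Lemma L20E : {ae mu, forall x, L2_fun (0 : L2 mu) x = 0}.
Proof. by have := L2BE 0 0; rewrite subrr; apply: filterS => x ->; rewrite subrr. Qed.

Lemma L2on_sqn_measurable D f : cmeasurable D f -> measurable_fun D (fun x => sqn (f x)).
Proof. by move=> [f1 f2]; apply: measurable_funD; exact: measurable_funX. Qed.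

Lemma cmeasurableB D f (g : T -> R[i]) : cmeasurable D f -> cmeasurable D g ->
  cmeasurable D (fun x => f x - g x).
Proof.
move=> [f1 f2] [g1 g2]; split.
  by under eq_fun do rewrite ReB; exact: measurable_funB.
by under eq_fun do rewrite ImB; exact: measurable_funB.
Qed.

Lemma L2_sqnE u : (\int[mu]_x (sqn (u x))%:E = (hnorm u ^+ 2)%:E)%E.
Proof.
rewrite hnorm_sqr -[X in Re X]/(L2_inner u u) L2_inner_self/= /Rintegral fineK//.
exact: integrable_fin_num (sqn_integrable (L2P u)).
Qed.

Lemma L2_sqn_sub u v : (\int[mu]_x (sqn (u x - v x))%:E = (hnorm (u - v) ^+ 2)%:E)%E.
Proof.
have [mu_ _] := L2P u; have [mv _] := L2P v; have [muv _] := L2P (u - v).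
rewrite -L2_sqnE; apply: ae_eq_integral => //.
- by apply/measurable_EFinP; apply: L2on_sqn_measurable; exact: cmeasurableB.
- by apply/measurable_EFinP; exact: L2on_sqn_measurable.
- by apply: filterS (L2BE u v) => x -> _.
Qed.

Lemma nneseries_ub (a : nat -> R) : (forall k, 0 <= a k) ->
  (\sum_(k <oo) (a k)%:E < +oo)%E -> exists C, forall k, a k <= C.
Proof.
move=> a0 h; exists (fine (\sum_(k <oo) (a k)%:E)%E) => k.
have s0 : (0 <= \sum_(k <oo) (a k)%:E)%E by apply: nneseries_ge0 => n _ _; rewrite lee_fin.
rewrite -lee_fin fineK ?ge0_fin_numE//.
have := @nneseries_lim_ge R (fun k => (a k)%:E) xpredT 0 k.+1.
move=> /(_ (fun n _ _ => ltac:(by rewrite lee_fin))); apply: le_trans.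
rewrite big_nat_recr//= leeDr// sume_ge0// => i _.
by rewrite lee_fin.
Qed.

Lemma geometric_steps_cvg (a : nat -> R) (C : R) :
  (forall k, `|a k.+1 - a k| <= C * 2^-1 ^+ k) -> cvgn a.
Proof.
move=> h; have C0 : 0 <= C by have := le_trans (normr_ge0 _) (h 0%N); rewrite expr0 mulr1.
have tail n k : `|a (n + k)%N - a n| <= 2 * C * 2^-1 ^+ n.
  elim: k n => [n|k ih n]; first by rewrite addn0 subrr normr0 !mulr_ge0 ?exprn_ge0.
  have := ih n.+1; rewrite addSnnS exprS => h1; have h2 := h n.
  rewrite -(subrK (a n.+1) (a (n + k.+1)%N)) -addrA (le_trans (ler_normD _ _))//.
  lra.
apply: real_cauchy_cvg => e e0.
have : (fun n => 2 * C * 2^-1 ^+ n) @ \oo --> 2 * C * 0.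
  apply: cvgMr; apply: cvg_expr; rewrite ger0_norm ?invr_ge0// invf_lt1//.
  by rewrite ltr1n.
rewrite mulr0 => /cvgn_eps/(_ e e0)[N hN]; exists N => n Nn.
have := hN _ (leqnn N); rewrite sub0r normrN ger0_norm ?mulr_ge0 ?exprn_ge0//.
by apply: le_lt_trans; rewrite distrC -(subnKC Nn).
Qed.

(** Riesz-Fischer: a rapidly Cauchy subsequence converges almost everywhere, and Fatou's lemma
    compares the whole sequence with its limit. *)
Lemma L2_complete : hcomplete (L2 mu).
Proof.
move=> u cu0; have [u_ [cu uE]] : exists u_ : nat -> L2 mu, hcauchy u_ /\ u = u_ by exists u.
rewrite uE {u cu0 uE}.
have p4 k : 0 < 4^-1 ^+ k :> R by rewrite exprn_gt0.
have /choice[M hM] := fun k => cu _ (p4 k).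
pose n_ := fix n_ k := if k is k'.+1 then maxn (n_ k') (maxn (M k'.+1) k'.+1) else M 0%N.
have nM k : (M k <= n_ k)%N by case: k => //= k; rewrite !leq_max leqnn orbT.
have kn k : (k <= n_ k)%N by case: k => //= k; rewrite !leq_max leqnn !orbT.
have nn k : (n_ k <= n_ k.+1)%N by rewrite /= leq_maxl.
pose v k : L2 mu := u_ (n_ k).
have vv k : hnorm (v k.+1 - v k) <= 4^-1 ^+ k.
  by apply/ltW/hM; [exact: leq_trans (nM k) (nn k)|exact: nM].
have mv k : cmeasurable setT (v k) by have [] := L2P (v k).
pose D k x := sqn (v k.+1 x - v k x).
have mD k : measurable_fun setT (D k) by apply: L2on_sqn_measurable; exact: cmeasurableB.
have D0 k x : 0 <= D k x by exact: sqn_ge0.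
have D40 k x : 0 <= 4 ^+ k * D k x by rewrite mulr_ge0.
have mD4 k : measurable_fun setT (fun x => (4 ^+ k * D k x)%:E).
  by apply/measurable_EFinP; apply: measurable_funM.
(* The integral of [D k] is at most 16^-k, so the weighted series has integral at most the sum of
   4^-k. Where it is finite, 4^k D k is bounded, and consecutive terms differ by at most a constant
   times 2^-k. *)
pose S x := (\sum_(k <oo) (4 ^+ k * D k x)%:E)%E.
have mS : measurable_fun setT S.
  apply: (@ge0_emeasurable_sum _ _ _ setT (fun k x => (4 ^+ k * D k x)%:E) xpredT) => //.
  by move=> k x _ _; rewrite lee_fin.
have S0 x : (0 <= S x)%E by apply: nneseries_ge0 => n _ _; rewrite lee_fin.
have intS : (\int[mu]_x S x < +oo)%E.
  rewrite /S integral_nneseries//; last by move=> k x _; rewrite lee_fin.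
  apply: (@le_lt_trans _ _ (\sum_(k <oo) (4^-1 ^+ k)%:E)%E).
    apply: lee_nneseries => [k _ _|k _].
      by apply: integral_ge0 => x _; rewrite lee_fin.
    under eq_integral do rewrite EFinM.
    rewrite ge0_integralZl//; try (by rewrite lee_fin exprn_ge0); try exact/measurable_EFinP; last by move=> x _; rewrite lee_fin.
    rewrite L2_sqn_sub -EFinM lee_fin.
    have -> : 4^-1 ^+ k = 4 ^+ k * (4^-1 ^+ k * 4^-1 ^+ k) :> R.
      by rewrite mulrA -exprMn divff// expr1n mul1r.
    by rewrite ler_wpM2l ?exprn_ge0// expr2 ler_pM ?hnorm_ge0.
  have gc : cvgn (series (geometric (1 : R) 4^-1)).
    by apply: is_cvg_geometric_series; rewrite ger0_norm ?invr_ge0// invf_lt1// ltr1n.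
  rewrite (_ : (fun n => _) = EFin \o series (geometric (1 : R) 4^-1)); last first.
    apply/funext => n; rewrite /= /series/= sumEFin; congr EFin.
    by apply: eq_bigr => i _; rewrite mul1r.
  by rewrite EFin_lim// ltry.
pose E := [set x | (S x < +oo)%E].
have mE : measurable E.
  have := emeasurable_fun_infty_o measurableT mS +oo%E.
  by rewrite setTI.
have aeE : {ae mu, forall x, E x}.
  have : mu.-integrable setT S.
    apply/integrableP; split => //; under eq_integral do rewrite gee0_abs//.
    exact: intS.
  by move=> /(integrable_ae measurableT); apply: filterS => x /(_ I); rewrite ge0_fin_numE.
have steps x : E x -> exists C : R, forall k, cabs (v k.+1 x - v k x) <= C * 2^-1 ^+ k.
  move=> /nneseries_ub[//|C hC]; exists (Num.sqrt C) => k.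
  have C0 : 0 <= C by exact: le_trans (hC 0%N).
  rewrite -(ler_pXn2r (n := 2))// ?nnegrE ?cabs_ge0 ?mulr_ge0 ?sqrtr_ge0 ?exprn_ge0//.
  rewrite cabs_sqr exprMn (sqr_sqrtr C0) -exprM mulnC exprM.
  rewrite (_ : (2^-1 : R) ^+ 2 = 4^-1); last by rewrite exprVn -natrX.
  by rewrite exprVn ler_pdivlMr ?exprn_gt0// mulrC.
(* The indicator of [E] makes the sequence converge at every point, so that the limit is measurable
   without completing the measure. *)
pose w x : R[i] := limn (fun k => Re (v k x) * \1_E x) +i* limn (fun k => Im (v k x) * \1_E x).
have cRe x : (fun k => Re (v k x) * \1_E x) @ \oo --> Re (w x).
  rewrite /w/= indicE; have [/set_mem xE|xE] := boolP (x \in E); last first.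
    by under eq_fun do rewrite mulr0; exact: is_cvg_cst.
  have [C hC] := steps x xE; under eq_fun do rewrite mulr1.
  apply: (@geometric_steps_cvg _ C) => k; rewrite -ReB.
  exact: le_trans (Re_le_cabs _) (hC k).
have cIm x : (fun k => Im (v k x) * \1_E x) @ \oo --> Im (w x).
  rewrite /w/= indicE; have [/set_mem xE|xE] := boolP (x \in E); last first.
    by under eq_fun do rewrite mulr0; exact: is_cvg_cst.
  have [C hC] := steps x xE; under eq_fun do rewrite mulr1.
  apply: (@geometric_steps_cvg _ C) => k; rewrite -ImB.
  exact: le_trans (Im_le_cabs _) (hC k).
have mw : cmeasurable setT w.
  split; apply/measurable_EFinP.
    apply: (emeasurable_fun_cvg (fun k x => (Re (v k x) * \1_E x)%:E)).
      by move=> k; apply/measurable_EFinP; apply: measurable_funM => //; exact: (proj1 (mv k)).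
    by move=> x _; apply/cvg_EFin; [exact: nearW|exact: cRe].
  apply: (emeasurable_fun_cvg (fun k x => (Im (v k x) * \1_E x)%:E)).
    by move=> k; apply/measurable_EFinP; apply: measurable_funM => //; exact: (proj2 (mv k)).
  by move=> x _; apply/cvg_EFin; [exact: nearW|exact: cIm].
have cw x y : E x -> (fun k => sqn (y - v k x)) @ \oo --> sqn (y - w x).
  move=> xE; have xE' : \1_E x = 1 :> R by rewrite indicE mem_set.
  apply: sqn_cvg.
    by have := cRe x; rewrite xE'; under eq_fun do rewrite mulr1.
  by have := cIm x; rewrite xE'; under eq_fun do rewrite mulr1.
have fat m (e : R) N : (forall k, (N <= k)%N -> hnorm (u_ m - v k) <= e) -> 0 <= e ->
    (\int[mu]_x (sqn (u_ m x - w x))%:E <= (e ^+ 2)%:E)%E.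
  move=> he e0; have [mum _] := L2P (u_ m).
  rewrite (_ : integral mu _ _ = \int[mu]_x limn_einf (fun k => (sqn (u_ m x - v (k + N)%N x))%:E))%E; last first.
    apply: ae_eq_integral => //.
    - by apply/measurable_EFinP; apply: L2on_sqn_measurable; exact: cmeasurableB.
    - have mf k : measurable_fun setT (fun x => (sqn (u_ m x - v (k + N)%N x))%:E).
        by apply/measurable_EFinP; apply: L2on_sqn_measurable; exact: cmeasurableB.
      apply: (emeasurable_fun_cvg (fun k x => einfs (fun k => (sqn (u_ m x - v (k + N)%N x))%:E) k)).
        by move=> k; exact: measurable_fun_einfs.
      by move=> x _; rewrite limn_einf_lim; exact: is_cvg_einfs.
    - apply: filterS aeE => x xE _; apply/esym.
      apply: (cvg_limn_einf_sup _).1.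
      apply/cvg_EFin; first exact: nearW.
      have := cw x (u_ m x) xE.
      by rewrite -(cvg_shiftn N).
  apply: (le_trans (fatou _ _ _ _)) => //.
    by move=> k; apply/measurable_EFinP; apply: L2on_sqn_measurable; exact: cmeasurableB.
    by move=> k x _; rewrite lee_fin sqn_ge0.
  under eq_fun do rewrite L2_sqn_sub.
  rewrite limn_einf_lim; apply: lime_le; first exact: is_cvg_einfs.
  apply: nearW => k; apply: (@le_trans _ _ (hnorm (u_ m - v (k + N)%N) ^+ 2)%:E).
    by apply: ereal_inf_lbound; exists k => /=.
  by rewrite lee_fin ler_pXn2r ?nnegrE ?hnorm_ge0// he// leq_addl.
have key (e : R) : 0 < e -> exists N, forall m, (N <= m)%N ->
    (\int[mu]_x (sqn (u_ m x - w x))%:E <= (e ^+ 2)%:E)%E.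
  move=> e0; have [N hN] := cu e e0; exists N => m Nm.
  apply: (fat m e N) (ltW e0) => k Nk.
  by apply/ltW/hN => //; exact: leq_trans Nk (kn k).
have [w' w'E] : exists w' : L2 mu, {ae mu, forall x, w' x = w x}.
  apply: L2_mk; have [N hN] := key 1 ltr01.
  have L1 : L2on mu setT (fun x => u_ N x - w x).
    split; first by apply: cmeasurableB => //; have [] := L2P (u_ N).
    by rewrite (le_lt_trans (hN N (leqnn N)))// ltry.
  have := L2on_lin (-1) L1 (L2P (u_ N)).
  rewrite (_ : (fun x => _) = w)//; apply/funext => x.
  by rewrite mulN1r opprB subrK.
exists w'; apply/hcvgP => e e0; have e2 : 0 < e / 2 by lra.
have [N hN] := key _ e2; exists N => m Nm.
apply: (@le_lt_trans _ _ (e / 2)); last by lra.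
rewrite -(ler_pXn2r (n := 2))// ?nnegrE ?hnorm_ge0 ?(ltW e2)// -lee_fin -L2_sqn_sub.
rewrite (le_trans _ (hN m Nm))// le_eqVlt; apply/orP; left; apply/eqP.
have [mum _] := L2P (u_ m); have [mw' _] := L2P w'.
apply: ae_eq_integral => //.
- by apply/measurable_EFinP; apply: L2on_sqn_measurable; exact: cmeasurableB.
- by apply/measurable_EFinP; apply: L2on_sqn_measurable; exact: cmeasurableB.
- by apply: filterS w'E => x -> _.
Qed.

End L2_space.

(** * Absolutely continuous functions and weak derivatives *)

Section triangle.
Context {R : realType}.
Notation leb := (@lebesgue_measure R).
Implicit Types (u v F G : R -> R) (a b t : R).

Lemma integrable_patch (D : set R) u : measurable D ->
  leb.-integrable D (EFin \o u) <-> leb.-integrable setT (EFin \o (u \_ D)).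
Proof.
by move=> mD; have := integrable_mkcond (mu := leb) (EFin \o u) mD; rewrite restrict_EFin.
Qed.

(** Fubini for u(x) v(y) on the triangle a <= y <= x <= b, with both functions extended by zero to
    the line. *)
Lemma triangle_fubini u v a b : a <= b ->
  leb.-integrable `[a, b] (EFin \o u) -> leb.-integrable `[a, b] (EFin \o v) ->
  leb.-integrable `[a, b] (EFin \o (fun x => u x * \int[leb]_(y in `[a, x]) v y)) /\
  \int[leb]_(x in `[a, b]) (u x * \int[leb]_(y in `[a, x]) v y) =
  \int[leb]_(y in `[a, b]) (v y * \int[leb]_(x in `[y, b]) u x).
Proof.
move=> ab iu iv.
have mab : measurable (`[a, b]%classic : set R) by exact: measurable_itv.
have iu' := iffLR (integrable_patch u mab) iu.
have iv' := iffLR (integrable_patch v mab) iv.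
move: iu' iv'; set u' := u \_ _; set v' := v \_ _ => iu' iv'.
have mu' : measurable_fun setT u' by apply/measurable_EFinP; exact: measurable_int iu'.
have mv' : measurable_fun setT v' by apply/measurable_EFinP; exact: measurable_int iv'.
pose T : set (measurableTypeR R * measurableTypeR R) := (fun z => z.1 - z.2) @^-1` `[0, +oo[.
have mT : measurable T.
  rewrite -[T]setTI; apply: measurable_funB => //.
pose h (z : measurableTypeR R * measurableTypeR R) : \bar R := (u' z.1 * v' z.2 * \1_T z)%:E.
have mh : measurable_fun setT h.
  apply/measurable_EFinP; apply: measurable_funM; last exact: measurable_indic.
  by apply: measurable_funM; apply: measurableT_comp.
have mah : measurable_fun setT (abse \o h) by exact: measurableT_comp.
have hxy x y : h (x, y) = (u' x * (v' y * (y <= x)%R%:R))%:E.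
  rewrite /h/= indicE mulrA; congr (_ * _ %:R)%:E.
  have -> : ((x, y) \in T) = (y <= x).
    apply/idP/idP => [/set_mem|yx]; first by rewrite /T/= in_itv/= andbT subr_ge0.
    by apply/mem_set; rewrite /T/= in_itv/= andbT subr_ge0.
  by [].
have ih : (leb \x leb)%E.-integrable setT h.
  apply: (iffRL (integrable12ltyP leb leb mh)).
  apply: (@le_lt_trans _ _ (\int[leb]_x (`|u' x|%:E * \int[leb]_y `|v' y|%:E))%E).
    apply: ge0_le_integral => //.
    - by move=> x _; exact: integral_ge0.
    - have H := @measurable_fun_fubini_tonelli_F _ _ _ _ R leb (abse \o h) mah (fun x => abse_ge0 _).
      exact: H.
    - apply: emeasurable_funM => //; apply/measurable_EFinP; exact: measurableT_comp.
    - move=> x _; rewrite -ge0_integralZl//; last first.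
        by apply/measurable_EFinP; exact: measurableT_comp.
      apply: ge0_le_integral => //.
      + by apply: measurableT_comp => //; apply: measurableT_comp mh _.
      + by apply: measurable_funeM; apply/measurable_EFinP; exact: measurableT_comp.
      + move=> y _; rewrite hxy abse_EFin -EFinM lee_fin !normrM ler_wpM2l//.
        by rewrite ler_piMr// normr_nat lern1 leq_b1.
  have /integrableP[_ iv'oo] := iv'.
  have /integrableP[_ iu'oo] := iu'.
  rewrite ge0_integralZr//; [|by apply/measurable_EFinP; exact: measurableT_comp|].
    by rewrite lte_mul_pinfty ?integral_ge0// ge0_fin_numE ?integral_ge0.
  exact: integral_ge0.
have restr (w : R -> R) (D : set R) : measurable D ->
    \int[leb]_(x in D) w x = fine (\int[leb]_x ((w \_ D) x)%:E).
  by move=> mD; rewrite Rintegral_mkcond.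
have V'E x : a <= x <= b ->
    \int[leb]_y (v' y * (y <= x)%R%:R) = \int[leb]_(y in `[a, x]) v y.
  move=> /andP[ax xb]; rewrite [RHS]Rintegral_mkcond; apply: eq_Rintegral => y _.
  rewrite /v' !patchE !mem_setE !in_itv/=.
  have [ay|] := leP a y; last by rewrite !mul0r.
  have [yx|] := leP y x; last by rewrite andbF mulr0.
  by rewrite (le_trans yx xb)/= mulr1.
have U'E y : a <= y <= b ->
    \int[leb]_x (u' x * (y <= x)%R%:R) = \int[leb]_(x in `[y, b]) u x.
  move=> /andP[ay yb]; rewrite [RHS]Rintegral_mkcond; apply: eq_Rintegral => x _.
  rewrite /u' !patchE !mem_setE !in_itv/=.
  have [xb|] := leP x b; last by rewrite !andbF mul0r.
  have [yx|] := leP y x; last by rewrite mulr0.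
  by rewrite (le_trans ay yx)/= mulr1.
have ind_int (w : R -> R) (p : R -> bool) : measurable_fun setT p ->
    leb.-integrable setT (EFin \o w) -> leb.-integrable setT (EFin \o (fun y => w y * (p y)%:R)).
  move=> mp iw; apply: (le_integrable _ _ _ iw) => //.
    have mw : measurable_fun setT w by apply/measurable_EFinP; exact: measurable_int iw.
    apply/measurable_EFinP.
    rewrite (_ : (fun y => _) = fun y => if p y then w y else 0); last first.
      by apply/funext => y; case: (p y); rewrite ?mulr1 ?mulr0.
    exact: measurable_fun_ifT.
  move=> y _; rewrite !abse_EFin lee_fin normrM ler_piMr//.
  by rewrite normr_nat lern1 leq_b1.
have F1 x : (\int[leb]_y h (x, y) = ((u \_ `[a, b]) x * \int[leb]_(y in `[a, x]) v y)%:E)%E.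
  under eq_integral do rewrite hxy.
  have [xab|xab] := boolP (a <= x <= b).
    have iw : leb.-integrable setT (EFin \o (fun y => v' y * (y <= x)%R%:R)).
      by apply: ind_int => //; apply: measurable_fun_ler.
    under eq_integral do rewrite EFinM.
    by rewrite integralZl// -V'E// EFinM /Rintegral fineK// integrable_fin_num.
  rewrite /u' patchE mem_setE in_itv/= (negbTE xab) mul0r.
  by under eq_integral do rewrite mul0r; rewrite integral0.
have F2 y : (\int[leb]_x h (x, y) = ((v \_ `[a, b]) y * \int[leb]_(x in `[y, b]) u x)%:E)%E.
  under eq_integral do rewrite hxy mulrCA.
  have [yab|yab] := boolP (a <= y <= b).
    have iw : leb.-integrable setT (EFin \o (fun x => u' x * (y <= x)%R%:R)).
      by apply: ind_int => //; apply: measurable_fun_ler.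
    under eq_integral do rewrite EFinM.
    by rewrite integralZl// -U'E// EFinM /Rintegral fineK// integrable_fin_num.
  rewrite /v' patchE mem_setE in_itv/= (negbTE yab) mul0r.
  by under eq_integral do rewrite mul0r; rewrite integral0.
have patchM (w W : R -> R) x : (w \_ `[a, b]) x * W x = ((fun x => w x * W x) \_ `[a, b]) x.
  by rewrite !patchE; case: ifP => //; rewrite mul0r.
have PM1 x : (u \_ `[a, b]) x * \int[leb]_(y in `[a, x]) v y =
    ((fun x => u x * \int[leb]_(y in `[a, x]) v y) \_ `[a, b]) x.
  exact: (patchM u (fun x => \int[leb]_(y in `[a, x]) v y)).
have PM2 y : (v \_ `[a, b]) y * \int[leb]_(x in `[y, b]) u x =
    ((fun y => v y * \int[leb]_(x in `[y, b]) u x) \_ `[a, b]) y.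
  exact: (patchM v (fun y => \int[leb]_(x in `[y, b]) u x)).
split.
  apply/(integrable_patch _ mab); have := integrable_fubini_F ih.
  apply: eq_integrable => // x _ /=.
  by rewrite /fubini_F F1 PM1.
rewrite Rintegral_mkcond [RHS]Rintegral_mkcond; apply: (congr1 (@fine R)).
transitivity (\int[leb]_x \int[leb]_y h (x, y))%E.
  by apply: eq_integral => x _; rewrite F1 PM1.
transitivity (\int[leb]_y \int[leb]_x h (x, y))%E; first exact: (Fubini ih).
by apply: eq_integral => y _; rewrite F2 PM2.
Qed.

End triangle.

Section real_ac.
Context {R : realType}.
Notation leb := (@lebesgue_measure R).
Implicit Types (u v F G : R -> R) (a b c t r s : R).

(* Absolute continuity of [F] with a.e. derivative [u], in its integral form. *)
Definition rAC a b F u : Prop := leb.-integrable `[a, b] (EFin \o u) /\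
  forall t, a <= t <= b -> F t = F a + \int[leb]_(s in `[a, t]) u s.

Lemma integrable_itvS (A B : interval R) u : leb.-integrable [set` B] (EFin \o u) ->
  [set` A] `<=` [set` B] -> leb.-integrable [set` A] (EFin \o u).
Proof. by move=> h AB; apply: integrableS h. Qed.

Lemma itvcc_sub a b c e : a <= c -> e <= b -> (`[c, e]%classic : set R) `<=` `[a, b]%classic.
Proof.
move=> ac eb t; rewrite /= !in_itv/= => /andP[ct te].
by rewrite (le_trans ac ct) (le_trans te eb).
Qed.

Lemma Rintegral_split a c b u : a <= c <= b -> leb.-integrable `[a, b] (EFin \o u) ->
  \int[leb]_(s in `[a, b]) u s = \int[leb]_(s in `[a, c]) u s + \int[leb]_(s in `[c, b]) u s.
Proof.
move=> /andP[ac cb] iu.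
have icb : leb.-integrable `[c, b] (EFin \o u) by apply: integrable_itvS iu _; exact: itvcc_sub.
have := @Rintegral_itvB R u (BLeft a) (BRight b) c iu.
rewrite !bnd_simp => /(_ ac cb).
rewrite Rintegral_itv_obnd_cbnd; first by move/eqP; rewrite subr_eq addrC => /eqP.
by apply: integrable_itvS icb _; apply: subset_itv; rewrite bnd_simp.
Qed.

Lemma rAC_sub a b c t F u : rAC a b F u -> a <= c -> c <= t -> t <= b ->
  F t = F c + \int[leb]_(s in `[c, t]) u s.
Proof.
move=> [iu hF] ac ct tb; rewrite (hF t) ?(hF c) ?ac ?(le_trans ct tb) ?(le_trans ac ct)//=.
rewrite (@Rintegral_split a c t) ?ac ?ct//; first by rewrite addrA.
by apply: integrable_itvS iu _; exact: itvcc_sub.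
Qed.

Lemma rAC_restrict a b c e F u : rAC a b F u -> a <= c -> e <= b -> rAC c e F u.
Proof.
move=> h ac eb; split; first by case: h => iu _; apply: integrable_itvS iu _; exact: itvcc_sub.
by move=> t /andP[ct te]; apply: (rAC_sub h) => //; exact: le_trans te eb.
Qed.

Lemma rAC_lin a b r s F G u v : rAC a b F u -> rAC a b G v ->
  rAC a b (fun t => r * F t + s * G t) (fun t => r * u t + s * v t).
Proof.
move=> [iu hF] [iv hG].
have iru (c : R) w t : leb.-integrable `[a, b] (EFin \o w) -> t <= b ->
    leb.-integrable `[a, t] (EFin \o (fun x => c * w x)) /\
    \int[leb]_(x in `[a, t]) (c * w x) = c * \int[leb]_(x in `[a, t]) w x.
  move=> iw tb; have iw' : leb.-integrable `[a, t] (EFin \o w).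
    by apply: integrable_itvS iw _; exact: itvcc_sub.
  split; first exact: (integrableZl _ c iw').
  by rewrite RintegralZl.
split.
  have [i1 _] := iru r u b iu (lexx _); have [i2 _] := iru s v b iv (lexx _).
  exact: (integrableD _ i1 i2).
move=> t /andP[at_ tb]; rewrite hF ?at_//= hG ?at_//=.
have [i1 e1] := iru r u t iu tb; have [i2 e2] := iru s v t iv tb.
by rewrite RintegralD// e1 e2; ring.
Qed.

(** With U and V the primitives vanishing at [a], [triangle_fubini] gives the integral of u V as
    that of v (U(b) - U); the rest is linear algebra in F(a) and G(a). *)
Lemma rAC_parts a b F G u v : a <= b -> rAC a b F u -> rAC a b G v -> [/\
  leb.-integrable `[a, b] (EFin \o (fun s => u s * G s)),
  leb.-integrable `[a, b] (EFin \o (fun s => F s * v s)) &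
  \int[leb]_(s in `[a, b]) (u s * G s) + \int[leb]_(s in `[a, b]) (F s * v s) =
  F b * G b - F a * G a].
Proof.
move=> ab [iu hF] [iv hG].
pose U t := \int[leb]_(s in `[a, t]) u s; pose V t := \int[leb]_(s in `[a, t]) v s.
have [i1 e1] : leb.-integrable `[a, b] (EFin \o (fun s => u s * V s)) /\
    \int[leb]_(s in `[a, b]) (u s * V s) =
    \int[leb]_(y in `[a, b]) (v y * \int[leb]_(s in `[y, b]) u s) := triangle_fubini ab iu iv.
have [i2 _] : leb.-integrable `[a, b] (EFin \o (fun s => v s * U s)) /\ _ :=
  triangle_fubini ab iv iu.
have ZI (c : R) w : leb.-integrable `[a, b] (EFin \o w) ->
    leb.-integrable `[a, b] (EFin \o (fun x => c * w x)).
  by move=> iw; exact: (integrableZl _ c iw).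
have j1 : leb.-integrable `[a, b] (EFin \o (fun s => G a * u s + u s * V s)).
  exact: (integrableD _ (ZI (G a) u iu) i1).
have j2 : leb.-integrable `[a, b] (EFin \o (fun s => F a * v s + v s * U s)).
  exact: (integrableD _ (ZI (F a) v iv) i2).
have E1 : {in `[a, b]%classic, (fun s => G a * u s + u s * V s) =1 (fun s => u s * G s)}.
  move=> s; rewrite inE/= in_itv/= => sab.
  by rewrite (hG s sab) mulrDr [u s * G a]mulrC.
have E2 : {in `[a, b]%classic, (fun s => F a * v s + v s * U s) =1 (fun s => F s * v s)}.
  move=> s; rewrite inE/= in_itv/= => sab.
  by rewrite (hF s sab) mulrDl [v s * U s]mulrC.
split.
- by apply: eq_integrable j1 => // s st; rewrite /= E1.
- by apply: eq_integrable j2 => // s st; rewrite /= E2.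
transitivity (\int[leb]_(s in `[a, b]) (G a * u s + u s * V s) +
    \int[leb]_(s in `[a, b]) (F a * v s + v s * U s)).
  by congr (_ + _); apply/esym/eq_Rintegral => s st; [exact: E1|exact: E2].
rewrite (RintegralD _ (ZI (G a) u iu) i1)// (RintegralD _ (ZI (F a) v iv) i2)//.
rewrite !RintegralZl// e1.
have -> : \int[leb]_(s in `[a, b]) (v s * \int[leb]_(x in `[s, b]) u x) =
    \int[leb]_(s in `[a, b]) (U b * v s - v s * U s).
  apply: eq_Rintegral => s; rewrite inE/= in_itv/= => sab.
  by rewrite /U (Rintegral_split sab iu) [in RHS]mulrC -mulrBr addrC addKr.
rewrite RintegralB ?RintegralZl//; last exact: (ZI (U b) v iv).
have bab : a <= b <= b by rewrite ab lexx.
rewrite (hF b bab) (hG b bab) -/(U b) -/(V b).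
move: (\int[leb]_(s in _) (v s * U s)) => r.
by move: (U b) (V b) (F a) (G a) => *; ring.
Qed.

Lemma rAC_mul a b F G u v : a <= b -> rAC a b F u -> rAC a b G v ->
  rAC a b (fun t => F t * G t) (fun t => u t * G t + F t * v t).
Proof.
move=> ab hF hG; split.
  by have [i1 i2 _] := rAC_parts ab hF hG; exact: (integrableD _ i1 i2).
move=> t /andP[at_ tb].
have [i1 i2 e] := rAC_parts at_ (rAC_restrict hF (lexx _) tb) (rAC_restrict hG (lexx _) tb).
by rewrite RintegralD// e addrC subrK.
Qed.

End real_ac.

Section real_ac_theory.
Context {R : realType}.
Notation leb := (@lebesgue_measure R).
Implicit Types (u v F G : R -> R) (a b c t r s : R).

Lemma rAC_within_continuous a b F u : a <= b -> rAC a b F u -> {within `[a, b], continuous F}.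
Proof.
move=> ab [iu hF].
have c1 := parameterized_integral_continuous ab iu.
have c2 : {within `[a, b], continuous (fun x => F a + \int[leb]_(s in `[a, x]) u s)}.
  by move=> x; apply: cvgD; [exact: cvg_cst|exact: c1].
apply: subspace_eq_continuous c2 => t.
by move=> /set_mem/=; rewrite in_itv/= => tab; rewrite /from_subspace (hF t tab).
Qed.

(** Extension of [u] by zero reduces the claim to the differentiation theorem for primitives taken
    from minus infinity. *)
Lemma rAC_derive a b F u : rAC a b F u ->
  {ae leb, forall t, a < t < b -> derivable F t 1 /\ F^`() t = u t}.
Proof.
move=> [iu hF].
pose w := u \_ `[a, b].
have mab : measurable (`[a, b]%classic : set R) by exact: measurable_itv.
have iw : leb.-integrable setT (EFin \o w) by exact: iffLR (integrable_patch u mab) iu.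
have iwy y : leb.-integrable `]-oo, y] (EFin \o w) by apply: integrableS iw.
have locw : locally_integrable setT w by apply: integrable_locally.
pose W x := \int[leb]_(t in `]-oo, x]) w t.
have WE x : a <= x -> x <= b -> F x = F a + W x.
  move=> ax xb; rewrite hF ?ax//; congr (_ + _).
  rewrite /W Rintegral_mkcond [RHS]Rintegral_mkcond; apply: eq_Rintegral => t _.
  rewrite /w !patchE !mem_setE !in_itv/=.
  have [tx|] := leP t x; last by rewrite andbF.
  by rewrite (le_trans tx xb).
have := FTC1Ny iwy locw; apply: filterS; first exact: (ae_filter_ringOfSetsType leb).
move=> x [dx wx] /andP[ax xb].
have near_eq : \near x, F a + W x = F x.
  near=> y; apply/esym/WE; apply/ltW; near: y; [exact: lt_nbhsr|exact: lt_nbhsl].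
have dW : is_derive x 1 W (w x) by split; [exact: dx|rewrite -derive1E; exact: wx].
have dF : is_derive x 1 (fun y => F a + W y) (w x).
  by have := is_deriveD (is_derive_cst (F a) x 1) dW; rewrite add0r.
have xab : w x = u x by rewrite /w patchE mem_setE in_itv/= (ltW ax) (ltW xb).
have [dF1 dF2] := dF.
split; first exact: near_eq_derivable dF1.
by rewrite derive1E -(near_eq_derive _ near_eq) dF2.
Unshelve. all: by end_near. Qed.

Lemma ae_exists_itv a b (Q : R -> Prop) : a < b ->
  {ae leb, forall t, a < t < b -> Q t} -> exists2 t, a < t < b & Q t.
Proof.
move=> ab [N [mN N0 sN]]; apply: contrapT => h.
have : (leb `]a, b[ <= leb N)%E.
  apply: le_measure; rewrite ?inE//.
  move=> t /=; rewrite in_itv/= => tab; apply: sN => /= Qt.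
  by apply: h; exists t => //; exact: Qt.
by rewrite N0 lebesgue_measure_itv/= lte_fin ab -EFinB lee_fin leNgt subr_gt0 ab.
Qed.

Lemma rAC_eq a b F u : (forall t, a <= t <= b -> F t = F a) ->
  rAC a b F u -> {ae leb, forall t, a < t < b -> u t = 0}.
Proof.
move=> Fc /rAC_derive; apply: filterS; first exact: (ae_filter_ringOfSetsType leb).
move=> x h /andP[ax xb]; have [|_ <-] := h; first by rewrite ax.
rewrite derive1E (@near_eq_derive _ _ _ _ (cst (F a))) ?derive_cst//.
near=> y; rewrite Fc//; apply/andP; split; apply/ltW; near: y.
  exact: lt_nbhsr.
exact: lt_nbhsl.
Unshelve. all: by end_near. Qed.

Lemma rAC_C1 a b F : a <= b -> (forall t, derivable F t 1) -> continuous F^`() -> rAC a b F F^`().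
Proof.
move=> ab dF cF'.
have cw (x y : R) : {within `[x, y], continuous F^`()} by exact: continuous_subspaceT.
split.
  by apply: (@continuous_compact_integrable _ F^`()); [exact: segment_compact|exact: cw].
move=> t /andP[+ _]; rewrite le_eqVlt => /predU1P[<-|at_].
  by rewrite set_itv1 Rintegral_set1 addr0.
have dLR : derivable_oo_LRcontinuous F a t.
  split.
  - by move=> x _; exact: dF.
  - by apply: cvg_at_right_filter; exact/differentiable_continuous/derivable1_diffP.
  - by apply: cvg_at_left_filter; exact/differentiable_continuous/derivable1_diffP.
rewrite /Rintegral (@continuous_FTC2 _ F^`() F a t at_ (cw a t) dLR); last by [].
by rewrite /= addrCA subrr addr0.
Qed.

Lemma rAC_cst a b c : rAC a b (fun=> c) (fun=> 0).
Proof.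
split; first by have := integrable0 leb (`[a, b]%classic : set R).
by move=> t _; rewrite /Rintegral integral0 addr0.
Qed.

End real_ac_theory.

Section complex_ac.
Context {R : realType}.
Notation leb := (@lebesgue_measure R).
Implicit Types (F G u v : R -> R[i]) (a b t r s : R) (c : R[i]).

Definition cAC a b F u : Prop :=
  rAC a b (fun t => Re (F t)) (fun t => Re (u t)) /\
  rAC a b (fun t => Im (F t)) (fun t => Im (u t)).

Lemma rAC_ext a b (F G u v : R -> R) : (forall t, F t = G t) -> (forall t, u t = v t) ->
  rAC a b F u -> rAC a b G v.
Proof. by move=> /funext <- /funext <-. Qed.

Lemma rAC_ext_on a b (F G u : R -> R) : a <= b -> (forall t, a <= t <= b -> F t = G t) ->
  rAC a b F u -> rAC a b G u.
Proof.
move=> ab FG [iu hF]; split; first exact: iu.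
move=> t tab; have aa : a <= a <= b by rewrite lexx.
by rewrite -(FG t tab) -(FG a aa); exact: hF.
Qed.

Lemma cAC_ext a b F G u v : (forall t, F t = G t) -> (forall t, u t = v t) ->
  cAC a b F u -> cAC a b G v.
Proof. by move=> /funext <- /funext <-. Qed.

Lemma cAC_ext_on a b F G u : a <= b -> (forall t, a <= t <= b -> F t = G t) ->
  cAC a b F u -> cAC a b G u.
Proof.
move=> ab FG [h1 h2]; split.
  by apply: (rAC_ext_on ab _ h1) => t /FG ->.
by apply: (rAC_ext_on ab _ h2) => t /FG ->.
Qed.

Lemma cAC_restrict a b r s F u : cAC a b F u -> a <= r -> s <= b -> cAC r s F u.
Proof. by move=> [h1 h2] ar sb; split; [exact: rAC_restrict h1 _ _|exact: rAC_restrict h2 _ _]. Qed.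

Lemma cAC_lin a b c F G u v : a <= b -> cAC a b F u -> cAC a b G v ->
  cAC a b (fun t => c * F t + G t) (fun t => c * u t + v t).
Proof.
move=> ab [F1 F2] [G1 G2]; split.
  apply: (rAC_ext _ _ (rAC_lin 1 1 (rAC_lin (Re c) (- Im c) F1 F2) G1)) => t;
    by rewrite ReD ReM; ring.
apply: (rAC_ext _ _ (rAC_lin 1 1 (rAC_lin (Re c) (Im c) F2 F1) G2)) => t;
  by rewrite ImD ImM; ring.
Qed.

Lemma cAC_mul a b F G u v : a <= b -> cAC a b F u -> cAC a b G v ->
  cAC a b (fun t => F t * G t) (fun t => u t * G t + F t * v t).
Proof.
move=> ab [F1 F2] [G1 G2]; split.
  apply: (rAC_ext _ _ (rAC_lin 1 (-1) (rAC_mul ab F1 G1) (rAC_mul ab F2 G2))) => t.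
    by rewrite ReM; ring.
  by rewrite ReD !ReM; ring.
apply: (rAC_ext _ _ (rAC_lin 1 1 (rAC_mul ab F1 G2) (rAC_mul ab F2 G1))) => t.
  by rewrite ImM; ring.
by rewrite ImD !ImM; ring.
Qed.

Lemma cAC_cst a b c : cAC a b (fun=> c) (fun=> 0).
Proof. by split; exact: rAC_cst. Qed.

Lemma cAC_sqn a b F u : a <= b -> cAC a b F u ->
  rAC a b (fun t => sqn (F t)) (fun t => 2 * (Re (F t) * Re (u t) + Im (F t) * Im (u t))).
Proof.
move=> ab [F1 F2].
by apply: (rAC_ext _ _ (rAC_lin 1 1 (rAC_mul ab F1 F1) (rAC_mul ab F2 F2))) => t;
  rewrite ?/sqn; ring.
Qed.

Lemma integrable_rAC a b r (u : R -> R) : leb.-integrable `[a, b] (EFin \o u) ->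
  rAC a b (fun t => r + \int[leb]_(s in `[a, t]) u s) u.
Proof.
move=> iu; split; first exact: iu.
by move=> t _; rewrite set_itv1 Rintegral_set1 addr0.
Qed.

Lemma cintegrable_cAC a b c u : cintegrable leb `[a, b] u ->
  cAC a b (fun t => c + cint leb `[a, t] u) u.
Proof.
move=> [i1 i2]; split.
  have := integrable_rAC (Re c) i1.
  by congr (rAC _ _ _ _); apply/funext => t; rewrite ReD.
have := integrable_rAC (Im c) i2.
by congr (rAC _ _ _ _); apply/funext => t; rewrite ImD.
Qed.

Lemma is_derive_cexp_line (l : R[i]) (t : R) :
  is_derive t 1 (fun s => Re (cexp (l * s%:C))) (Re (l * cexp (l * t%:C))) /\
  is_derive t 1 (fun s => Im (cexp (l * s%:C))) (Im (l * cexp (l * t%:C))).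
Proof.
have E1 s : Re (l * s%:C) = Re l * s by rewrite ReM/=; ring.
have E2 s : Im (l * s%:C) = Im l * s by rewrite ImM/=; ring.
rewrite /cexp/=; split.
  rewrite (_ : (fun s => _) = fun s => expR (Re l * s) * cos (Im l * s)); last first.
    by apply/funext => s; rewrite E1 E2.
  apply: is_derive_eq; rewrite !scaler1/= E1 E2 ReM/= /GRing.scale/=; ring.
rewrite (_ : (fun s => _) = fun s => expR (Re l * s) * sin (Im l * s)); last first.
  by apply/funext => s; rewrite E1 E2.
by apply: is_derive_eq; rewrite !scaler1/= E1 E2 ImM/= /GRing.scale/=; ring.
Qed.

Lemma is_derive_rAC a b (F u : R -> R) : a <= b -> (forall t, is_derive t 1 F (u t)) ->
  continuous u -> rAC a b F u.
Proof.
move=> ab h cu.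
have uE : F^`() = u by apply/funext => t; rewrite derive1E; have [_ ->] := h t.
by rewrite -uE; apply: rAC_C1 => //; rewrite uE.
Qed.

Lemma is_derive_continuous (F : R -> R) (u : R -> R) :
  (forall t, is_derive t 1 F (u t)) -> continuous F.
Proof. by move=> h t; apply/differentiable_continuous/derivable1_diffP; have [] := h t. Qed.

Lemma cAC_cexp a b (l : R[i]) : a <= b ->
  cAC a b (fun t => cexp (l * t%:C)) (fun t => l * cexp (l * t%:C)).
Proof.
move=> ab.
have c1 : continuous (fun s => Re (cexp (l * s%:C))).
  by apply: is_derive_continuous => t; have [h _] := is_derive_cexp_line l t; exact: h.
have c2 : continuous (fun s => Im (cexp (l * s%:C))).
  by apply: is_derive_continuous => t; have [_ h] := is_derive_cexp_line l t; exact: h.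
split; apply: (is_derive_rAC ab).
- by move=> t; have [h _] := is_derive_cexp_line l t.
- under eq_fun do rewrite ReM.
  by move=> t; apply: cvgB; apply: cvgM; [exact: cvg_cst|exact: c1|exact: cvg_cst|exact: c2].
- by move=> t; have [_ h] := is_derive_cexp_line l t.
- under eq_fun do rewrite ImM.
  by move=> t; apply: cvgD; apply: cvgM; [exact: cvg_cst|exact: c2|exact: cvg_cst|exact: c1].
Qed.

Lemma rAC_modulus a b t e (F u : R -> R) : a < b -> rAC a b F u -> a <= t <= b -> 0 < e ->
  exists2 r, 0 < r & forall s, a <= s <= b -> `|t - s| < r -> `|F t - F s| < e.
Proof.
move=> ab hF tab e0.
have tA : `[a, b]%classic t by rewrite /= in_itv.
have /subspace_continuousP/(_ t tA)/cvgrPdist_lt/(_ _ e0) := rAC_within_continuous (ltW ab) hF.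
move=> /nbhs_ballP[r/= r0 hr]; exists r => // s sab ts.
by apply: hr => //=; rewrite in_itv.
Qed.

Lemma ae_exists_near a b t r (Q : R -> Prop) : a < b -> a <= t <= b -> 0 < r ->
  {ae leb, forall s, a < s < b -> Q s} -> exists s, [/\ a < s < b, `|t - s| < r & Q s].
Proof.
move=> ab /andP[at_ tb] r0 h.
have [s /andP[s1 s2] Qs] : exists2 s, Num.max a (t - r) < s < Num.min b (t + r) & Q s.
  apply: ae_exists_itv; first by rewrite gt_max !lt_min ab; lra.
  apply: filterS h; first exact: (ae_filter_ringOfSetsType leb).
  by move=> s h /andP[]; rewrite gt_max lt_min => /andP[s1 s2] /andP[s3 s4]; apply: h; rewrite s1.
move: s1 s2; rewrite gt_max lt_min => /andP[s1 s2] /andP[s3 s4].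
by exists s; split=> //; rewrite ?s1// ltr_norml; lra.
Qed.

Lemma rAC_ae_eq a b (F G u v : R -> R) : a < b -> rAC a b F u -> rAC a b G v ->
  {ae leb, forall t, a < t < b -> F t = G t} -> forall t, a <= t <= b -> F t = G t.
Proof.
move=> ab hF hG FG t tab; apply/eqP; rewrite -subr_eq0 -normr_le0; apply/ler_addgt0Pr => e e0.
have e2 : 0 < e / 2 by lra.
have [r1 r10 h1] := rAC_modulus ab hF tab e2; have [r2 r20 h2] := rAC_modulus ab hG tab e2.
have r0 : 0 < Num.min r1 r2 by rewrite lt_min r10.
have [s [/andP[as_ sb] + FGs]] := ae_exists_near ab tab r0 FG.
rewrite lt_min => /andP[d1 d2].
have sab : a <= s <= b by rewrite (ltW as_) (ltW sb).
have := h1 s sab d1; have := h2 s sab d2; rewrite FGs.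
move: (F t) (G t) (G s) => p q w; rewrite !ltr_norml add0r => /andP[? ?] /andP[? ?].
by rewrite ler_norml; lra.
Qed.

Lemma rAC_ae_zero a b (F u : R -> R) : a < b -> rAC a b F u ->
  {ae leb, forall t, a < t < b -> F t = 0} ->
  (forall t, a <= t <= b -> F t = 0) /\ {ae leb, forall t, a < t < b -> u t = 0}.
Proof.
move=> ab hF F0.
have E : forall t, a <= t <= b -> F t = 0 by exact: (rAC_ae_eq ab hF (rAC_cst a b 0)).
split; first exact: E.
by apply: rAC_eq hF => t tab; rewrite !E// lexx ltW.
Qed.

Lemma cAC_ae_zero a b F u : a < b -> cAC a b F u ->
  {ae leb, forall t, a < t < b -> F t = 0} ->
  (forall t, a <= t <= b -> F t = 0) /\ {ae leb, forall t, a < t < b -> u t = 0}.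
Proof.
move=> ab [F1 F2] F0.
have fae := ae_filter_ringOfSetsType leb.
have [|Z1 U1] := rAC_ae_zero ab F1; first by apply: filterS F0 => s h /h ->.
have [|Z2 U2] := rAC_ae_zero ab F2; first by apply: filterS F0 => s h /h ->.
split; first by move=> t tab; apply: complex_ext; [exact: Z1|exact: Z2].
apply: filterS2 U1 U2 => s h1 h2 sab.
by apply: complex_ext; [exact: h1|exact: h2].
Qed.

End complex_ac.

(** * Weak derivatives on an interval: the du Bois-Reymond lemma *)

Section weak_derivatives.
Context {R : realType}.
Notation leb := (@lebesgue_measure R).
Implicit Types (F u v f w : R -> R) (a b c t r s h : R).

Lemma Rintegral_dominated (D : set R) (f_ : nat -> R -> R) f (g : R -> R) : measurable D ->
  (forall n, measurable_fun D (f_ n)) -> measurable_fun D f -> leb.-integrable D (EFin \o g) ->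
  (forall t, D t -> f_^~ t @ \oo --> f t) -> (forall n t, D t -> `|f_ n t| <= g t) ->
  (fun n => \int[leb]_(t in D) f_ n t) @ \oo --> \int[leb]_(t in D) f t.
Proof.
move=> mD mf_ mf ig ff fg.
have [||i _ cv] := @dominated_convergence _ _ _ leb D mD (fun n => EFin \o f_ n) (EFin \o f)
  (EFin \o g) (fun n => iffRL (measurable_EFinP _ _) (mf_ n)) (iffRL (measurable_EFinP _ _) mf) _ ig.
- apply: aeW => t Dt; by apply: cvg_EFin; [exact: nearW|exact: ff].
- by apply: aeW => t n Dt; rewrite /= lee_fin fg.
by apply: fine_cvg; rewrite -/(Rintegral _ _ _) /Rintegral fineK//; exact: integrable_fin_num.
Qed.

Lemma itvoo_sub_cc a b : (`]a, b[%classic : set R) `<=` `[a, b]%classic.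
Proof. by apply: subset_itv; rewrite bnd_simp. Qed.

Lemma integrable_oo_cc a b u :
  leb.-integrable `]a, b[ (EFin \o u) -> leb.-integrable `[a, b] (EFin \o u).
Proof.
move=> /integrableP[mu iu].
have mu1 : measurable_fun `]a, b] (EFin \o u).
  exact/emeasurable_fun_itv_bndo_bndcP.
apply/integrableP; split; first exact/emeasurable_fun_itv_obnd_cbndP.
rewrite -integral_itv_obnd_cbnd; last exact: measurableT_comp.
by rewrite -integral_itv_bndo_bndc//; exact: measurableT_comp.
Qed.

Lemma Rintegral_oo_cc a b u : leb.-integrable `[a, b] (EFin \o u) ->
  \int[leb]_(t in `]a, b[) u t = \int[leb]_(t in `[a, b]) u t.
Proof.
move=> iu.
have i1 : leb.-integrable `]a, b] (EFin \o u).
  by apply: integrable_itvS iu _; apply: subset_itv; rewrite bnd_simp.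
have i2 : leb.-integrable `]a, b[ (EFin \o u).
  by apply: integrable_itvS iu _; exact: itvoo_sub_cc.
by rewrite (Rintegral_itv_bndo_bndc i2) (Rintegral_itv_obnd_cbnd i1).
Qed.

Lemma rAC_ext_deriv a b F u v : (forall t, a < t < b -> u t = v t) ->
  rAC a b F u -> rAC a b F v.
Proof.
move=> uv [iu hF].
have uvi t : t <= b -> {in `]a, t[%classic, (EFin \o u) =1 (EFin \o v)}.
  move=> tb s; rewrite inE/= in_itv/= => /andP[s1 s2].
  by congr EFin; apply: uv; rewrite s1 (lt_le_trans s2).
have iv t : t <= b -> leb.-integrable `[a, t] (EFin \o v).
  move=> tb; apply: integrable_oo_cc.
  apply: (@eq_integrable _ _ _ leb _ _ (EFin \o u)); [by []|exact: uvi|].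
  apply: integrable_itvS iu _ => s; rewrite /= !in_itv/= => /andP[s1 s2].
  by rewrite (ltW s1) (le_trans (ltW s2)).
split; first exact: iv.
move=> t /andP[at_ tb]; rewrite hF ?at_//; congr (_ + _).
have iu' : leb.-integrable `[a, t] (EFin \o u).
  by apply: integrable_itvS iu _; exact: itvcc_sub.
rewrite -(Rintegral_oo_cc iu') -(Rintegral_oo_cc (iv t tb)).
by apply: eq_Rintegral => s /(uvi t tb)[].
Qed.

Lemma C1_zero_off (K : set R) (phi : R -> R) t : closed K -> (forall s, ~ K s -> phi s = 0) -> ~ K t -> phi^`() t = 0.
Proof.
move=> cK h Kt; rewrite derive1E (@near_eq_derive _ _ _ _ (cst 0)) ?derive_cst//.
have /open_nbhs_nbhs : open_nbhs t (~` K) by split => //; exact: closed_openC.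
by apply: filterS => s /h.
Qed.

(** The support of the test function lies in ]a, b[, so both integrals localize there and
    integration by parts has no boundary terms. *)
Lemma weak_local (D : set R) a b f F u (phi : R -> R) (K : set R) : a <= b -> measurable D ->
  `]a, b[%classic `<=` D -> rAC a b F u -> {ae leb, forall t, a < t < b -> f t = F t} ->
  measurable_fun `]a, b[ f ->
  (forall t, derivable phi t 1) -> continuous (derive1 phi) -> closed K -> K `<=` `]a, b[%classic ->
  (forall t, ~ K t -> phi t = 0) ->
  \int[leb]_(t in D) (f t * derive1 phi t) = - \int[leb]_(t in D) (u t * phi t).
Proof.
move=> ab mD abD hF fF mf dphi cphi cK Kab phi0.
have hphi := rAC_C1 ab dphi cphi.
have [i1 i2 e] := rAC_parts ab hF hphi.
have phia : phi a = 0 by apply: phi0 => /Kab/=; rewrite in_itv/= ltxx.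
have phib : phi b = 0 by apply: phi0 => /Kab/=; rewrite in_itv/= ltxx andbF.
have loc (g p : R -> R) : (forall t, ~ K t -> p t = 0) ->
    \int[leb]_(t in D) (g t * p t) = \int[leb]_(t in `]a, b[) (g t * p t).
  move=> p0; rewrite Rintegral_mkcond [RHS]Rintegral_mkcond; apply: eq_Rintegral => t _.
  rewrite !patchE; case: ifPn; case: ifPn => //.
    by rewrite notin_setE => h _; rewrite p0 ?mulr0// => /Kab.
  by move=> /set_mem/abD h; rewrite notin_setE => /(_ h).
have dphi0 t : ~ K t -> derive1 phi t = 0 by exact: C1_zero_off.
rewrite (loc _ _ dphi0) (loc _ _ phi0) (Rintegral_oo_cc i1).
transitivity (\int[leb]_(t in `]a, b[) (F t * derive1 phi t)).
  have mF : measurable_fun `]a, b[ (EFin \o (fun t => F t * derive1 phi t)).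
    have := measurable_int _ i2; apply: measurable_funS; first exact: measurable_itv.
    exact: itvoo_sub_cc.
  congr fine; apply: ae_eq_integral; first exact: measurable_itv.
  - apply/measurable_EFinP; apply: measurable_funM; first exact: mf.
    apply: measurable_funTS; exact: continuous_measurable_fun.
  - exact: mF.
  - apply: filterS fF; first exact: (ae_filter_ringOfSetsType leb).
    by move=> t /= h; rewrite in_itv/= => /h ->.
rewrite (Rintegral_oo_cc i2).
by move: e; rewrite phia phib !mulr0 subr0 => /eqP; rewrite addrC addr_eq0 => /eqP.
Qed.

Lemma is_derive_quadratic_remainder F t c : (forall h, `|F (t + h) - F t - c * h| <= h ^+ 2) ->
  is_derive t 1 F c.
Proof.
move=> H.
have cv : (fun h => h^-1 *: (F (h *: 1 + t) - F t)) @ 0^' --> c.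
  apply/cvgrPdist_lt => e e0; near=> h.
  have h0 : h != 0 by near: h; exact: nbhs_dnbhs_neq.
  rewrite scaler1 /GRing.scale/= [h + t]addrC.
  have -> : c - h^-1 * (F (t + h) - F t) = - (h^-1 * (F (t + h) - F t - c * h)).
    by field.
  rewrite normrN normrM normfV ltr_pdivrMl ?normr_gt0//.
  rewrite (le_lt_trans (H h))// -real_normK ?num_real// expr2 ltr_pM2l ?normr_gt0//.
  near: h; apply: dnbhs0_lt; exact: e0.
have dF : derivable F t 1 by apply/cvg_ex; exists c.
by split => //; exact: cvg_lim.
Unshelve. all: by end_near. Qed.

Definition pos_part t : R := Num.max 0 t.

Lemma pos_part_sqr_derive t : is_derive t 1 (fun s => pos_part s ^+ 2) (2 * pos_part t).
Proof.
apply: is_derive_quadratic_remainder => h.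
rewrite /pos_part ler_norml; case: (leP 0 (t + h)) => ?; case: (leP 0 t) => ?;
  by apply/andP; split; nra.
Qed.

Lemma pos_part_continuous : continuous pos_part.
Proof. by move=> t; apply: (@continuous_max _ _ (cst 0) id); [exact: cvg_cst|exact: cvg_id]. Qed.

(** A continuous step from 0 to 1 on [0, e], approximating the indicator of the positive half-line.
    Its primitive below is C^1, which is all the smoothness asked of test functions. *)
Definition ramp (e t : R) : R := (pos_part t - pos_part (t - e)) / e.
Definition ramp_primitive (e t : R) : R := (pos_part t ^+ 2 - pos_part (t - e) ^+ 2) / (2 * e).

Lemma ramp_primitive_derive e c t : 0 < e ->
  is_derive t 1 (fun s => ramp_primitive e (s - c)) (ramp e (t - c)).
Proof.
move=> e0; rewrite /ramp_primitive /ramp.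
have sh k : is_derive t 1 (fun s => pos_part (s - k) ^+ 2) (2 * pos_part (t - k)).
  have := @is_derive1_comp _ (fun s => pos_part s ^+ 2) (fun s => s - k) t (2 * pos_part (t - k)) 1.
  rewrite mulr1; apply; first exact: pos_part_sqr_derive.
  by apply: is_derive_eq; rewrite subr0.
have h1 := sh c; have h2 := sh (c + e).
rewrite (_ : (fun s => _) = (fun s => (2 * e)^-1 * (pos_part (s - c) ^+ 2 -
  pos_part (s - (c + e)) ^+ 2))); last first.
  by apply/funext => s; rewrite mulrC opprD addrA.
apply: is_derive_eq; rewrite /GRing.scale/= opprD addrA invfM; field; exact: lt0r_neq0.
Qed.

Lemma ramp_continuous e c : continuous (fun t => ramp e (t - c)).
Proof.
move=> t; apply: cvgMl; apply: cvgB.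
  apply: (continuous_comp (f := fun t => t - c)); last exact: pos_part_continuous.
  by apply: cvgB; [exact: cvg_id|exact: cvg_cst].
apply: (continuous_comp (f := fun t => t - c - e)); last exact: pos_part_continuous.
by do 2 (apply: cvgB; last exact: cvg_cst); exact: cvg_id.
Qed.

Lemma ramp_bounds e t : 0 < e ->
  [/\ 0 <= ramp e t <= 1, t <= 0 -> ramp e t = 0, e <= t -> ramp e t = 1,
   t <= 0 -> ramp_primitive e t = 0 & e <= t -> ramp_primitive e t = t - e / 2].
Proof.
move=> e0; have en := lt0r_neq0 e0.
rewrite /ramp /ramp_primitive /pos_part divr_ge0 ?ler_pdivrMr ?mul1r ?(ltW e0)//; last first.
  by case: (leP 0 t) => ?; case: (leP 0 (t - e)) => ?; lra.
split.
- by case: (leP 0 t) => ?; case: (leP 0 (t - e)) => ?; lra.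
- by move=> t0; rewrite !max_l ?subrr ?mul0r//; lra.
- by move=> et; rewrite !max_r; [field|lra|lra].
- by move=> t0; rewrite !max_l ?subrr ?mul0r//; lra.
- by move=> et; rewrite !max_r; [field|lra|lra].
Qed.

Lemma ramp_cvg_integral a b c w (e : R) : a <= c < b -> 0 < e ->
  leb.-integrable `[a, b] (EFin \o w) ->
  (fun n => \int[leb]_(t in `[a, b]) (w t * ramp (e / n.+1%:R) (t - c))) @ \oo -->
  \int[leb]_(t in `[c, b]) w t.
Proof.
move=> /andP[ac cb] e0 iw.
have en n : 0 < e / n.+1%:R by rewrite divr_gt0.
have mw : measurable_fun `[a, b] w by apply/measurable_EFinP; exact: measurable_int iw.
have m1 : measurable_fun `[a, b] (fun t => w t * (c < t)%O%:R).
  apply: measurable_funM; first exact: mw.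
  rewrite (_ : (fun t => _) = \1_`]c, +oo[); first exact: measurable_indic.
  by apply/funext => t; rewrite indicE mem_setE in_itv/= andbT.
have -> : \int[leb]_(t in `[c, b]) w t = \int[leb]_(t in `[a, b]) (w t * (c < t)%O%:R).
  have icb : leb.-integrable `[c, b] (EFin \o w) by apply: integrable_itvS iw _; exact: itvcc_sub.
  rewrite -Rintegral_itv_obnd_cbnd; last first.
    by apply: integrable_itvS icb _; apply: subset_itv; rewrite bnd_simp.
  rewrite Rintegral_mkcond [RHS]Rintegral_mkcond; apply: eq_Rintegral => t _.
  rewrite !patchE !mem_setE !in_itv/=; have [ct|ct] := ltP c t; last by rewrite mulr0 if_same.
  by rewrite mulr1 (le_trans ac (ltW ct)).
apply: (@Rintegral_dominated _ _ _ (fun t => `|w t|)); first exact: measurable_itv.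
- move=> n; apply: measurable_funM; first exact: mw.
  by apply: measurable_funTS; apply: continuous_measurable_fun; exact: ramp_continuous.
- exact: m1.
- exact: integrable_norm iw.
- move=> t _; apply: cvgMr.
  have [ct|tc] := ltP c t; last first.
    rewrite (_ : (fun n => _) = fun=> 0); first exact: cvg_cst.
    by apply/funext => n; have [_ -> //] := ramp_bounds (t - c) (en n); rewrite subr_le0.
  apply: (cvg_near_cst); near=> n.
  have [_ _ + _ _] := ramp_bounds (t - c) (en n); apply.
  rewrite ler_pdivrMr// mulrC -ler_pdivrMr ?subr_gt0//.
  by rewrite (@le_trans _ _ n%:R) ?ler_nat//; near: n; exact: nbhs_infty_ger.
- move=> n t _; rewrite normrM ler_piMr//; have [/andP[r0 r1] _ _ _ _] := ramp_bounds (t - c) (en n).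
  by rewrite ger0_norm.
Unshelve. all: by end_near. Qed.

(** Test functions are built from primitives of ramps, and the width of the ramps tends to 0. As the
    derivative has integral zero, its primitive vanishes on both sides and has compact support. *)
Lemma weak_translation a b w s t h :
  (forall phi, test_fun `]a, b[ phi ->
    \int[leb]_(r in `[a, b]) (w r * derive1 phi r) = 0) ->
  leb.-integrable `[a, b] (EFin \o w) ->
  a < s < b -> a < t < b -> a < s + h < b -> a < t + h < b ->
  \int[leb]_(r in `[a, s + h]) w r - \int[leb]_(r in `[a, s]) w r =
  \int[leb]_(r in `[a, t + h]) w r - \int[leb]_(r in `[a, t]) w r.
Proof.
move=> hw iw sab tab shab thab.
pose m := Num.min (Num.min s t) (Num.min (s + h) (t + h)).
pose M := Num.max (Num.max s t) (Num.max (s + h) (t + h)).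
have [am Mb] : a < m /\ M < b.
  by rewrite !lt_min !gt_max; move: sab tab shab thab => /andP[-> ->] /andP[-> ->] /andP[-> ->] /andP[-> ->].
have mall : [/\ m <= s, m <= t, m <= s + h & m <= t + h].
  by rewrite /m !ge_min !lexx !orbT; split.
have Mall : [/\ s <= M, t <= M, s + h <= M & t + h <= M].
  by rewrite /M !le_max !lexx !orbT; split.
(* Ramps extend to the right of their starting points, so the room left of [b] limits their
   width. *)
have [e e0 eb] : exists2 e, 0 < e & M + e < b by exists ((b - M) / 2); lra.
have ab : a < b by move: sab => /andP[]; exact: lt_trans.
have mw : measurable_fun `[a, b] w by apply/measurable_EFinP; exact: measurable_int iw.
pose d n := e / n.+1%:R.
have d0 n : 0 < d n by rewrite divr_gt0.
have de n : d n <= e by rewrite ler_pdivrMr// ler_peMr ?ler1n// ltW.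
pose J n c := \int[leb]_(r in `[a, b]) (w r * ramp (d n) (r - c)).
have iJ n c : leb.-integrable `[a, b] (EFin \o (fun r => w r * ramp (d n) (r - c))).
  apply: (le_integrable _ _ _ iw); first exact: measurable_itv.
    apply/measurable_EFinP; apply: measurable_funM; first exact: mw.
    by apply: measurable_funTS; apply: continuous_measurable_fun; exact: ramp_continuous.
  move=> r _; rewrite /= lee_fin normrM ler_piMr//.
  by have [/andP[r0 r1] _ _ _ _] := ramp_bounds (r - c) (d0 n); rewrite ger0_norm.
have key n : J n s - J n (s + h) = J n t - J n (t + h).
  pose k c r := ramp_primitive (d n) (r - c).
  have dk c r : is_derive r 1 (k c) (ramp (d n) (r - c)) by exact: ramp_primitive_derive.
  (* phi' is a trapezoid on [s, s + h] minus its translate to [t, t + h]. *)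
  pose phi r := k s r - k (s + h) r - (k t r - k (t + h) r).
  have dphi r : is_derive r 1 phi (ramp (d n) (r - s) - ramp (d n) (r - (s + h)) -
      (ramp (d n) (r - t) - ramp (d n) (r - (t + h)))).
    exact: (is_deriveB (is_deriveB (dk s r) (dk (s + h) r)) (is_deriveB (dk t r) (dk (t + h) r))).
  have phiE : (derive1 phi) = fun r => ramp (d n) (r - s) - ramp (d n) (r - (s + h)) -
      (ramp (d n) (r - t) - ramp (d n) (r - (t + h))).
    by apply/funext => r; rewrite derive1E; have [_ ->] := dphi r.
  have := hw phi; rewrite phiE => h0.
  suff : J n s - J n (s + h) - (J n t - J n (t + h)) = 0 by move/eqP; rewrite subr_eq0 => /eqP.
  rewrite -{}h0.
    rewrite /J -RintegralB; [|exact: measurable_itv|exact: iJ|exact: iJ].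
    rewrite -RintegralB; [|exact: measurable_itv|exact: iJ|exact: iJ].
    rewrite -RintegralB; [|exact: measurable_itv| |].
    - by apply: eq_Rintegral => r _; rewrite !mulrBr.
    - exact: (integrableB _ (iJ n s) (iJ n (s + h))).
    - exact: (integrableB _ (iJ n t) (iJ n (t + h))).
  split; [by move=> r; have [] := dphi r| |].
    by rewrite phiE => r; apply: cvgB; apply: cvgB; exact: ramp_continuous.
  exists `[m, M + e]%classic; split; first exact: segment_compact.
    by move=> r /=; rewrite !in_itv/= => /andP[r1 r2]; lra.
  move=> r /=; rewrite in_itv/= => /negP; rewrite negb_and -!ltNge => rK.
    case: mall Mall => m1 m2 m3 m4 [M1 M2 M3 M4].
    rewrite /phi /k; case/orP: rK => rK.
      have z c : m <= c -> ramp_primitive (d n) (r - c) = 0.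
        by move=> mc; have [_ _ _ + _] := ramp_bounds (r - c) (d0 n); apply; lra.
      by rewrite !z// !subr0.
    have z c : c <= M -> ramp_primitive (d n) (r - c) = r - c - d n / 2.
      by move=> cM; have [_ _ _ _] := ramp_bounds (r - c) (d0 n); apply; have := de n; lra.
    by rewrite !z//; ring.
have Jc c : a < c < b -> (J^~ c) @ \oo --> \int[leb]_(r in `[c, b]) w r.
  by move=> /andP[ac cb]; apply: ramp_cvg_integral => //; rewrite (ltW ac).
have lim1 : (fun n => J n s - J n (s + h)) @ \oo -->
    \int[leb]_(r in `[s, b]) w r - \int[leb]_(r in `[s + h, b]) w r.
  by apply: cvgB; apply: Jc.
have lim2 : (fun n => J n t - J n (t + h)) @ \oo -->
    \int[leb]_(r in `[t, b]) w r - \int[leb]_(r in `[t + h, b]) w r.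
  by apply: cvgB; apply: Jc.
have : \int[leb]_(r in `[s, b]) w r - \int[leb]_(r in `[s + h, b]) w r =
    \int[leb]_(r in `[t, b]) w r - \int[leb]_(r in `[t + h, b]) w r.
  by rewrite -(cvg_lim (@Rhausdorff R) lim1) -(cvg_lim (@Rhausdorff R) lim2) (funext key).
have split c : a < c < b -> \int[leb]_(r in `[c, b]) w r =
    \int[leb]_(r in `[a, b]) w r - \int[leb]_(r in `[a, c]) w r.
  by move=> /andP[ac cb]; rewrite (@Rintegral_split _ a c b w _ iw) ?(ltW ac) ?(ltW cb)//; ring.
rewrite (split s sab) (split _ shab) (split t tab) (split _ thab).
move: (\int[leb]_(r in `[a, s]) w r) (\int[leb]_(r in `[a, s + h]) w r).
move: (\int[leb]_(r in `[a, t]) w r) (\int[leb]_(r in `[a, t + h]) w r).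
by move: (\int[leb]_(r in `[a, b]) w r) => p q u v k; clear -p q u v k; lra.
Qed.

(** By [weak_translation] the primitive of [w] has the same difference quotients at all points,
    hence the same derivative wherever it is differentiable, and this derivative is [w] almost
    everywhere. *)
Lemma weak_const a b w : a < b ->
  (forall phi, test_fun `]a, b[ phi ->
    \int[leb]_(r in `[a, b]) (w r * derive1 phi r) = 0) ->
  leb.-integrable `[a, b] (EFin \o w) ->
  exists c, {ae leb, forall t, a < t < b -> w t = c}.
Proof.
move=> ab hw iw.
have [W [hW WE]] : exists W, rAC a b W w /\ forall t, W t = \int[leb]_(r in `[a, t]) w r.
  by eexists; split=> [|t]; [exact: (integrable_rAC 0 iw)|exact: add0r].
have dW := rAC_derive hW.
have [s /andP[as_ sb] [ds ws]] := ae_exists_itv ab dW.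
exists (w s).
apply: filterS dW; first exact: (ae_filter_ringOfSetsType leb).
move=> t h /andP[at_ tb]; have [|dt <-] := h; first by rewrite at_.
rewrite -ws !derive1E.
apply: cvg_lim; first exact: Rhausdorff.
apply: cvg_trans ds; apply: near_eq_cvg; near=> k.
rewrite !scaler1 /=; congr (_ *: _).
have k1 : `|k| < Num.min (Num.min (s - a) (b - s)) (Num.min (t - a) (b - t)).
  near: k; apply: dnbhs0_lt; rewrite !lt_min !subr_gt0.
  by rewrite as_ sb at_ tb.
move: k1; rewrite !lt_min !ltr_norml => /andP[/andP[/andP[? ?] /andP[? ?]] /andP[/andP[? ?] /andP[? ?]]].
rewrite !WE ![k + _]addrC.
by apply: (weak_translation hw iw); apply/andP; split; lra.
Unshelve. all: by end_near. Qed.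

(** The difference of [f] and a primitive of [u] has zero weak derivative, so it is constant almost
    everywhere. *)
Lemma weak_rAC a b f u : a < b -> leb.-integrable `[a, b] (EFin \o f) ->
  leb.-integrable `[a, b] (EFin \o u) ->
  (forall phi, test_fun `]a, b[ phi ->
    \int[leb]_(r in `[a, b]) (f r * derive1 phi r) = - \int[leb]_(r in `[a, b]) (u r * phi r)) ->
  exists F, rAC a b F u /\ {ae leb, forall t, a < t < b -> f t = F t}.
Proof.
move=> ab if_ iu hf.
have [V [hV VE]] : exists V, rAC a b V u /\ forall t, V t = \int[leb]_(r in `[a, t]) u r.
  by eexists; split=> [|t]; [exact: (integrable_rAC 0 iu)|exact: add0r].
have iV : leb.-integrable `[a, b] (EFin \o V).
  apply: continuous_compact_integrable; first exact: segment_compact.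
  exact: rAC_within_continuous (ltW ab) hV.
have iw : leb.-integrable `[a, b] (EFin \o (fun t => f t - V t)).
  exact: (integrableB _ if_ iV).
have [|c hc] := @weak_const a b (fun t => f t - V t) ab _ iw.
  move=> phi tphi; have [dphi cphi [K [cK Kab phi0]]] := tphi.
  have hphi := rAC_C1 (ltW ab) dphi cphi.
  have [i1 i2 e] := rAC_parts (ltW ab) hV hphi.
  have phia : phi a = 0 by apply: phi0 => /Kab/=; rewrite in_itv/= ltxx.
  have phib' : phi b = 0 by apply: phi0 => /Kab/=; rewrite in_itv/= ltxx andbF.
  have e' : \int[leb]_(r in `[a, b]) (V r * derive1 phi r) = - \int[leb]_(r in `[a, b]) (u r * phi r).
    by move: e; rewrite phia phib' !mulr0 subr0 => /eqP; rewrite addrC addr_eq0 => /eqP.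
  have [C hC] : exists C, forall t, a <= t <= b -> `|derive1 phi t| <= C.
    have [c cab hc] := EVT_max (ltW ab) (continuous_subspaceT (fun x => cvg_norm (cphi x))).
    by exists `|(derive1 phi) c| => t tab; apply: hc; rewrite in_itv.
  have i3 : leb.-integrable `[a, b] (EFin \o (fun r => f r * derive1 phi r)).
    have iCf : leb.-integrable `[a, b] (EFin \o (fun r => C * f r)).
      exact: (integrableZl _ C if_).
    apply: (le_integrable _ _ _ iCf); first exact: measurable_itv.
      apply/measurable_EFinP; apply: measurable_funM.
        by apply/measurable_EFinP; exact: measurable_int if_.
      by apply: measurable_funTS; exact: continuous_measurable_fun.
    move=> r rab; have {}rab : a <= r <= b by move: rab; rewrite /= in_itv.
    have C0 := le_trans (normr_ge0 _) (hC r rab).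
    by rewrite /= lee_fin !normrM mulrC ler_wpM2r// (ger0_norm C0) hC.
  rewrite (_ : (fun r => _) = (fun r => f r * derive1 phi r - V r * derive1 phi r)); last first.
    by apply/funext => r; rewrite mulrBl.
  rewrite RintegralB; [|exact: measurable_itv|exact: i3|exact: i2].
  by rewrite (hf phi tphi) e' subrr.
exists (fun t => c + \int[leb]_(r in `[a, t]) u r); split; first exact: integrable_rAC.
apply: filterS hc; first exact: (ae_filter_ringOfSetsType leb).
by move=> t h /h <-; rewrite VE subrK.
Qed.

End weak_derivatives.

Section complex_weak.
Context {R : realType}.
Notation leb := (@lebesgue_measure R).
Implicit Types (a b c t r s : R).

Lemma integrable_cat a c b (u : R -> R) : a <= c -> c <= b ->
  leb.-integrable `[a, c] (EFin \o u) -> leb.-integrable `[c, b] (EFin \o u) ->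
  leb.-integrable `[a, b] (EFin \o u).
Proof.
move=> ac cb i1 i2.
have m1 : measurable (`[a, c]%classic : set R) by exact: measurable_itv.
have m2 : measurable (`]c, b]%classic : set R) by exact: measurable_itv.
have m3 : measurable (`[a, b]%classic : set R) by exact: measurable_itv.
have i2' : leb.-integrable `]c, b] (EFin \o u).
  by apply: integrable_itvS i2 _; apply: subset_itv; rewrite bnd_simp.
have j1 := iffLR (integrable_patch u m1) i1; have j2 := iffLR (integrable_patch u m2) i2'.
apply: iffRL (integrable_patch u m3) _.
rewrite (_ : EFin \o _ = EFin \o (fun t => (u \_ `[a, c]) t + (u \_ `]c, b]) t)).
  exact: (integrableD _ j1 j2).
apply/funext => t /=; congr EFin; rewrite !patchE !mem_setE !in_itv/=.
have [tc|ct] := leP t c; first by rewrite andbT addr0 (le_trans tc cb) andbT.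
by rewrite andbF add0r (ltW (le_lt_trans ac ct)).
Qed.

Lemma rAC_cat a c b (F u : R -> R) : a <= c -> c <= b -> rAC a c F u -> rAC c b F u -> rAC a b F u.
Proof.
move=> ac cb [i1 h1] [i2 h2].
have iu := integrable_cat ac cb i1 i2.
split; first exact: iu.
move=> t /andP[at_ tb]; have [tc|ct] := leP t c; first by apply: h1; rewrite at_.
rewrite h2 ?(ltW ct)// h1 ?ac ?lexx// -addrA; congr (_ + _).
rewrite (@Rintegral_split _ a c t) ?ac ?(ltW ct)//.
by apply: integrable_itvS iu _; exact: itvcc_sub.
Qed.

Lemma cAC_cat a c b (F u : R -> R[i]) : a <= c -> c <= b ->
  cAC a c F u -> cAC c b F u -> cAC a b F u.
Proof. by move=> ac cb [h1 h2] [h3 h4]; split;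
  [exact: (rAC_cat ac cb h1 h3)|exact: (rAC_cat ac cb h2 h4)]. Qed.

Lemma cAC_ext_deriv a b (F u v : R -> R[i]) : (forall t, a < t < b -> u t = v t) ->
  cAC a b F u -> cAC a b F v.
Proof. by move=> uv [h1 h2]; split; [apply: rAC_ext_deriv h1|apply: rAC_ext_deriv h2] => t /uv ->. Qed.

(** The interval is bounded, so 1 + |f|^2 is an integrable majorant. *)
Lemma L2on_cintegrable a b (f : R -> R[i]) : L2on leb `]a, b[ f -> cintegrable leb `[a, b] f.
Proof.
move=> [[m1 m2] fi].
have mI : measurable (`]a, b[%classic : set R) by exact: measurable_itv.
have isq : leb.-integrable `]a, b[ (EFin \o (fun t => sqn (f t))).
  apply/integrableP; split.
    by apply/measurable_EFinP; apply: (L2on_sqn_measurable (conj m1 m2)).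
  under eq_integral => t _ do rewrite gee0_abs ?lee_fin ?sqn_ge0//.
  exact: fi.
have i1 : leb.-integrable `]a, b[ (EFin \o (fun=> 1 : R)).
  apply/integrableP; split; first by apply/measurable_EFinP; exact: measurable_cst.
  under eq_integral => t _ do rewrite /= normr1.
  rewrite integral_cst//= mul1e lebesgue_measure_itv/=; case: ifP => _; rewrite ltry//.
have i2 : leb.-integrable `]a, b[ (EFin \o (fun t => 1 + sqn (f t))) by exact: (integrableD _ i1 isq).
have p0 t : 0 <= 1 + sqn (f t) by exact: (addr_ge0 ler01 (sqn_ge0 _)).
have dom (g : R -> R) : measurable_fun `]a, b[ g -> (forall t, g t ^+ 2 <= sqn (f t)) ->
    leb.-integrable `[a, b] (EFin \o g).
  move=> mg gf; apply: integrable_oo_cc; apply: (le_integrable _ _ _ i2); first exact: mI.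
    exact/measurable_EFinP.
  move=> t _; rewrite /= lee_fin [leRHS](ger0_norm (p0 t)).
  have := gf t; have := sqr_ge0 (g t - 1); have := sqr_ge0 (g t + 1).
  by move: (g t) (sqn (f t)) => p q *; rewrite ler_norml; apply/andP; split; nra.
by split; apply: dom => // t; rewrite /sqn ?lerDl ?lerDr sqr_ge0.
Qed.

Lemma cint_real_mul (D : set R) (f : R -> R[i]) (phi : R -> R) :
  cint leb D (fun t => f t * (phi t)%:C) =
  (\int[leb]_(t in D) (Re (f t) * phi t)) +i* (\int[leb]_(t in D) (Im (f t) * phi t)).
Proof.
by rewrite /cint; congr (_ +i* _); apply: eq_Rintegral => t _; rewrite ?ReM ?ImM/= mulr0;
  rewrite ?subr0 ?add0r.
Qed.

Lemma weak_deriv_cAC a b (f f1 : R -> R[i]) : a < b -> L2on leb `]a, b[ f ->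
  L2on leb `]a, b[ f1 -> weak_deriv `]a, b[ f f1 ->
  exists F, cAC a b F f1 /\ {ae leb, forall t, a < t < b -> f t = F t}.
Proof.
move=> ab Lf Lf1 wd.
have [i1 i2] := L2on_cintegrable Lf; have [j1 j2] := L2on_cintegrable Lf1.
have bnd (g phi : R -> R) : leb.-integrable `[a, b] (EFin \o g) -> continuous phi ->
    leb.-integrable `[a, b] (EFin \o (fun t => g t * phi t)).
  move=> ig cphi.
  have [C hC] : exists C, forall t, a <= t <= b -> `|phi t| <= C.
    have [c cab hc] := EVT_max (ltW ab) (continuous_subspaceT (fun x => cvg_norm (cphi x))).
    by exists `|phi c| => t tab; apply: hc; rewrite in_itv.
  have iCg : leb.-integrable `[a, b] (EFin \o (fun r => C * g r)) by exact: (integrableZl _ C ig).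
  apply: (le_integrable _ _ _ iCg); first exact: measurable_itv.
    apply/measurable_EFinP; apply: measurable_funM.
      by apply/measurable_EFinP; exact: measurable_int ig.
    by apply: measurable_funTS; exact: continuous_measurable_fun.
  move=> r rab; have {}rab : a <= r <= b by move: rab; rewrite /= in_itv.
  have C0 := le_trans (normr_ge0 _) (hC r rab).
  by rewrite /= lee_fin !normrM mulrC ler_wpM2r// (ger0_norm C0) hC.
have key (p : R[i] -> R) : leb.-integrable `[a, b] (EFin \o (fun t => p (f t))) ->
    leb.-integrable `[a, b] (EFin \o (fun t => p (f1 t))) ->
    (forall phi, test_fun `]a, b[ phi ->
      \int[leb]_(t in `]a, b[) (p (f t) * derive1 phi t) =
      - \int[leb]_(t in `]a, b[) (p (f1 t) * phi t)) ->
    exists F, rAC a b F (fun t => p (f1 t)) /\ {ae leb, forall t, a < t < b -> p (f t) = F t}.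
  move=> ip ip1 h; apply: (weak_rAC ab ip ip1) => phi tphi.
  have [dphi cphi _] := tphi.
  have cphi0 : continuous phi.
    by move=> t; apply/differentiable_continuous/derivable1_diffP.
  by have := h phi tphi; rewrite (Rintegral_oo_cc (bnd _ _ ip cphi)) (Rintegral_oo_cc (bnd _ _ ip1 cphi0)).
have [phi tphi|F1 [A1 E1]] := key (fun z => Re z) i1 j1.
  by have := wd phi tphi; rewrite !cint_real_mul => -[].
have [phi tphi|F2 [A2 E2]] := key (fun z => Im z) i2 j2.
  by have := wd phi tphi; rewrite !cint_real_mul => -[].
exists (fun t => F1 t +i* F2 t); split; first by split.
have fae := ae_filter_ringOfSetsType leb.
by apply: filterS2 E1 E2 => t h1 h2 tab; apply: complex_ext; rewrite /= -?h1// -?h2.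
Qed.

(** Each test function sees only a compact set, so a representative on one bounded interval around
    it suffices, even for the whole line. *)
Lemma cAC_weak_deriv (D : set R) (f f1 : R -> R[i]) : measurable D -> cmeasurable D f ->
  (forall K, compact K -> K `<=` D -> exists a b F, [/\ a <= b, K `<=` `]a, b[%classic,
    `]a, b[%classic `<=` D, cAC a b F f1 & {ae leb, forall t, a < t < b -> f t = F t}]) ->
  weak_deriv D f f1.
Proof.
move=> mD [m1 m2] h phi [dphi cphi [K [cK KD phi0]]].
have [a [b [F [ab Kab abD [A1 A2] fF]]]] := h K cK KD.
have clK : closed K by apply: compact_closed; [exact: Rhausdorff|exact: cK].
have fae := ae_filter_ringOfSetsType leb.
have ms (g : R -> R) : measurable_fun D g -> measurable_fun `]a, b[ g by exact: measurable_funS.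
have fF1 : {ae leb, forall t, a < t < b -> Re (f t) = Re (F t)}.
  by apply: filterS fF => t ht /ht ->.
have fF2 : {ae leb, forall t, a < t < b -> Im (f t) = Im (F t)}.
  by apply: filterS fF => t ht /ht ->.
have E1 := weak_local ab mD abD A1 fF1 (ms _ m1) dphi cphi clK Kab phi0.
have E2 := weak_local ab mD abD A2 fF2 (ms _ m2) dphi cphi clK Kab phi0.
by rewrite !cint_real_mul; apply: complex_ext; [exact: E1|exact: E2].
Qed.

Lemma cvg_cabsP (T : Type) (Fi : set_system T) (FF : Filter Fi) (f : T -> R[i]) (v : R[i]) :
  (f t : R[i]^o) @[t --> Fi] --> (v : R[i]^o) <->
  forall e : R, 0 < e -> \forall t \near Fi, cabs (v - f t) < e.
Proof.
have cE (z : R[i]) : `|z| = (cabs z)%:C by case: z => p q; rewrite normc_def.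
split=> [/cvgrPdist_lt h e e0|h].
  have := h e%:C; rewrite ltcR => /(_ e0); apply: filterS => t.
  by rewrite /= cE ltcR.
apply/cvgrPdist_lt => e e0.
have [re ie] : 0 < Re e /\ Im e = 0 by move: e0; rewrite ltcE/= => /andP[/eqP -> ->].
have eE : e = (Re e)%:C by apply: complex_ext.
by have := h _ re; apply: filterS => t; rewrite /= cE eE ltcR.
Qed.

Lemma traceP (D : set R) (f : R -> R[i]) c v : trace D f c v <->
  exists F, {ae leb, forall t, D t -> F t = f t} /\
    forall e, 0 < e -> exists2 r, 0 < r & forall t, D t -> `|c - t| < r -> cabs (v - F t) < e.
Proof.
split=> -[F [FE h]]; exists F; split => //.
  move=> e e0; move/cvg_cabsP : h => /(_ _ e0)/nbhs_ballP[r/= r0 hr].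
  by exists r => // t Dt ct; apply: hr.
apply/cvg_cabsP => e e0; have [r r0 hr] := h e e0.
by apply/nbhs_ballP; exists r => // t /= ct Dt; exact: hr.
Qed.

Lemma trace_sub (D E : set R) (f : R -> R[i]) c v : D `<=` E -> trace E f c v -> trace D f c v.
Proof.
move=> DE /traceP[F [FE h]]; apply/traceP; exists F; split.
  by apply: filterS FE => [|t ht /DE]; [exact: (ae_filter_ringOfSetsType leb)|exact: ht].
by move=> e /h[r r0 hr]; exists r => // t /DE; exact: hr.
Qed.

Lemma cAC_modulus a b t e (F u : R -> R[i]) : a < b -> cAC a b F u -> a <= t <= b -> 0 < e ->
  exists2 r, 0 < r & forall s, a <= s <= b -> `|t - s| < r -> cabs (F t - F s) < e.
Proof.
move=> ab [h1 h2] tab e0; have e2 : 0 < e / 2 by lra.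
have [r1 r10 H1] := rAC_modulus ab h1 tab e2; have [r2 r20 H2] := rAC_modulus ab h2 tab e2.
exists (Num.min r1 r2) => [|s sab]; first by rewrite lt_min r10.
rewrite lt_min => /andP[d1 d2].
have := H1 s sab d1; have := H2 s sab d2; rewrite -ReB -ImB => l2 l1.
set z := F t - F s in l1 l2 *.
have -> : z = (Re z)%:C + 'i%C * (Im z)%:C.
  by apply: complex_ext; rewrite ?ReD ?ImD ?ReM ?ImM/=; ring.
rewrite (le_lt_trans (cabsD _ _))// cabsM !cabsr.
have -> : cabs 'i%C = 1 :> R by rewrite /cabs /sqn/= expr0n/= add0r expr1n sqrtr1.
by rewrite mul1r; lra.
Qed.

(** A trace may use any representative; two of them agree at points arbitrarily close to [c], which
    forces equal limits, also at an endpoint. *)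
Lemma trace_cAC a b c (f F u : R -> R[i]) v : a < b -> cAC a b F u ->
  {ae leb, forall t, a < t < b -> f t = F t} -> a <= c <= b ->
  trace `]a, b[ f c v <-> v = F c.
Proof.
move=> ab hF fF cab; split=> [/traceP[G [GE hG]]|->]; last first.
  apply/traceP; exists F; split.
    apply: filterS fF; first exact: (ae_filter_ringOfSetsType leb).
    by move=> t h /=; rewrite in_itv/= => /h ->.
  move=> e e0; have [r r0 hr] := cAC_modulus ab hF cab e0.
  exists r => // t /=; rewrite in_itv/= => /andP[t1 t2]; apply: hr.
  by rewrite (ltW t1) (ltW t2).
apply/eqP; rewrite -subr_eq0; apply/eqP/cabs_eq0/eqP; rewrite eq_le cabs_ge0 andbT.
apply/ler_addgt0Pr => e e0; rewrite add0r.
have e2 : 0 < e / 2 by lra.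
have [r1 r10 H1] := hG _ e2; have [r2 r20 H2] := cAC_modulus ab hF cab e2.
have r0 : 0 < Num.min r1 r2 by rewrite lt_min r10.
have fae := ae_filter_ringOfSetsType leb.
have GF : {ae leb, forall t, a < t < b -> G t = F t}.
  by apply: filterS2 GE fF => t h1 h2 tab; rewrite h1 ?h2//= in_itv.
have [s [sab + GFs]] := ae_exists_near ab cab r0 GF.
rewrite lt_min => /andP[d1 d2].
have l1 : cabs (v - G s) < e / 2 by apply: H1 => //=; rewrite in_itv.
have l2 : cabs (F c - F s) < e / 2.
  by apply: H2 => //; move: sab => /andP[/ltW -> /ltW ->].
have -> : v - F c = (v - G s) + - (F c - F s) by rewrite GFs opprB addrA subrK.
by rewrite (le_trans (cabsD _ _))// cabsN; lra.
Qed.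

End complex_weak.

(** * The maximal domain and its Green identity *)

Section nodes.
Context {R : realType}.
Notation leb := (@lebesgue_measure R).
Variables (x : int -> R) (d : R).
Hypotheses (x_incr : forall m n : int, m < n -> x m < x n) (d_gt0 : 0 < d)
  (x_gap : forall n, d <= x (n + 1) - x n).
Implicit Types (h : R -> R) (n : int) (N : nat) (t : R).

Lemma node_lt n : x n < x (n + 1). Proof. by apply: x_incr; rewrite ltrDl. Qed.

Lemma node_le m n : m <= n -> x m <= x n.
Proof. by rewrite le_eqVlt => /predU1P[->//|/x_incr/ltW]. Qed.

Lemma NegzD1 N : Negz N + 1 = - Posz N. Proof. by rewrite NegzE -addn1 PoszD opprD subrK. Qed.

Lemma PoszS N : Posz N + 1 = Posz N.+1. Proof. by rewrite -PoszD addn1. Qed.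

Lemma node_bounds N : x 0 + d * N%:R <= x (Posz N) /\ x (- Posz N) <= x 0 - d * N%:R.
Proof.
elim: N => [|N [ih1 ih2]]; first by rewrite mulr0 addr0 oppr0 subr0.
rewrite -!natr1 !mulrDr !mulr1; have := x_gap (Posz N); have := x_gap (Negz N).
by rewrite NegzD1 PoszS -NegzE; lra.
Qed.

Lemma node_cover t : exists N, x (- Posz N) < t < x (Posz N).
Proof.
have /archi_boundP : 0 <= (`|t - x 0| + 1) / d by rewrite divr_ge0 ?addr_ge0// ltW.
set N := Num.bound _; rewrite ltr_pdivrMr// => h.
exists N; have [h1 h2] := node_bounds N.
have /andP[] : - `|t - x 0| <= t - x 0 <= `|t - x 0| by rewrite -ler_norml.
by move: h; rewrite mulrC; lra.
Qed.

Lemma node_index t : exists n, x n <= t < x (n + 1).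
Proof.
have [N /andP[t1 t2]] := node_cover t.
have step k : t < x (- Posz N + Posz k) -> exists n, x n <= t < x (n + 1).
  elim: k => [|k ih]; first by rewrite addr0 => h; move: (lt_trans t1 h); rewrite ltxx.
  have [/ih//|h1 h2] := ltP t (x (- Posz N + Posz k)).
  by exists (- Posz N + Posz k); rewrite h1 -addrA PoszS.
by apply: (step (N + N)%N); rewrite PoszD addrA addNr add0r.
Qed.

Lemma node_index_unique m n t : x m <= t < x (m + 1) -> x n <= t < x (n + 1) -> m = n.
Proof.
move=> /andP[m1 m2] /andP[n1 n2]; apply/eqP; rewrite eq_le -!ltzD1.
by apply/andP; split; rewrite ltNge; apply/negP => /node_le; lra.
Qed.

(** The union of the closed gaps with indices in [-N, N - 1], matching the partial sums
    [zseries]. *)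
Definition window N : set R := `[x (- Posz N), x (Posz N)].

Lemma window_cover : \bigcup_N window N = setT.
Proof.
apply/seteqP; split=> // t _; have [N /andP[t1 t2]] := node_cover t.
by exists N => //; rewrite /window/= in_itv/= (ltW t1) (ltW t2).
Qed.

Lemma node_opp_le N : x (- Posz N) <= x (Posz N).
Proof. by apply: node_le; lia. Qed.

Lemma window_nondecreasing : nondecreasing_seq window.
Proof.
move=> m n mn; apply/subsetPset => t; rewrite /window/= !in_itv/= => /andP[t1 t2].
by rewrite (le_trans _ t1) ?(le_trans t2)//; apply: node_le; lia.
Qed.

Lemma window_integral h N : leb.-integrable (window N) (EFin \o h) ->
  \int[leb]_(t in window N) h t = zseries (fun n => \int[leb]_(t in `[x n, x (n + 1)]) h t) N.
Proof.
elim: N => [|N ih] ih1.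
  by rewrite zseries0 /window oppr0 set_itv1 Rintegral_set1.
have e1 : x (- Posz N.+1) <= x (- Posz N) by apply: node_le; lia.
have e2 : x (Posz N) <= x (Posz N.+1) by apply: node_le; lia.
have e3 := node_opp_le N.
have ihN : leb.-integrable (window N) (EFin \o h).
  by apply: integrable_itvS ih1 _; exact: itvcc_sub.
have ih2 : leb.-integrable `[x (- Posz N), x (Posz N.+1)] (EFin \o h).
  by apply: integrable_itvS ih1 _; exact: itvcc_sub.
rewrite zseriesS -(ih ihN) /window (@Rintegral_split _ _ (x (- Posz N)) _ h _ ih1); last first.
  by rewrite e1 (le_trans e3).
rewrite (@Rintegral_split _ _ (x (Posz N)) _ h _ ih2); last by rewrite e3.
by rewrite NegzD1 PoszS NegzE addrC addrA.
Qed.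

Lemma window_cvg h : leb.-integrable setT (EFin \o h) ->
  (fun N => \int[leb]_(t in window N) h t) @ \oo --> \int[leb]_t h t.
Proof.
move=> ih; have mh : measurable_fun setT h by apply/measurable_EFinP; exact: measurable_int ih.
have mW N : measurable (window N) by exact: measurable_itv.
rewrite (_ : (fun N => _) = (fun N => \int[leb]_t (h \_ (window N)) t)); last first.
  by apply/funext => N; rewrite Rintegral_mkcond.
apply: (@Rintegral_dominated _ _ _ _ (fun t => `|h t|)); first exact: measurableT.
- move=> N; apply/(measurable_restrictT _ (mW N)).
  exact: measurable_funTS.
- exact: mh.
- exact: integrable_norm ih.
- move=> t _; apply: cvg_near_cst; have [M /andP[t1 t2]] := node_cover t.
  exists M => // N /= MN; rewrite patchE ifT//; apply/mem_set.
  have /subsetPset := window_nondecreasing MN; apply.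
  by rewrite /window/= in_itv/= (ltW t1) (ltW t2).
- by move=> N t _; rewrite patchE; case: ifP => // _; rewrite normr0.
Qed.

Lemma zseries_gap_cvg h : leb.-integrable setT (EFin \o h) ->
  (fun N => zseries (fun n => \int[leb]_(t in `[x n, x (n + 1)]) h t) N) @ \oo --> \int[leb]_t h t.
Proof.
move=> ih; have := window_cvg ih; rewrite (_ : (fun N => _) = (fun N =>
  zseries (fun n => \int[leb]_(t in `[x n, x (n + 1)]) h t) N)) //.
apply/funext => N; apply: window_integral.
by apply: (integrableS _ _ _ ih) => //; exact: measurable_itv.
Qed.

Lemma zsummable_gap h : (forall t, 0 <= h t) -> leb.-integrable setT (EFin \o h) ->
  zsummable (fun n => \int[leb]_(t in `[x n, x (n + 1)]) h t) /\
  forall n, \int[leb]_(t in `[x n, x (n + 1)]) h t <= \int[leb]_t h t.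
Proof.
move=> h0 /zseries_gap_cvg cv.
have cs : zsummable (fun n => \int[leb]_(t in `[x n, x (n + 1)]) h t).
  by apply/cvg_ex; eexists; exact: cv.
have a0 n : 0 <= \int[leb]_(t in `[x n, x (n + 1)]) h t by apply: Rintegral_ge0.
split => // n; have := term_le_zsum n a0 cs.
by rewrite /zsum (cvg_lim (@Rhausdorff R) cv).
Qed.

Lemma gap_integrable h (C : R) : measurable_fun setT h -> (forall t, 0 <= h t) ->
  (forall n, leb.-integrable `[x n, x (n + 1)] (EFin \o h)) ->
  (forall N, zseries (fun n => \int[leb]_(t in `[x n, x (n + 1)]) h t) N <= C) ->
  leb.-integrable setT (EFin \o h).
Proof.
move=> mh h0 ih hC.
have iw N : leb.-integrable (window N) (EFin \o h).
  elim: N => [|N ihN].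
    rewrite /window oppr0 set_itv1; apply/integrableP; split.
      by apply/measurable_EFinP; exact: measurable_funTS.
    by rewrite integral_set1.
  have e1 : x (Negz N) <= x (Negz N + 1) by rewrite ltW// node_lt.
  have e2 : x (Posz N) <= x (Posz N + 1) by rewrite ltW// node_lt.
  have e3 := node_opp_le N.
  rewrite /window -NegzE -PoszS; apply: (@integrable_cat _ _ (x (Posz N))) => //.
    by rewrite (le_trans e1)// NegzD1.
  by apply: (@integrable_cat _ _ (x (- Posz N))) => //; rewrite -?NegzD1.
apply/integrableP; split; first exact/measurable_EFinP.
under eq_integral => t _ do rewrite gee0_abs ?lee_fin//.
rewrite -window_cover.
have cv : (fun N => \int[leb]_(t in window N) (h t)%:E)%E @ \oo -->
    (\int[leb]_(t in \bigcup_N window N) (h t)%:E)%E.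
  apply: ge0_nondecreasing_set_cvg_integral.
  - exact: window_nondecreasing.
  - by move=> N; exact: measurable_itv.
  - by move=> N; apply: measurable_funTS; exact/measurable_EFinP.
  - by move=> N t _; rewrite lee_fin.
rewrite -(cvg_lim (@ereal_hausdorff R) cv).
apply: (@le_lt_trans _ _ C%:E); last exact: ltry.
apply: lime_le; first by apply/cvg_ex; eexists; exact: cv.
apply: nearW => N; rewrite -(fineK (integrable_fin_num _ (iw N))); last exact: measurable_itv.
rewrite lee_fin; have := hC N; rewrite -(window_integral (iw N)); exact.
Qed.

End nodes.

Section gap_bounds.
Context {R : realType}.
Notation leb := (@lebesgue_measure R).
Implicit Types (a b c t r s : R) (F G u v : R -> R[i]).

Lemma rAC_ae_deriv a b (F u v : R -> R) : rAC a b F u -> leb.-integrable `[a, b] (EFin \o v) ->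
  {ae leb, forall t, a < t < b -> u t = v t} -> rAC a b F v.
Proof.
move=> [iu hF] iv uv; split; first exact: iv.
move=> t /andP[at_ tb]; rewrite hF ?at_//; congr (_ + _).
have iu' : leb.-integrable `[a, t] (EFin \o u).
  by apply: integrable_itvS iu _; exact: itvcc_sub.
have iv' : leb.-integrable `[a, t] (EFin \o v).
  by apply: integrable_itvS iv _; exact: itvcc_sub.
rewrite -(Rintegral_oo_cc iu') -(Rintegral_oo_cc iv').
have mo (w : R -> R) : leb.-integrable `[a, t] (EFin \o w) -> measurable_fun `]a, t[ (EFin \o w).
  move=> iw; have := measurable_int _ iw; apply: measurable_funS; first exact: measurable_itv.
  exact: itvoo_sub_cc.
congr fine; apply: ae_eq_integral; [exact: measurable_itv|exact: mo|exact: mo|].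
apply: filterS uv; first exact: (ae_filter_ringOfSetsType leb).
by move=> s h /=; rewrite in_itv/= => /andP[s1 s2]; rewrite h// s1 (lt_le_trans s2).
Qed.

Lemma cAC_ae_deriv a b F u v : cAC a b F u -> cintegrable leb `[a, b] v ->
  {ae leb, forall t, a < t < b -> u t = v t} -> cAC a b F v.
Proof.
have fae := ae_filter_ringOfSetsType leb.
move=> [h1 h2] [i1 i2] uv; split.
  by apply: (rAC_ae_deriv h1 i1); apply: filterS uv => t h /h ->.
by apply: (rAC_ae_deriv h2 i2); apply: filterS uv => t h /h ->.
Qed.

Lemma rAC_integrable a b (F u : R -> R) : a <= b -> rAC a b F u ->
  leb.-integrable `[a, b] (EFin \o F).
Proof.
move=> ab h; apply: continuous_compact_integrable; first exact: segment_compact.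
exact: rAC_within_continuous ab h.
Qed.

Lemma cAC_cintegrable a b F u : a <= b -> cAC a b F u -> cintegrable leb `[a, b] F.
Proof. by move=> ab [h1 h2]; split; [exact: rAC_integrable h1|exact: rAC_integrable h2]. Qed.

Lemma cAC_sqn_integrable a b F u : a <= b -> cAC a b F u ->
  leb.-integrable `[a, b] (EFin \o (fun t => sqn (F t))).
Proof. by move=> ab h; exact: (rAC_integrable ab (cAC_sqn ab h)). Qed.

Lemma cAC_deriv_cintegrable a b F u : cAC a b F u -> cintegrable leb `[a, b] u.
Proof. by move=> [[i1 _] [i2 _]]; split. Qed.

Lemma L2on_sub (D : set R) (f : R -> R[i]) : measurable D -> L2on leb setT f -> L2on leb D f.
Proof.
move=> mD [[m1 m2] fi]; split; first by split; exact: measurable_funTS.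
apply: le_lt_trans fi; apply: ge0_subset_integral => //.
  by apply/measurable_EFinP; exact: (L2on_sqn_measurable (conj m1 m2)).
by move=> t _; rewrite lee_fin sqn_ge0.
Qed.

Lemma L2_cintegrable (k : L2R R) a b : cintegrable leb `[a, b] (k : R -> R[i]).
Proof. by apply: L2on_cintegrable; apply: L2on_sub (L2P k); exact: measurable_itv. Qed.

Lemma L2_sqn_integrable (k : L2R R) : leb.-integrable setT (EFin \o (fun t => sqn (k t))).
Proof. exact: (sqn_integrable (L2P k)). Qed.

Lemma L2_sqn_integrable_itv (k : L2R R) a b :
  leb.-integrable `[a, b] (EFin \o (fun t => sqn (k t))).
Proof. by apply: (integrableS _ _ _ (L2_sqn_integrable k)) => //; exact: measurable_itv. Qed.

Lemma le_Rintegral_itv a b (f g : R -> R) : leb.-integrable `[a, b] (EFin \o f) ->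
  leb.-integrable `[a, b] (EFin \o g) -> (forall t, a <= t <= b -> f t <= g t) ->
  \int[leb]_(t in `[a, b]) f t <= \int[leb]_(t in `[a, b]) g t.
Proof.
move=> if_ ig fg; apply: (le_Rintegral _ if_ ig); first exact: measurable_itv.
by move=> t; rewrite /= in_itv/= => tab; exact: fg.
Qed.

Lemma Rintegral_itvD a b (f g : R -> R) (p q : R) : leb.-integrable `[a, b] (EFin \o f) ->
  leb.-integrable `[a, b] (EFin \o g) ->
  leb.-integrable `[a, b] (EFin \o (fun t => p * f t + q * g t)) /\
  \int[leb]_(t in `[a, b]) (p * f t + q * g t) =
  p * \int[leb]_(t in `[a, b]) f t + q * \int[leb]_(t in `[a, b]) g t.
Proof.
move=> if_ ig.
have i1 : leb.-integrable `[a, b] (EFin \o (fun t => p * f t)) by exact: (integrableZl _ p if_).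
have i2 : leb.-integrable `[a, b] (EFin \o (fun t => q * g t)) by exact: (integrableZl _ q ig).
split; first exact: (integrableD _ i1 i2).
rewrite (RintegralD _ i1 i2); last exact: measurable_itv.
by rewrite !RintegralZl//; exact: measurable_itv.
Qed.

(* The weight [(t - a) / (b - a)] vanishes at [a], so that no boundary term
   at [a] appears. *)
Lemma cAC_endpoint_le a b (e : R) F u : 0 < e -> e <= b - a -> cAC a b F u ->
  leb.-integrable `[a, b] (EFin \o (fun t => sqn (u t))) ->
  sqn (F b) <= (e^-1 + 1) * \int[leb]_(t in `[a, b]) sqn (F t) + \int[leb]_(t in `[a, b]) sqn (u t).
Proof.
move=> e0 eab hF iu.
have L0 : 0 < b - a by apply: lt_le_trans eab.
have ab : a <= b by lra.
pose th t := (t - a) / (b - a).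
have hth : rAC a b th (fun=> (b - a)^-1).
  apply: is_derive_rAC => // [t|]; last by move=> t; exact: cvg_cst.
  rewrite /th (_ : (fun t => _) = fun t => (b - a)^-1 * (t - a)); last first.
    by apply/funext => s; rewrite mulrC.
  by apply: is_derive_eq; rewrite /GRing.scale/= subr0 mulr1.
have hS := cAC_sqn ab hF.
have hP := rAC_mul ab hth hS.
have iF := cAC_sqn_integrable ab hF.
have [iB eB] := Rintegral_itvD (e^-1 + 1) 1 iF iu.
have := hP.2 b; rewrite ab lexx /th subrr mul0r mul0r add0r divff ?gt_eqF// mul1r => -> //.
rewrite -[X in _ <= _ + X]mul1r -eB.
apply: le_Rintegral_itv; [exact: hP.1|exact: iB|] => t /andP[at_ tb].
have th0 : 0 <= (t - a) / (b - a) by rewrite divr_ge0; lra.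
have th1 : (t - a) / (b - a) <= 1 by rewrite ler_pdivrMr//; lra.
have Le : (b - a)^-1 <= e^-1 by rewrite lef_pV2.
have p0 : 0 <= sqn (F t) := sqn_ge0 _.
have h1 : (b - a)^-1 * sqn (F t) <= e^-1 * sqn (F t) by rewrite ler_wpM2r.
have h2 : 2 * (Re (F t) * Re (u t) + Im (F t) * Im (u t)) <= sqn (F t) + sqn (u t).
  rewrite /sqn; have := sqr_ge0 (Re (F t) - Re (u t)); have := sqr_ge0 (Im (F t) - Im (u t)).
  by move: (Re _) (Im (F t)) (Re _) (Im (u t)) => *; nra.
have q0 : 0 <= sqn (u t) := sqn_ge0 _.
move: ((t - a) / (b - a)) th0 th1 => k k0 k1.
have -> : (e^-1 + 1) * sqn (F t) + 1 * sqn (u t) = e^-1 * sqn (F t) + (sqn (F t) + sqn (u t)).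
  by ring.
apply: lerD => //.
apply: (@le_trans _ _ (k * (sqn (F t) + sqn (u t)))); first by rewrite ler_wpM2l.
by rewrite ler_piMl// addr_ge0.
Qed.

Lemma cAC_parts a b F G u v : a <= b -> cAC a b F u -> cAC a b G v ->
  leb.-integrable `[a, b] (EFin \o (fun t => Re (u t) * Re (G t) + Im (u t) * Im (G t))) /\
  \int[leb]_(t in `[a, b]) (Re (u t) * Re (G t) + Im (u t) * Im (G t)) =
  (Re (F b) * Re (G b) + Im (F b) * Im (G b)) - (Re (F a) * Re (G a) + Im (F a) * Im (G a)) -
  \int[leb]_(t in `[a, b]) (Re (F t) * Re (v t) + Im (F t) * Im (v t)).
Proof.
move=> ab [F1 F2] [G1 G2].
have [i1 j1 e1] := rAC_parts ab F1 G1; have [i2 j2 e2] := rAC_parts ab F2 G2.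
have mI : measurable (`[a, b]%classic : set R) by exact: measurable_itv.
split; first exact: (integrableD _ i1 i2).
rewrite (RintegralD _ i1 i2)// (RintegralD _ j1 j2)//.
move: e1 e2; move: (Rintegral _ _ _) (Rintegral _ _ _) (Rintegral _ _ _) (Rintegral _ _ _) => p q r s.
by move=> *; lra.
Qed.

Lemma cintegrableN a b u : cintegrable leb `[a, b] u -> cintegrable leb `[a, b] (fun t => - u t).
Proof.
have opp (g : R -> R) : leb.-integrable `[a, b] (EFin \o g) ->
    leb.-integrable `[a, b] (EFin \o (fun t => - g t)).
  move=> ig; have jg : leb.-integrable `[a, b] (EFin \o (fun t => -1 * g t)).
    exact: (integrableZl _ (-1) ig).
  apply: (@eq_integrable _ _ _ leb _ _ (EFin \o (fun t => -1 * g t))); last exact: jg.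
    exact: measurable_itv.
  by move=> t _; rewrite /= mulN1r.
move=> [i1 i2]; split.
  apply: (@eq_integrable _ _ _ leb _ _ (EFin \o (fun t => - Re (u t)))); last exact: opp i1.
    exact: measurable_itv.
  by move=> t _ /=; case: (u t).
apply: (@eq_integrable _ _ _ leb _ _ (EFin \o (fun t => - Im (u t)))); last exact: opp i2.
  exact: measurable_itv.
by move=> t _ /=; case: (u t).
Qed.

End gap_bounds.

Section node_representation.
Context {R : realType}.
Notation leb := (@lebesgue_measure R).
Variables (x : int -> R) (d : R).
Hypotheses (x_incr : forall m n : int, m < n -> x m < x n) (d_gt0 : 0 < d)
  (x_gap : forall n, d <= x (n + 1) - x n).
Implicit Types (f k : L2R R) (z e : l2 R) (F : R -> R[i]) (G : int -> R -> R[i]).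

Local Notation gapint q n := (\int[leb]_(t in `[x n, x (n + 1)]) q t).

(* [F] is the continuous representative of [f] on the line and [G n] the
   continuous representative of its derivative on the n-th gap. *)
Definition node_rep f k z e F G : Prop :=
  [/\ forall n, cAC (x n) (x (n + 1)) F (G n) /\
        cAC (x n) (x (n + 1)) (G n) (fun t => - k t),
      forall n, F (x n) = - z n,
      forall n, e n = G n (x n) - G (n - 1) (x n),
      {ae leb, forall t, f t = F t} &
      zsummable (fun n => gapint (fun t => sqn (G n t)) n)].

Definition max_domain f k z e : Prop := exists F G, node_rep f k z e F G.

Let xlt n : x n < x (n + 1) := node_lt x_incr n.
Let xle n : x n <= x (n + 1) := ltW (xlt n).

Lemma max_domain_lin c f k z e f' k' z' e' : max_domain f k z e -> max_domain f' k' z' e' ->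
  max_domain (c *: f + f') (c *: k + k') (c *: z + z') (c *: e + e').
Proof.
move=> [F [G [FG Fz eG fF sG]]] [F' [G' [FG' Fz' eG' fF' sG']]].
have fae := ae_filter_ringOfSetsType leb.
exists (fun t => c * F t + F' t), (fun n t => c * G n t + G' n t); split.
- move=> n; have [h1 h2] := FG n; have [h1' h2'] := FG' n.
  split; first exact: (cAC_lin c (xle n) h1 h1').
  apply: (cAC_ae_deriv (cAC_lin c (xle n) h2 h2')); first exact/cintegrableN/L2_cintegrable.
  by apply: filterS (L2_linE c k k') => t -> _; rewrite mulrN opprD.
- by move=> n; rewrite Fz Fz' l2D l2Z mulrN opprD.
- by move=> n; rewrite l2D l2Z eG eG'; ring.
- by apply: filterS3 fF fF' (L2_linE c f f') => t -> -> ->.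
- have [sA _] := zsum_lin (2 * sqn c) 2 sG sG'.
  apply: zsummable_le sA => n.
  have [_ h2] := FG n; have [_ h2'] := FG' n.
  have i1 := cAC_sqn_integrable (xle n) h2; have i2 := cAC_sqn_integrable (xle n) h2'.
  have [iB <-] := Rintegral_itvD (2 * sqn c) 2 i1 i2.
  have i3 := cAC_sqn_integrable (xle n) (cAC_lin c (xle n) h2 h2').
  rewrite ger0_norm; last by apply: Rintegral_ge0 => t _; exact: sqn_ge0.
  apply: (le_Rintegral_itv i3 iB) => t _.
  by rewrite (le_trans (sqnD_le _ _))// sqnM mulrA.
Qed.

(** The endpoint inequality on gap [n - 1], uniform in [n] because every gap has length at least
    [d]. It serves to make the boundary terms at infinity vanish. *)
Lemma endpoint_bound f k z e F G : node_rep f k z e F G ->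
  exists2 C, 0 <= C & forall n, cabs (G (n - 1) (x n)) <= C.
Proof.
move=> [FG _ _ _ sG].
pose S := zsum (fun n => gapint (fun t => sqn (G n t)) n).
pose Kk := \int[leb]_t sqn (k t).
have g0 n : 0 <= gapint (fun t => sqn (G n t)) n by apply: Rintegral_ge0 => t _; exact: sqn_ge0.
have [_ hk] := zsummable_gap x_incr d_gt0 x_gap (fun t => sqn_ge0 (k t)) (L2_sqn_integrable k).
exists (Num.sqrt ((d^-1 + 1) * S + Kk)); first exact: sqrtr_ge0.
move=> n; rewrite /cabs ler_wsqrtr//.
have [_ h2] := FG (n - 1); move: h2; have := x_gap (n - 1); have := hk (n - 1).
have := term_le_zsum (n - 1) g0 sG; rewrite subrK => hS hK hd h2.
have sN (t : R) : sqn (- k t) = sqn (k t) by rewrite /sqn ReN ImN !sqrrN.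
have iN : leb.-integrable `[x (n - 1), x n] (EFin \o (fun t => sqn (- k t))).
  apply: (@eq_integrable _ _ _ leb _ _ (EFin \o (fun t => sqn (k t)))); first exact: measurable_itv.
    by move=> t _; rewrite /= sN.
  exact: L2_sqn_integrable_itv.
have := cAC_endpoint_le d_gt0 hd h2 iN; move=> /le_trans; apply.
apply: lerD; first by rewrite ler_wpM2l// addr_ge0// invr_ge0 ltW.
by rewrite (_ : (fun t => sqn (- k t)) = (fun t => sqn (k t)))//; apply/funext.
Qed.

(** The limit is the real part of (f', f''s counterpart), that is, of the Dirichlet form of the two
    elements. Its symmetry gives Green's identity and its positivity gives [bs_pos]. *)
Lemma form_cvg f k z e F G f' k' z' e' F' G' : node_rep f k z e F G ->
  node_rep f' k' z' e' F' G' ->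
  zseries (fun n => gapint (fun t => Re (G n t) * Re (G' n t) + Im (G n t) * Im (G' n t)) n) @ \oo -->
  Re ('[k, f'] + '[e, z']).
Proof.
move=> rep rep'; have [C C0 hC] := endpoint_bound rep.
case: rep rep' => FG Fz eG fF sG [FG' Fz' eG' fF' sG'].
have fae := ae_filter_ringOfSetsType leb.
pose q n := gapint (fun t => Re (G n t) * Re (G' n t) + Im (G n t) * Im (G' n t)) n.
pose p n := gapint (fun t => Re (k t * (f' t)^*)) n.
pose b n := Re (G (n - 1) (x n) * Num.conj (z' n)).
have [iRe iIm] := L2on_mul_conj (L2P k) (L2P f').
have cvp : zseries p @ \oo --> Re '[k, f'] := zseries_gap_cvg x_incr d_gt0 x_gap iRe.
have [cve _] := l2_csummable e z'.
have cvz : zseries (fun n => Re (e n * (z' n)^*)) @ \oo --> Re '[e, z'] by exact: cve.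
have pE n : p n = q n + Re (G n (x (n + 1)) * Num.conj (z' (n + 1))) - Re (G n (x n) * Num.conj (z' n)).
  have [_ hG] := FG n; have [hF' _] := FG' n.
  have [i1 e1] := cAC_parts (xle n) hG hF'.
  have -> : p n = - gapint (fun t => Re (- k t) * Re (F' t) + Im (- k t) * Im (F' t)) n.
    rewrite -[RHS]mulN1r -RintegralZl//; congr fine; apply: ae_eq_integral.
    - exact: measurable_itv.
    - apply: measurable_funTS; exact: measurable_int iRe.
    - have i1' : leb.-integrable `[x n, x (n + 1)] (EFin \o (fun t => -1 *
          (Re (- k t) * Re (F' t) + Im (- k t) * Im (F' t)))).
        exact: (integrableZl _ (-1) i1).
      exact: measurable_int i1'.
    - apply: filterS fF' => t h _; rewrite /= h ReM ReN ImN.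
      by congr EFin; rewrite ReC ImC; ring.
  rewrite e1 !Fz' /q !ReM; have cR (w : R[i]) : Re (Num.conj w) = Re w by case: w.
  have cI (w : R[i]) : Im (Num.conj w) = - Im w by case: w.
  by rewrite !cR !cI !ReN !ImN; ring.
have eE n : Re (e n * (z' n)^*) = Re (G n (x n) * Num.conj (z' n)) - b n.
  by rewrite eG /b -ReB -mulrBl.
(* After integration by parts on each gap, the jump terms of [e] absorb one side of every node; what
   remains telescopes to the two ends of the window. *)
have tele N : zseries q N = zseries p N + zseries (fun n => Re (e n * (z' n)^*)) N -
    (b (Posz N) - b (- Posz N)).
  rewrite -zseries_telescope -zseriesD.
  rewrite -[X in _ - X]mul1r -mulNr -zseriesZ -zseriesD; congr zseries; apply/funext => n.
  by rewrite pE eE /b addrK; ring.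
rewrite ReD (_ : zseries _ = zseries q)//; rewrite (funext tele) -[X in _ --> X]subr0.
apply: cvgB; first exact: cvgD.
have bb n : `|b n| <= C * cabs (z' n).
  rewrite (le_trans (Re_le_cabs _))// cabsM ler_pM ?cabs_ge0//.
  by rewrite /cabs /sqn; case: (z' n) => ? ?; rewrite /= sqrrN.
have sz0 n : 0 <= sqn (z' n) := sqn_ge0 _.
have [c1 c2] := zsummable_cvg0 sz0 (@l2P R z').
have bcv (u : nat -> int) : (fun N => sqn (z' (u N))) @ \oo --> 0 -> (fun N => b (u N)) @ \oo --> 0.
  move=> cu; apply/eps_cvgn => r r0.
  have r1 : 0 < (r / (C + 1)) ^+ 2 by rewrite exprn_gt0// divr_gt0// ltr_wpDl.
  have [N hN] := cvgn_eps cu r1; exists N => n /hN; rewrite !sub0r !normrN ger0_norm// -cabs_sqr.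
  have rC : 0 <= r / (C + 1) by rewrite divr_ge0 ?addr_ge0// ltW.
  rewrite ltr_pXn2r ?nnegrE ?cabs_ge0// ltr_pdivlMr ?ltr_wpDl// => h.
  have := bb (u n); have := cabs_ge0 (z' (u n)); nra.
rewrite -[X in _ --> X]subr0; apply: cvgB; first exact: bcv.
(* At [N + 1] the left end [- Posz (N + 1)] is [Negz N], where square summability yields the
   limit. *)
rewrite -cvg_shiftS/=; apply: (@cvg_trans _ ((fun N => b (Negz N)) @ \oo)).
  by apply: near_eq_cvg; apply: nearW => N; rewrite NegzE.
exact: bcv.
Qed.

Lemma max_domain_green_re f k z e f' k' z' e' : max_domain f k z e -> max_domain f' k' z' e' ->
  Re ('[k, f'] + '[e, z']) = Re ('[f, k'] + '[z, e']).
Proof.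
move=> [F [G rep]] [F' [G' rep']].
have c1 := form_cvg rep rep'; have c2 := form_cvg rep' rep.
rewrite [in RHS]ReD (Re_inner_conj k' f) (Re_inner_conj e' z) -ReD.
rewrite -(cvg_lim (@Rhausdorff R) c1) -(cvg_lim (@Rhausdorff R) c2).
congr (limn (zseries _)); apply/funext => n; apply: eq_Rintegral => t _.
by rewrite mulrC [Im _ * _]mulrC.
Qed.

Lemma max_domain_green f k z e f' k' z' e' : max_domain f k z e -> max_domain f' k' z' e' ->
  '[k, f'] + '[e, z'] = '[f, k'] + '[z, e'].
Proof.
move=> h h'; have r0 := max_domain_green_re h h'.
apply: complex_ext => //.
(* The real identity for (i + 1) f, minus the one for [f], is the imaginary identity. *)
have := max_domain_green_re (max_domain_lin 'i%C h h) h'.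
rewrite !innerDl !innerZl !ImD; move: r0; rewrite !ReD !ReM.
rewrite (_ : Re ('i%C : R[i]) = 0)// (_ : Im ('i%C : R[i]) = 1)//.
by move: (Re _) (Re _) (Re _) (Re _) (Im _) (Im _) (Im _) (Im _) => *; lra.
Qed.

Lemma max_domain_pos f k z e : max_domain f k z e -> 0 <= Re ('[k, f] + '[e, z]).
Proof.
move=> [F [G rep]]; have c1 := form_cvg rep rep.
rewrite -(cvg_lim (@Rhausdorff R) c1); apply: limr_ge; first by apply/cvg_ex; eexists; exact: c1.
apply: nearW => N; apply: zseries_ge0 => n; apply: Rintegral_ge0 => t _.
by rewrite addr_ge0// -expr2 sqr_ge0.
Qed.

Lemma ae_gap (Q : R -> Prop) : (forall n, {ae leb, forall t, x n < t < x (n + 1) -> Q t}) ->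
  {ae leb, forall t, Q t}.
Proof.
move=> h; have fae := ae_filter_ringOfSetsType leb.
have hn n : {ae leb, forall t, x n <= t < x (n + 1) -> Q t}.
  have : {ae leb, forall t, t <> x n}.
    exists [set x n]; split; [exact: measurable_set1|exact: lebesgue_measure_set1|].
    by move=> t /= /contrapT.
  apply: filterS2 (h n) => t ht tx /andP[+ t2]; rewrite le_eqVlt => /predU1P[xt|t1].
    by case: tx.
  by apply: ht; rewrite t1.
have hp : {ae leb, forall t, forall m : nat, x (Posz m) <= t < x (Posz m + 1) -> Q t}.
  by apply/ae_foralln => m; exact: hn.
have hm : {ae leb, forall t, forall m : nat, x (Negz m) <= t < x (Negz m + 1) -> Q t}.
  by apply/ae_foralln => m; exact: hn.
apply: filterS2 hp hm => t h1 h2.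
by have [[m|m] hm] := node_index d_gt0 x_gap t; [exact: h1 hm|exact: h2 hm].
Qed.

Lemma max_domain_ker k z e : max_domain 0 k z e -> [/\ k = 0, z = 0 & e = 0].
Proof.
move=> [F [G [FG Fz eG fF sG]]].
have fae := ae_filter_ringOfSetsType leb.
have z0 := @L20E _ _ R leb.
have F0 : {ae leb, forall t, F t = 0}.
  by apply: (filterS2 _ _ fF z0) => t <- ->.
have FZ n : (forall t, x n <= t <= x (n + 1) -> F t = 0) /\
    {ae leb, forall t, x n < t < x (n + 1) -> G n t = 0}.
  by have [h1 _] := FG n; apply: (cAC_ae_zero (xlt n) h1); apply: filterS F0 => t ->.
have GZ n : (forall t, x n <= t <= x (n + 1) -> G n t = 0) /\
    {ae leb, forall t, x n < t < x (n + 1) -> - k t = 0}.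
  by have [_ h2] := FG n; apply: (cAC_ae_zero (xlt n) h2); exact: (FZ n).2.
have Gl n : G n (x n) = 0 by apply: (GZ n).1; rewrite lexx xle.
have Gr n : G (n - 1) (x n) = 0.
  by apply: (GZ (n - 1)).1; have := xle (n - 1); rewrite subrK lexx => ->.
split.
- apply: L2_ext; have kZ : {ae leb, forall t, k t = 0}.
    apply: ae_gap => n; apply: filterS (GZ n).2 => t h /h /eqP.
    by rewrite oppr_eq0 => /eqP.
  by apply: filterS2 kZ z0 => t -> ->.
- apply: l2_ext => n; apply/eqP; rewrite l20 -oppr_eq0 -Fz; apply/eqP/(FZ n).1.
  by rewrite lexx xle.
- by apply: l2_ext => n; rewrite eG Gl Gr subrr.
Qed.

End node_representation.

Section maximal_domain.
Context {R : realType}.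
Notation leb := (@lebesgue_measure R).
Variables (x : int -> R) (d : R).
Hypotheses (x_incr : forall m n : int, m < n -> x m < x n) (d_gt0 : 0 < d)
  (x_gap : forall n, d <= x (n + 1) - x n).
Implicit Types (f k : L2R R) (z e : l2 R) (F u : R -> R[i]) (G : int -> R -> R[i]).

Let xlt n : x n < x (n + 1) := node_lt x_incr n.
Let xle n : x n <= x (n + 1) := ltW (xlt n).

Lemma L2on_sqn_integrable (D : set R) (f : R -> R[i]) : L2on leb D f ->
  leb.-integrable D (EFin \o (fun t => sqn (f t))).
Proof.
move=> [[m1 m2] fi]; apply/integrableP; split.
  by apply/measurable_EFinP; apply: (L2on_sqn_measurable (conj m1 m2)).
under eq_integral => t _ do rewrite gee0_abs ?lee_fin ?sqn_ge0//.
exact: fi.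
Qed.

Lemma integrable_sqn_L2on (D : set R) (f : R -> R[i]) : cmeasurable D f ->
  leb.-integrable D (EFin \o (fun t => sqn (f t))) -> L2on leb D f.
Proof.
move=> mf /integrableP[_ h]; split; first exact: mf.
apply: le_lt_trans h.
have E : (\int[leb]_(t in D) (sqn (f t))%:E = \int[leb]_(t in D) `|(EFin \o (fun t => sqn (f t))) t|)%E.
  by apply: eq_integral => t _; rewrite gee0_abs// lee_fin sqn_ge0.
by rewrite E.
Qed.

Lemma eq_integrable_oo (a b : R) (p q : R -> R) : (forall t, a < t < b -> p t = q t) ->
  leb.-integrable `[a, b] (EFin \o q) ->
  leb.-integrable `[a, b] (EFin \o p) /\
  \int[leb]_(t in `[a, b]) p t = \int[leb]_(t in `[a, b]) q t.
Proof.
move=> pq iq.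
have iq' : leb.-integrable `]a, b[ (EFin \o q).
  by apply: integrable_itvS iq _; exact: itvoo_sub_cc.
have ip : leb.-integrable `[a, b] (EFin \o p).
  apply: integrable_oo_cc; apply: (@eq_integrable _ _ _ leb _ _ (EFin \o q)); last exact: iq'.
    exact: measurable_itv.
  by move=> t; rewrite inE/= in_itv/= => /pq ->.
split; first exact: ip.
rewrite -(Rintegral_oo_cc ip) -(Rintegral_oo_cc iq).
by apply: eq_Rintegral => t; rewrite inE/= in_itv/= => /pq.
Qed.

Lemma node_index_fun : exists idx : R -> int,
  (forall t, x (idx t) <= t < x (idx t + 1)) /\ forall n t, x n <= t < x (n + 1) -> idx t = n.
Proof.
have /choice[idx hidx] := node_index d_gt0 x_gap.
exists idx; split=> // n t tn; exact: (node_index_unique x_incr (hidx t) tn).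
Qed.

Lemma window_cAC F u : (forall n, cAC (x n) (x (n + 1)) F u) ->
  forall N, cAC (x (- Posz N)) (x (Posz N)) F u.
Proof.
move=> h; elim=> [|N ih]; first by apply: (cAC_restrict (h 0)); rewrite ?oppr0 ?lexx ?xle.
have hN := h (Negz N); rewrite NegzD1 NegzE in hN.
have hP := h (Posz N); rewrite PoszS in hP.
have e1 : x (- Posz N.+1) <= x (- Posz N) by apply: (node_le x_incr); lia.
have e2 : x (Posz N) <= x (Posz N.+1) by apply: (node_le x_incr); lia.
have e3 : x (- Posz N) <= x (Posz N) by apply: (node_le x_incr); lia.
apply: (cAC_cat _ e2 _ hP); first exact: le_trans e1 e3.
exact: cAC_cat e1 e3 hN ih.
Qed.

Lemma window_cmeasurable u : (forall N, cintegrable leb (window x N) u) -> cmeasurable setT u.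
Proof.
move=> iu; rewrite -(window_cover d_gt0 x_gap).
have mW N : measurable (window x N) by exact: measurable_itv.
split; apply/(measurable_fun_bigcup _ mW) => N; apply/measurable_EFinP.
  exact: measurable_int (iu N).1.
exact: measurable_int (iu N).2.
Qed.

Lemma glue_H1 (f : R -> R[i]) F u : (forall n, cAC (x n) (x (n + 1)) F u) ->
  {ae leb, forall t, f t = F t} -> L2on leb setT f -> L2on leb setT u -> is_H1 setT f u.
Proof.
have fae := ae_filter_ringOfSetsType leb.
move=> h fF Lf Lu; split; [exact: Lf|exact: Lu|].
have [mf _] := Lf.
apply: cAC_weak_deriv; [exact: measurableT|exact: mf|] => K cK _.
have [M [_ hM]] := compact_bounded cK.
have hM1 t : K t -> `|t| <= M + 1 by apply: hM; rewrite ltrDl.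
have [N1 /andP[l1 _]] := node_cover d_gt0 x_gap (- (M + 1)).
have [N2 /andP[_ l2]] := node_cover d_gt0 x_gap (M + 1).
pose N := maxn N1 N2.
have g1 : x (- Posz N) <= x (- Posz N1) by apply: (node_le x_incr); rewrite /N; lia.
have g2 : x (Posz N2) <= x (Posz N) by apply: (node_le x_incr); rewrite /N; lia.
exists (x (- Posz N)), (x (Posz N)), F; split.
- exact: node_opp_le.
- move=> t /hM1; rewrite ler_norml /= in_itv/= => /andP[t1 t2].
  by rewrite (le_lt_trans g1 (lt_le_trans l1 t1)) (le_lt_trans t2 (lt_le_trans l2 g2)).
- by [].
- exact: window_cAC.
- by apply: filterS fF => t -> _.
Qed.

Lemma glue_L2 u G : (forall n, cintegrable leb `[x n, x (n + 1)] (G n)) ->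
  (forall n, leb.-integrable `[x n, x (n + 1)] (EFin \o (fun t => sqn (G n t)))) ->
  (forall n t, x n < t < x (n + 1) -> u t = G n t) -> cmeasurable setT u ->
  zsummable (fun n => \int[leb]_(t in `[x n, x (n + 1)]) sqn (G n t)) ->
  L2on leb setT u.
Proof.
move=> iG sG uG mu_ sumG; apply: integrable_sqn_L2on; first exact: mu_.
have E n := eq_integrable_oo (fun t ht => congr1 sqn (uG n t ht)) (sG n).
apply: (gap_integrable x_incr d_gt0 x_gap (C := zsum (fun n => \int[leb]_(t in `[x n, x (n + 1)]) sqn (G n t)))).
- exact: (L2on_sqn_measurable mu_).
- by move=> t; exact: sqn_ge0.
- by move=> n; exact: (E n).1.
- move=> N; rewrite (_ : (fun n => _) = (fun n => \int[leb]_(t in `[x n, x (n + 1)]) sqn (G n t))).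
    by apply: zseries_le_zsum => // n; apply: Rintegral_ge0 => t _; exact: sqn_ge0.
  by apply/funext => n; exact: (E n).2.
Qed.

Lemma node_rep_glue f k z e F G : node_rep x f k z e F G -> exists f1 : R -> R[i],
  [/\ forall n t, x n <= t < x (n + 1) -> f1 t = G n t,
      forall n, cAC (x n) (x (n + 1)) F f1, L2on leb setT f1 & is_H1 setT (f : R -> R[i]) f1].
Proof.
move=> [FG Fz eG fF sG]; have [idx [hi1 hi2]] := node_index_fun.
pose f1 t := G (idx t) t.
have f1E n t : x n <= t < x (n + 1) -> f1 t = G n t by move=> /hi2 h; rewrite /f1 h.
have f1E' n t : x n < t < x (n + 1) -> f1 t = G n t.
  by move=> /andP[t1 t2]; apply: f1E; rewrite (ltW t1).
have hF n : cAC (x n) (x (n + 1)) F f1.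
  by have [h _] := FG n; apply: cAC_ext_deriv h => t /f1E'.
have mf1 : cmeasurable setT f1.
  by apply: window_cmeasurable => N; exact: (cAC_deriv_cintegrable (window_cAC hF N)).
have L1 : L2on leb setT f1.
  apply: (@glue_L2 f1 G) => // n; have [h1 h2] := FG n.
    exact: cAC_cintegrable h2.
  exact: cAC_sqn_integrable h2.
by exists f1; split => //; exact: glue_H1 hF fF (L2P f) L1.
Qed.

(** Gamma0 f = 0 says that the derivatives on adjacent gaps match at the nodes, so the glued
    derivative is itself absolutely continuous across them. *)
Lemma max_domain_A_free f k z : max_domain x f k z 0 -> A_free (f, k).
Proof.
move=> [F [G rep]]; have [f1 [f1E hF L1 H1]] := node_rep_glue rep.
case: rep => FG Fz eG fF sG.
have GG n : G n (x (n + 1)) = f1 (x (n + 1)).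
  rewrite (f1E (n + 1)) ?lexx ?xlt//.
  by have /eqP := eG (n + 1); rewrite l20 addrK eq_sym subr_eq0 => /eqP.
have hf1 n : cAC (x n) (x (n + 1)) f1 (fun t => - k t).
  have [_ h2] := FG n; apply: (cAC_ext_on (xle n) _ h2) => t /andP[t1].
  by rewrite le_eqVlt => /predU1P[->|t2]; [exact: GG|rewrite (f1E n)// t1].
have Lk : L2on leb setT (fun t => - k t).
  have [[m1 m2] ki] := L2P k; split.
    by split; [under eq_fun do rewrite ReN|under eq_fun do rewrite ImN]; exact: measurable_funN.
  rewrite (_ : (fun t => (sqn (- k t))%:E) = (fun t => (sqn (k t))%:E))//.
  by apply/funext => t; rewrite /sqn ReN ImN !sqrrN.
exists f1, (fun t => - k t); split; last by apply: aeW => t /=; rewrite opprK.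
split; first exact: H1.
by apply: (glue_H1 hf1 _ L1 Lk); exact: aeW.
Qed.

(** The bridge between the definition by weak derivatives and traces and the description by
    continuous representatives, on which all computations rest. *)
Lemma max_domainP f k z e : max_domain x f k z e <->
  exists f1 f2 g : R -> R[i], [/\ is_H2_off x f f1 f2, is_H1 setT (f : R -> R[i]) g, Gamma1 x f z,
    Gamma0 x f1 e & {ae leb, forall t, k t = - f2 t}].
Proof.
have fae := ae_filter_ringOfSetsType leb.
split=> [[F [G rep]]|].
  have [f1 [f1E hF L1 H1]] := node_rep_glue rep.
  case: rep => FG Fz eG fF sG.
  have mg n : measurable (gap x n) by exact: measurable_itv.
  have f1E' n t : x n < t < x (n + 1) -> f1 t = G n t.
    by move=> /andP[t1 t2]; apply: f1E; rewrite (ltW t1).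
  have Lk : L2on leb setT (fun t => - k t).
    have [[m1 m2] ki] := L2P k; split.
      by split; [under eq_fun do rewrite ReN|under eq_fun do rewrite ImN]; exact: measurable_funN.
    rewrite (_ : (fun t => (sqn (- k t))%:E) = (fun t => (sqn (k t))%:E))//.
    by apply/funext => t; rewrite /sqn ReN ImN !sqrrN.
  have bracket n (K : set R) : compact K -> K `<=` gap x n ->
      [/\ x n <= x (n + 1), K `<=` `]x n, x (n + 1)[%classic & `]x n, x (n + 1)[%classic `<=` gap x n].
    by move=> _ Kn; split => //; exact: xle.
  exists f1, (fun t => - k t), f1; split.
  - split=> [n|].
      split; split.
      + exact: L2on_sub (L2P f).
      + exact: L2on_sub L1.
      + apply: cAC_weak_deriv => //; first by have [] := L2on_sub (mg n) (L2P f).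
        move=> K cK Kn; have [b1 b2 b3] := bracket n K cK Kn.
        exists (x n), (x (n + 1)), F; split => //; by apply: filterS fF => t -> _.
      + exact: L2on_sub L1.
      + exact: L2on_sub Lk.
      + apply: cAC_weak_deriv => //; first by have [] := L2on_sub (mg n) L1.
        move=> K cK Kn; have [b1 b2 b3] := bracket n K cK Kn.
        exists (x n), (x (n + 1)), (G n); split => //; first exact: (FG n).2.
        by apply: aeW => t; exact: f1E'.
    have [s1 _] := zsummable_gap x_incr d_gt0 x_gap (fun t => sqn_ge0 (f t)) (L2_sqn_integrable f).
    have [s2 _] := zsummable_gap x_incr d_gt0 x_gap (fun t => sqn_ge0 (f1 t)) (L2on_sqn_integrable L1).
    have [s3 _] := zsummable_gap x_incr d_gt0 x_gap (fun t => sqn_ge0 (- k t)) (L2on_sqn_integrable Lk).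
    have [s12 _] := zsum_lin 1 1 s1 s2; have [s123 _] := zsum_lin 1 1 s12 s3.
    apply: zsummable_le s123 => n; rewrite /H2_sqnorm ger0_norm; last first.
      by apply: Rintegral_ge0 => t _; exact: (addr_ge0 (addr_ge0 (sqn_ge0 _) (sqn_ge0 _)) (sqn_ge0 _)).
    have sub (h : R -> R[i]) : L2on leb setT h ->
        leb.-integrable `[x n, x (n + 1)] (EFin \o (fun t => sqn (h t))).
      by move=> Lh; apply: (integrableS _ _ _ (L2on_sqn_integrable Lh)) => //; exact: measurable_itv.
    have [i12 e12] := Rintegral_itvD 1 1 (sub _ (L2P f)) (sub _ L1).
    have [i123 e123] := Rintegral_itvD 1 1 i12 (sub _ Lk).
    rewrite -e12 -e123 (_ : (fun t => _ + _ + _) = (fun t =>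
      1 * (1 * sqn (f t) + 1 * sqn (f1 t)) + 1 * sqn (- k t))); last first.
      by apply/funext => t; ring.
    by rewrite /gap (Rintegral_oo_cc i123).
  - exact: H1.
  (* [F] is absolutely continuous on the union of two adjacent gaps; the radius is cut down so as to
     stay inside it. *)
  - move=> n; rewrite -Fz; apply/traceP; exists F; split; first by apply: filterS fF => t ->.
    move=> r r0; have hFF : cAC (x (n - 1)) (x (n + 1)) F f1.
      by apply: (cAC_cat _ (xle n) _ (hF n)); have := hF (n - 1); have := xle (n - 1); rewrite subrK.
    have l1 : x (n - 1) < x n by have := xlt (n - 1); rewrite subrK.
    have nn : x (n - 1) <= x n <= x (n + 1) by rewrite (ltW l1) xle.
    have [q q0 hq] := cAC_modulus (lt_trans l1 (xlt n)) hFF nn r0.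
    exists (Num.min q (Num.min (x n - x (n - 1)) (x (n + 1) - x n))).
      by rewrite !lt_min q0 !subr_gt0 l1 xlt.
    move=> t _; rewrite !lt_min => /andP[t1 /andP[]]; rewrite !ltr_norml => /andP[? ?] /andP[? ?].
    by apply: hq => //; apply/andP; split; lra.
  - move=> n; exists (G n (x n)), (G (n - 1) (x n)); split; last exact: eG.
      apply/(trace_cAC _ (xlt n) (FG n).2); rewrite ?lexx ?xle//.
      by apply: aeW => t; exact: f1E'.
    have := xle (n - 1); have [_ h2] := FG (n - 1); have := xlt (n - 1).
    have E := f1E' (n - 1); move: h2 E; rewrite /gap subrK => h2 E l1 l2.
    by apply/(trace_cAC _ l1 h2); rewrite ?lexx ?l2//; apply: aeW => t; exact: E.
  - by apply: aeW => t /=; rewrite opprK.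
move=> [f1 [f2 [g [[H2 sH] _ G1 G0 kf]]]].
have H n : exists FH : (R -> R[i]) * (R -> R[i]), [/\ cAC (x n) (x (n + 1)) FH.1 FH.2,
    cAC (x n) (x (n + 1)) FH.2 (fun t => - k t),
    {ae leb, forall t, x n < t < x (n + 1) -> f t = FH.1 t} &
    {ae leb, forall t, x n < t < x (n + 1) -> f1 t = FH.2 t}].
  have [[Lf Lf1 w1] [_ Lf2 w2]] := H2 n.
  have [F [cF fF]] := weak_deriv_cAC (xlt n) Lf Lf1 w1.
  have [Gn [cG fG]] := weak_deriv_cAC (xlt n) Lf1 Lf2 w2.
  exists (F, Gn); split => //=.
    by apply: (cAC_ae_deriv cF _ fG); exact: cAC_cintegrable cG.
  apply: (cAC_ae_deriv cG); first exact/cintegrableN/L2_cintegrable.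
  by apply: filterS kf => t -> _; rewrite opprK.
have {H}/choice[FH hFH] := H.
(* The trace of [f] on the whole line restricts to both gaps next to a node, so the gap
   representatives share the value [- z n] and glue to a continuous function. *)
have Tl n : (FH n).1 (x n) = - z n.
  have [cF _ fF _] := hFH n.
  apply/esym/(trace_cAC _ (xlt n) cF fF); first by rewrite lexx xle.
  exact: trace_sub (G1 n).
have Tr n : (FH n).1 (x (n + 1)) = - z (n + 1).
  have [cF _ fF _] := hFH n.
  apply/esym/(trace_cAC _ (xlt n) cF fF); first by rewrite lexx xle.
  exact: trace_sub (G1 (n + 1)).
have [idx [hi1 hi2]] := node_index_fun.
pose F t := (FH (idx t)).1 t.
have FE n t : x n <= t <= x (n + 1) -> (FH n).1 t = F t.
  move=> /andP[t1]; rewrite le_eqVlt => /predU1P[->|t2]; last by rewrite /F (hi2 n) ?t1.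
  by rewrite Tr /F (hi2 (n + 1)) ?lexx ?xlt// Tl.
exists F, (fun n => (FH n).2); split.
- by move=> n; have [cF cG _ _] := hFH n; split => //; exact: (cAC_ext_on (xle n) (FE n) cF).
- by move=> n; rewrite -(FE n) ?lexx ?xle// Tl.
- move=> n; have [p [q [tp tq ->]]] := G0 n; congr (_ - _).
    have [_ cG _ fG] := hFH n.
    have nn : x n <= x n <= x (n + 1) by rewrite lexx xle.
    exact: (iffLR (trace_cAC p (xlt n) cG fG nn) tp).
  have [_ cG _ fG] := hFH (n - 1); have l1 := xlt (n - 1); have l2 := xle (n - 1).
  move: tq cG fG l1 l2; rewrite /gap subrK => tq cG fG l1 l2.
  have nn : x (n - 1) <= x n <= x n by rewrite lexx l2.
  exact: (iffLR (trace_cAC q l1 cG fG nn) tq).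
- apply: (ae_gap d_gt0 x_gap) => n; have [_ _ fF _] := hFH n.
  by apply: filterS fF => t h tn; rewrite (h tn) FE//; move: tn => /andP[/ltW -> /ltW ->].
- apply: zsummable_le sH => n; have [_ cG _ fG] := hFH n; have [[Lf Lf1 _] [_ Lf2 _]] := H2 n.
  rewrite ger0_norm; last by apply: Rintegral_ge0 => t _; exact: sqn_ge0.
  have i0 := cAC_sqn_integrable (xle n) cG.
  have i1 := L2on_sqn_integrable Lf; have i2 := L2on_sqn_integrable Lf1; have i3 := L2on_sqn_integrable Lf2.
  rewrite -(Rintegral_oo_cc i0) -/(gap x n).
  have -> : \int[leb]_(t in gap x n) sqn ((FH n).2 t) = \int[leb]_(t in gap x n) sqn (f1 t).
    congr fine; apply: ae_eq_integral; first exact: measurable_itv.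
    - have := measurable_int _ i0; apply: measurable_funS; first exact: measurable_itv.
      exact: itvoo_sub_cc.
    - exact: measurable_int i2.
    - by apply: filterS fG => t h /=; rewrite /gap/= in_itv/= => /h ->.
  apply: le_Rintegral; [exact: measurable_itv|exact: i2| |].
    have [i12 _] := Rintegral_itvD 1 1 (integrable_oo_cc i1) (integrable_oo_cc i2).
    have [i123 _] := Rintegral_itvD 1 1 i12 (integrable_oo_cc i3).
    apply: (@eq_integrable _ _ _ leb _ _ (EFin \o (fun t =>
      1 * (1 * sqn (f t) + 1 * sqn (f1 t)) + 1 * sqn (f2 t)))); first exact: measurable_itv.
      by move=> t _ /=; congr EFin; ring.
    by apply: integrable_itvS i123 _; exact: itvoo_sub_cc.
  move=> t _; rewrite -addrA addrCA -[leLHS]addr0; apply: lerD => //.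
  exact: (addr_ge0 (sqn_ge0 _) (sqn_ge0 _)).
Qed.

End maximal_domain.

(** * The resolvent kernel *)

Section gap_equation.
Context {R : realType}.
Notation leb := (@lebesgue_measure R).
Variable s : R[i].
Hypothesis s_gt0 : 0 < Im s.
Implicit Types (a b t : R) (h p q : R -> R[i]) (c : R[i]).

Definition wave (r : R) : R[i] := cexp ('i%C * s * r%:C).

Lemma wave0 : wave 0 = 1. Proof. by rewrite /wave mulr0 cexp0. Qed.

Lemma waveD r t : wave (r + t) = wave r * wave t.
Proof. by rewrite /wave -cexpD -mulrDr; congr (cexp (_ * _)); apply: complex_ext; rewrite /= ?addr0. Qed.

Lemma cabs_wave r : cabs (wave r) = expR (- Im s * r).
Proof. by rewrite /wave cabs_cexp !ReM !ImM/=; congr expR; ring. Qed.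

Lemma cabs_wave_le1 r : 0 <= r -> cabs (wave r) <= 1.
Proof. by move=> r0; rewrite cabs_wave -expR0 ler_expR mulNr oppr_le0 mulr_ge0// ltW. Qed.

Lemma cAC_wave a b (r : R) : a <= b ->
  cAC a b (fun t => wave (t - r)) (fun t => 'i%C * s * wave (t - r)).
Proof.
move=> ab.
have h := cAC_mul ab (cAC_cst a b (wave (- r))) (cAC_cexp ('i%C * s) ab).
apply: cAC_ext h => t; first by rewrite addrC waveD.
by rewrite mul0r add0r [t - r]addrC waveD; rewrite /wave; ring.
Qed.

Lemma cAC_wave_opp a b (r : R) : a <= b ->
  cAC a b (fun t => wave (r - t)) (fun t => - ('i%C * s * wave (r - t))).
Proof.
move=> ab.
have E t : cexp (- ('i%C * s) * t%:C) = wave (- t).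
  rewrite /wave; congr cexp; rewrite mulNr -mulrN; congr (_ * _).
  by apply: complex_ext; rewrite /= ?oppr0.
have h := cAC_mul ab (cAC_cst a b (wave r)) (cAC_cexp (- ('i%C * s)) ab).
apply: cAC_ext h => t; first by rewrite waveD E.
by rewrite mul0r add0r waveD E; ring.
Qed.

Lemma cintegrable_mul_cAC a b p q h : a <= b -> cAC a b p q -> cintegrable leb `[a, b] h ->
  cintegrable leb `[a, b] (fun t => h t * p t).
Proof.
move=> ab [p1 p2] [h1 h2].
have H1 := integrable_rAC 0 h1; have H2 := integrable_rAC 0 h2.
have [i11 _ _] := rAC_parts ab H1 p1; have [i12 _ _] := rAC_parts ab H1 p2.
have [i21 _ _] := rAC_parts ab H2 p1; have [i22 _ _] := rAC_parts ab H2 p2.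
have [j1 _] := Rintegral_itvD 1 (-1) i11 i22; have [j2 _] := Rintegral_itvD 1 1 i12 i21.
have mI : measurable (`[a, b]%classic : set R) by exact: measurable_itv.
split.
  apply: (@eq_integrable _ _ _ leb _ _ (EFin \o (fun t =>
    1 * (Re (h t) * Re (p t)) + -1 * (Im (h t) * Im (p t))))); [exact: mI| |exact: j1].
  by move=> t _ /=; rewrite ReM; congr EFin; ring.
apply: (@eq_integrable _ _ _ leb _ _ (EFin \o (fun t =>
  1 * (Re (h t) * Im (p t)) + 1 * (Im (h t) * Re (p t))))); [exact: mI| |exact: j2].
by move=> t _ /=; rewrite ImM; congr EFin; ring.
Qed.

Lemma linear_ode a b c h : a <= b -> cintegrable leb `[a, b] h ->
  exists p, cAC a b p (fun t => c * p t + h t) /\ p a = 0.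
Proof.
move=> ab ih.
have i1 := cintegrable_mul_cAC ab (cAC_cexp (- c) ab) ih.
have h1 := cintegrable_cAC 0 i1.
have h2 := cAC_mul ab (cAC_cexp c ab) h1.
eexists; split.
  apply: cAC_ext h2 => t; first by [].
  have E : cexp (c * t%:C) * cexp (- c * t%:C) = 1 by rewrite -cexpD mulNr subrr cexp0.
  by rewrite -mulrA; congr (_ + _); rewrite mulrCA E mulr1.
rewrite /= /cint set_itv1 !Rintegral_set1.
by rewrite add0r [X in _ * X](_ : _ = 0) ?mulr0.
Qed.

(** The derivative of |p|^2 is - 2 Im s |p|^2 + 2 Re(h conj p), at most - Im s |p|^2 + |h|^2 / Im s.
    One inequality thus controls the outgoing value and the L2 norm, with constants independent of
    the length of the gap. *)
Lemma wave_energy a b p h : a <= b -> cAC a b p (fun t => 'i%C * s * p t + h t) ->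
  leb.-integrable `[a, b] (EFin \o (fun t => sqn (h t))) ->
  sqn (p b) + Im s * \int[leb]_(t in `[a, b]) sqn (p t) <=
  sqn (p a) + (Im s)^-1 * \int[leb]_(t in `[a, b]) sqn (h t).
Proof.
move=> ab hp ih; have hS := cAC_sqn ab hp; have ip := cAC_sqn_integrable ab hp.
have [iB eB] := Rintegral_itvD (- Im s) (Im s)^-1 ip ih.
have := hS.2 b; rewrite ab lexx => -> //.
suff H : \int[leb]_(t in `[a, b]) (2 * (Re (p t) * Re ('i%C * s * p t + h t) +
    Im (p t) * Im ('i%C * s * p t + h t))) <=
    - Im s * \int[leb]_(t in `[a, b]) sqn (p t) + (Im s)^-1 * \int[leb]_(t in `[a, b]) sqn (h t).
  by move: H; move: (Rintegral _ _ _) (Rintegral _ _ _) (Rintegral _ _ _) => *; nra.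
rewrite -eB; apply: le_Rintegral_itv; [exact: hS.1|exact: iB|] => t _.
have c1 : Re ('i%C * s) = - Im s by rewrite ReM/=; ring.
have c2 : Im ('i%C * s) = Re s by rewrite ImM/=; ring.
move: ('i%C * s) c1 c2 => c c1 c2.
rewrite !ReD !ImD !ReM !ImM /sqn c1 c2; move: (Re (p t)) (Im (p t)) (Re (h t)) (Im (h t)) => u v y w.
have si : 0 < (Im s)^-1 by rewrite invr_gt0.
have E : Im s * (Im s)^-1 = 1 by rewrite divff ?gt_eqF.
move: (Re s) (Im s) (Im s)^-1 s_gt0 si E => k g gi g0 gi0 E.
have h1 : 0 <= gi * (g * u - y) ^+ 2 by rewrite mulr_ge0 ?sqr_ge0// ltW.
have h2 : 0 <= gi * (g * v - w) ^+ 2 by rewrite mulr_ge0 ?sqr_ge0// ltW.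
have e1 : gi * (g * u - y) ^+ 2 = g * u ^+ 2 - 2 * (u * y) + gi * y ^+ 2.
  have -> : gi * (g * u - y) ^+ 2 = (g * gi) * (g * u ^+ 2) - 2 * (g * gi) * (u * y) + gi * y ^+ 2 by ring.
  by rewrite E; ring.
have e2 : gi * (g * v - w) ^+ 2 = g * v ^+ 2 - 2 * (v * w) + gi * w ^+ 2.
  have -> : gi * (g * v - w) ^+ 2 = (g * gi) * (g * v ^+ 2) - 2 * (g * gi) * (v * w) + gi * w ^+ 2 by ring.
  by rewrite E; ring.
by rewrite e1 in h1; rewrite e2 in h2; lra.
Qed.

Lemma wave_energy_opp a b q h : a <= b -> cAC a b q (fun t => - ('i%C * s * q t) - h t) ->
  leb.-integrable `[a, b] (EFin \o (fun t => sqn (h t))) ->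
  sqn (q a) + Im s * \int[leb]_(t in `[a, b]) sqn (q t) <=
  sqn (q b) + (Im s)^-1 * \int[leb]_(t in `[a, b]) sqn (h t).
Proof.
move=> ab hp ih; have hS := cAC_sqn ab hp; have ip := cAC_sqn_integrable ab hp.
have [iB eB] := Rintegral_itvD (Im s) (- (Im s)^-1) ip ih.
have := hS.2 b; rewrite ab lexx => -> //.
suff H : Im s * \int[leb]_(t in `[a, b]) sqn (q t) + - (Im s)^-1 * \int[leb]_(t in `[a, b]) sqn (h t) <=
    \int[leb]_(t in `[a, b]) (2 * (Re (q t) * Re (- ('i%C * s * q t) - h t) +
    Im (q t) * Im (- ('i%C * s * q t) - h t))).
  by move: H; move: (Rintegral _ _ _) (Rintegral _ _ _) (Rintegral _ _ _) => *; nra.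
rewrite -eB; apply: le_Rintegral_itv; [exact: iB|exact: hS.1|] => t _.
have c1 : Re ('i%C * s) = - Im s by rewrite ReM/=; ring.
have c2 : Im ('i%C * s) = Re s by rewrite ImM/=; ring.
move: ('i%C * s) c1 c2 => c c1 c2.
rewrite !ReD !ImD !ReN !ImN !ReM !ImM /sqn c1 c2; move: (Re (q t)) (Im (q t)) (Re (h t)) (Im (h t)) => u v y w.
have si : 0 < (Im s)^-1 by rewrite invr_gt0.
have E : Im s * (Im s)^-1 = 1 by rewrite divff ?gt_eqF.
move: (Re s) (Im s) (Im s)^-1 s_gt0 si E => k g gi g0 gi0 E.
have h1 : 0 <= gi * (g * u - y) ^+ 2 by rewrite mulr_ge0 ?sqr_ge0// ltW.
have h2 : 0 <= gi * (g * v - w) ^+ 2 by rewrite mulr_ge0 ?sqr_ge0// ltW.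
have e1 : gi * (g * u - y) ^+ 2 = g * u ^+ 2 - 2 * (u * y) + gi * y ^+ 2.
  have -> : gi * (g * u - y) ^+ 2 = (g * gi) * (g * u ^+ 2) - 2 * (g * gi) * (u * y) + gi * y ^+ 2 by ring.
  by rewrite E; ring.
have e2 : gi * (g * v - w) ^+ 2 = g * v ^+ 2 - 2 * (v * w) + gi * w ^+ 2.
  have -> : gi * (g * v - w) ^+ 2 = (g * gi) * (g * v ^+ 2) - 2 * (g * gi) * (v * w) + gi * w ^+ 2 by ring.
  by rewrite E; ring.
by rewrite e1 in h1; rewrite e2 in h2; lra.
Qed.

(** Factorization of the second-order equation into two first-order ones: [p] travels to the right
    and starts from zero on the left, [q] travels to the left and starts from zero on the right, so
    both decay in their direction of travel. [q] is corrected by a homogeneous wave to vanish at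
    [b]. *)
Lemma gap_solutions a b h : a <= b -> cintegrable leb `[a, b] h -> exists p q,
  [/\ cAC a b p (fun t => 'i%C * s * p t + h t), p a = 0,
      cAC a b q (fun t => - ('i%C * s * q t) - h t) & q b = 0].
Proof.
move=> ab ih; have [p [hp p0]] := linear_ode ('i%C * s) ab ih.
have [q1 [hq _]] := linear_ode (- ('i%C * s)) ab (cintegrableN ih).
exists p, (fun t => - q1 b * wave (b - t) + q1 t); split => //.
  by apply: cAC_ext (cAC_lin (- q1 b) ab (cAC_wave_opp b ab) hq) => t; ring.
by rewrite subrr wave0; ring.
Qed.

End gap_equation.

Section node_equation.
Context {R : realType}.
Notation leb := (@lebesgue_measure R).
Variables (x : int -> R) (d : R) (s : R[i]).
Hypotheses (x_incr : forall m n : int, m < n -> x m < x n) (d_gt0 : 0 < d)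
  (x_gap : forall n, d <= x (n + 1) - x n) (s_gt0 : 0 < Im s).
Implicit Types (e z : l2 R) (n : int) (t : R).

Let xlt n : x n < x (n + 1) := node_lt x_incr n.
Let xle n : x n <= x (n + 1) := ltW (xlt n).
Local Notation gapint q n := (\int[leb]_(t in `[x n, x (n + 1)]) q t).

Definition decay : R := expR (- Im s * d).

Lemma decay_ge0_lt1 : 0 <= decay < 1.
Proof. by rewrite expR_ge0/= -expR0 ltr_expR mulNr oppr_lt0 mulr_gt0. Qed.

Lemma cabs_wave_gap (r : R) : d <= r -> cabs (wave s r) <= decay.
Proof. by move=> dr; rewrite cabs_wave ler_expR !mulNr lerN2 ler_pM2l. Qed.

Lemma node_recurrence_pred (a : l2 R) : exists al : l2 R,
  (forall n, al n = wave s (x n - x (n - 1)) * al (n - 1) + a n) /\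
  hnorm (al - a) <= decay * hnorm al.
Proof.
have /andP[q0 q1] := decay_ge0_lt1.
have w n : cabs (wave s (x n - x (n - 1))) <= decay.
  by apply: cabs_wave_gap; have := x_gap (n - 1); rewrite subrK.
have [Z [Zl Ze Zb]] := weighted_shift_pred q0 w.
have [al e] := neumann_solve decay_ge0_lt1 Zl Zb a.
exists al; split=> [n|]; first by rewrite {1}e l2D Ze.
by rewrite {1}e addrK.
Qed.

Lemma node_recurrence_succ (a : l2 R) : exists be : l2 R,
  (forall n, be n = wave s (x (n + 1) - x n) * be (n + 1) + a n) /\
  hnorm (be - a) <= decay * hnorm be.
Proof.
have /andP[q0 q1] := decay_ge0_lt1.
have w n : cabs (wave s (x (n + 1) - x n)) <= decay by exact: cabs_wave_gap.
have [Z [Zl Ze Zb]] := weighted_shift_succ q0 w.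
have [be e] := neumann_solve decay_ge0_lt1 Zl Zb a.
exists be; split=> [n|]; first by rewrite {1}e l2D Ze.
by rewrite {1}e addrK.
Qed.

Lemma s_neq0 : s != 0.
Proof. by apply: contraTneq s_gt0 => ->; rewrite ltxx. Qed.

(** The prefactor of the series for M; the series for gamma carries its negative. *)
Definition coupling : R[i] := 'i%C / (2 * s).

Lemma coupling_is : coupling * ('i%C * s) = - 2^-1.
Proof.
have i2 : 'i%C * 'i%C = -1 :> R[i] by rewrite -expr2 sqr_i.
have -> : coupling * ('i%C * s) = 'i%C * 'i%C * (s / (2 * s)).
  by rewrite /coupling; ring.
by rewrite i2; field; exact: s_neq0.
Qed.

Lemma coupling_sqr : s ^+ 2 * coupling = 2^-1 * ('i%C * s).
Proof. by rewrite /coupling; field; exact: s_neq0. Qed.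

Variables (h : L2R R) (P Q : int -> R -> R[i]).
Hypotheses (hP : forall n, cAC (x n) (x (n + 1)) (P n) (fun t => 'i%C * s * P n t + h t))
  (hP0 : forall n, P n (x n) = 0)
  (hQ : forall n, cAC (x n) (x (n + 1)) (Q n) (fun t => - ('i%C * s * Q n t) - h t))
  (hQ0 : forall n, Q n (x (n + 1)) = 0).

Let H n := gapint (fun t => sqn (h t)) n.

Lemma H_summable : (forall n, 0 <= H n) /\ zsummable H.
Proof.
split=> [n|]; first by apply: Rintegral_ge0 => t _; exact: sqn_ge0.
by have [] := zsummable_gap x_incr d_gt0 x_gap (fun t => sqn_ge0 (h t)) (L2_sqn_integrable h).
Qed.

Lemma zsummable_scale c (a : int -> R) : zsummable a -> zsummable (fun n => c * a n).
Proof.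
move=> sa; have [+ _] := zsum_lin c 0 sa sa.
by rewrite (_ : (fun n => _) = fun n => c * a n)//; apply/funext => n; rewrite mul0r addr0.
Qed.

(** The energy inequalities bound these outgoing values by the L2 norm of [h] on one gap, and these
    norms are square summable. *)
Lemma forced_l2 : exists U V : l2 R,
  (forall n, U n = P (n - 1) (x n)) /\ (forall n, V n = Q n (x n)).
Proof.
have [H0 Hs] := H_summable.
have [Hs' _] := zsum_shift_pred H0 Hs.
have bP n : sqn (P n (x (n + 1))) <= (Im s)^-1 * H n.
  have := wave_energy s_gt0 (xle n) (hP n) (L2_sqn_integrable_itv h _ _).
  rewrite hP0 sqn0 add0r; apply: le_trans; rewrite lerDl; apply: (mulr_ge0 (ltW s_gt0)).
  by apply: Rintegral_ge0 => t _; exact: sqn_ge0.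
have bQ n : sqn (Q n (x n)) <= (Im s)^-1 * H n.
  have := wave_energy_opp s_gt0 (xle n) (hQ n) (L2_sqn_integrable_itv h _ _).
  rewrite hQ0 sqn0 add0r; apply: le_trans; rewrite lerDl; apply: (mulr_ge0 (ltW s_gt0)).
  by apply: Rintegral_ge0 => t _; exact: sqn_ge0.
have [|U UE] := l2_mk (f := fun n => P (n - 1) (x n)).
  apply: (@zsummable_le _ _ (fun n => (Im s)^-1 * H (n - 1))); last exact: zsummable_scale.
  by move=> n; rewrite ger0_norm ?sqn_ge0//; have := bP (n - 1); rewrite subrK.
have [|V VE] := l2_mk (f := fun n => Q n (x n)).
  apply: (@zsummable_le _ _ (fun n => (Im s)^-1 * H n)); last exact: zsummable_scale.
  by move=> n; rewrite ger0_norm ?sqn_ge0.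
by exists U, V.
Qed.

(** On gap [n] the solution is [coupling] times p + q, where [al n] is the amplitude entering from
    the left and [be (n + 1)] the one entering from the right. The recurrences only pass amplitudes
    from one gap to the next. *)
Lemma node_solve e : exists f z (al be : l2 R) F G,
  [/\ node_rep x f (h + s ^+ 2 *: f) z e F G,
      forall n, al n = wave s (x n - x (n - 1)) * al (n - 1) + (P (n - 1) (x n) - e n),
      forall n, be n = wave s (x (n + 1) - x n) * be (n + 1) + (Q n (x n) - e n),
      z = - coupling *: (al + be + e) &
      forall n t, x n <= t < x (n + 1) -> F t = coupling *
        (al n * wave s (t - x n) + P n t + (be (n + 1) * wave s (x (n + 1) - t) + Q n t))].
Proof.
have fae := ae_filter_ringOfSetsType leb.
have [U [V [UE VE]]] := forced_l2.
have [al [alE _]] := node_recurrence_pred (U - e).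
have [be [beE _]] := node_recurrence_succ (V - e).
pose p n t := al n * wave s (t - x n) + P n t.
pose q n t := be (n + 1) * wave s (x (n + 1) - t) + Q n t.
have cp n : cAC (x n) (x (n + 1)) (p n) (fun t => 'i%C * s * p n t + h t).
  by apply: cAC_ext (cAC_lin (al n) (xle n) (cAC_wave s (x n) (xle n)) (hP n)) => t; rewrite /p; ring.
have cq n : cAC (x n) (x (n + 1)) (q n) (fun t => - ('i%C * s * q n t) - h t).
  by apply: cAC_ext (cAC_lin (be (n + 1)) (xle n) (cAC_wave_opp s (x (n + 1)) (xle n)) (hQ n)) => t;
    rewrite /q; ring.
(* Crossing [x n] from left to right, [p] loses [e n] and [q] gains [e n]. So p + q is continuous,
   while the derivative, which is (q - p) / 2, jumps by exactly [e n]. *)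
have pl n : p n (x n) = al n by rewrite /p subrr wave0 mulr1 hP0 addr0.
have qr n : q n (x (n + 1)) = be (n + 1) by rewrite /q subrr wave0 mulr1 hQ0 addr0.
have pr n : p n (x (n + 1)) = al (n + 1) + e (n + 1).
  by rewrite alE l2D l2N UE /p addrK; ring.
have ql n : q n (x n) = be n + e n.
  by rewrite [in RHS]beE l2D l2N VE /q; ring.
pose Fn n t := coupling * p n t + coupling * q n t.
pose G n t := - 2^-1 * p n t + 2^-1 * q n t.
have cF n : cAC (x n) (x (n + 1)) (Fn n) (G n).
  have c2 := cAC_lin 0 (xle n) (cq n) (cAC_cst (x n) (x (n + 1)) 0).
  have h2 := cAC_lin coupling (xle n) (cq n) (cAC_cst (x n) (x (n + 1)) 0).
  apply: cAC_ext (cAC_lin coupling (xle n) (cp n) h2) => t; first by rewrite /Fn addr0.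
  rewrite /G addr0 -coupling_is; have -> : 2^-1 = - (coupling * ('i%C * s)) by rewrite coupling_is opprK.
  by ring.
have cG n : cAC (x n) (x (n + 1)) (G n) (fun t => - (s ^+ 2 * Fn n t + h t)).
  have h2 := cAC_lin (2^-1) (xle n) (cq n) (cAC_cst (x n) (x (n + 1)) 0).
  apply: cAC_ext (cAC_lin (- 2^-1) (xle n) (cp n) h2) => t; first by rewrite /G addr0.
  have -> : s ^+ 2 * Fn n t = 2^-1 * ('i%C * s) * (p n t + q n t).
    by rewrite /Fn -coupling_sqr; ring.
  rewrite addr0.
  have h21 : h t = 2^-1 * h t + 2^-1 * h t by field.
  by rewrite [in RHS]h21; ring.
have [idx [hi1 hi2]] := node_index_fun x_incr d_gt0 x_gap.
pose F t := Fn (idx t) t.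
have FE n t : x n <= t <= x (n + 1) -> Fn n t = F t.
  move=> /andP[t1]; rewrite le_eqVlt => /predU1P[->|t2]; last by rewrite /F (hi2 n) ?t1.
  by rewrite /F (hi2 (n + 1)) ?lexx ?xlt// /Fn pr qr pl ql; ring.
have cFF n : cAC (x n) (x (n + 1)) F (G n) := cAC_ext_on (xle n) (FE n) (cF n).
have [H0 Hs] := H_summable.
have bp n : gapint (fun t => sqn (p n t)) n <= (Im s)^-1 * (sqn (al n) + (Im s)^-1 * H n).
  have := wave_energy s_gt0 (xle n) (cp n) (L2_sqn_integrable_itv h _ _).
  by rewrite pl => E; rewrite ler_pdivlMl//; apply: le_trans E; rewrite lerDr sqn_ge0.
have bq n : gapint (fun t => sqn (q n t)) n <= (Im s)^-1 * (sqn (be (n + 1)) + (Im s)^-1 * H n).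
  have := wave_energy_opp s_gt0 (xle n) (cq n) (L2_sqn_integrable_itv h _ _).
  by rewrite qr => E; rewrite ler_pdivlMl//; apply: le_trans E; rewrite lerDr sqn_ge0.
have summable_comb (c c' : R[i]) : zsummable (fun n => gapint (fun t => sqn (c * p n t + c' * q n t)) n).
  have [sA _] := zsum_lin (Im s)^-1 ((Im s)^-1 * (Im s)^-1) (@l2P R al) Hs.
  have [sb _] := zsum_shift_succ (fun n => sqn_ge0 (be n)) (@l2P R be).
  have [sB _] := zsum_lin (Im s)^-1 ((Im s)^-1 * (Im s)^-1) sb Hs.
  have [sC _] := zsum_lin (2 * sqn c) (2 * sqn c') sA sB.
  apply: zsummable_le sC => n; rewrite ger0_norm; last first.
    by apply: Rintegral_ge0 => t _; exact: sqn_ge0.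
  have ip := cAC_sqn_integrable (xle n) (cp n); have iq := cAC_sqn_integrable (xle n) (cq n).
  have [i1 e1] := Rintegral_itvD (2 * sqn c) (2 * sqn c') ip iq.
  have c2 := cAC_lin c' (xle n) (cq n) (cAC_cst (x n) (x (n + 1)) 0).
  have i2 := cAC_sqn_integrable (xle n) (cAC_lin c (xle n) (cp n) c2).
  have i2' : leb.-integrable `[x n, x (n + 1)] (EFin \o (fun t => sqn (c * p n t + c' * q n t))).
    by move: i2; rewrite (_ : (fun t => sqn (_ + _)) = (fun t => sqn (c * p n t + c' * q n t)))//;
      apply/funext => t; rewrite addr0.
  apply: (@le_trans _ _ (2 * sqn c * gapint (fun t => sqn (p n t)) n +
      2 * sqn c' * gapint (fun t => sqn (q n t)) n)).
    rewrite -e1; apply: (le_Rintegral_itv i2' i1) => t _.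
    by rewrite (le_trans (sqnD_le _ _))// !sqnM !mulrA.
  have k0 (w : R[i]) : 0 <= 2 * sqn w by rewrite mulr_ge0 ?sqn_ge0.
  by apply: lerD; apply: ler_wpM2l => //; rewrite -mulrA -mulrDr; [exact: bp|exact: bq].
have LF : L2on leb setT F.
  apply: (@glue_L2 _ x d x_incr d_gt0 x_gap F Fn).
  - by move=> n; exact: cAC_cintegrable (xle n) (cF n).
  - by move=> n; exact: cAC_sqn_integrable (xle n) (cF n).
  - by move=> n t /andP[t1 t2]; rewrite -(FE n)// (ltW t1) ltW.
  - pose f1 t := G (idx t) t.
    have hF1 n : cAC (x n) (x (n + 1)) F f1.
      apply: cAC_ext_deriv (cFF n) => t /andP[t1 t2].
      by rewrite /f1 (hi2 n)// (ltW t1).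
    apply: (window_cmeasurable d_gt0 x_gap) => N.
    have xN : x (- Posz N) <= x (Posz N) by apply: (node_le x_incr); lia.
    have hW := window_cAC x_incr d_gt0 hF1 N.
    exact: (cAC_cintegrable xN hW).
  - exact: summable_comb.
have [f fF] := L2_mk LF.
exists f, (- coupling *: (al + be + e)), al, be, F, G; split; [| | |exact: erefl|].
- split.
  + move=> n; split; first exact: cFF.
    apply: (cAC_ae_deriv (cG n)); first exact/cintegrableN/L2_cintegrable.
    rewrite [h + _]addrC; apply: filterS2 fF (L2_linE (s ^+ 2) f h) => t ft -> /andP[t1 t2].
    by rewrite ft -(FE n)// (ltW t1) ltW.
  + by move=> n; rewrite -(FE n) ?lexx ?xle// /Fn pl ql l2Z !l2D; ring.
  + move=> n; rewrite /G pl ql.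
    have := pr (n - 1); have := qr (n - 1); rewrite subrK => -> ->.
    have e2 : e n = 2^-1 * e n + 2^-1 * e n by field.
    by rewrite [in LHS]e2; ring.
  + exact: fF.
  + exact: summable_comb.
- by move=> n; rewrite alE l2D l2N UE.
- by move=> n; rewrite beE l2D l2N VE.
- by move=> n t /andP[t1 t2]; rewrite -(FE n) ?t1 ?ltW// /Fn /p /q; ring.
Qed.

End node_equation.

Section bilateral_telescoping.
Context {R : realType}.

(** Partial sums equal b(n) - b(-n), so the series is evaluated without any prior proof of
    summability. *)
Lemma csum_telescope (g b : int -> R[i]) (L : R[i]) : (forall n, g n = b (n + 1) - b n) ->
  (forall r : R, 0 < r -> exists N, forall n, (N <= n)%N ->
    cabs (L - b (Posz n)) < r /\ cabs (b (- Posz n)) < r) ->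
  csum g = L.
Proof.
move=> gb lim.
have part (p : R[i] -> R) : (forall z w, p (z - w) = p z - p w) -> (forall z, `|p z| <= cabs z) ->
    zsum (fun n => p (g n)) = p L.
  move=> pB pc; apply: (cvg_lim (@Rhausdorff R)); apply/eps_cvgn => r r0.
  have r2 : 0 < r / 2 by lra.
  have [N hN] := lim _ r2; exists N => n /hN[l1 l2].
  rewrite (_ : (fun n => p (g n)) = (fun n => p (b (n + 1)) - p (b n))); last first.
    by apply/funext => k; rewrite gb pB.
  rewrite (zseries_telescope (fun k => p (b k))) opprB addrCA.
  rewrite (le_lt_trans (ler_normD _ _))// -pB.
  by have := pc (L - b (Posz n)); have := pc (b (- Posz n)); lra.
apply: complex_ext; rewrite /csum/=.
  by apply: part => [z w|z]; [rewrite ReB|exact: Re_le_cabs].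
by apply: part => [z w|z]; [rewrite ImB|exact: Im_le_cabs].
Qed.

Lemma csum_single (f : int -> R[i]) : (forall n, n != 0 -> f n = 0) -> csum f = f 0.
Proof.
move=> f0; apply: (@csum_telescope _ (fun n => if n <= 0 then 0 else f 0)) => [n|r r0].
  case: (ltgtP n 0) => [n0|n0|->]; last by rewrite add0r ler10 subr0.
    by rewrite -lezD1 in n0; rewrite n0 subr0 f0// lt_eqF// -lezD1.
  by rewrite leNgt (lt_trans n0) ?ltrDl// subrr f0// gt_eqF.
exists 1%N => n n1.
have -> : (Posz n <= 0) = false by apply/negbTE; lia.
have -> : - Posz n <= 0 by lia.
by rewrite subrr cabs0.
Qed.

Lemma l2_tail (u : l2 R) (r : R) : 0 < r -> exists N, forall n, (N <= n)%N ->
  cabs (u (Posz n)) < r /\ cabs (u (Negz n)) < r.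
Proof.
move=> r0; have [c1 c2] := zsummable_cvg0 (fun n => sqn_ge0 (u n)) (@l2P R u).
have r2 : 0 < r ^+ 2 by rewrite exprn_gt0.
have [N1 h1] := cvgn_eps c1 r2; have [N2 h2] := cvgn_eps c2 r2.
exists (maxn N1 N2) => n; rewrite geq_max => /andP[/h1 + /h2].
rewrite !sub0r !normrN !ger0_norm ?sqn_ge0// -!cabs_sqr.
by rewrite !ltr_pXn2r ?nnegrE ?cabs_ge0// ltW.
Qed.

End bilateral_telescoping.

Section perturbed_sum.
Context {R : realType} {K : preHilbertType R} {al be e : K} {r : R}.
Hypotheses (al_le : hnorm (al + e) <= r * hnorm e) (be_le : hnorm (be + e) <= r * hnorm e).

Let sumE : al + be + e = (al + e) + (be + e) - e.
Proof. by rewrite addrACA [in RHS]addrA addrK. Qed.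

Lemma hnorm_perturbed_sum : hnorm (al + be + e) <= (r + r + 1) * hnorm e.
Proof.
rewrite sumE !mulrDl mul1r (le_trans (ler_hnormB _ _))// lerD2r.
exact: le_trans (ler_hnormD _ _) (lerD al_le be_le).
Qed.

(** [al] and [be] are both close to [- e], so al + be + e is close to [- e]. Real and imaginary
    parts are added because the coupling constant used with this lemma is a positive multiple of 1 +
    i. *)
Lemma inner_perturbed_sum :
  Re '[al + be + e, e] + Im '[al + be + e, e] <= - (1 - 4 * r) * hnorm e ^+ 2.
Proof.
have [rC iC] : (forall a : R, Re a%:C = a) /\ (forall a : R, Im a%:C = 0) by [].
rewrite sumE innerBl innerDl !ReB !ImB !ReD !ImD inner_selfE rC iC.
have bnd (w : K) : hnorm w <= r * hnorm e ->
    Re '[w, e] <= r * hnorm e ^+ 2 /\ Im '[w, e] <= r * hnorm e ^+ 2.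
  move=> wr; have we : hnorm w * hnorm e <= r * hnorm e ^+ 2.
    by rewrite expr2 mulrA ler_wpM2r ?hnorm_ge0.
  have [h1 h2] := (Re_inner_norm_le w e, Im_inner_norm_le w e).
  by split; apply: le_trans we; [apply: le_trans h1|apply: le_trans h2]; exact: ler_norm.
have [a1 a2] := bnd _ al_le; have [b1 b2] := bnd _ be_le.
move: a1 a2 b1 b2; move: (Re _) (Im _) (Re _) (Im _) (hnorm e ^+ 2) => *; lra.
Qed.

End perturbed_sum.

Section resolvent_kernel.
Context {R : realType}.
Notation leb := (@lebesgue_measure R).
Variables (x : int -> R) (d : R).
Hypotheses (x_incr : forall m n : int, m < n -> x m < x n) (d_gt0 : 0 < d)
  (x_gap : forall n, d <= x (n + 1) - x n).
Implicit Types (e z : l2 R) (n : int) (t : R) (s l : R[i]) (u : L2R R).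

Let xlt n : x n < x (n + 1) := node_lt x_incr n.
Let xle n : x n <= x (n + 1) := ltW (xlt n).
Local Notation D := (max_domain x).

Lemma solve_existence s (h : L2R R) e : 0 < Im s -> exists f z, D f (h + s ^+ 2 *: f) z e.
Proof.
move=> s0.
have /choice[PQ hPQ] : forall n, exists PQ : (R -> R[i]) * (R -> R[i]),
    [/\ cAC (x n) (x (n + 1)) PQ.1 (fun t => 'i%C * s * PQ.1 t + h t), PQ.1 (x n) = 0,
      cAC (x n) (x (n + 1)) PQ.2 (fun t => - ('i%C * s * PQ.2 t) - h t) & PQ.2 (x (n + 1)) = 0].
  move=> n; have [p [q hpq]] := gap_solutions s (xle n) (L2_cintegrable h (x n) (x (n + 1))).
  by exists (p, q).
have [||||f [z [al [be [F [G [rep _ _ _ _]]]]]]] := @node_solve R x d s x_incr d_gt0 x_gap s0 h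
  (fun n => (PQ n).1) (fun n => (PQ n).2) _ _ _ _ e.
- by move=> n; have [] := hPQ n.
- by move=> n; have [] := hPQ n.
- by move=> n; have [] := hPQ n.
- by move=> n; have [] := hPQ n.
by exists f, z, F, G.
Qed.

(* [- al n] is the sum over [k <= n] of [exp (i s (x n - x k)) e k], and [- be n]
   the corresponding sum over [k >= n]. *)
Definition node_waves s e (al be : l2 R) : Prop :=
  (forall n, al n = wave s (x n - x (n - 1)) * al (n - 1) - e n) /\
  (forall n, be n = wave s (x (n + 1) - x n) * be (n + 1) - e n).

Lemma kernel_solution s e : 0 < Im s -> exists f z (al be : l2 R) (F : R -> R[i]),
  [/\ D f (s ^+ 2 *: f) z e, node_waves s e al be, z = - coupling s *: (al + be + e),
      {ae leb, forall t, f t = F t} &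
      forall n t, x n <= t < x (n + 1) -> F t = coupling s *
        (al n * wave s (t - x n) + be (n + 1) * wave s (x (n + 1) - t))].
Proof.
move=> s0; have z0 := @L20E _ _ R leb.
have fae := ae_filter_ringOfSetsType leb.
have [||||f [z [al [be [F [G [rep alE beE zE FE]]]]]]] := @node_solve R x d s x_incr d_gt0 x_gap s0 0
  (fun _ _ => 0) (fun _ _ => 0) _ _ _ _ e.
- move=> n; have h0 := L2_cintegrable (0 : L2R R) (x n) (x (n + 1)).
  apply: cAC_ext (cAC_ae_deriv (cAC_cst _ _ 0) h0 _) => [//|t|]; first by rewrite mulr0 add0r.
  by apply: filterS z0 => t -> _.
- by [].
- move=> n; have h0 := cintegrableN (L2_cintegrable (0 : L2R R) (x n) (x (n + 1))).
  apply: cAC_ext (cAC_ae_deriv (cAC_cst _ _ 0) h0 _) => [//|t|]; first by rewrite mulr0 oppr0 add0r.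
  by apply: filterS z0 => t -> _; rewrite oppr0.
- by [].
exists f, z, al, be, F; split => //.
- by exists F, G; rewrite add0r in rep.
- by split=> n; rewrite (alE, beE) add0r.
- by case: rep.
- by move=> n t /FE ->; rewrite !addr0.
Qed.

(** The recurrence reads a + e = Z a with a weighted shift of norm at most q = [decay]; then |a| <=
    |e| / (1 - q), and one factor [q] remains. *)
Lemma node_waves_bound s e al be : 0 < Im s -> node_waves s e al be ->
  hnorm (al + e) <= decay d s / (1 - decay d s) * hnorm e /\
  hnorm (be + e) <= decay d s / (1 - decay d s) * hnorm e.
Proof.
move=> s0 [ha hb]; have q01 := decay_ge0_lt1 d_gt0 s0; have /andP[q0 q1] := q01.
have key (a : l2 R) : hnorm (a + e) <= decay d s * hnorm a ->
    hnorm (a + e) <= decay d s / (1 - decay d s) * hnorm e.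
  move=> h; have := ler_hnormB (a + e) e; rewrite addrK => h1.
  have q2 : 0 < 1 - decay d s by lra.
  rewrite mulrAC ler_pdivlMr//; move: h h1; have := hnorm_ge0 a.
  move: (hnorm _) (hnorm _) (hnorm _) (decay d s) q0 q1 q2 => *; nra.
have wg n := cabs_wave_gap s0 (x_gap n).
split; apply: key.
  have [|Z [_ ZE Zb]] := @weighted_shift_pred R (fun n => wave s (x n - x (n - 1))) _ q0.
    by move=> n; have := wg (n - 1); rewrite subrK.
  suff -> : al + e = Z al by exact: Zb.
  by apply: l2_ext => n; rewrite l2D ZE [in LHS]ha subrK.
have [Z [_ ZE Zb]] := weighted_shift_succ q0 wg.
suff -> : be + e = Z be by exact: Zb.
by apply: l2_ext => n; rewrite l2D ZE [in LHS]hb subrK.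
Qed.

Lemma cabs_coupling s : s != 0 -> cabs (coupling s) = (2 * cabs s)^-1.
Proof.
move=> s0; have c0 : cabs s != 0 by apply: contra_neq s0; exact: cabs_eq0.
have h : cabs (coupling s) * (2 * cabs s) = 1.
  have -> : 2 = cabs (2 : R[i]) by rewrite (_ : 2 = (2 : R)%:C) ?cabsr ?ger0_norm// rmorph_nat.
  rewrite -cabsM -cabsM /coupling divfK ?mulf_neq0 ?pnatr_eq0//.
  by rewrite /cabs /sqn/= expr0n/= add0r expr1n sqrtr1.
by apply: (mulIf (_ : 2 * cabs s != 0)); rewrite ?h ?mulVf// mulf_neq0 ?pnatr_eq0.
Qed.

Lemma kernel_csum s e al be m t : 0 < Im s -> node_waves s e al be -> x m <= t <= x (m + 1) ->
  csum (fun n => cexp ('i%C * s * `|x n - t|%:C) * e n) =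
  - (al m * wave s (t - x m) + be (m + 1) * wave s (x (m + 1) - t)).
Proof.
move=> s0 [ha hb] /andP[mt tm]; set L := - (al m * _ + _).
(* The terms are the increments of [S] on the left of [t] and of [T] on its
   right. *)
pose S n := - (wave s (t - x (n - 1)) * al (n - 1)).
pose T n := L + wave s (x n - t) * be n.
pose b n := if n <= m then S n else T n.
have ST : S (m + 1) = T (m + 1) by rewrite /S /T /L addrK; ring.
have bS n : n <= m + 1 -> b n = S n.
  move=> nm; rewrite /b; have [//|mn] := leP n m.
  by have -> : n = m + 1 by lia.
have bT n : m + 1 <= n -> b n = T n by move=> mn; rewrite /b leNgt -lezD1 mn.
have xm n : n <= m -> x n <= t by move=> nm; apply: le_trans mt; exact: (node_le x_incr).
have xp n : m + 1 <= n -> t <= x n by move=> nm; apply: le_trans tm _; exact: (node_le x_incr).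
apply: (@csum_telescope _ _ b) => [n|r r0].
  have [nm|mn] := leP n m.
    rewrite (bS (n + 1)) ?lerD2r// (bS n) ?(le_trans nm) ?lerDl// /S addrK.
    have tn := xm n nm; rewrite distrC ger0_norm ?subr_ge0// -/(wave s (t - x n)).
    have -> : t - x (n - 1) = (t - x n) + (x n - x (n - 1)) by rewrite addrA subrK.
    by rewrite (waveD s (t - x n)) (ha n); ring.
  rewrite -lezD1 in mn; rewrite (bT n)// (bT (n + 1)); last by rewrite (le_trans mn)// lerDl.
  have tn := xp n mn; rewrite ger0_norm ?subr_ge0// -/(wave s (x n - t)) /T.
  have -> : x (n + 1) - t = (x n - t) + (x (n + 1) - x n) by ring.
  by rewrite (waveD s (x n - t)) (hb n); ring.
have [N1 h1] := l2_tail be r0; have [N2 h2] := l2_tail al r0.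
exists (maxn (`|m| + 1)%N (maxn N1 N2)) => n; rewrite !geq_max => /andP[hm /andP[/h1[hn _] /h2[_ hn']]].
have mn : m + 1 <= Posz n by lia.
have nm : - Posz n <= m by lia.
split.
  rewrite (bT _ mn) /T opprD addrA subrr sub0r cabsN cabsM.
  apply: le_lt_trans hn; rewrite ler_piMl ?cabs_ge0// cabs_wave_le1// subr_ge0; exact: xp.
rewrite bS; last by rewrite (le_trans nm)// lerDl.
rewrite /S cabsN cabsM; have -> : - Posz n - 1 = Negz n by rewrite NegzE -addn1 PoszD opprD.
apply: le_lt_trans hn'; rewrite ler_piMl ?cabs_ge0// cabs_wave_le1// subr_ge0.
by apply: xm; lia.
Qed.

Lemma kernel_weyl s e al be : 0 < Im s -> node_waves s e al be -> forall m,
  (- coupling s *: (al + be + e) : l2 R) m = coupling s *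
    csum (fun n => cexp ('i%C * s * `|x n - x m|%:C) * e n).
Proof.
move=> s0 hw m; rewrite (kernel_csum (m := m) s0 hw) ?lexx ?xle//.
have [_ hb] := hw; rewrite subrr wave0 mulr1 l2Z !l2D (hb m); ring.
Qed.

Lemma max_domain_boundary_system : boundary_system D.
Proof.
split.
- by move=> *; exact: max_domain_lin.
- by move=> *; exact: (max_domain_green x_incr d_gt0 x_gap).
- by move=> *; exact: (max_domain_pos x_incr d_gt0 x_gap).
- by move=> *; exact: (max_domain_ker x_incr d_gt0 x_gap).
- move=> l nl h xi; have := solve_existence h xi (Im_sqrtC_gt0 nl).
  by rewrite sqrtCK.
Qed.

Let BS := max_domain_boundary_system.

Lemma axis_sqr s : 0 < Im s -> ~ nonneg_axis (s ^+ 2).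
Proof.
move=> s0 [+ +]; rewrite expr2 ImM ReM => h1 h2.
have : Re s * Im s = 0 by lra.
by move=> /eqP; rewrite mulf_eq0 (gt_eqF s0) orbF => /eqP r0; rewrite r0 in h2; nra.
Qed.

Lemma weyl_solution s u z e : 0 < Im s -> D u (s ^+ 2 *: u) z e -> exists al be,
  node_waves s e al be /\ z = - coupling s *: (al + be + e).
Proof.
move=> s0 h; have [f [z' [al [be [F [h' hw zE _ _]]]]]] := kernel_solution e s0.
have [_ ->] := gamma_uniq BS (axis_sqr s0) h h'.
by exists al, be.
Qed.

Lemma gamma_fieldE l : ~ nonneg_axis l -> gamma_field x l = gamma_rel (D := D) l.
Proof.
move=> nl; have s0 := Im_sqrtC_gt0 nl; have fae := ae_filter_ringOfSetsType leb.
have E (e : l2 R) : exists f z, D f (l *: f) z e /\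
    {ae leb, forall t, f t = - 'i%C / (2 * sqrtC l) *
      csum (fun n => cexp ('i%C * sqrtC l * `|x n - t|%:C) * e n)}.
  have [f [z [al [be [F [h hw zE fF FE]]]]]] := kernel_solution e s0.
  exists f, z; split; first by rewrite sqrtCK in h.
  apply: filterS fF => t ->; have [n tn] := node_index d_gt0 x_gap t.
  rewrite (FE n t tn) (kernel_csum (m := n) s0 hw).
    by rewrite mulNr mulrN mulNr opprK.
  by move: tn => /andP[-> /ltW ->].
apply/seteqP; split=> -[e u].
  move=> /= hu; have [f [z [h fE]]] := E e.
  suff -> : u = f by exists z.
  by apply: L2_ext; apply: filterS2 hu fE => t -> ->.
move=> [z h]; have [f [z' [h' fE]]] := E e.
have [uf _] := gamma_uniq BS nl h h'; rewrite /= in uf.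
by rewrite /gamma_field/= uf.
Qed.

Lemma weyl_funE l : ~ nonneg_axis l -> weyl_fun x l = weyl_rel (D := D) l.
Proof.
move=> nl; have s0 := Im_sqrtC_gt0 nl.
apply/seteqP; split=> -[e z].
  move=> /= hz; have [f [z' [al [be [F [h hw zE _ _]]]]]] := kernel_solution e s0.
  exists f => /=; rewrite sqrtCK in h; suff -> : z = z' by [].
  by apply: l2_ext => m; rewrite hz zE (kernel_weyl s0 hw).
move=> [u h] m /=; rewrite -(sqrtCK l) in h.
have [al [be [hw zE]]] := weyl_solution s0 h; rewrite /= in hw zE.
by rewrite zE (kernel_weyl s0 hw).
Qed.

(** With q = exp(- d Im s), the direct term and the two one-sided sums give 1 + 2 q / (1 - q) = (1 +
    q) / (1 - q), which is coth(d Im s / 2). *)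
Lemma weyl_norm_bound s u z e : 0 < Im s -> D u (s ^+ 2 *: u) z e ->
  hnorm z <= coth (d / 2 * Im s) / (2 * cabs s) * hnorm e.
Proof.
move=> s0 h; have [al [be [hw ->]]] := weyl_solution s0 h.
have sn : s != 0 by exact: s_neq0.
have [h1 h2] := node_waves_bound s0 hw.
have /andP[q0 q1] := decay_ge0_lt1 d_gt0 s0.
have -> : coth (d / 2 * Im s) = (1 + decay d s) / (1 - decay d s).
  rewrite cothE ?mulr_gt0 ?divr_gt0//; have -> : - (2 * (d / 2 * Im s)) = - Im s * d by field.
  by [].
rewrite hnormZ cabsN (cabs_coupling sn) mulrAC [leRHS]mulrC.
rewrite ler_wpM2l ?invr_ge0 ?mulr_ge0 ?cabs_ge0//.
have -> : (1 + decay d s) / (1 - decay d s) =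
    decay d s / (1 - decay d s) + decay d s / (1 - decay d s) + 1.
  have : 1 - decay d s != 0 by rewrite subr_eq0 gt_eqF.
  by move: (decay d s) => p p1; field.
exact: hnorm_perturbed_sum h1 h2.
Qed.

(** At s = k (1 + i) with k = 9 / d the decay is exp(-9) <= 1/10, so the off-diagonal sums have norm
    at most 1/9 each. The coupling is (1 + i) / (4 k), and 1 - 4/9 >= 1/2 leaves the constant 1 / (8
    k). *)
Lemma weyl_Im_lower : exists (s : R[i]) (c : R), [/\ 0 < Im s, 0 < Im (s ^+ 2), 0 < c &
  forall u z e, D u (s ^+ 2 *: u) z e -> c * hnorm e ^+ 2 <= Im '[z, e]].
Proof.
pose k := 9 / d; have k0 : 0 < k by rewrite divr_gt0.
have small (q : R) : q <= 10^-1 -> q / (1 - q) <= 9^-1 by move=> ?; rewrite ler_pdivrMr; lra.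
have fin (p q : R) : 0 <= q -> p <= - (1 - 4 / 9) * q -> 2^-1 * q <= - p by move=> *; lra.
exists (k +i* k), (8 * k)^-1; split; first exact: k0.
- by rewrite expr2 ImM/= addr_gt0// mulr_gt0.
- by rewrite invr_gt0 mulr_gt0.
move=> u z e h; have s0 : 0 < Im (k +i* k) by [].
have [al [be [hw ->]]] := weyl_solution s0 h.
have [h1 h2] := node_waves_bound s0 hw.
have cE : coupling (k +i* k) = (4 * k)^-1 +i* (4 * k)^-1.
  have sn : (k +i* k) != 0 :> R[i] by exact: s_neq0.
  have E : ((4 * k)^-1 +i* (4 * k)^-1) * (2 * (k +i* k)) = 'i%C.
    have -> : 2 = (2 : R)%:C by rewrite rmorph_nat.
    by apply: complex_ext; rewrite !(ReM, ImM)/=; field; rewrite gt_eqF.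
  by rewrite /coupling -E mulfK// mulf_neq0 ?pnatr_eq0.
have q9 : decay d (k +i* k) <= 10^-1.
  rewrite /decay/= (_ : - k * d = - 9); last by rewrite /k; field; rewrite gt_eqF.
  rewrite expRN lef_pV2 ?posrE ?expR_gt0//.
  apply: le_trans (expR_ge1Dx (9 : R)).
  by rewrite (_ : 1 + 9 = 10 :> R)//; ring.
have /andP[q0 q1] := decay_ge0_lt1 d_gt0 s0.
have qq : decay d (k +i* k) / (1 - decay d (k +i* k)) <= 9^-1.
  exact: small.
have n1 : hnorm (al + e) <= 9^-1 * hnorm e.
  by apply: (le_trans h1); rewrite ler_wpM2r ?hnorm_ge0.
have n2 : hnorm (be + e) <= 9^-1 * hnorm e.
  by apply: (le_trans h2); rewrite ler_wpM2r ?hnorm_ge0.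
have cw (w : R[i]) : Im (- ((4 * k)^-1 +i* (4 * k)^-1) * w) = (4 * k)^-1 * - (Re w + Im w).
  by rewrite ImM/=; ring.
have c0 : 0 < (4 * k)^-1 by rewrite invr_gt0 mulr_gt0.
have -> : (8 * k)^-1 = (4 * k)^-1 / 2 by field; rewrite gt_eqF.
rewrite innerZl cE cw -mulrA ler_pM2l//.
exact: fin (sqr_ge0 _) (inner_perturbed_sum n1 n2).
Qed.

End resolvent_kernel.

(** * Spectral estimates *)

Section spectral_facts.
Context {R : realType}.
Variables (x : int -> R) (d : R).
Hypotheses (x_incr : forall m n : int, m < n -> x m < x n) (d_gt0 : 0 < d)
  (x_gap : forall n, d <= x (n + 1) - x n).
Implicit Types (z e : l2 R) (s l : R[i]) (u : L2R R).

Local Notation D := (max_domain x).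
Let BS : boundary_system D := max_domain_boundary_system x_incr d_gt0 x_gap.

Lemma cabs_le_ReIm (z : R[i]) : cabs z <= `|Re z| + `|Im z|.
Proof.
have {1}-> : z = (Re z)%:C + 'i%C * (Im z)%:C.
  by apply: complex_ext; rewrite ?ReD ?ImD ?ReM ?ImM/=; ring.
rewrite (le_trans (cabsD _ _))// cabsM !cabsr.
have -> : cabs 'i%C = 1 :> R by rewrite /cabs /sqn/= expr0n/= add0r expr1n sqrtr1.
by rewrite mul1r.
Qed.

Lemma l2_delta : exists e : l2 R, forall n, e n = if n == 0 then 1 else 0.
Proof.
apply: l2_mk; apply: (@zsummable_bound _ _ 1) => [n|N]; first exact: sqn_ge0.
have E (n : int) : sqn (if n == 0 then 1 else 0 : R[i]) = if n == 0 then 1 else 0 :> R.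
  by rewrite /sqn; case: ifP => _; rewrite /= ?expr0n ?expr1n ?addr0.
under [X in zseries X]eq_fun do rewrite E.
suff -> : zseries (fun n => if n == 0 then 1 else 0 : R) N = if N == 0%N then 0 else 1.
  by case: ifP.
elim: N => [|N ih]; first by rewrite zseries0.
by rewrite zseriesS ih; case: N {ih} => [|N] /=; rewrite ?add0r ?addr0.
Qed.

(* The identity Im l ||u||^2 = Im (z, xi) gives the norm of the resolvent
   kernel with pole at [x 0] without computing an integral. *)
Lemma kernel_norm s u z e : 0 < Im s -> 0 < Re s -> (forall n, e n = if n == 0 then 1 else 0) ->
  D u (s ^+ 2 *: u) z e -> 4 * Im s * sqn s * hnorm u ^+ 2 = 1.
Proof.
move=> s0 r0 eE h; have := gamma_im BS h.
have [al [be [hw zE]]] := weyl_solution x_incr d_gt0 x_gap s0 h.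
have -> : '[z, e] = coupling s.
  rewrite -[LHS]/(l2_inner z e) /l2_inner csum_single; last first.
    move=> n n0; rewrite eE (negbTE n0).
    by apply: complex_ext; rewrite ?ReM ?ImM/= ?oppr0 !mulr0 ?subr0 ?addr0.
  have -> : z 0 * (e 0)^* = z 0.
    by rewrite eE eqxx; apply: complex_ext;
      rewrite ?ReM ?ImM/= ?oppr0 ?mulr1 ?mulr0 ?subr0 ?addr0 ?add0r.
  rewrite zE (kernel_weyl x_incr d_gt0 s0 hw) csum_single.
    by rewrite eE eqxx subrr normr0 mulr0 cexp0 !mulr1.
  by move=> n n0; rewrite eE (negbTE n0) mulr0.
have sq0 : 0 < sqn s by rewrite /sqn ltr_wpDr ?sqr_ge0// exprn_gt0.
have cE : coupling s = (Im s / (2 * sqn s)) +i* (Re s / (2 * sqn s)).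
  have sn : s != 0 by exact: s_neq0.
  have E : ((Im s / (2 * sqn s)) +i* (Re s / (2 * sqn s))) * (2 * s) = 'i%C.
    have -> : 2 = (2 : R)%:C by rewrite rmorph_nat.
    move: sq0; rewrite /sqn => sq0; have sq1 := lt0r_neq0 sq0.
    apply: complex_ext; rewrite !(ReM, ImM)/=; move: (Re s) (Im s) sq1 => p q sq1; field => //.
  by rewrite /coupling -E mulfK// mulf_neq0 ?pnatr_eq0.
rewrite cE expr2 ImM/= => E.
have : 4 * Im s * sqn s * hnorm u ^+ 2 = ((Re s * Im s + Im s * Re s) * hnorm u ^+ 2) * (2 * sqn s / Re s).
  by field; exact: lt0r_neq0.
by move=> ->; rewrite E; field; rewrite !lt0r_neq0.
Qed.

(* For [l = k^2], the parameters [(k + sg + i sg)^2] tend to [l] while the norms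
   of their kernel elements with a pole at [x 0] blow up as [sg] tends to 0. *)
Lemma free_resolvent_off_axis l : resolvent_set (@A_free R) l -> ~ nonneg_axis l.
Proof.
move=> hl [il rl]; have [e eE] := l2_delta.
apply: (free_spectrum BS (e := e) _ _ hl) => [l' nl h|T del del0].
  have [f [z hf]] := bs_solve BS nl h 0; exists f, z; split => //.
  exact: (max_domain_A_free x_incr d_gt0 x_gap hf).
pose k := Num.sqrt (Re l); have k0 : 0 <= k by exact: sqrtr_ge0.
have kE : k ^+ 2 = Re l by rewrite sqr_sqrtr.
pose A := (k + 1) ^+ 2 + 1; have A0 : 0 < A by rewrite /A ltr_wpDl ?sqr_ge0.
(* [W] collects the requirements on sg = 1 / W. As |s|^2 <= A, the identity 4 sg |s|^2 |u|^2 = 1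
   excludes |u| < T, and |s^2 - k^2| <= 4 sg (k + 1) is less than [del]. *)
pose W := 1 + 4 * A * (T ^+ 2 + 1) + 8 * (k + 1) / del.
have w1 : 0 <= 4 * A * (T ^+ 2 + 1) by rewrite !mulr_ge0 ?addr_ge0 ?sqr_ge0// ltW.
have w2 : 0 <= 8 * (k + 1) / del by rewrite divr_ge0 ?mulr_ge0 ?addr_ge0// ltW.
have W1 : 1 <= W by rewrite /W -addrA lerDl addr_ge0.
have W0 : 0 < W by apply: lt_le_trans W1.
have [sg [sg0 sg1 sgA sgd]] : exists sg : R, [/\ 0 < sg, sg <= 1,
    sg * (4 * A * (T ^+ 2 + 1)) <= 1 & sg * (8 * (k + 1)) <= del].
  exists W^-1; split; first by rewrite invr_gt0.
  - by rewrite invf_le1.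
  - by rewrite mulrC ler_pdivrMr// mul1r /W; lra.
  - rewrite mulrC ler_pdivrMr//.
    have -> : 8 * (k + 1) = del * (8 * (k + 1) / del) by field; exact: lt0r_neq0.
    by rewrite ler_pM2l// /W; lra.
pose s := (k + sg) +i* sg; have s0 : 0 < Im s by [].
exists (s ^+ 2); split; first exact: axis_sqr.
- have lE : l = (k%:C) ^+ 2.
    by apply: complex_ext; rewrite expr2 ?ReM ?ImM/= -?kE ?il ?expr2; ring.
  rewrite lE subr_sqr cabsM.
  have b1 : cabs (s - k%:C) <= 2 * sg.
    apply: (le_trans (cabs_le_ReIm _)); rewrite ReB ImB /= subr0 addrAC subrr add0r.
    by rewrite (ger0_norm (ltW sg0)); lra.
  have b2 : cabs (s + k%:C) <= 2 * (k + 1).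
    apply: (le_trans (cabs_le_ReIm _)); rewrite ReD ImD /= addr0.
    have e1 : 0 <= k + sg + k by lra.
    by rewrite (ger0_norm e1) (ger0_norm (ltW sg0)); lra.
  have := cabs_ge0 (s - k%:C); have := cabs_ge0 (s + k%:C).
  have : 2 * sg * (2 * (k + 1)) < del.
    by have : 0 < sg * (k + 1) by [rewrite mulr_gt0// ltr_wpDl]; lra.
  move: (cabs _) (cabs _) b1 b2 => p q *; apply: (@le_lt_trans _ _ (2 * sg * (2 * (k + 1)))) => //.
  by rewrite ler_pM.
move=> u z h; have r0 : 0 < Re s by rewrite /= ltr_wpDl.
have := kernel_norm s0 r0 eE h.
have q1 : sqn s <= A.
  by rewrite /sqn /A /=; have : sg ^+ 2 <= 1 by [rewrite expr_le1// ltW]; nra.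
have q0 : 0 <= sqn s := sqn_ge0 s.
have n0 := hnorm_ge0 u; have N0 := sqr_ge0 (hnorm u).
rewrite /= => E; have [//|Tn] := leP T (hnorm u).
have T0 : 0 <= T := le_trans n0 (ltW Tn).
exfalso; have TT : hnorm u ^+ 2 <= T ^+ 2 by rewrite ler_pXn2r// ltW.
have : 4 * sg * sqn s * hnorm u ^+ 2 <= 4 * sg * A * T ^+ 2.
  by rewrite ler_pM ?mulr_ge0 ?(ltW sg0)// ler_pM2l// mulr_gt0.
rewrite E; have : 0 < sg * A by rewrite mulr_gt0.
by move: sgA; nra.
Qed.

Lemma A_brackE B : A_brack x B = brack (D := D) B.
Proof.
apply/seteqP; split=> -[f k].
  move=> [f1 [f2 [g [h1 h2 [z [e [G1 G0 Bze]]] h3]]]]; exists z, e; split => //.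
  by apply/(max_domainP x_incr d_gt0 x_gap); exists f1, f2, g.
move=> [z [e [/(max_domainP x_incr d_gt0 x_gap)[f1 [f2 [g [h1 h2 G1 G0 h3]]]] Bze]]].
by exists f1, f2, g; split => //; exists z, e.
Qed.

Lemma weyl_bound_negative mu kappa u z e : 0 < mu -> mu <= kappa ->
  D u ((- kappa ^+ 2)%:C *: u) z e ->
  hnorm z <= 2^-1 * coth (d / 2 * mu) / kappa * hnorm e.
Proof.
move=> mu0 mk h; have k0 : 0 < kappa by apply: lt_le_trans mk.
pose s := 0 +i* kappa; have s0 : 0 < Im s by [].
have sE : s ^+ 2 = (- kappa ^+ 2)%:C.
  by apply: complex_ext; rewrite expr2 ?ReM ?ImM/= ?expr2; ring.
rewrite -sE in h; have := weyl_norm_bound x_incr d_gt0 x_gap s0 h.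
have -> : cabs s = kappa by rewrite /cabs /sqn/= expr0n/= add0r sqrtr_sqr ger0_norm ?ltW.
move=> /le_trans; apply; rewrite ler_wpM2r ?hnorm_ge0//=.
rewrite invfM mulrA [_ / 2]mulrC ler_wpM2r ?invr_ge0 ?(ltW k0)// ler_wpM2l//.
by apply: ler_coth; rewrite ?mulr_gt0 ?divr_gt0// ler_pM2l// divr_gt0.
Qed.

Lemma weyl_bound_imaginary r u z e : 1 <= r -> D u ((2 * r ^+ 2) *i *: u) z e ->
  hnorm z <= coth (d / 2) / (2 * r) * hnorm e.
Proof.
move=> r1 h; have r0 : 0 < r by lra.
pose s := r +i* r; have s0 : 0 < Im s by [].
have sE : s ^+ 2 = (2 * r ^+ 2) *i.
  by apply: complex_ext; rewrite expr2 ?ReM ?ImM/= ?expr2; ring.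
rewrite -sE in h; have := weyl_norm_bound x_incr d_gt0 x_gap s0 h.
move=> /le_trans; apply; rewrite ler_wpM2r ?hnorm_ge0//=.
have d2 : 0 < d / 2 by rewrite divr_gt0.
have c0 := coth_gt0 d2.
have c1 : coth (d / 2 * r) <= coth (d / 2) by apply: ler_coth => //; rewrite ler_peMr// ltW.
have c2 : 0 < coth (d / 2 * r) by rewrite coth_gt0// mulr_gt0.
have rs : r <= cabs s by apply: le_trans (Re_le_cabs s); exact: ler_norm.
apply: ler_pM => //; rewrite ?(ltW c2)// ?invr_ge0 ?mulr_ge0 ?cabs_ge0//.
by rewrite lef_pV2 ?posrE ?mulr_gt0 ?(lt_le_trans r0 rs)// ler_pM2l.
Qed.

End spectral_facts.

Section imaginary_part.
Context {R : realType} {K : preHilbertType R}.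

(** The quadratic form of Im B is the imaginary part of that of [B], so Cauchy-Schwarz applies with
    the norm of Im B. *)
Lemma rel_Im_bound (B : set (K * K)) (P : K -> K) (beta : R) : hlinear P ->
  (forall u v, B (u, v) <-> v = P u) -> (forall u, hnorm (P u) <= beta * hnorm u) ->
  (exists Q : K -> K, [/\ hlinear Q, forall u v, '[P u, v] = '[u, Q v] &
    forall v, hnorm (Q v) <= `|beta| * hnorm v]) ->
  0 <= rel_norm (rel_Im B) /\
  forall u, `|Im '[P u, u]| <= rel_norm (rel_Im B) * hnorm u ^+ 2.
Proof.
move=> Pl BP Pb [Q [Ql PQ Qb]].
have adjE v w : rel_adj B (v, w) <-> w = Q v.
  split=> [h|-> u v' /BP ->]; last exact: PQ.
  by apply: inner_ext => u; rewrite -PQ; apply/esym/h/BP.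
pose c : R[i] := (2 * 'i%C)^-1.
have ImE u v : rel_Im B (u, v) <-> v = c *: (P u - Q u).
  split=> [[w [/rel_subE[v1 [v2 [/= /BP -> /adjE -> ->]]] ->]]//|->].
  exists (P u - Q u); split => //; apply/rel_subE; exists (P u), (Q u).
  by split; [apply/BP|apply/adjE|].
have l2' : linear_rel (rel_Im B).
  split; first by apply/ImE; rewrite /= (hlinear0 Pl) (hlinear0 Ql) subrr scaler0.
  move=> a [u v] [u' v'] /ImE -> /ImE ->; apply/ImE => /=.
  rewrite Pl Ql !scalerA [a * c]mulrC -scalerA -scalerDr; congr (_ *: _).
  by rewrite scalerBr opprD !addrA; congr (_ + _); rewrite addrAC.
have [|||T [Tl TE n0 Tb]] := @bounded_rel_fun R K K (rel_Im B) l2'.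
- by move=> u v w /ImE -> /ImE ->.
- by apply/seteqP; split => // u _; exists (c *: (P u - Q u)); apply/ImE.
- exists (cabs c * (2 * `|beta|)) => u v /ImE ->; rewrite hnormZ -mulrA ler_wpM2l ?cabs_ge0//.
  have := Pb u; have := Qb u; have := ler_hnormB (P u) (Q u).
  have : beta * hnorm u <= `|beta| * hnorm u by rewrite ler_wpM2r ?hnorm_ge0// ler_norm.
  rewrite -mulrA.
  by move: (hnorm (_ - _)) (hnorm (P u)) (hnorm (Q u)) (beta * _) (`|beta| * _) => *; lra.
split => // u; have Tu : T u = c *: (P u - Q u) by apply/ImE/TE.
have E : '[T u, u] = (Im '[P u, u])%:C.
  have -> : '[T u, u] = c * ('[P u, u] - '[Q u, u]) by rewrite Tu innerZl innerBl.
  have q1 : Re '[Q u, u] = Re '[P u, u] by rewrite PQ Re_inner_conj.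
  have q2 : Im '[Q u, u] = - Im '[P u, u] by rewrite PQ Im_inner_conj.
  have c2 : c * (2 * 'i%C) = 1.
    by rewrite mulVf// mulf_neq0 ?pnatr_eq0//; apply/eqP => -[/eqP]; rewrite oner_eq0.
  have -> : '[P u, u] - '[Q u, u] = (2 * 'i%C) * (Im '[P u, u])%:C.
    have -> : 2 = (2 : R)%:C by rewrite rmorph_nat.
    by apply: complex_ext; rewrite ?ReB ?ImB ?q1 ?q2 !(ReM, ImM)/=; ring.
  by rewrite mulrA c2 mul1r.
have := Re_inner_norm_le (T u) u; rewrite E/= => /le_trans; apply.
by rewrite expr2 mulrA ler_wpM2r ?hnorm_ge0.
Qed.

End imaginary_part.

(** The origin of J_0: 2 (Im sqrt z)^2 = |z| - Re z, and on the cone this is at least |z| (1 - cos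
    nu) = 2 |z| sin^2(nu/2), with |z| >= |w0| sin nu. *)
Lemma cone_sqrt_bound {R : realType} (w0 nu : R) (z : R[i]) : w0 < 0 -> 0 < nu < pi ->
  cone_region w0 nu z -> [/\ ~ nonneg_axis z, 0 < cabs z, sqn (sqrtC z) = cabs z &
    0 < Num.sqrt (`|w0| * sin nu) * sin (nu / 2) <= Im (sqrtC z)].
Proof.
move=> w00 nu0pi zc; have [h1 h2] := cone_bounds w00 nu0pi zc.
have /andP[nu0 nupi] := nu0pi.
have sn : 0 < sin nu by rewrite sin_gt0_pi// nu0.
have s2 : 0 < sin (nu / 2) by rewrite sin_gt0_pi//; apply/andP; split; have := @pi_gt0 R; lra.
have wp : 0 < `|w0| * sin nu by rewrite mulr_gt0// normr_gt0 lt_eqF.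
have z0 : 0 < cabs z by apply: lt_le_trans h1.
have c2 : cos nu = 1 - 2 * sin (nu / 2) ^+ 2.
  have := cos2Dsin2 (nu / 2); have := cosD (nu / 2) (nu / 2).
  have -> : nu / 2 + nu / 2 = nu by field.
  by move=> ->; rewrite -!expr2; lra.
have nz : ~ nonneg_axis z.
  move=> [iz rz]; have rE : cabs z = Re z by rewrite /cabs /sqn iz expr0n/= addr0 sqrtr_sqr ger0_norm.
  have : 0 < sin (nu / 2) ^+ 2 by rewrite exprn_gt0.
  by move: h2; rewrite c2 -rE; nra.
have s0 := Im_sqrtC_gt0 nz.
have sE : sqn (sqrtC z) = cabs z.
  have : cabs (sqrtC z ^+ 2) = cabs z by rewrite sqrtCK.
  by rewrite expr2 cabsM -expr2 cabs_sqr.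
split => //; rewrite mulr_gt0 ?sqrtr_gt0//=.
have re : Re z = sqn (sqrtC z) - 2 * Im (sqrtC z) ^+ 2.
  by rewrite -[in LHS](sqrtCK z) expr2 ReM /sqn; ring.
rewrite -(ler_pXn2r (n := 2))// ?nnegrE ?(ltW s0)//; last by rewrite mulr_ge0 ?sqrtr_ge0// ltW.
rewrite exprMn sqr_sqrtr ?(ltW wp)//.
have k0 : 0 < sin (nu / 2) ^+ 2 by rewrite exprn_gt0.
apply: (@le_trans _ _ (cabs z * sin (nu / 2) ^+ 2)); first by rewrite ler_pM2r.
by move: h2; rewrite c2 re sE; lra.
Qed.

(** The distance is compared with that to the origin; assertion (c) follows from an estimate of |z|
    itself. *)
Lemma dist_nonneg_axis_le {R : realType} (z : R[i]) : dist_to z nonneg_axis <= cabs z.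
Proof.
apply: ge_inf; first by exists 0 => _ [w _ <-]; exact: cabs_ge0.
by exists 0; rewrite ?subr0.
Qed.

Lemma num_range_scale {R : realType} {K : preHilbertType R} (B : set (K * K)) (s : R) :
  linear_rel B -> (forall w, num_range B w -> 0 <= s * Im w) ->
  forall z xi, B (z, xi) -> 0 <= s * Im '[xi, z].
Proof.
move=> [B0 Bl] h z xi Bz; have [z0|z0] := eqVneq z 0; first by rewrite z0 inner0r mulr0.
have n0 := hnorm_gt0 z0; have nn := lt0r_neq0 n0.
pose c : R[i] := ((hnorm z)^-1)%:C.
have Bc : B (c *: z, c *: xi) by have := Bl c _ _ Bz B0; rewrite /= !addr0.
have nc : hnorm (c *: z) = 1 by rewrite hnormZ cabsr ger0_norm ?invr_ge0 ?ltW// mulVf.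
have nrw : num_range B '[c *: xi, c *: z] by exists (c *: z), (c *: xi).
have := h _ nrw; rewrite innerZl innerZr.
have -> : Im (c * (Num.conj c * '[xi, z])) = (hnorm z)^-1 ^+ 2 * Im '[xi, z].
  by rewrite !(ReM, ImM)/=; ring.
by rewrite mulrCA pmulr_rge0// exprn_gt0// invr_gt0.
Qed.

Unset Implicit Arguments.

Theorem theorem9p3 (R : realType) (x : int -> R) (d : R)
    (B : set (l2 R * l2 R))
    (x_incr : forall m n : int, m < n -> x m < x n)
    (d_def : d = inf (range (fun n : int => x (n + 1) - x n)))
    (d_gt0 : 0 < d)
    (B_closed : closed_operator B) :
  closed_operator (A_brack x B) /\
  (forall l : R[i],
    (resolvent_set (A_brack x B) `&` resolvent_set (@A_free R)) l ->
    let G := gamma_field x l in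
    let Gs := rel_adj (gamma_field x l^*) in
    let M := weyl_fun x l in
    let res := resolvent (A_brack x B) l in
    let res0 := resolvent (@A_free R) l in
    let rhs := rel_add res0
      (rel_comp G (rel_comp (rel_inv (rel_sub rel_id (rel_comp B M)))
                            (rel_comp B Gs))) in
    [/\ single_valued (rel_inv (rel_sub rel_id (rel_comp B M))),
        rel_restrict res (rel_dom (rel_comp B Gs)) = rhs,
        everywhere_defined B -> res = rhs &
        res = rel_add res0
          (rel_comp G (rel_comp (rel_inv (rel_sub (rel_inv B) M)) Gs))]) /\
  ((self_adjoint B -> self_adjoint (A_brack x B)) /\
   (maximal_dissipative B -> maximal_accumulative (A_brack x B)) /\
   (maximal_accumulative B -> maximal_dissipative (A_brack x B))) /\
  A_brack x (rel_adj B) = rel_adj (A_brack x B) /\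
  (forall b : R,
    everywhere_defined B -> bounded_rel B ->
    (forall u v, B (u, v) -> complex.Re '[v, u] <= b * hnorm u ^+ 2) ->
    m_sectorial (A_brack x B) /\
    spectrum (A_brack x B) `<=`
      closure (num_range (A_brack x B) : set R[i]^o) /\
    (forall mu C : R, mu < 0 ->
      C = 2^-1 * coth (d / 2 * Num.sqrt (- mu)) ->
      (0 < b -> forall xi : R, xi < mu - (C * b) ^+ 2 ->
        let K := 2 * C * rel_norm (rel_Im B) /
                 (1 - C * b / Num.sqrt (mu - xi)) in
        num_range (A_brack x B) `<=`
          [set z | mu - (C * b) ^+ 2 <= complex.Re z /\
                   `|complex.Im z| <= K * Num.sqrt (complex.Re z - xi)]) /\
      (b <= 0 ->
        num_range (A_brack x B) `<=`
          [set z | 0 <= complex.Re z /\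
                   `|complex.Im z| <=
                     2 * C * rel_norm (rel_Im B) * (complex.Re z - mu) /
                     (Num.sqrt (complex.Re z - mu) - C * b)])) /\
    (forall w0 nu : R, w0 < 0 -> 0 < nu < pi ->
      let J0 := d / 2 * Num.sqrt (`|w0| * sin nu) * sin (nu / 2) in
      spectrum (A_brack x B) `&` cone_region w0 nu `<=`
        [set z | cone_region w0 nu z /\
                 dist_to z nonneg_axis <=
                   4^-1 * coth J0 ^+ 2 * rel_norm B ^+ 2])).
Proof.
have x_gap n : d <= x (n + 1) - x n.
  rewrite d_def; apply: ge_inf; last by exists n.
  by exists 0 => _ [m _ <-]; rewrite subr_ge0 ltW// x_incr// ltrDl.
have [Bl Bs Bc] := B_closed.
have BS := max_domain_boundary_system x_incr d_gt0 x_gap.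
have Kc := @l2_complete R; have Hc := @L2_complete _ _ R (@lebesgue_measure R).
have [s [c0 [s0 l0_gt0 c0_gt0 weyl_im]]] := weyl_Im_lower x_incr d_gt0 x_gap.
have weyl_le u z e := @weyl_norm_bound R x d x_incr d_gt0 x_gap s u z e s0.
rewrite !(A_brackE x_incr d_gt0 x_gap).
have nl0 : ~ nonneg_axis (s ^+ 2) by exact: axis_sqr.
split; first by split; [exact: brack_linear|exact: brack_single_valued|
  exact: (brack_closed BS Kc l0_gt0 c0_gt0 weyl_le weyl_im)].
split.
  move=> l [lA l0] G Gs M res res0 rhs.
  have nl := free_resolvent_off_axis x_incr d_gt0 x_gap l0.
  have nl' := nonneg_axis_conj nl.
  have GE : G = gamma_rel (D := max_domain x) l by exact: (gamma_fieldE x_incr d_gt0 x_gap nl).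
  have GsE : Gs = rel_adj (gamma_rel (D := max_domain x) l^*).
    by rewrite /Gs (gamma_fieldE x_incr d_gt0 x_gap nl').
  have ME : M = weyl_rel (D := max_domain x) l by exact: (weyl_funE x_incr d_gt0 x_gap nl).
  have hres0 h g : res0 (h, g) <-> exists z, max_domain x g (h + l *: g) z 0.
    split=> [hg|[z hz]]; last first.
      by apply/resolventE; exact: (max_domain_A_free x_incr d_gt0 x_gap hz).
    have [g' [z hz]] := bs_solve BS nl h 0.
    have [sv _ _] := l0.
    have -> : g = g'.
      by apply: (sv _ _ _ hg); apply/resolventE; exact: (max_domain_A_free x_incr d_gt0 x_gap hz).
    by exists z.
  have restr := krein_formula_restrict BS nl Bl hres0.
  rewrite /rhs GE ME GsE; split.
  - by apply: krein_inverse_single_valued => //; have [] := lA.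
  - exact: restr.
  - move=> Be; rewrite -restr; apply/seteqP; split=> -[h f]; last by case.
    move=> hf; split => //.
    have [g [w hw]] := bs_solve BS nl h 0.
    have : rel_dom B w by rewrite Be.
    by move=> [v Bwv]; exists v, w; split => //; apply/(gamma_adjE BS nl); exists g.
  - exact: krein_formula.
have adj := brack_adj BS Kc l0_gt0 c0_gt0 weyl_le weyl_im.
(* At the conjugate point M is the adjoint of M(l0), so its imaginary part is at most - c0; this
   serves the accumulative case. *)
have weyl_im' u z e : max_domain x u ((s ^+ 2)^* *: u) z e -> c0 * hnorm e ^+ 2 <= -1 * Im '[z, e].
  move=> h; have [u' [z' h']] := gamma_solve BS e nl0.
  have := weyl_im _ _ _ h'; rewrite -(weyl_conj BS h' h) (Im_inner_conj z e).
  by rewrite mulN1r.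
have Im_form f k z e : max_domain x f k z e -> Im '[k, f] = - Im '[e, z].
  by move=> /(green_im BS); rewrite ImD => /eqP; rewrite addr_eq0 => /eqP.
split.
  split; first by move=> sB; rewrite /self_adjoint -adj// sB.
  split=> -[nr [l1 [l1r l1s]]]; rewrite /= in l1s.
    have Bim : forall z xi, B (z, xi) -> 0 <= 1 * Im '[xi, z].
      by apply: num_range_scale => // w /nr; rewrite /closed_upper_half/= mul1r.
    split.
      move=> w [f [k [[z [e [hD Bze]]] _ ->]]]; change (Im '[k, f] <= 0).
      by have := Bim _ _ Bze; rewrite (Im_form f k z e hD) mul1r oppr_le0.
    exists (s ^+ 2); split; last exact: l0_gt0.
    apply: (@maximal_resolvent_set _ _ _ _ BS Kc _ _ l0_gt0 weyl_le 1 c0 _ l1) => //.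
    - by left.
    - by move=> u z e h; rewrite mul1r; exact: weyl_im h.
    - by rewrite mul1r.
  have Bim : forall z xi, B (z, xi) -> 0 <= -1 * Im '[xi, z].
    by apply: num_range_scale => // w /nr; rewrite /closed_lower_half/= mulN1r oppr_ge0.
  split.
    move=> w [f [k [[z [e [hD Bze]]] _ ->]]]; change (0 <= Im '[k, f]).
    by have := Bim _ _ Bze; rewrite (Im_form f k z e hD) mulN1r.
  exists (s ^+ 2)^*; split; last by rewrite /lower_half/= ImC oppr_lt0.
  apply: (@maximal_resolvent_set _ _ _ _ BS Kc _ _ l0_gt0 weyl_le (-1) c0 _ l1) => //.
  - by right.
  - exact: nonneg_axis_conj.
  - by rewrite mulN1r oppr_lt0.
split; first exact: adj.
move=> b Be Bb Bre.
have [P [Pl BP beta0 Pb]] := bounded_rel_fun Bl Bs Be Bb.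
set beta := rel_norm B in beta0 Pb *.
have Pre u : Re '[P u, u] <= b * hnorm u ^+ 2 by apply: Bre; apply/BP.
have [I0 hI] := rel_Im_bound Pl BP Pb (bounded_adjoint Kc Pl Pb).
have small eps : 0 < eps -> exists2 kappa0, 0 < kappa0 & forall kappa : R, kappa0 <= kappa ->
    forall u z xi, max_domain x u ((- kappa ^+ 2)%:C *: u) z xi -> hnorm z <= eps * hnorm xi.
  move=> eps0; pose C1 := 2^-1 * coth (d / 2 * 1).
  have C10 : 0 < C1 by rewrite mulr_gt0 ?invr_gt0// coth_gt0// mulr1 divr_gt0.
  exists (1 + C1 / eps); first by rewrite addr_gt0// divr_gt0.
  move=> kappa hk u z xi h.
  have Ce : 0 < C1 / eps by rewrite divr_gt0.
  have k1 : 1 <= kappa by lra.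
  apply: (le_trans (weyl_bound_negative x_incr d_gt0 x_gap ltr01 k1 h)).
  rewrite ler_wpM2r ?hnorm_ge0// ler_pdivrMr; last by lra.
  by rewrite -/C1 [leRHS]mulrC -ler_pdivrMr//; lra.
split; first exact: (m_sectorial_brack BS Kc l0_gt0 weyl_le Pl BP beta0 Pb Pre small).
split.
  apply: (spectrum_brack BS Hc Kc l0_gt0 c0_gt0 weyl_le weyl_im Pl BP beta0 Pb Pre).
    move=> eps eps0; pose C1 := coth (d / 2).
    have C10 : 0 < C1 by rewrite coth_gt0// divr_gt0.
    (* At 2 i r^2, the square of r (1 + i), the norm of M is at most C1 / (2 r), and this [r] makes
       it at most [eps]. *)
    pose r := 1 + C1 / (2 * eps).
    have Ce : 0 < C1 / (2 * eps) by rewrite divr_gt0// mulr_gt0.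
    have r1 : 1 <= r by rewrite lerDl ltW.
    have r0 : 0 < r by lra.
    exists (2 * r ^+ 2), (C1 / (2 * r)); split.
    - by have : 1 <= r ^+ 2 by [rewrite exprn_ege1]; lra.
    - have r2 : 0 < 2 * r by rewrite mulr_gt0.
      have rE : eps * (2 * r) = 2 * eps + C1 by rewrite /r; field; exact: lt0r_neq0.
      apply/andP; split; first by apply: divr_ge0; exact: ltW.
      by rewrite ler_pdivrMr// rE; lra.
    - by move=> u z xi; exact: (weyl_bound_imaginary x_incr d_gt0 x_gap r1).
  have e0 : 0 < (2 * (beta + 1))^-1 by rewrite invr_gt0 mulr_gt0// ltr_wpDl.
  have [kappa k0 hk] := small _ e0; exists kappa, (2 * (beta + 1))^-1; split => //.
  - exact: ltW.
  - by rewrite ltr_pdivrMr ?mul1r; lra.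
  - exact: hk.
split.
  move=> mu C mu0 CE; have m0 : 0 < Num.sqrt (- mu) by rewrite sqrtr_gt0 oppr_gt0.
  have C0 : 0 < C by rewrite CE mulr_gt0 ?invr_gt0// coth_gt0// mulr_gt0// divr_gt0.
  have wb kappa : Num.sqrt (- mu) <= kappa -> forall u z xi,
      max_domain x u ((- kappa ^+ 2)%:C *: u) z xi -> hnorm z <= C / kappa * hnorm xi.
    by move=> hk u z xi; rewrite CE; exact: (weyl_bound_negative x_incr d_gt0 x_gap m0 hk).
  have range w : num_range (brack (D := max_domain x) B) w -> exists F N : R, [/\ 0 <= F, 0 <= N,
      N <= 2 * C * Num.sqrt (F - mu), F - b * N <= Re w &
      `|Im w| <= rel_norm (rel_Im B) * N].
    move=> /(num_range_brack BS BP Pre)[F [N [f [k [z [hD f1 F0 NE [FE Fb iw]]]]]]].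
    exists F, N; split => //; first by rewrite NE sqr_ge0.
      by rewrite NE FE; exact: (trace_sqrt_bound BS mu0 C0 wb hD f1).
    by rewrite iw normrN NE; exact: hI.
  split=> [b0 xi hxi K w /range[F [N [F0 N0 hN Fb iw]]]|b0 w /range[F [N [F0 N0 hN Fb iw]]]].
    exact: (enclosure_pos F0 mu0 C0 b0 I0 hN Fb iw hxi).
  exact: (enclosure_neg F0 mu0 C0 b0 I0 N0 hN Fb iw).
move=> w0 nu w00 nu0 J0 z [zs zc]; split; first exact: zc.
have [nz z0 sE /andP[j0 jI]] := cone_sqrt_bound w00 nu0 zc.
have s1 := Im_sqrtC_gt0 nz.
have J0_gt0 : 0 < J0 by rewrite /J0 -mulrA mulr_gt0// divr_gt0.
have cJ := coth_gt0 J0_gt0.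
apply: (le_trans (dist_nonneg_axis_le z)); rewrite -sE -cabs_sqr.
have c1 : 0 < cabs (sqrtC z).
  by rewrite lt_neqAle cabs_ge0 andbT eq_sym; apply: contraTneq z0 => h; rewrite -sE -cabs_sqr h expr0n/= ltxx.
(* Contraposition: a product less than 1 would put [z] in the resolvent set. Solving for |sqrt z|
   and squaring gives the bound on |z|. *)
have bm : 1 <= beta * (coth J0 / (2 * cabs (sqrtC z))).
  rewrite leNgt; apply/negP => bm; apply: zs.
  apply: (bounded_resolvent_set BS Kc l0_gt0 weyl_le Pl BP beta0 Pb nz _ bm).
    by apply: divr_ge0; [exact: ltW|apply: mulr_ge0; [exact: ler0n|exact: ltW]].
  move=> u y xi h; rewrite -(sqrtCK z) in h.
  apply: (le_trans (weyl_norm_bound x_incr d_gt0 x_gap s1 h)).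
  rewrite ler_wpM2r ?hnorm_ge0// ler_wpM2r ?invr_ge0 ?mulr_ge0 ?(ltW c1)//.
  by apply: ler_coth => //; rewrite /J0 -mulrA ler_pM2l// divr_gt0.
have h2 : 2 * cabs (sqrtC z) <= beta * coth J0.
  by move: bm; rewrite mulrA ler_pdivlMr ?mulr_gt0// mul1r.
have h3 : (2 * cabs (sqrtC z)) ^+ 2 <= (beta * coth J0) ^+ 2.
  have q0 : 0 <= 2 * cabs (sqrtC z) by apply: mulr_ge0; [exact: ler0n|exact: ltW].
  by rewrite !expr2; exact: ler_pM.
by move: h3; rewrite !exprMn; move: (coth J0 ^+ 2) (beta ^+ 2) (cabs _ ^+ 2) => p q r; lra.
Qed.
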